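(* Let $f:\overline{\Omega}\times\mathbb{R}^{m\times n}\to\mathbb{R}_{\ge 0}$ be Borel measurable, convex in the second variable, and assume there are constants $c_0,C_0>0$ with $c_0|Ay|\le f(x,y)\le C_0(1+|Ay|)$ for all $(x,y)$. Then for every $u_0\in L^2(\Omega,\mathbb{R}^m)$ there is a unique $$u\in C([0,\infty),L^2(\Omega,\mathbb{R}^m))\cap W^{1,\infty}_{loc}((0,\infty),L^2(\Omega,\mathbb{R}^m))$$ which solves $$u(0)=u_0,\qquad \partial_tu(t)\in\operatorname{div}\big(\partial_yf(x,\mathbb{A}u(t))\big)\ \text{ in }\Omega,\qquad \langle\partial_yf(x,\mathbb{A}u),\nu\rangle=0\ \text{ on }\partial\Omega,$$ where the time derivative is taken in the weak sense and the second and third conditions are understood in the sense that, for a.e. $t>0$, the function $r=-\partial_tu(t)$ satisfies, with $u=u(t)$, the equivalent conditions (a)–(d) listed in the context.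
   Context: Setting: $\Omega\subset\mathbb{R}^n$ is a bounded open set with Lipschitz boundary and outer unit normal $\nu$. $A:\mathbb{R}^{m\times n}\to\mathbb{R}^{m\times n}$ is a fixed linear map, symmetric with respect to the Frobenius product $y:y'=\sum_{i,j}y_{ij}y'_{ij}$, with $A^2=A$. For $u:\Omega\to\mathbb{R}^m$ set $\mathbb{A}u:=A\,\mathrm{D}u$ (distributional). $\mathrm{BV}^{\mathbb{A}}(\Omega)$ is the space of $u\in L^1(\Omega,\mathbb{R}^m)$ for which $\mathbb{A}u$ is a bounded $\mathbb{R}^{m\times n}$-valued Radon measure on $\Omega$. The divergence of matrix fields is row-wise, $(\operatorname{div}z)_i=\sum_j\partial_jz_{ij}$, distributional. $X_2(\Omega):=\{z\in L^\infty(\Omega,\mathbb{R}^{m\times n}): Az=z,\ \operatorname{div}z\in L^2(\Omega,\mathbb{R}^m)\}$. For $u\in\mathrm{BV}^{\mathbb{A}}(\Omega)\cap L^2(\Omega,\mathbb{R}^m)$ and $z\in X_2(\Omega)$ the pairing $(z,\mathbb{A}u)$ is the distribution $\langle (z,\mathbb{A}u),\phi\rangle:=-\int_\Omega\sum_{i,j}(\phi\,\partial_jz_{ij}u_i+\partial_j\phi\, z_{ij}u_i)\,dx$, $\phi\in C_c^\infty(\Omega)$, which is a bounded Radon measure on $\Omega$. For $z\in X_2(\Omega)$, the normal trace $\langle z,\nu\rangle\in L^\infty(\partial\Omega,\mathbb{R}^m)$ is the unique function with $\int_\Omega\langle\operatorname{div}z,\phi\rangle+z:\mathrm{D}\phi\,dx=\int_{\partial\Omega}\langle\phi,\langle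 z,\nu\rangle\rangle\,d\mathcal{H}^{n-1}$ for all $\phi\in (W^{1,1}\cap L^{2})(\Omega,\mathbb{R}^m)$. $f^*(x,z)=\sup_{y}(z:y-f(x,y))$. $\mathcal{Z}:=\{z\in X_2(\Omega): f^*(x,z(x))\in L^1(\Omega)\}$. For $u\in L^2(\Omega,\mathbb{R}^m)$, $F_{dual}(u):=\sup_{z\in\mathcal{Z}}\big(\int_\Omega -f^*(x,z(x))\,dx+\int_\Omega (z,\mathbb{A}u)\big)$ if $u\in\mathrm{BV}^{\mathbb{A}}(\Omega)$ and $+\infty$ otherwise. On a Hilbert space $H$, $v\in\partial\mathcal{G}(u)$ iff $\langle v,w-u\rangle\le\mathcal{G}(w)-\mathcal{G}(u)$ for all $w\in H$. For $u,r\in L^2(\Omega,\mathbb{R}^m)$ the following conditions are equivalent: (a) $r\in\partial F_{dual}(u)$ in $L^2(\Omega,\mathbb{R}^m)$; (b) there is $z\in\mathcal{Z}$ with $\int_\Omega\langle w-u,r\rangle dx\le\int_\Omega -f^*(x,z)dx+\int_\Omega (z,\mathbb{A}w)-F_{dual}(u)$ for all $w\in\mathrm{BV}^{\mathbb{A}}(\Omega)\cap L^2(\Omega,\mathbb{R}^m)$; (c) there is $z\in\mathcal{Z}$ for which (b) holds with equality for all such $w$; (d) $u\in\mathrm{BV}^{\mathbb{A}}(\Omega)$ and there is $z\in\mathcal{Z}$ with $r=-\operatorname{div}z$, $\langle z,\nu\rangle=0$ and $F_{dual}(u)=\int_\Omega -f^*(x,z)dx+\int_\Omega (z,\mathbb{A}u)$.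 *)

(* Defs.v *)
From HB Require Import structures.
From mathcomp Require Import all_boot all_order all_algebra.
From mathcomp Require Import all_classical all_reals all_analysis.

Set Implicit Arguments.
Unset Strict Implicit.
Unset Printing Implicit Defensive.

Import Order.TTheory GRing.Theory Num.Theory.
Import numFieldNormedType.Exports.

Local Open Scope classical_set_scope.
Local Open Scope ring_scope.

(* Real matrices carry the product sigma-algebra of their entries, i.e. the
   Borel sigma-algebra of R^(p x q). *)
Definition mx_display : measure_display.
Proof. exact: default_measure_display. Qed.

Section mx_measurable.
Variables (R : realType) (p q : nat).

Definition mx_cylinders : set (set 'M[R]_(p, q)) :=
  [set (fun M : 'M[R]_(p, q) => M ij.1 ij.2) @^-1` B |
     ij in [set: 'I_p * 'I_q] & B in (@measurable _ R)].

Let mx0 : <<s mx_cylinders >> set0. Proof. exact: sigma_algebra0. Qed.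
Let mxC A : <<s mx_cylinders >> A -> <<s mx_cylinders >> (~` A).
Proof. exact: sigma_algebraC. Qed.
Let mxU (F : (set 'M[R]_(p, q))^nat) :
  (forall i, <<s mx_cylinders >> (F i)) ->
  <<s mx_cylinders >> (\bigcup_i F i).
Proof. exact: sigma_algebra_bigcup. Qed.

HB.instance Definition _ :=
  @isMeasurable.Build mx_display 'M[R]_(p, q) <<s mx_cylinders >> mx0 mxC mxU.

Lemma measurable_mx_entry (i : 'I_p) (j : 'I_q) :
  measurable_fun [set: 'M[R]_(p, q)] (fun M => M i j).
Proof.
move=> _ B mB; rewrite setTI; apply: sub_sigma_algebra.
by exists (i, j) => //; exists B.
Qed.

Lemma measurable_fun_mx d (T : measurableType d) (g : T -> 'M[R]_(p, q)) :
  (forall i j, measurable_fun [set: T] (fun x => g x i j)) ->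
  measurable_fun [set: T] g.
Proof.
move=> mg; apply: (@measurability _ _ _ _ _ _ mx_cylinders) => //.
move=> _ [_ [[i j] _ [B mB <-]] <-].
by have := mg i j measurableT B mB.
Qed.

End mx_measurable.

Section lebesgue_rV.
Variable R : realType.

Definition row_cons n (xv : R * 'rV[R]_n) : 'rV[R]_n.+1 :=
  row_mx (const_mx xv.1 : 'rV[R]_1) xv.2.

Definition row_uncons n (w : 'rV[R]_n.+1) : R * 'rV[R]_n :=
  (w 0 0, rsubmx (w : 'rV[R]_(1 + n))).

Lemma row_consK n : cancel (@row_cons n) (@row_uncons n).
Proof.
move=> [x v]; rewrite /row_cons /row_uncons row_mxKr; congr (_, _).
rewrite (_ : (0 : 'I_n.+1) = lshift n (0 : 'I_1)); last exact/val_inj.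
by rewrite (@row_mxEl _ 1 1 n) mxE.
Qed.

Lemma measurable_row_cons n : measurable_fun [set: R * 'rV[R]_n] (@row_cons n).
Proof.
apply: measurable_fun_mx => i j; rewrite /row_cons.
case: (@split_ordP 1 n j) => k ->.
- apply: (eq_measurable_fun fst) => [x _|]; last exact: measurable_fst.
  by rewrite (@row_mxEl _ 1 1 n) mxE.
- apply: (eq_measurable_fun (fun x : R * 'rV[R]_n => x.2 i k)) => [x _|].
    by rewrite (@row_mxEr _ 1 1 n).
  apply: (measurableT_comp (f := fun v : 'rV[R]_n => v i k)) => //.
  exact: measurable_mx_entry.
Qed.

Lemma measurable_row_uncons n :
  measurable_fun [set: 'rV[R]_n.+1] (@row_uncons n).
Proof.
apply: measurable_fun_pair; first exact: measurable_mx_entry.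
apply: measurable_fun_mx => i j.
apply: (eq_measurable_fun (fun w : 'rV[R]_n.+1 => w i (rshift 1 j))) => [x _|].
  by rewrite mxE.
exact: measurable_mx_entry.
Qed.

Section step.
Variables (n : nat) (mu : {sigma_finite_measure set 'rV[R]_n -> \bar R}).

Definition lebesgue_step (A : set 'rV[R]_n.+1) : \bar R :=
  (@lebesgue_measure R \x mu)%E (@row_cons n @^-1` A).

Let mpre (A : set 'rV[R]_n.+1) :
  measurable A -> measurable (@row_cons n @^-1` A).
Proof. by move=> mA; rewrite -[X in measurable X]setTI; exact: measurable_row_cons. Qed.

Let step0 : lebesgue_step set0 = 0%E.
Proof. by rewrite /lebesgue_step preimage_set0 measure0. Qed.

Let step_ge0 A : (0 <= lebesgue_step A)%E.
Proof. exact: measure_ge0. Qed.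

Let step_sigma_additive : semi_sigma_additive lebesgue_step.
Proof.
move=> F mF tF mUF; rewrite /lebesgue_step preimage_bigcup.
apply: measure_semi_sigma_additive.
- by move=> k; exact: mpre.
- apply/trivIsetP => /= i j _ _ ij; rewrite -preimage_setI.
  by move/trivIsetP : tF => /(_ _ _ _ _ ij) ->//; rewrite preimage_set0.
- by rewrite -preimage_bigcup; exact: mpre.
Qed.

HB.instance Definition _ := isMeasure.Build _ _ _ lebesgue_step
  step0 step_ge0 step_sigma_additive.

Let step_sigma_finite : sigma_finite setT lebesgue_step.
Proof.
have /sigma_finiteP[F [TF ndF Foo]] := sigma_finiteT (@lebesgue_measure R).
have /sigma_finiteP[G [TG ndG Goo]] := sigma_finiteT mu.
exists (fun k => @row_uncons n @^-1` (F k `*` G k)).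
  rewrite -preimage_bigcup (_ : \bigcup_i _ = setT) ?preimage_setT//.
  rewrite -setXTT TF TG predeqE => -[x y]; split; last first.
    move=> [/= [i _ Fix] [k _ Gky]]; exists (maxn i k) => //; split.
    - by move: x Fix; exact/subsetPset/ndF/leq_maxl.
    - by move: y Gky; exact/subsetPset/ndG/leq_maxr.
  by move=> [i _ []/= ? ?]; split; exists i.
move=> k; have [mF Fk] := Foo k; have [mG Gk] := Goo k.
split.
  rewrite -[X in measurable X]setTI; apply: measurable_row_uncons => //.
  exact: measurableX.
rewrite /lebesgue_step -comp_preimage (_ : _ \o _ = id) ?preimage_id; last first.
  by apply/funext => x /=; rewrite row_consK.
by rewrite product_measure1E// lte_mul_pinfty// ge0_fin_numE.
Qed.

HB.instance Definition _ :=
  Measure_isSigmaFinite.Build _ _ _ lebesgue_step step_sigma_finite.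
End step.

(* n-dimensional Lebesgue measure: the n-fold product of Lebesgue measure on R,
   transported along R x R^k -> R^(k+1). *)
Fixpoint lebesgue_rV n : {sigma_finite_measure set 'rV[R]_n -> \bar R} :=
  match n with
  | 0 => \d_(0 : 'rV[R]_0)
  | k.+1 => lebesgue_step (lebesgue_rV k)
  end.
End lebesgue_rV.


Section frobenius.
Variables (R : realType) (p q : nat).

Definition frob (y y' : 'M[R]_(p, q)) : R := \sum_i \sum_j y i j * y' i j.

(* The library norm of a matrix is the sup norm of its entries. *)
Definition frob_norm (y : 'M[R]_(p, q)) : R := Num.sqrt (frob y y).
End frobenius.

Section test_functions.
Variables (R : realType) (V : normedModType R).

Definition iter_derive (s : seq V) (phi : V -> R) : V -> R :=
  foldr (fun v g => 'D_v g) phi s.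

Definition smooth (phi : V -> R) :=
  forall s : seq V, continuous (iter_derive s phi) /\
    forall x v, derivable (iter_derive s phi) x v.

(* C_c^oo(O) *)
Definition test_fun (O : set V) : set (V -> R) :=
  [set phi | [/\ smooth phi, compact (closure [set x | phi x != 0]) &
                 closure [set x | phi x != 0] `<=` O]].
End test_functions.

(* Near every boundary point, Omega is the strict epigraph of a Lipschitz
   function over the hyperplane orthogonal to a unit vector e. *)
Definition lipschitz_boundary (R : realType) n (Omega : set 'rV[R]_n) :=
  forall x0, (closure Omega `\` interior Omega) x0 ->
  exists (e : 'rV[R]_n) (g : 'rV[R]_n -> R) (r : R),
    [/\ frob e e = 1, lipschitz g, 0 < r &
      forall x, ball x0 r x ->
        (Omega x <-> g (x - frob x e *: e) < frob x e)].

Section spaces.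
Variables (R : realType) (m n : nat) (Omega : set 'rV[R]_n).
Local Notation leb := (lebesgue_rV R n).
Local Notation partial j phi x := ('D_(delta_mx 0 j : 'rV[R]_n) phi x).

(* Function spaces on Omega; the values outside Omega are irrelevant, and two
   functions are identified when ae_eq leb Omega. *)
Definition L1 p q : set ('rV[R]_n -> 'M[R]_(p, q)) :=
  [set u | forall i j, leb.-integrable Omega (fun x => (u x i j)%:E)].

Definition L2 p q : set ('rV[R]_n -> 'M[R]_(p, q)) :=
  [set u : 'rV[R]_n -> 'M[R]_(p, q) | forall i j,
             measurable_fun Omega (fun x => u x i j) /\
             leb.-integrable Omega (fun x => ((u x i j) ^+ 2)%:E)].

Definition Linf p q : set ('rV[R]_n -> 'M[R]_(p, q)) :=
  [set u : 'rV[R]_n -> 'M[R]_(p, q) |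
     (forall i j, measurable_fun Omega (fun x => u x i j)) /\
           exists M : R, {ae leb, forall x, Omega x -> frob_norm (u x) <= M}].

Definition L2_inner p q (u v : 'rV[R]_n -> 'M[R]_(p, q)) : R :=
  \int[leb]_(x in Omega) frob (u x) (v x).

Definition L2_norm p q (u : 'rV[R]_n -> 'M[R]_(p, q)) : R :=
  Num.sqrt (L2_inner u u).

(* The distribution T is the signed measure mup - mum on Omega; a bounded
   (signed) Radon measure is a difference of two finite Borel measures. *)
Definition represents (T : ('rV[R]_n -> R) -> R)
    (mup mum : {finite_measure set 'rV[R]_n -> \bar R}) :=
  forall phi, test_fun Omega phi ->
    T phi = (\int[mup]_(x in Omega) phi x) - (\int[mum]_(x in Omega) phi x).

Definition is_bounded_measure (T : ('rV[R]_n -> R) -> R) :=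
  exists mup mum, represents T mup mum.

(* The integral over Omega of 1 against the measure T. *)
Definition total_mass (T : ('rV[R]_n -> R) -> R) : R :=
  get [set l | exists mup mum, represents T mup mum /\
                 l = fine (mup Omega) - fine (mum Omega)].

Definition distr_grad (u : 'rV[R]_n -> 'rV[R]_m) (phi : 'rV[R]_n -> R) :
  'M[R]_(m, n) :=
  \matrix_(i, j) - \int[leb]_(x in Omega) (u x 0 i * partial j phi x).

Definition BVA (A : 'M[R]_(m, n) -> 'M[R]_(m, n)) :
  set ('rV[R]_n -> 'rV[R]_m) :=
  [set u | L1 u /\
     forall i j, is_bounded_measure (fun phi => A (distr_grad u phi) i j)].

Definition is_weak_grad (phi : 'rV[R]_n -> 'rV[R]_m)
    (G : 'rV[R]_n -> 'M[R]_(m, n)) :=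
  forall psi, test_fun Omega psi -> forall i j,
    distr_grad phi psi i j = \int[leb]_(x in Omega) (G x i j * psi x).

Definition is_weak_div (z : 'rV[R]_n -> 'M[R]_(m, n))
    (g : 'rV[R]_n -> 'rV[R]_m) :=
  forall psi, test_fun Omega psi -> forall i,
    - (\int[leb]_(x in Omega) (\sum_j z x i j * partial j psi x)) =
    \int[leb]_(x in Omega) (g x 0 i * psi x).

(* A representative of the distributional divergence of z, when it is in L2. *)
Definition divergence (z : 'rV[R]_n -> 'M[R]_(m, n)) : 'rV[R]_n -> 'rV[R]_m :=
  get [set g | L2 g /\ is_weak_div z g].

Definition X2 (A : 'M[R]_(m, n) -> 'M[R]_(m, n)) :
  set ('rV[R]_n -> 'M[R]_(m, n)) :=
  [set z | [/\ Linf z, ae_eq leb Omega (fun x => A (z x)) z &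
               exists g, L2 g /\ is_weak_div z g]].

Definition pairing (z : 'rV[R]_n -> 'M[R]_(m, n)) (u : 'rV[R]_n -> 'rV[R]_m)
    (phi : 'rV[R]_n -> R) : R :=
  - \int[leb]_(x in Omega)
      (phi x * frob (divergence z x) (u x)
       + \sum_i \sum_j partial j phi x * z x i j * u x 0 i).

(* <z, nu> = 0: the boundary integral in the identity that defines the normal
   trace vanishes for every test function in W^{1,1} and L2. *)
Definition zero_normal_trace (z : 'rV[R]_n -> 'M[R]_(m, n)) :=
  forall (phi : 'rV[R]_n -> 'rV[R]_m) (G : 'rV[R]_n -> 'M[R]_(m, n)),
    L1 phi -> L2 phi -> L1 G -> is_weak_grad phi G ->
    (\int[leb]_(x in Omega)
       (frob (divergence z x) (phi x) + frob (z x) (G x))) = 0.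

(* Subdifferential in L2(Omega, R^m). In the library +oo - +oo = -oo, so it is
   empty at points where G is +oo. *)
Definition subdifferential (G : ('rV[R]_n -> 'rV[R]_m) -> \bar R)
    (u : 'rV[R]_n -> 'rV[R]_m) : set ('rV[R]_n -> 'rV[R]_m) :=
  [set r | L2 r /\ forall w, L2 w ->
     ((L2_inner r (fun x => w x - u x))%:E <= G w - G u)%E].

Section functional.
Variables (A : 'M[R]_(m, n) -> 'M[R]_(m, n)).
Variable f : 'rV[R]_n -> 'M[R]_(m, n) -> R.

Definition fstar (x : 'rV[R]_n) (z : 'M[R]_(m, n)) : \bar R :=
  ereal_sup [set (frob z y - f x y)%:E | y in [set: 'M[R]_(m, n)]].

Definition Zset : set ('rV[R]_n -> 'M[R]_(m, n)) :=
  [set z | X2 A z /\ leb.-integrable Omega (fun x => fstar x (z x))].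

Definition dual_value (z : 'rV[R]_n -> 'M[R]_(m, n))
    (u : 'rV[R]_n -> 'rV[R]_m) : \bar R :=
  ((\int[leb]_(x in Omega) (- fstar x (z x))) + (total_mass (pairing z u))%:E)%E.

Definition Fdual (u : 'rV[R]_n -> 'rV[R]_m) : \bar R :=
  if u \in BVA A then ereal_sup [set dual_value z u | z in Zset] else +oo%E.

Definition cond_a (u r : 'rV[R]_n -> 'rV[R]_m) := subdifferential Fdual u r.

Definition cond_b (u r : 'rV[R]_n -> 'rV[R]_m) :=
  exists2 z, Zset z & forall w, BVA A w -> L2 w ->
    ((L2_inner (fun x => w x - u x) r)%:E <= dual_value z w - Fdual u)%E.

Definition cond_c (u r : 'rV[R]_n -> 'rV[R]_m) :=
  exists2 z, Zset z & forall w, BVA A w -> L2 w ->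
    ((L2_inner (fun x => w x - u x) r)%:E = dual_value z w - Fdual u)%E.

Definition cond_d (u r : 'rV[R]_n -> 'rV[R]_m) :=
  BVA A u /\ exists2 z, Zset z &
    [/\ ae_eq leb Omega r (fun x => - divergence z x),
        zero_normal_trace z & Fdual u = dual_value z u].

End functional.

Section evolution.
Implicit Types (u v g : R -> 'rV[R]_n -> 'rV[R]_m).

(* A step function sum_k 1_(E_k) h_k from R to L2(Omega, R^m). *)
Definition step_val (s : seq (set R * ('rV[R]_n -> 'rV[R]_m))) :
  R -> 'rV[R]_n -> 'rV[R]_m :=
  fun t x => \sum_(Eh <- s) \1_(Eh.1) t *: Eh.2 x.

Definition step_int (s : seq (set R * ('rV[R]_n -> 'rV[R]_m))) :
  'rV[R]_n -> 'rV[R]_m :=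
  fun x => \sum_(Eh <- s) fine (@lebesgue_measure R Eh.1) *: Eh.2 x.

Definition is_step (D : set R) (s : seq (set R * ('rV[R]_n -> 'rV[R]_m))) :=
  forall k, (k < size s)%N -> let Eh := nth (set0, fun=> 0) s k in
    [/\ measurable Eh.1, Eh.1 `<=` D,
        (@lebesgue_measure R Eh.1 < +oo)%E & L2 Eh.2].

(* J is the Bochner integral of g : D -> L2(Omega, R^m). *)
Definition is_bochner_integral (D : set R) g (J : 'rV[R]_n -> 'rV[R]_m) :=
  L2 J /\ exists s : nat -> seq (set R * ('rV[R]_n -> 'rV[R]_m)),
    let err k t := L2_norm (fun x => g t x - step_val (s k) t x) in
    [/\ forall k, is_step D (s k) /\ measurable_fun D (err k),
        (fun k => \int[@lebesgue_measure R]_(t in D) (err k t)%:E)%E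
          @ \oo --> 0%E &
        (fun k => L2_norm (fun x => step_int (s k) x - J x)) @ \oo --> (0 : R)].

Definition in_C_L2 u :=
  (forall t, 0 <= t -> L2 (u t)) /\
  forall t0, 0 <= t0 ->
    L2_norm (fun x => u t x - u t0 x) @[t --> within `[0, +oo[ (nbhs t0)]
      --> (0 : R).

Definition Linf_loc g :=
  (forall t, 0 < t -> L2 (g t)) /\
  forall a b : R, 0 < a -> exists M : R,
    {ae @lebesgue_measure R, forall t, a <= t <= b -> L2_norm (g t) <= M}.

Definition is_weak_time_derivative u v :=
  forall phi : R -> R, test_fun (`]0, +oo[ : set R) phi ->
  exists J K, [/\
    is_bochner_integral `]0, +oo[ (fun t x => derive1 phi t *: u t x) J,
    is_bochner_integral `]0, +oo[ (fun t x => phi t *: v t x) K &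
    ae_eq leb Omega J (fun x => - K x)].

(* u is in W^{1,oo}_loc((0, oo), L2(Omega, R^m)) with weak derivative v; strong
   measurability is part of the existence of the Bochner integrals. *)
Definition W1inf_loc u v :=
  [/\ Linf_loc u, Linf_loc v & is_weak_time_derivative u v].

(* u is in the regularity class, takes the value u0 at time 0, and r = - d_t u
   satisfies the condition P for almost every t > 0. *)
Definition is_solution
    (P : ('rV[R]_n -> 'rV[R]_m) -> ('rV[R]_n -> 'rV[R]_m) -> Prop)
    (u0 : 'rV[R]_n -> 'rV[R]_m) u :=
  [/\ in_C_L2 u, ae_eq leb Omega (u 0) u0 &
      exists2 v, W1inf_loc u v &
        {ae @lebesgue_measure R, forall t, 0 < t -> P (u t) (fun x => - v t x)}].

End evolution.
End spaces.

(* Main.v *)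
(** F_dual is a nonnegative, convex, lower semicontinuous functional on L2 with
    dense domain, being a supremum of affine continuous functionals of w: by
    cutting off the field z one may take compactly supported fields, for which
    the pairing with Aw is - \int <div z, w>. Hence it has a gradient flow
    (implicit Euler scheme and Kobayashi's estimate, then semigroup arguments
    for the right derivative), and - d/dt u(t) is a subgradient for every t > 0.
    A subgradient r at u is realised by one field z: minimising a quadratic
    perturbation of the dual problem produces z with r = - div z, zero normal
    trace and F_dual(u) attained at z, which is (d). The Lipschitz boundary
    enters to push such a field inward, which approximates it by compactly
    supported ones and turns (d) into the equality (c). Uniqueness follows from
    monotonicity of the subdifferential, the weak time derivative being tested
    against smooth trapezoids. *)
From HB Require Import structures.
From mathcomp Require Import all_boot all_order all_algebra.
From mathcomp Require Import all_classical all_reals all_analysis.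
From mathcomp Require Import measurable_realfun ring lra.
Require Import Defs.

Set Implicit Arguments.
Unset Strict Implicit.
Unset Printing Implicit Defensive.

Import Order.TTheory GRing.Theory Num.Theory.
Import numFieldNormedType.Exports.

Local Open Scope classical_set_scope.
Local Open Scope ring_scope.

(** * Semi-Hilbert spaces *)

(** Elements of L2 are functions, not classes, so the Hilbert theory is developed for a
    semi-definite form: limits, resolvents and projections are determined up to seminorm 0, and no
    quotient is formed. Weak compactness is avoided: wherever a minimiser is wanted, elements that
    nearly minimise both the functional and the norm are Cauchy by the parallelogram law. This
    yields the resolvents, the right derivatives of the flow and the optimal field. The analytic
    obstacle is that [pairing] is only a distribution and that [total_mass] picks a value by choice.
    Before F_dual can be computed, the pairing must be shown to be a measure dominated by the
    variation of Aw, and its mass must be recovered from cut-offs. A Riesz theorem for bounded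
    distributions gives the measure; it also shows that a function at which the affine functionals
    of compactly supported fields are bounded above lies in BV^A. The growth bounds act through the
    conjugate: finiteness of f* bounds a field by C0, and fields of size at most c0 have f* at most
    0. *)

Record semi_ip (R : realType) (H : lmodType R) := SemiIp {
  ip_val :> H -> H -> R;
  ipC : forall x y, ip_val x y = ip_val y x;
  ipDl : forall x y z, ip_val (x + y) z = ip_val x z + ip_val y z;
  ipZl : forall a x y, ip_val (a *: x) y = a * ip_val x y;
  ip_ge0 : forall x, 0 <= ip_val x x }.

Definition snorm (R : realType) (H : lmodType R) (ip : semi_ip H) x :=
  Num.sqrt (ip x x).

(** Stated with epsilons since [H] is a bare module without a topology; a limit is determined only
    up to seminorm 0. *)
Definition scvg (R : realType) (H : lmodType R) (ip : semi_ip H)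
    (x : nat -> H) (l : H) :=
  forall e, 0 < e -> exists N, forall k, (N <= k)%N -> snorm ip (x k - l) < e.

Definition scauchy (R : realType) (H : lmodType R) (ip : semi_ip H)
    (x : nat -> H) :=
  forall e, 0 < e -> exists N, forall i j, (N <= i)%N -> (N <= j)%N ->
    snorm ip (x i - x j) < e.

Definition scomplete (R : realType) (H : lmodType R) (ip : semi_ip H) :=
  forall x, scauchy ip x -> exists l, scvg ip x l.

Section semi_hilbert.
Variables (R : realType) (H : lmodType R) (ip : semi_ip H).
Implicit Types x y z : H.
Local Notation nrm := (snorm ip).

Lemma ip0l y : ip 0 y = 0.
Proof. by rewrite -(scale0r (0 : H)) ipZl mul0r. Qed.

Lemma ipNl x y : ip (- x) y = - ip x y.
Proof. by rewrite -scaleN1r ipZl mulN1r. Qed.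

Lemma ipBl x y z : ip (x - y) z = ip x z - ip y z.
Proof. by rewrite ipDl ipNl. Qed.

Lemma ipDr x y z : ip z (x + y) = ip z x + ip z y.
Proof. by rewrite ipC ipDl !(ipC _ z). Qed.

Lemma ipZr a x y : ip x (a *: y) = a * ip x y.
Proof. by rewrite ipC ipZl ipC. Qed.

Lemma ip0r x : ip x 0 = 0.
Proof. by rewrite ipC ip0l. Qed.

Lemma ipNr x y : ip x (- y) = - ip x y.
Proof. by rewrite ipC ipNl ipC. Qed.

Lemma ipBr x y z : ip z (x - y) = ip z x - ip z y.
Proof. by rewrite ipDr ipNr. Qed.

Let ipE := (ipBl, ipBr, ipDl, ipDr, ipNl, ipNr, ipZl, ipZr, ip0l, ip0r).

Lemma snorm_ge0 x : 0 <= nrm x.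
Proof. exact: sqrtr_ge0. Qed.

Lemma snorm_sqr x : nrm x ^+ 2 = ip x x.
Proof. by rewrite sqr_sqrtr// ip_ge0. Qed.

Lemma ip_sqr_le x y : ip x y ^+ 2 <= ip x x * ip y y.
Proof.
have [y0|y0] := eqVneq (ip y y) 0.
  rewrite y0 mulr0; suff -> : ip x y = 0 by rewrite expr0n.
  apply/eqP/negPn/negP => xy0.
  (* When [ip y y = 0] the square is affine in the multiple of [y]; this multiple makes it equal to
     [-1]. *)
  have := ip_ge0 ip (x - ((ip x x + 1) / (2 * ip x y)) *: y).
  rewrite !ipE y0 (ipC ip y x).
  set c := _ / _; have : c * ip x y = (ip x x + 1) / 2 by rewrite /c; field.
  lra.
have yp : 0 < ip y y by rewrite lt_neqAle eq_sym y0 ip_ge0.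
have := ip_ge0 ip (x - (ip x y / ip y y) *: y).
rewrite !ipE (ipC ip y x).
set c := _ / _; have -> : c * (c * ip y y) = c * ip x y by rewrite /c; field.
by rewrite subrr subr0 subr_ge0 /c mulrAC -expr2 ler_pdivrMr.
Qed.

Lemma ip_le x y : `|ip x y| <= nrm x * nrm y.
Proof.
rewrite -(ler_pXn2r (n := 2)) ?nnegrE ?mulr_ge0 ?snorm_ge0//.
by rewrite exprMn !snorm_sqr real_normK ?num_real// ip_sqr_le.
Qed.

Lemma ip_le_norm x y : ip x y <= nrm x * nrm y.
Proof. exact: le_trans (ler_norm _) (ip_le x y). Qed.

Lemma snormD x y : nrm (x + y) <= nrm x + nrm y.
Proof.
rewrite -(ler_pXn2r (n := 2)) ?nnegrE ?addr_ge0 ?snorm_ge0//.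
rewrite snorm_sqr !ipE sqrrD !snorm_sqr (ipC ip y x).
have := ip_le_norm x y; lra.
Qed.

Lemma snormZ a x : nrm (a *: x) = `|a| * nrm x.
Proof. by rewrite /snorm ipZl ipZr mulrA -expr2 sqrtrM ?sqr_ge0// sqrtr_sqr. Qed.

Lemma snormN x : nrm (- x) = nrm x.
Proof. by rewrite /snorm ipNl ipNr opprK. Qed.

Lemma snorm0 : nrm 0 = 0.
Proof. by rewrite /snorm ip0l sqrtr0. Qed.

Lemma snormBC x y : nrm (x - y) = nrm (y - x).
Proof. by rewrite -snormN opprB. Qed.

Lemma snormB_le x y z : nrm (x - z) <= nrm (x - y) + nrm (y - z).
Proof. by rewrite (le_trans _ (snormD _ _))// addrA subrK. Qed.

Lemma snormB x y : nrm (x - y) <= nrm x + nrm y.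
Proof. by rewrite (le_trans (snormD _ _))// snormN. Qed.

Lemma snorm_leB x y : nrm x <= nrm y + nrm (x - y).
Proof. by rewrite (le_trans _ (snormD _ _))// addrC subrK. Qed.

Lemma snorm_le_sqr x c : 0 <= c -> (nrm x <= c) = (ip x x <= c ^+ 2).
Proof.
by move=> c0; rewrite -snorm_sqr ler_pXn2r// ?nnegrE ?snorm_ge0.
Qed.

Lemma snorm_lt_sqr x c : 0 <= c -> (nrm x < c) = (ip x x < c ^+ 2).
Proof.
by move=> c0; rewrite -snorm_sqr ltr_pXn2r// ?nnegrE ?snorm_ge0.
Qed.

Lemma parallelogram x y :
  ip (x - y) (x - y) = 2 * ip x x + 2 * ip y y
    - 4 * ip (2^-1 *: (x + y)) (2^-1 *: (x + y)).
Proof. by rewrite !ipE (ipC ip y x); field. Qed.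

Lemma ip_convex t x y : 0 <= t <= 1 ->
  ip (t *: x + (1 - t) *: y) (t *: x + (1 - t) *: y)
    <= t * ip x x + (1 - t) * ip y y.
Proof.
move=> /andP[t0 t1]; rewrite -subr_ge0.
have -> : t * ip x x + (1 - t) * ip y y -
  ip (t *: x + (1 - t) *: y) (t *: x + (1 - t) *: y) =
  t * (1 - t) * ip (x - y) (x - y) by rewrite !ipE (ipC ip y x); ring.
by rewrite mulr_ge0 ?ip_ge0// mulr_ge0// subr_ge0.
Qed.

(** Stands in for rewriting along an equality: two points at distance 0 need not be equal. *)
Lemma snorm_null_eq x y z : nrm (x - y) = 0 -> nrm (x - z) = nrm (y - z).
Proof.
move=> xy; apply/eqP; rewrite eq_le.
have := snormB_le x y z; have := snormB_le y x z.
rewrite (snormBC y x) xy; lra.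
Qed.

End semi_hilbert.

Definition ipE := (ipBl, ipBr, ipDl, ipDr, ipNl, ipNr, ipZl, ipZr, ip0l, ip0r).

Section scvg_theory.
Variables (R : realType) (H : lmodType R) (ip : semi_ip H).
Implicit Types (x y : nat -> H) (l : H).
Local Notation nrm := (snorm ip).

Lemma scvg_cauchy x l : scvg ip x l -> scauchy ip x.
Proof.
move=> xl e e0; have [N HN] := xl _ (divr_gt0 e0 (ltr0Sn _ 1)); exists N => i j Ni Nj.
have := HN _ Ni; have := HN _ Nj; have := snormB_le ip (x i) l (x j).
rewrite (snormBC ip l); lra.
Qed.

Lemma scvg_unique x l l' : scvg ip x l -> scvg ip x l' -> nrm (l - l') = 0.
Proof.
move=> xl xl'; apply/eqP; rewrite eq_le snorm_ge0 andbT.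
apply/ler_addgt0Pr => e e0.
have [N HN] := xl _ (divr_gt0 e0 (ltr0Sn _ 1)).
have [M HM] := xl' _ (divr_gt0 e0 (ltr0Sn _ 1)).
have := HN (maxn N M) (leq_maxl _ _); have := HM (maxn N M) (leq_maxr _ _).
have := snormB_le ip l (x (maxn N M)) l'; rewrite (snormBC ip l (x _)); lra.
Qed.

Lemma scvg_cst l : scvg ip (fun=> l) l.
Proof. by move=> e e0; exists 0%N => k _; rewrite subrr snorm0. Qed.

Lemma scvgD x y l l' : scvg ip x l -> scvg ip y l' ->
  scvg ip (fun k => x k + y k) (l + l').
Proof.
move=> xl yl e e0.
have [N HN] := xl _ (divr_gt0 e0 (ltr0Sn _ 1)).
have [M HM] := yl _ (divr_gt0 e0 (ltr0Sn _ 1)).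
exists (maxn N M) => k; rewrite geq_max => /andP[/HN h1 /HM h2].
have := snormD ip (x k - l) (y k - l'); rewrite addrACA opprD; lra.
Qed.

Lemma scvgZ a x l : scvg ip x l -> scvg ip (fun k => a *: x k) (a *: l).
Proof.
move=> xl e e0; have a0 : 0 < `|a| + 1 by have := normr_ge0 a; lra.
have [N HN] := xl _ (divr_gt0 e0 a0).
exists N => k /HN; rewrite -scalerBr snormZ ltr_pdivlMr// => h.
apply: le_lt_trans h; rewrite mulrC ler_wpM2l ?snorm_ge0// lerDl//.
Qed.

Lemma scvgB x y l l' : scvg ip x l -> scvg ip y l' ->
  scvg ip (fun k => x k - y k) (l - l').
Proof.
by move=> xl /(scvgZ (-1)) yl; have := scvgD xl yl; rewrite scaleN1r;
  under [X in scvg _ X]eq_fun do rewrite scaleN1r.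
Qed.

Lemma scvgP x l : scvg ip x l <-> (fun k => nrm (x k - l)) @ \oo --> (0 : R).
Proof.
split=> [xl|/cvgrPdist_lt xl e e0].
  apply/cvgrPdist_lt => e /xl[N HN]; exists N => // k /= /HN.
  by rewrite sub0r normrN ger0_norm// snorm_ge0.
have [N _ HN] := xl e e0; exists N => k /HN /=.
by rewrite sub0r normrN ger0_norm// snorm_ge0.
Qed.

Lemma scvg_snorm x l : scvg ip x l -> (fun k => nrm (x k)) @ \oo --> nrm l.
Proof.
move=> xl; apply/cvgrPdist_lt => e /xl[N HN]; exists N => // k /= /HN h.
apply: le_lt_trans h; rewrite ler_norml.
have := snorm_leB ip l (x k); have := snorm_leB ip (x k) l.
rewrite (snormBC ip l); lra.
Qed.

Lemma scvg_ip x l (y : H) : scvg ip x l -> (fun k => ip (x k) y) @ \oo --> ip l y.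
Proof.
move=> xl; apply/cvgrPdist_lt => e e0.
have y0 : 0 < nrm y + 1 by have := snorm_ge0 ip y; lra.
have [N HN] := xl _ (divr_gt0 e0 y0).
exists N => // k /= /HN; rewrite ltr_pdivlMr// => h; rewrite -ipBl.
apply: le_lt_trans (ip_le _ _ _) _; rewrite snormBC; apply: le_lt_trans h.
by rewrite ler_wpM2l ?snorm_ge0// lerDl.
Qed.

Lemma scvg_sqr x l : scvg ip x l -> (fun k => ip (x k) (x k)) @ \oo --> ip l l.
Proof.
move=> /scvg_snorm xl; rewrite -snorm_sqr.
by under eq_fun do rewrite -snorm_sqr; rewrite expr2;
  under eq_fun do rewrite expr2; exact: cvgM.
Qed.

Lemma scvg_subseq x l (s : nat -> nat) : (forall k, (k <= s k)%N) ->
  scvg ip x l -> scvg ip (x \o s) l.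
Proof.
move=> sk xl e /xl[N HN]; exists N => k Nk; apply: HN; exact: leq_trans (sk k).
Qed.

End scvg_theory.

(** * Nearly minimal elements of decreasing midpoint-convex sets *)

Section nested_convex.
Variables (R : realType) (H : lmodType R) (ip : semi_ip H).
Variable C : nat -> set H.
Hypothesis C_decr : forall k, C k.+1 `<=` C k.
Hypothesis C_mid : forall k x y, C k x -> C k y -> C k (2^-1 *: (x + y)).
Variable M : R.
Hypothesis C_bnd : forall k, exists2 x, C k x & ip x x <= M.

Lemma nested_decr i j : (i <= j)%N -> C j `<=` C i.
Proof.
move=> /subnK <-; elim: (j - i)%N => [|d IH] x //.
by rewrite addSn => /C_decr/IH.
Qed.

(* The supremum [m] over [k] of the minimal squared norm in [C k]. *)
Lemma nested_level : exists m : R,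
  (forall e, 0 < e -> exists k, forall x, C k x -> m - e < ip x x) /\
  (forall k e, 0 < e -> exists2 x, C k x & ip x x < m + e).
Proof.
pose E k := [set ip x x | x in C k].
have E0 k : lbound (E k) 0 by move=> _ [x _ <-]; exact: ip_ge0.
have Ei k : has_inf (E k).
  split; last by exists 0.
  by have [x Cx _] := C_bnd k; exists (ip x x), x.
pose I := [set inf (E k) | k in [set: nat]].
have hI : has_sup I.
  split; first by exists (inf (E 0%N)), 0%N.
  exists M => _ [k _ <-]; have [x Cx xM] := C_bnd k.
  by apply: le_trans xM; apply: ge_inf; [by exists 0|exists x].
exists (sup I); split=> [e e0|k e e0].
- have [_ [k _ <-] Hk] := sup_adherent e0 hI.
  exists k => x Cx; apply: lt_le_trans Hk _.
  by apply: ge_inf; [exists 0|exists x].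
- have [_ [x Cx <-] Hx] := inf_adherent e0 (Ei k).
  exists x => //; apply: lt_le_trans Hx _; rewrite lerD2r.
  by apply: ub_le_sup; [exact: hI.2|exists k].
Qed.

(** The midpoint of [p] and [q] stays in [C k], where squares exceed [m - e]; the parallelogram law
    then bounds the squared distance by [4 (m + e) - 4 (m - e) = 8 e], which is [d ^+ 2 / 2] for
    [e = d ^+ 2 / 16]. *)
Lemma nested_close m :
  (forall e, 0 < e -> exists k, forall x, C k x -> m - e < ip x x) ->
  forall d, 0 < d -> exists2 e, 0 < e & exists k, forall p q, C k p -> C k q ->
    ip p p <= m + e -> ip q q <= m + e -> snorm ip (p - q) < d.
Proof.
move=> Hm d d0; exists (d ^+ 2 / 16); first by rewrite divr_gt0 ?exprn_gt0.
have [|k Hk] := Hm (d ^+ 2 / 16); first by rewrite divr_gt0 ?exprn_gt0.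
exists k => p q Cp Cq pm qm; rewrite snorm_lt_sqr ?(ltW d0)// parallelogram.
have := Hk _ (C_mid Cp Cq); have : 0 < d ^+ 2 by rewrite exprn_gt0.
lra.
Qed.

(** The sets are not assumed closed, so the nearly minimal elements are only shown to be Cauchy;
    where their limit lies is settled in each application. *)
Lemma nested_min : exists m : R,
  (forall e, 0 < e -> exists k, forall x, C k x -> m - e < ip x x) /\
  exists2 z : nat -> H, (forall k, C k (z k) /\ ip (z k) (z k) < m + k.+1%:R^-1) &
    scauchy ip z.
Proof.
have [m [Hm1 Hm2]] := nested_level; exists m; split => //.
have step k : exists x, C k x /\ ip x x < m + k.+1%:R^-1.
  by have [|x Cx xm] := Hm2 k (k.+1%:R^-1); [rewrite invr_gt0|exists x].
have [z Hz] := choice step; exists z => // d d0.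
have [e e0 [k Hk]] := nested_close Hm1 d0.
have [N Ne] : exists N : nat, N.+1%:R^-1 < e.
  exists (Num.truncn e^-1); rewrite invf_plt ?posrE//.
  by rewrite truncnS_gt.
have aux i : (maxn k N <= i)%N -> C k (z i) /\ ip (z i) (z i) <= m + e.
  rewrite geq_max => /andP[ki Ni]; have [Cz zm] := Hz i; split.
    exact: nested_decr Cz.
  apply/ltW/(lt_trans zm); rewrite ltrD2l; apply: le_lt_trans Ne.
  by rewrite lef_pV2 ?posrE// ler_nat.
exists (maxn k N) => i j /aux[Ci mi] /aux[Cj mj]; exact: Hk.
Qed.

Lemma nested_cauchy : exists2 z : nat -> H, (forall k, C k (z k)) & scauchy ip z.
Proof.
have [m [_ [z Cz cz]]] := nested_min; exists z => // k; by have [] := Cz k.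
Qed.

End nested_convex.

(** * Gradient flow of a convex functional *)

(** Extracts first-order optimality from minimality along a segment. For negative [P] the chosen [t]
    makes [t * |Q|] at most [- P / 2], and the linear term wins. *)
Lemma ge0_of_quadratic (R : realType) (P Q : R) :
  (forall t, 0 < t <= 1 -> 0 <= t * P + t ^+ 2 * Q) -> 0 <= P.
Proof.
move=> h; rewrite leNgt; apply/negP => P0.
have Q0 := normr_ge0 Q; have QQ := ler_norm Q.
pose t := Num.min 1 (- P / (2 * (`|Q| + 1))).
have d0 : 0 < 2 * (`|Q| + 1) by lra.
have t0 : 0 < t by rewrite lt_min ltr01 divr_gt0// oppr_gt0.
have := h t; rewrite t0 ge_min lexx => /(_ isT).
rewrite expr2 -mulrA -mulrDr pmulr_rge0//.
have : t * (2 * (`|Q| + 1)) <= - P by rewrite -ler_pdivlMr// ge_min lexx orbT.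
nra.
Qed.

Lemma cvg_invS (R : realType) : (fun k => k.+1%:R^-1) @ \oo --> (0 : R).
Proof. exact: cvg_harmonic. Qed.

Lemma invS_lt (R : realType) (e : R) : 0 < e ->
  exists N, forall k, (N <= k)%N -> k.+1%:R^-1 < e.
Proof.
move=> e0; exists (Num.truncn e^-1) => k Nk.
rewrite invf_plt ?posrE//; apply: lt_le_trans (truncnS_gt _) _.
by rewrite ler_nat.
Qed.

Section convex_functional.
Variables (R : realType) (H : lmodType R) (ip : semi_ip H).
Hypothesis Hcomplete : scomplete ip.
Local Notation nrm := (snorm ip).
Variable F : H -> \bar R.
Hypothesis F_ge0 : forall x, (0 <= F x)%E.
Hypothesis F_conv : forall x y (a b t : R), 0 <= t <= 1 ->
  (F x <= a%:E)%E -> (F y <= b%:E)%E ->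
  (F (t *: x + (1 - t) *: y)%R <= (t * a + (1 - t) * b)%:E)%E.
Hypothesis F_lsc : forall X x (a : R), scvg ip X x ->
  (forall k, F (X k) <= a%:E)%E -> (F x <= a%:E)%E.
Hypothesis F_dense : forall x e, 0 < e ->
  exists2 y, (F y < +oo)%E & nrm (x - y) < e.

(** The subgradient relation. Quantifying over real upper bounds [a] of [F w] avoids subtracting
    extended reals, and points of infinite energy have no subgradient. *)
Definition sub_at x r := exists2 b : R, F x = b%:E &
  forall w (a : R), (F w <= a%:E)%E -> ip r (w - x) <= a - b.

Lemma F_lim X x (a : nat -> R) l : scvg ip X x -> a @ \oo --> l ->
  (forall k, F (X k) <= (a k)%:E)%E -> (F x <= l%:E)%E.
Proof.
move=> Xx al Fa; apply/lee_addgt0Pr => e e0; rewrite -EFinD.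
move/cvgrPdist_lt: al => /(_ e e0)[N _ HN].
have XNx := scvg_subseq (fun k => leq_addl N k) Xx.
apply: (F_lsc XNx) => k /=; apply: le_trans (Fa _) _; rewrite lee_fin.
have /= := HN (N + k)%N (leq_addr _ _); rewrite ltr_norml; lra.
Qed.

Lemma F_null x y : nrm (x - y) = 0 -> F x = F y.
Proof.
have aux u w : nrm (u - w) = 0 -> (F w <= F u)%E.
  move=> xy; case E : (F u) => [a| |]; rewrite ?leey//; last first.
    by have := F_ge0 u; rewrite E.
  apply: (@F_lsc (fun=> u)) => [e e0|k]; last by rewrite E.
  by exists 0%N => k _; rewrite xy.
by move=> xy; apply/eqP; rewrite eq_le !aux// snormBC.
Qed.

Lemma F_fin x a : (F x <= a%:E)%E -> exists2 b, F x = b%:E & 0 <= b <= a.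
Proof.
have := F_ge0 x; case: (F x) => [b| |]// b0 ba; exists b => //.
by rewrite -!lee_fin b0 ba.
Qed.

Lemma F_dom x : (F x < +oo)%E -> exists b, F x = b%:E.
Proof. by have := F_ge0 x; case: (F x) => [b| |]// _ _; exists b. Qed.

(** The point [y] minimises [F w + |w - x|^2 / (2 h)], and the subgradient is the first-order
    condition of this problem. *)
Lemma resolvent_exists (h : R) x : 0 < h -> exists y, sub_at y (h^-1 *: (x - y)).
Proof.
move=> h0; have [q qE] : exists q : H -> R,
    forall w, q w = ip (w - x) (w - x) / (2 * h) by eexists.
have h20 : 0 < 2 * h by lra.
have q0 w : 0 <= q w by rewrite qE divr_ge0 ?ip_ge0// ltW.
pose V := [set p : R | exists w (a : R), (F w <= a%:E)%E /\ p = a + q w].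
have V0 : lbound V 0.
  move=> _ [w [a [Fa ->]]]; have [b _ ?] := F_fin Fa; have := q0 w; lra.
have VI : has_inf V.
  split; last by exists 0.
  have [y /F_dom[b Fy] _] := F_dense x ltr01.
  by exists (b + q y), y, b; rewrite Fy.
set I := inf V.
have Iq w a : (F w <= a%:E)%E -> I <= a + q w.
  by move=> Fw; apply: ge_inf; [exists 0|exists w, a].
(* Near-minimisers of the penalised energy: decreasing in [k], midpoint-convex, and bounded because
   of the quadratic term. *)
pose C k w := exists2 a : R, (F w <= a%:E)%E & a + q w <= I + k.+1%:R^-1.
have [z Cz cz] : exists2 z : nat -> H, (forall k, C k (z k)) & scauchy ip z.
  (* The bound is [ip w w <= 2 ip (w - x) (w - x) + 2 ip x x] combined with [q w <= I + 1], which
     holds since energies are nonnegative. *)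
  apply: (@nested_cauchy _ _ ip C _ _ (2 * ip x x + 4 * h * (I + 1))).
  - move=> k w [a Fa aq]; exists a => //; apply: le_trans aq _.
    by rewrite lerD2l lef_pV2 ?posrE// ler_nat.
  - move=> k w w' [a Fa aq] [b Fb bq]; exists (2^-1 * a + (1 - 2^-1) * b).
      rewrite scalerDr (_ : 2^-1 *: w' = (1 - 2^-1) *: w').
        by apply: F_conv => //; lra.
      by congr (_ *: _); field.
    suff : q (2^-1 *: (w + w')) <= 2^-1 * q w + 2^-1 * q w'.
      by move: aq bq; move: (k.+1%:R^-1) => d; lra.
    rewrite !qE !mulrA -mulrDl ler_pM2r ?invr_gt0//.
    have := ip_ge0 ip (w - w'); rewrite !ipE (ipC ip w' w) (ipC ip x).
    rewrite (ipC ip x w'); lra.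
  - move=> k; have [|_ [w [a [Fa ->]]] aq] := @inf_adherent _ _ k.+1%:R^-1 _ VI.
      by rewrite invr_gt0.
    exists w; first by exists a => //; exact: ltW.
    have [b _ /andP[b0 ba]] := F_fin Fa.
    have : q w <= I + 1.
      have : k.+1%:R^-1 <= 1 :> R by rewrite invf_le1// ler1n.
      have : a + q w <= I + k.+1%:R^-1 by exact: ltW.
      by move: (k.+1%:R^-1) => d; lra.
    rewrite qE ler_pdivrMr// => qw.
    have := ip_ge0 ip (w - 2 *: x).
    move: qw; rewrite !ipE (ipC ip x w); lra.
have [y zy] := Hcomplete cz.
have qz : (fun k => q (z k)) @ \oo --> q y.
  under eq_fun do rewrite qE; rewrite qE; apply: cvgMr_tmp.
  exact: (scvg_sqr (scvgB zy (scvg_cst ip x))).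
have Fy : (F y <= (I - q y)%:E)%E.
  apply: (@F_lim z y (fun k => I + k.+1%:R^-1 - q (z k))) => //.
    apply: cvgB => //; rewrite -[X in _ --> X]addr0.
    by apply: cvgD; [exact: cvg_cst|exact: cvg_invS].
  move=> k; have [a Fa aq] := Cz k; apply: le_trans Fa _; rewrite lee_fin.
  by move: aq; move: (k.+1%:R^-1) => d; lra.
have [b Fyb /andP[b0 bI]] := F_fin Fy.
have bE : b = I - q y by have := Iq y b; rewrite Fyb lexx => /(_ isT); lra.
exists y, b => // w a Fa; rewrite -subr_ge0.
(* Minimality of [y] along the segment towards [w] is a quadratic inequality in [t]; its linear part
   is the subgradient inequality. *)
apply: (@ge0_of_quadratic _ _ (ip (w - y) (w - y) / (2 * h))) => t /andP[t0 t1].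
have Fyb' : (F y <= b%:E)%E by rewrite Fyb.
have := Iq _ _ (@F_conv w y a b t _ Fa Fyb').
rewrite (ltW t0) t1 => /(_ isT).
have -> : q (t *: w + (1 - t) *: y) = q y - t * ip (h^-1 *: (x - y)) (w - y) +
    t ^+ 2 * (ip (w - y) (w - y) / (2 * h)).
  rewrite !qE !ipE !(ipC ip _ w) !(ipC ip y x); field.
  by rewrite gt_eqF.
rewrite bE; lra.
Qed.

(** The resolvent [(I + h dF)^-1], taken by choice because it is determined only up to seminorm
    0. *)
Definition J h x := xget x [set y | sub_at y (h^-1 *: (x - y))].

Lemma J_sub h x : 0 < h -> sub_at (J h x) (h^-1 *: (x - J h x)).
Proof. by move=> h0; exact: (xgetPex x (resolvent_exists x h0)). Qed.

Lemma sub_monotone x r y s : sub_at x r -> sub_at y s -> 0 <= ip (r - s) (x - y).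
Proof.
move=> [a Fx hx] [b Fy hy].
have := hx y b; rewrite Fy => /(_ (lexx _)).
have := hy x a; rewrite Fx => /(_ (lexx _)).
rewrite !ipE; lra.
Qed.

(** In the square of [(x - y) + h (r - s)] the cross term is [2 h ip (r - s) (x - y)], nonnegative
    by monotonicity. Every contraction property below is an instance of this. *)
Lemma sub_expansive h x r y s : 0 <= h -> sub_at x r -> sub_at y s ->
  nrm (x - y) <= nrm ((x + h *: r) - (y + h *: s)).
Proof.
move=> h0 hx hy; have m := sub_monotone hx hy.
rewrite opprD addrACA -scalerBr snorm_le_sqr ?snorm_ge0// snorm_sqr.
move: (r - s) (x - y) m => p d m.
have := mulr_ge0 h0 m; have := mulr_ge0 (mulr_ge0 h0 h0) (ip_ge0 ip p).
rewrite !ipE (ipC ip d p); lra.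
Qed.

Lemma J_shift h x : 0 < h -> J h x + h *: (h^-1 *: (x - J h x)) = x.
Proof. by move=> h0; rewrite scalerA divff ?gt_eqF// scale1r addrC subrK. Qed.

Lemma J_nonexp h x y : 0 < h -> nrm (J h x - J h y) <= nrm (x - y).
Proof.
move=> h0; have := sub_expansive (ltW h0) (J_sub x h0) (J_sub y h0).
by rewrite !J_shift.
Qed.

Lemma iterJ_nonexp h n x y : 0 < h ->
  nrm (iter n (J h) x - iter n (J h) y) <= nrm (x - y).
Proof.
move=> h0; elim: n => //= n IH; exact: le_trans (J_nonexp _ _ h0) IH.
Qed.

Lemma J_dist h x r : 0 < h -> sub_at x r -> nrm (J h x - x) <= h * nrm r.
Proof.
move=> h0 hx; have := sub_expansive (ltW h0) (J_sub x h0) hx.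
by rewrite J_shift// opprD addrA subrr sub0r snormN snormZ ger0_norm// ltW.
Qed.

Lemma iterJ_step h n x r : 0 < h -> sub_at x r ->
  nrm (iter n.+1 (J h) x - iter n (J h) x) <= h * nrm r.
Proof.
move=> h0 hx; rewrite iterSr; apply: le_trans (iterJ_nonexp _ _ _ h0) _.
exact: J_dist.
Qed.

Lemma iterJ_dist h n x r : 0 < h -> sub_at x r ->
  nrm (iter n (J h) x - x) <= n%:R * h * nrm r.
Proof.
move=> h0 hx; elim: n => [|n IH]; first by rewrite subrr snorm0 !mul0r.
apply: le_trans (snormB_le ip _ (iter n (J h) x) _) _.
rewrite -natr1 !mulrDl mul1r addrC; apply: lerD => //; exact: iterJ_step.
Qed.

(* Kobayashi's estimate between two implicit Euler schemes. *)
Lemma iterJ_compare (l m : R) i j x r : 0 < m -> m <= l -> sub_at x r ->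
  ip (iter i (J l) x - iter j (J m) x) (iter i (J l) x - iter j (J m) x) <=
  ip r r * ((i%:R * l - j%:R * m) ^+ 2 + i%:R * l ^+ 2 + j%:R * m ^+ 2).
Proof.
move=> m0 ml hx; have l0 : 0 < l by exact: lt_le_trans ml.
have rr0 := ip_ge0 ip r.
elim: j i => [|j IHj] i.
  rewrite mul0r subr0 mul0r addr0 /=.
  have := iterJ_dist i l0 hx; rewrite snorm_le_sqr; last first.
    by rewrite !mulr_ge0 ?snorm_ge0// ltW.
  move=> /le_trans; apply; rewrite exprMn snorm_sqr mulrC ler_wpM2l// lerDl.
  by rewrite mulr_ge0// sqr_ge0.
case: i => [|i].
  rewrite mul0r sub0r sqrrN mul0r addr0 /=.
  have := iterJ_dist j.+1 m0 hx; rewrite snorm_le_sqr; last first.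
    by rewrite !mulr_ge0 ?snorm_ge0// ltW.
  rewrite -(snorm_sqr ip (x - _)) snormBC snorm_sqr.
  move=> /le_trans; apply; rewrite exprMn snorm_sqr mulrC ler_wpM2l// lerDl.
  by rewrite mulr_ge0// sqr_ge0.
rewrite !iterS; set P := iter i (J l) x; set Q := iter j (J m) x.
have := sub_expansive (ltW m0) (J_sub P l0) (J_sub Q m0).
rewrite J_shift// snorm_le_sqr ?snorm_ge0// snorm_sqr => /le_trans; apply.
(* Resolvent identity: [J l P] is also a resolvent with the smaller step [m], of the convex
   combination of [P] and [J l P] with weights [m / l] and [1 - m / l]. *)
have -> : J l P + m *: (l^-1 *: (P - J l P)) - Q =
    (m / l) *: (P - Q) + (1 - m / l) *: (J l P - Q).
  rewrite scalerA [(1 - _) *: _]scalerBl scale1r addrCA -scalerBr.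
  by rewrite opprB addrA subrK addrAC.
have tl : 0 <= m / l <= 1.
  by rewrite divr_ge0 ?(ltW m0) ?(ltW l0)//= ler_pdivrMr// mul1r.
apply: le_trans (ip_convex ip _ _ tl) _.
have h1 := IHj i; have h2 := IHj i.+1; rewrite !iterS -/P -/Q in h1 h2.
have /andP[t0 t1] := tl.
have t1' : 0 <= 1 - m / l by rewrite subr_ge0.
apply: le_trans (lerD (ler_wpM2l t0 h1) (ler_wpM2l t1' h2)) _.
rewrite !(mulrCA _ (ip r r)) -mulrDr ler_wpM2l//.
rewrite -!natr1 -subr_ge0.
set a := i%:R; set b := j%:R.
(* The claimed bound exceeds the convex combination of the two inductive bounds by exactly
   [2 * m ^+ 2]. *)
have -> : (((a + 1) * l - (b + 1) * m) ^+ 2 + (a + 1) * l ^+ 2 +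
   (b + 1) * m ^+ 2 - (m / l * ((a * l - b * m) ^+ 2 + a * l ^+ 2 + b * m ^+ 2) +
   (1 - m / l) * (((a + 1) * l - b * m) ^+ 2 + (a + 1) * l ^+ 2 + b * m ^+ 2)))
  = 2 * m ^+ 2 by field; rewrite gt_eqF.
by rewrite mulr_ge0// sqr_ge0.
Qed.

Lemma cvgn_le (u : nat -> R) (l c : R) : u @ \oo --> l ->
  (forall k, u k <= c) -> l <= c.
Proof.
move=> /cvgrPdist_lt ul uc; apply/ler_addgt0Pr => e e0.
have [N _ /(_ N (leqnn _)) /=] := ul e e0.
by rewrite ltr_norml; have := uc N; lra.
Qed.

(** Resolvents of a point of the domain have subgradients and tend to that point as the step tends
    to 0. *)
Lemma sub_dense x e : 0 < e -> exists y r, sub_at y r /\ nrm (x - y) < e.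
Proof.
move=> e0; have e20 : 0 < e / 2 by lra.
have [y /F_dom[b Fy] xy] := F_dense x e20.
have b0 : 0 <= b by rewrite -lee_fin -Fy.
(* The subgradient inequality at [J h y], tested with [y], gives [|y - J h y|^2 <= h * b], below
   [(e / 2) ^+ 2] for this step. *)
pose h := (e / 2) ^+ 2 / (b + 1).
have h0 : 0 < h by rewrite divr_gt0 ?exprn_gt0//; lra.
exists (J h y), (h^-1 *: (y - J h y)); split; first exact: J_sub.
have [c Fc /(_ y b)] := J_sub y h0; rewrite Fy lexx => /(_ isT).
have c0 : 0 <= c by rewrite -lee_fin -Fc.
rewrite ipZl mulrC ler_pdivrMr// => H1.
have : nrm (y - J h y) < e / 2.
  rewrite snorm_lt_sqr ?(ltW e20)//.
  have : b * h < (e / 2) ^+ 2.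
    rewrite /h mulrA ltr_pdivrMr; last by lra.
    by have := exprn_gt0 2 e20; nra.
  by have := mulr_ge0 c0 (ltW h0); lra.
have := snormB_le ip x y (J h y); lra.
Qed.

Let st k : R := k.+1%:R^-1.
Let N k t := Num.truncn (t * k.+1%:R : R).
Let U k t x := iter (N k t) (J (st k)) x.

Let st_gt0 k : 0 < st k. Proof. by rewrite invr_gt0. Qed.

Let st_le i j : (i <= j)%N -> st j <= st i.
Proof. by move=> ij; rewrite lef_pV2 ?posrE// ler_nat. Qed.

Let N_itv k t : 0 <= t -> (N k t)%:R * st k <= t < (N k t)%:R * st k + st k.
Proof.
move=> t0; have := @truncn_itv R (t * k.+1%:R) (mulr_ge0 t0 (ler0n _ _)).
rewrite -/(N k t) => /andP[h1 h2]; rewrite ler_pdivrMr// h1 /=.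
by rewrite -{2}[st k]mul1r -mulrDl natr1 ltr_pdivlMr.
Qed.

(** Both schemes stop less than one step before [t], so in Kobayashi's estimate the squared time
    difference is at most [st i ^+ 2 <= st i], and each of the two remaining terms is at most
    [t * st i]. *)
Let U_dist i j t x r : 0 <= t -> sub_at x r -> (i <= j)%N ->
  ip (U i t x - U j t x) (U i t x - U j t x) <= ip r r * (1 + 2 * t) * st i.
Proof.
move=> t0 hx ij; apply: le_trans (iterJ_compare _ _ (st_gt0 j) (st_le ij) hx) _.
rewrite -mulrA ler_wpM2l ?ip_ge0// !expr2 !mulrA.
have := N_itv i t0; have := N_itv j t0.
have := st_gt0 j; have := st_gt0 i; have := st_le ij.
have : st i <= 1 by rewrite invf_le1// ler1n.
move: (st i) (st j) ((N i t)%:R * st i) ((N j t)%:R * st j) => c d a b.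
move=> c1 dc c0 d0 /andP[b1 b2] /andP[a1 a2].
have h1 : (a - b) ^+ 2 <= c ^+ 2.
  by rewrite -subr_ge0 subr_sqr mulr_ge0//; lra.
rewrite -expr2; have : c ^+ 2 <= c by rewrite expr2; nra.
have : a * c <= t * c by rewrite ler_wpM2r// ltW.
have : b * d <= t * c.
  apply: le_trans (ler_wpM2r (ltW d0) b1) _; exact: ler_wpM2l.
by nra.
Qed.

Let U_ne k t x y : nrm (U k t x - U k t y) <= nrm (x - y).
Proof. exact: iterJ_nonexp. Qed.

Let U_cauchy t x : 0 <= t -> scauchy ip (fun k => U k t x).
Proof.
move=> t0 e e0; have e30 : 0 < e / 3 by lra.
have [y [r [hy xy]]] := sub_dense x e30.
have c0 : 0 < ip r r * (1 + 2 * t) + 1.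
  by have := mulr_ge0 (ip_ge0 ip r) (_ : 0 <= 1 + 2 * t); lra.
have [M HM] := invS_lt (divr_gt0 (exprn_gt0 2 e30) c0).
exists M => i j; wlog ij : i j / (i <= j)%N => [W Mi Mj|Mi _].
  by have [/W|/ltnW/W] := leqP i j; [exact|rewrite snormBC; exact].
have := snormB_le ip (U i t x) (U i t y) (U j t x).
have := snormB_le ip (U i t y) (U j t y) (U j t x).
have := U_ne i t x y; have := U_ne j t y x; rewrite (snormBC ip y x).
suff : nrm (U i t y - U j t y) < e / 3 by lra.
rewrite snorm_lt_sqr ?(ltW e30)//.
apply: le_lt_trans (U_dist t0 hy ij) _.
have := HM i Mi; rewrite ltr_pdivlMr// -/(st i).
by have := st_gt0 i; lra.
Qed.

Definition S t x := xget x [set l | scvg ip (fun k => U k t x) l].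

Let S_cvg t x : 0 <= t -> scvg ip (fun k => U k t x) (S t x).
Proof. by move=> t0; exact: (xgetPex x (Hcomplete (U_cauchy x t0))). Qed.

Lemma S_nonexp t x y : 0 <= t -> nrm (S t x - S t y) <= nrm (x - y).
Proof.
move=> t0; apply: (cvgn_le (scvg_snorm (scvgB (S_cvg x t0) (S_cvg y t0)))) => k.
exact: U_ne.
Qed.

Lemma S_0 x : nrm (S 0 x - x) = 0.
Proof.
apply: (scvg_unique (S_cvg x (lexx 0))).
suff -> : (fun k => U k 0 x) = fun=> x by exact: scvg_cst.
by apply/funext => k; rewrite /U /N mul0r truncn0.
Qed.

Let iterJ_diff h n d x r : 0 < h -> sub_at x r ->
  nrm (iter (n + d) (J h) x - iter n (J h) x) <= d%:R * h * nrm r.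
Proof.
move=> h0 hx; rewrite iterD; apply: le_trans (iterJ_nonexp _ _ _ h0) _.
exact: iterJ_dist.
Qed.

Lemma S_lip s t x r : sub_at x r -> 0 <= s <= t ->
  nrm (S t x - S s x) <= (t - s) * nrm r.
Proof.
move=> hx /andP[s0 st']; have t0 := le_trans s0 st'.
have := scvg_snorm (scvgB (S_cvg x t0) (S_cvg x s0)).
move=> cv; rewrite -subr_le0.
apply: (@cvgn_le (fun k => nrm (U k t x - U k s x) - (t - s + st k) * nrm r)).
  apply: cvgB => //; apply: cvgMr_tmp; rewrite -[X in _ --> X]addr0.
  by apply: cvgD; [exact: cvg_cst|exact: cvg_invS].
move=> k; rewrite subr_le0 /U.
have Nst : (N k s <= N k t)%N by apply: le_truncn; rewrite ler_pM2r.
rewrite -{1}(subnKC Nst); apply: le_trans (iterJ_diff _ _ (st_gt0 k) hx) _.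
rewrite ler_wpM2r ?snorm_ge0// natrB// mulrBl.
have := N_itv k s0; have := N_itv k t0; lra.
Qed.

Let S_lip0 h x r : 0 < h -> sub_at x r -> nrm (S h x - x) <= h * nrm r.
Proof.
move=> h0 hx; have := @S_lip 0 h x r hx; rewrite lexx (ltW h0) subr0 => /(_ isT).
by rewrite snormBC (snorm_null_eq _ (S_0 x)) snormBC.
Qed.

Lemma S_cont x t0 e : 0 <= t0 -> 0 < e -> exists2 d, 0 < d &
  forall t, 0 <= t -> `|t - t0| < d -> nrm (S t x - S t0 x) < e.
Proof.
move=> t00 e0; have e30 : 0 < e / 3 by lra.
have [y [r [hy xy]]] := sub_dense x e30.
have r0 : 0 < nrm r + 1 by have := snorm_ge0 ip r; lra.
exists (e / 3 / (nrm r + 1)) => [|t tt0]; first by rewrite divr_gt0.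
rewrite ltr_pdivlMr// => tr.
have h1 : nrm (S t y - S t0 y) <= `|t - t0| * nrm r.
  have [tle|/ltW tle] := leP t0 t.
    by rewrite ger0_norm ?subr_ge0//; apply: S_lip; rewrite // t00.
  rewrite snormBC ler0_norm ?subr_le0// opprB; apply: S_lip => //.
  by rewrite tt0.
have := snormB_le ip (S t x) (S t y) (S t0 x).
have := snormB_le ip (S t y) (S t0 y) (S t0 x).
have := S_nonexp x y tt0; have := S_nonexp y x t00; rewrite (snormBC ip y x).
have := normr_ge0 (t - t0); lra.
Qed.

Let N_add k t s : 0 <= t -> 0 <= s ->
  exists2 d, (d <= 1)%N & N k (t + s) = (N k t + N k s + d)%N.
Proof.
move=> t0 s0; have ts0 : 0 <= t + s by rewrite addr_ge0.
have := N_itv k t0; have := N_itv k s0; have := N_itv k ts0.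
have k0 := st_gt0 k => /andP[a1 a2] /andP[b1 b2] /andP[c1 c2].
have h1 : (N k t + N k s < (N k (t + s)).+1)%N.
  rewrite -(ltr_nat R) -(ltr_pM2r k0) -natr1 natrD !mulrDl mul1r; lra.
have h2 : (N k (t + s) < (N k t + N k s).+2)%N.
  rewrite -(ltr_nat R) -(ltr_pM2r k0) -natr1 -natr1 natrD !mulrDl mul1r; lra.
exists (N k (t + s) - (N k t + N k s))%N; last by rewrite subnKC.
by rewrite leq_subLR addn1.
Qed.

(** The step counts are not additive: [N k (t + s)] may exceed [N k t + N k s] by one. The extra
    step costs [st k * nrm r] at a point with a subgradient [r], hence the detour through a nearby
    [y]. *)
Lemma S_add t s x : 0 <= t -> 0 <= s -> nrm (S (t + s) x - S t (S s x)) = 0.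
Proof.
move=> t0 s0; have ts0 : 0 <= t + s by rewrite addr_ge0.
apply/eqP; rewrite eq_le snorm_ge0 andbT.
apply/ler_addgt0Pr => e e0; rewrite add0r; have e0' : 0 < e / 6 by lra.
have [y [r [hy xy]]] := sub_dense x e0'.
have r0 : 0 < nrm r + 1 by have := snorm_ge0 ip r; lra.
have [n1 H1] := S_cvg y ts0 e0'; have [n2 H2] := S_cvg y s0 e0'.
have [n3 H3] := S_cvg (S s y) t0 e0'.
have [n4 H4] := invS_lt (divr_gt0 e0' r0).
pose k := (n1 + n2 + n3 + n4)%N.
have k1 : (n1 <= k)%N by rewrite /k -!addnA leq_addr.
have k2 : (n2 <= k)%N by rewrite /k -!addnA addnCA leq_addr.
have k3 : (n3 <= k)%N by rewrite /k -addnA addnCA leq_addr.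
have k4 : (n4 <= k)%N by rewrite leq_addl.
have := H1 k k1; have := H2 k k2; have := H3 k k3; have := H4 k k4.
rewrite -/(st k) ltr_pdivlMr// => h4 h3 h2 h1.
have h5 : nrm (U k (t + s) y - U k t (U k s y)) <= st k * nrm r.
  have [d d1 dE] := N_add k t0 s0.
  rewrite /U dE -iterD; apply: le_trans (iterJ_diff _ _ (st_gt0 k) hy) _.
  rewrite -mulrA -[leRHS]mul1r ler_wpM2r ?(ler_nat R d 1)//.
  by rewrite mulr_ge0 ?snorm_ge0// ltW.
have h6 := U_ne k t (U k s y) (S s y).
move: {H1 H2 H3 H4 k1 k2 k3 k4} h1 h2 h3 h4 h5 h6 => h1 h2 h3 h4 h5 h6.
have h7 : st k * nrm r < e / 6 by have := st_gt0 k; lra.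
have h8 : nrm (U k t (U k s y) - S t (S s y)) < e / 3.
  by have := snormB_le ip (U k t (U k s y)) (U k t (S s y)) (S t (S s y)); lra.
have h9 : nrm (U k (t + s) y - S t (S s y)) < e / 2.
  have := snormB_le ip (U k (t + s) y) (U k t (U k s y)) (S t (S s y)).
  by move: h5 h7 h8; lra.
have h10 : nrm (S (t + s) y - S t (S s y)) < 2 * e / 3.
  have := snormB_le ip (S (t + s) y) (U k (t + s) y) (S t (S s y)).
  rewrite (snormBC ip (S (t + s) y) (U _ _ _)).
  by move: h1 h9; lra.
have h11 := le_lt_trans (S_nonexp x y ts0) xy.
rewrite snormBC in xy.
have h12 := le_lt_trans (le_trans (S_nonexp _ _ t0) (S_nonexp y x s0)) xy.
apply: le_trans (snormB_le ip _ (S (t + s) y) _) _.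
apply: le_trans (lerD (ltW h11) (snormB_le ip _ (S t (S s y)) _)) _.
apply: le_trans (lerD (lexx _) (lerD (ltW h10) (ltW h12))) _.
by rewrite le_eqVlt (_ : _ + _ = e) ?eqxx//; field.
Qed.

Let J_evi h x w a : 0 < h -> (F w <= a%:E)%E -> exists2 b, F (J h x) = b%:E &
  ip (J h x - w) (J h x - w) - ip (x - w) (x - w) <= 2 * h * (a - b).
Proof.
move=> h0 Fw; have [b Fb /(_ w a Fw) Hb] := J_sub x h0; exists b => //.
move: {Fb} (J h x) Hb => y; rewrite ipZl mulrC ler_pdivrMr// => h1.
rewrite -subr_ge0.
have := ip_ge0 ip (x - y); move: h1.
rewrite !ipE (ipC ip y x) (ipC ip w x) (ipC ip w y); lra.
Qed.

(** Sum of the one-step inequalities. The energy decreases along the scheme, so each intermediate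
    energy may be replaced by the last one. *)
Let iterJ_evi h n x w a : 0 < h -> (F w <= a%:E)%E ->
  exists2 b, F (iter n.+1 (J h) x) = b%:E &
  ip (iter n.+1 (J h) x - w) (iter n.+1 (J h) x - w) - ip (x - w) (x - w)
    <= 2 * (n.+1%:R * h) * (a - b).
Proof.
move=> h0 Fw; elim: n => [|n [b Fb Hb]].
  by rewrite mul1r; exact: J_evi.
rewrite iterS; set y := iter n.+1 (J h) x in Fb Hb *.
have [c Fc Hc] := J_evi y h0 Fw; exists c => //.
have cb : c <= b.
  have Fy : (F y <= b%:E)%E by rewrite Fb.
  have [c' Fc' Hc'] := J_evi y h0 Fy.
  have -> : c = c' by apply: EFin_inj; rewrite -Fc.
  move: Hc'; rewrite subrr ip0l subr0 => Hc'.
  have := le_trans (ip_ge0 _ _) Hc'.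
  by rewrite pmulr_rge0 ?subr_ge0//; lra.
have := mulr_ge0 (mulr_ge0 (ler0n R n.+1) (ltW h0)) (_ : 0 <= b - c).
rewrite subr_ge0 => /(_ cb).
rewrite -(natr1 n.+1) [(_ + 1) * h]mulrDl mul1r.
by move: Hb Hc; move: (n.+1%:R * h) => d; lra.
Qed.

(** Integrated evolution variational inequality. It holds for every initial point [x], so it
    contains the smoothing effect: the energy is finite at every positive time. *)
Lemma S_evi t x w a : 0 < t -> (F w <= a%:E)%E -> exists2 b, F (S t x) = b%:E &
  ip (S t x - w) (S t x - w) - ip (x - w) (x - w) <= 2 * t * (a - b).
Proof.
move=> t0 Fw.
have [M HM] := invS_lt t0.
(* The time actually reached by the scheme. Starting at index [M], at least one step fits into
   [[0, t]], so that dividing by [2 * T k] is legitimate. *)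
pose T k := (N (M + k) t)%:R * st (M + k).
have T0 k : 0 < T k.
  rewrite mulr_gt0// ltr0n truncn_gt0.
  by rewrite -ler_pdivrMr// div1r; apply/ltW/HM; rewrite leq_addr.
have Tt : T @ \oo --> t.
  apply/cvgrPdist_lt => e e0; have [K HK] := invS_lt e0; exists K => // k /= Kk.
  have := N_itv (M + k) (ltW t0); rewrite -/(T k).
  have := HK (M + k)%N (leq_trans Kk (leq_addl _ _)); rewrite -/(st _).
  by move=> h1 h2; rewrite ger0_norm; lra.
have cv : scvg ip (fun k => U (M + k) t x) (S t x).
  exact: (scvg_subseq (fun k => leq_addl M k) (S_cvg x (ltW t0))).
have FS : (F (S t x) <= (a - (ip (S t x - w) (S t x - w) - ip (x - w) (x - w))
    / (2 * t))%:E)%E.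
  apply: (@F_lim _ _ (fun k => a - (ip (U (M + k) t x - w) (U (M + k) t x - w)
    - ip (x - w) (x - w)) / (2 * T k)) _ cv).
    apply: cvgB; first exact: cvg_cst.
    apply: cvgM.
      by apply: cvgB; [exact: (scvg_sqr (scvgB cv (scvg_cst ip w)))|exact: cvg_cst].
    apply: cvgV; first by rewrite mulf_neq0// gt_eqF.
    exact: cvgMl_tmp.
  move=> k; have := T0 k; rewrite /T /U.
  case: (N (M + k) t) => [|n]; first by rewrite mul0r ltxx.
  move=> n0; have [b -> Hb] := iterJ_evi n x (st_gt0 (M + k)) Fw.
  rewrite lee_fin lerBrDr -lerBrDl ler_pdivrMr; last by rewrite mulr_gt0.
  by rewrite mulrC.
have [b Fb /andP[b0 bb]] := F_fin FS; exists b => //.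
move: bb; rewrite lerBrDr -lerBrDl ler_pdivrMr; last by rewrite mulr_gt0.
by rewrite mulrC.
Qed.

Variable x0 : H.
Let u t := S t x0.
Let f t := fine (F (u t)).

Let u_shift s h : 0 <= s -> 0 <= h -> nrm (u (s + h) - S h (u s)) = 0.
Proof. by move=> s0 h0; rewrite (addrC s); exact: S_add. Qed.

Let u_evi s h w a : 0 <= s -> 0 < h -> (F w <= a%:E)%E ->
  F (u (s + h)) = (f (s + h))%:E /\
  ip (u (s + h) - w) (u (s + h) - w) - ip (u s - w) (u s - w)
    <= 2 * h * (a - f (s + h)).
Proof.
move=> s0 h0 Fw; have sh := u_shift s0 (ltW h0).
have [b Fb] := S_evi (u s) h0 Fw.
rewrite /f (F_null sh) Fb; split => //; rewrite -2!snorm_sqr.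
by rewrite (snorm_null_eq w sh) 2!snorm_sqr.
Qed.

Let F_some : exists w a, (F w <= a%:E)%E.
Proof.
have [y /F_dom[b Fy] _] := F_dense 0 ltr01.
by exists y, b; rewrite Fy.
Qed.

Let fE t : 0 < t -> F (u t) = (f t)%:E.
Proof.
move=> t0; have [w [a Fw]] := F_some.
by have [] := u_evi (lexx 0) t0 Fw; rewrite add0r.
Qed.

Let f_ge0 t : 0 < t -> 0 <= f t.
Proof. by move=> t0; rewrite -lee_fin -fE. Qed.

Let f_drop s h : 0 < s -> 0 < h ->
  ip (u (s + h) - u s) (u (s + h) - u s) <= 2 * h * (f s - f (s + h)).
Proof.
move=> s0 h0; have Fs : (F (u s) <= (f s)%:E)%E by rewrite fE.
by have [_] := u_evi (ltW s0) h0 Fs; rewrite subrr ip0l subr0.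
Qed.

Let f_decr s t : 0 < s -> s <= t -> f t <= f s.
Proof.
move=> s0; rewrite le_eqVlt => /predU1P[->//|st'].
have h0 : 0 < t - s by rewrite subr_gt0.
have := le_trans (ip_ge0 _ _) (f_drop s0 h0).
by rewrite (addrC s) subrK pmulr_rge0 ?subr_ge0// mulr_gt0.
Qed.

Let D h t := nrm (u (t + h) - u t).

Let D_ge0 h t : 0 <= D h t. Proof. exact: snorm_ge0. Qed.

Let D_decr h s t : 0 <= h -> 0 <= s -> s <= t -> D h t <= D h s.
Proof.
move=> h0 s0 st'; have d0 : 0 <= t - s by rewrite subr_ge0.
have -> : t = s + (t - s) by rewrite addrC subrK.
rewrite /D addrAC.
rewrite (snorm_null_eq _ (u_shift (addr_ge0 s0 h0) d0)) snormBC.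
rewrite (snorm_null_eq _ (u_shift s0 d0)) snormBC.
exact: S_nonexp.
Qed.

Let D_add a b t : 0 <= t -> 0 <= a -> 0 <= b -> D (a + b) t <= D a t + D b t.
Proof.
move=> t0 a0 b0.
have := snormB_le ip (u (t + (a + b))) (u (t + a)) (u t).
have : D b (t + a) <= D b t by apply: D_decr => //; rewrite lerDl.
by rewrite /D addrA; lra.
Qed.

Let D_muln n h t : 0 <= t -> 0 <= h -> D (n%:R * h) t <= n%:R * D h t.
Proof.
move=> t0 h0; elim: n => [|n IH].
  by rewrite !mul0r /D addr0 subrr snorm0.
rewrite -natr1 !mulrDl !mul1r; apply: le_trans (D_add _ _ _) _ => //.
  by rewrite mulr_ge0.
by rewrite lerD2r.
Qed.

(** By [f_drop] the squared increments at [n] successive times telescope against the energy, and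
    increments decrease in time, so each is at least the one at the final time. *)
Let D_tele s h n : 0 < s -> 0 < h ->
  n%:R * D h (s + n%:R * h) ^+ 2 <= 2 * h * (f s - f (s + n%:R * h)).
Proof.
move=> s0 h0; elim: n => [|n IH]; first by rewrite !mul0r addr0 subrr mulr0.
have nh : 0 <= n%:R * h by rewrite mulr_ge0// ltW.
have snh : 0 < s + n%:R * h by lra.
have := f_drop snh h0; rewrite -addrA.
rewrite -[n.+1%:R]natr1 (mulrDl n%:R 1 h) mul1r.
rewrite -snorm_sqr addrA -/(D h _) => drop.
have dec : D h (s + n%:R * h + h) ^+ 2 <= D h (s + n%:R * h) ^+ 2.
  rewrite ler_pXn2r ?nnegrE ?D_ge0//; apply: D_decr; [exact: ltW|exact: ltW|].
  by rewrite lerDl ltW.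
rewrite (mulrDl n%:R 1 (_ ^+ 2)) mul1r; have := ler_wpM2l (ler0n R n) dec.
move: IH drop dec; rewrite -!addrA.
by move: (D h (s + (n%:R * h + h)) ^+ 2) (D h (s + n%:R * h) ^+ 2) => p q; lra.
Qed.

Let K t := Num.sqrt (8 * f (t / 2) / t).

(** Go back from [t] by [n] steps of size [h], with [n] the integer part of [t / (2 h)]. The start
    is not before [t / 2], so the energy spent is at most [f (t / 2)], and [n * h >= t / 4]; this is
    the origin of the 8 in [K]. *)
Let D_small t h : 0 < t -> 0 < h -> h <= t / 2 -> D h t <= h * K t.
Proof.
move=> t0 h0 ht; pose n := Num.truncn (t / 2 / h).
have t20 : 0 < t / 2 by lra.
have /andP[n1 n2] := truncn_itv (divr_ge0 (ltW t20) (ltW h0)).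
have n0 : (0 < n)%N by rewrite truncn_gt0 ler_pdivlMr// mul1r.
rewrite -/n ler_pdivlMr// in n1; rewrite -/n ltr_pdivrMr// in n2.
have n3 : t / 2 < n%:R * h + h by rewrite -{2}[h]mul1r -mulrDl natr1.
have n1' : 1 <= n%:R :> R by rewrite ler1n.
pose s := t - n%:R * h.
have s0 : 0 < s by rewrite /s; lra.
have := D_tele n s0 h0; rewrite /s subrK -/s => Hn.
have ft : 0 <= f t by exact: f_ge0.
have fs : f s <= f (t / 2) by apply: f_decr => //; rewrite /s; lra.
have f0 : 0 <= f (t / 2) by exact: f_ge0.
rewrite snorm_le_sqr; last by rewrite mulr_ge0 ?sqrtr_ge0// ltW.
rewrite -snorm_sqr -/(D h t) exprMn [K t ^+ 2]sqr_sqrtr; last first.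
  by rewrite divr_ge0 ?(ltW t0)// mulr_ge0.
have h1 : n%:R * D h t ^+ 2 <= 2 * h * f (t / 2).
  apply: le_trans Hn _; rewrite ler_wpM2l//; first by lra.
  by lra.
have h2 : n%:R * (h ^+ 2 * (8 * f (t / 2) / t)) >= 2 * h * f (t / 2).
  have -> : n%:R * (h ^+ 2 * (8 * f (t / 2) / t)) =
      2 * h * f (t / 2) * (4 * (n%:R * h) / t) by field; rewrite gt_eqF.
  rewrite ler_peMr ?mulr_ge0 ?(ltW h0)// ler_pdivlMr// mul1r.
  have : h <= n%:R * h by rewrite ler_peMl// ltW.
  by move: n3; move: (n%:R * h) => nh; lra.
by rewrite -(ler_pM2l (_ : 0 < n%:R :> R)) ?ltr0n//; exact: le_trans h1 h2.
Qed.

Let D_bound t h : 0 < t -> 0 < h -> D h t <= h * K t.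
Proof.
move=> t0 h0; pose n := (Num.truncn (h / (t / 2))).+1.
have t20 : 0 < t / 2 by lra.
have n0 : 0 < n%:R :> R by rewrite ltr0n.
have hn : h / n%:R <= t / 2.
  rewrite ler_pdivrMr// mulrC -ler_pdivrMr//; apply/ltW.
  exact: truncnS_gt.
have -> : h = n%:R * (h / n%:R) by field; rewrite gt_eqF.
have h1 := D_small t0 (divr_gt0 h0 n0) hn.
apply: le_trans (D_muln n (ltW t0) (ltW (divr_gt0 h0 n0))) _.
by rewrite -mulrA ler_wpM2l// ltW.
Qed.

(** The best forward Lipschitz constant of [u] from time [t]. It will turn out to be the norm of the
    right derivative. *)
Let L t := sup [set D h t / h | h in [set h : R | 0 < h]].

Let L_has t : 0 < t -> has_sup [set D h t / h | h in [set h : R | 0 < h]].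
Proof.
move=> t0; split; first by exists (D 1 t / 1), 1 => //=; exact: ltr01.
exists (K t) => _ [h h0 <-]; rewrite ler_pdivrMr// mulrC; exact: D_bound.
Qed.

Let D_L t h : 0 < t -> 0 < h -> D h t <= h * L t.
Proof.
move=> t0 h0; rewrite mulrC -ler_pdivrMr//.
by apply: ub_le_sup; [exact: (L_has t0).2|exists h].
Qed.

Let L_le t c : 0 < t -> (forall h, 0 < h -> D h t <= h * c) -> L t <= c.
Proof.
move=> t0 Hc; apply: ge_sup; first exact: (L_has t0).1.
by move=> _ [h h0 <-]; rewrite ler_pdivrMr// mulrC; exact: Hc.
Qed.

Let L_ge0 t : 0 < t -> 0 <= L t.
Proof.
move=> t0; have := D_L t0 ltr01; rewrite mul1r; exact: le_trans.
Qed.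

Let L_decr s t : 0 < s -> s <= t -> L t <= L s.
Proof.
move=> s0 st'; have t0 := lt_le_trans s0 st'; apply: L_le => // h h0.
by apply: le_trans (D_L s0 h0); apply: D_decr => //; exact: ltW.
Qed.

(** Otherwise the energy would stay at most [f t - e] along times tending to [t] from the right,
    against lower semicontinuity and the continuity of [u]. With monotonicity this is right
    continuity of [f]. *)
Let f_rcont t e : 0 < t -> 0 < e -> exists2 d, 0 < d &
  forall h, 0 < h -> h < d -> f t - e < f (t + h).
Proof.
move=> t0 e0; apply: contrapT => /forall2NP Hd.
have Hk k : exists h : R, [/\ 0 < h, h < k.+1%:R^-1 & f (t + h) <= f t - e].
  have [/negP|/existsNP[h]] := Hd k.+1%:R^-1; first by rewrite invr_gt0 ltr0n.
  move=> /not_implyP[h0 /not_implyP[hk /negP]]; rewrite -leNgt => fh.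
  by exists h.
have [h Hh] := choice Hk.
have : (F (u t) <= (f t - e)%:E)%E.
  apply: (@F_lsc (fun k => u (t + h k))) => [eps eps0|k]; last first.
    by have [h0 _ fh] := Hh k; rewrite fE ?lee_fin// addr_gt0.
  have [d d0 Hd'] := S_cont x0 (ltW t0) eps0.
  have [M HM] := invS_lt d0; exists M => k Mk; have [h0 hk _] := Hh k.
  apply: Hd'; first by rewrite addr_ge0// ltW.
  rewrite addrAC subrr add0r gtr0_norm//; exact: lt_trans hk (HM k Mk).
by rewrite fE// lee_fin; lra.
Qed.

(** The approximate subdifferential at [u t] with tolerance [k.+1%:R^-1]. For small [h] it contains
    the difference quotients [- q t h], which need not be exact subgradients there. *)
Let C t k r := forall w a, (F w <= a%:E)%E ->
  ip r (w - u t) <= a - f t + k.+1%:R^-1.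

Let sub_C t k r : 0 < t -> sub_at (u t) r -> C t k r.
Proof.
move=> t0 [b]; rewrite fE// => -[<-] Hr w a Fw; apply: le_trans (Hr w a Fw) _.
by rewrite lerDl invr_ge0.
Qed.

Let C_sub t r : 0 < t -> (forall k, C t k r) -> sub_at (u t) r.
Proof.
move=> t0 Cr; exists (f t); first by rewrite fE.
move=> w a Fw; apply/ler_addgt0Pr => e /invS_lt[M /(_ M (leqnn _)) HM].
by apply: le_trans (Cr M w a Fw) _; rewrite lerD2l ltW.
Qed.

Let q t h := h^-1 *: (u (t + h) - u t).

Let q_norm t h : 0 < t -> 0 < h -> nrm (- q t h) <= L t.
Proof.
move=> t0 h0; rewrite snormN snormZ gtr0_norm ?invr_gt0//.
by rewrite mulrC ler_pdivrMr// mulrC; exact: D_L.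
Qed.

(** The evolution inequality makes [- q t h] a subgradient up to replacing [f t] by [f (t + h)];
    right continuity of the energy absorbs the difference. *)
Let q_C t k : 0 < t -> exists2 d, 0 < d &
  forall h, 0 < h -> h < d -> C t k (- q t h).
Proof.
move=> t0; have [|d d0 Hd] := @f_rcont t k.+1%:R^-1 t0.
  by rewrite invr_gt0.
exists d => // h h0 hd w a Fw; have := Hd h h0 hd.
suff : ip (- q t h) (w - u t) <= a - f (t + h).
  by move: (k.+1%:R^-1) => c; lra.
have [_] := u_evi (ltW t0) h0 Fw.
have -> : ip (- q t h) (w - u t) =
    h^-1 * ip (u (t + h) - u t) (u t - w) by rewrite /q ipNl -ipNr opprB ipZl.
rewrite (mulrC h^-1) ler_pdivrMr//.
have := ip_ge0 ip (u (t + h) - u t).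
move: (u (t + h)) (u t) => y z; rewrite !ipE (ipC ip z y) (ipC ip w y) (ipC ip w z).
by lra.
Qed.

Let C_decr t k : C t k.+1 `<=` C t k.
Proof.
move=> r Cr w a Fw; apply: le_trans (Cr w a Fw) _.
by rewrite lerD2l lef_pV2 ?posrE// ler_nat.
Qed.

Let C_mid t k r s : C t k r -> C t k s -> C t k (2^-1 *: (r + s)).
Proof.
move=> Cr Cs w a Fw; have := Cr w a Fw; have := Cs w a Fw.
by rewrite ipZl ipDl; move: (k.+1%:R^-1) => d; lra.
Qed.

Let C_limit t k (z : nat -> H) r j : (forall i, (j <= i)%N -> C t k (z i)) ->
  scvg ip z r -> C t k r.
Proof.
move=> Cz zr w a Fw.
have := scvg_ip (y := w - u t) (scvg_subseq (fun i => leq_addl j i) zr).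
by move=> /cvgn_le; apply => i; apply: Cz; rewrite ?leq_addr.
Qed.

(* Elements of the approximate subdifferentials of norm at most [L t] are
   asymptotically unique: [L t] does not exceed the minimal norm of the
   subdifferential. *)
Let C_close t d : 0 < t -> 0 < d -> exists k, forall p r, C t k p -> C t k r ->
  nrm p <= L t -> nrm r <= L t -> nrm (p - r) < d.
Proof.
move=> t0 d0.
have bnd k : exists2 p, C t k p & ip p p <= L t ^+ 2.
  have [c c0 Hc] := q_C k t0; have h0 : 0 < c / 2 by lra.
  exists (- q t (c / 2)); first by apply: Hc => //; lra.
  by rewrite -snorm_le_sqr ?L_ge0//; exact: q_norm.
have [m [Hm [z Hz cz]]] := nested_min (@C_decr t) (@C_mid t) bnd.
have [r zr] := Hcomplete cz.
have rsub : sub_at (u t) r.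
  apply: C_sub => // k; apply: (@C_limit t k z r k) => // i ki.
  by apply: (nested_decr (@C_decr t) ki); have [] := Hz i.
have rm : ip r r <= m.
  rewrite -subr_le0.
  apply: (@cvgn_le (fun k => ip (z k) (z k) - (m + k.+1%:R^-1))).
    apply: cvgB; first exact: scvg_sqr.
    by rewrite -[X in _ --> X]addr0; apply: cvgD; [exact: cvg_cst|exact: cvg_invS].
  by move=> k; have [_ /ltW] := Hz k; rewrite subr_le0.
(* A subgradient at [u t] bounds all forward increments by [h * nrm r]. Hence [L t ^+ 2 <= m], and
   elements of norm at most [L t] are nearly minimal. *)
have Lr : L t <= nrm r.
  apply: L_le => // h h0.
  by rewrite /D (snorm_null_eq _ (u_shift (ltW t0) (ltW h0))); apply: S_lip0.
have Lm : L t ^+ 2 <= m.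
  by apply: le_trans rm; rewrite -snorm_sqr ler_pXn2r ?nnegrE ?L_ge0 ?snorm_ge0.
have [e e0 [k Hk]] := nested_close (@C_mid t) Hm d0.
exists k => p s Cp Cs pL sL; apply: Hk => //.
  by move: pL; rewrite snorm_le_sqr ?L_ge0//; lra.
by move: sL; rewrite snorm_le_sqr ?L_ge0//; lra.
Qed.

Let q_cauchy t d : 0 < t -> 0 < d -> exists2 c, 0 < c &
  forall h l, 0 < h -> h < c -> 0 < l -> l < c -> nrm (q t h - q t l) < d.
Proof.
move=> t0 d0; have [k Hk] := C_close t0 d0.
have [c c0 Hc] := q_C k t0; exists c => // h l h0 hc l0 lc.
by rewrite snormBC -[q t l]opprK addrC; apply: Hk; rewrite ?q_norm//; exact: Hc.
Qed.

Let v t := xget 0 [set l | forall d, 0 < d -> exists2 c, 0 < c &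
  forall h, 0 < h -> h < c -> nrm (q t h - l) < d].

Let v_lim t : 0 < t -> forall d, 0 < d -> exists2 c, 0 < c &
  forall h, 0 < h -> h < c -> nrm (q t h - v t) < d.
Proof.
move=> t0; rewrite /v.
suff ex : exists l, forall d, 0 < d -> exists2 c, 0 < c &
    forall h, 0 < h -> h < c -> nrm (q t h - l) < d by exact: (xgetPex 0 ex).
have cq : scauchy ip (fun k => q t k.+1%:R^-1).
  move=> d /(q_cauchy t0)[c /invS_lt[M HM] Hc]; exists M => i j Mi Mj.
  by apply: Hc; rewrite ?invr_gt0//; exact: HM.
have [l ql] := Hcomplete cq; exists l => d d0; have d20 : 0 < d / 2 by lra.
have [c c0 Hc] := q_cauchy t0 d20; exists c => // h h0 hc.
have [M HM] := ql _ d20; have [M' HM'] := invS_lt c0.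
have h1 := HM (maxn M M') (leq_maxl _ _).
have h2 : nrm (q t h - q t (maxn M M').+1%:R^-1) < d / 2.
  by apply: Hc; rewrite ?invr_gt0//; exact: HM' (leq_maxr _ _).
have := snormB_le ip (q t h) (q t (maxn M M').+1%:R^-1) l; lra.
Qed.

Let v_cvg t : 0 < t -> scvg ip (fun k => q t k.+1%:R^-1) (v t).
Proof.
move=> t0 d /(v_lim t0)[c /invS_lt[M HM] Hc]; exists M => i Mi.
by apply: Hc; rewrite ?invr_gt0//; exact: HM.
Qed.

Let v_sub t : 0 < t -> sub_at (u t) (- v t).
Proof.
move=> t0; apply: C_sub => // k.
have [c /invS_lt[M HM] Hc] := q_C k t0.
have := scvgZ (-1) (v_cvg t0); rewrite scaleN1r => /(C_limit (j := M)); apply.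
by move=> i Mi; rewrite scaleN1r; apply: Hc; rewrite ?invr_gt0//; exact: HM.
Qed.

Let v_norm t : 0 < t -> nrm (v t) = L t.
Proof.
move=> t0; apply/eqP; rewrite eq_le; apply/andP; split.
  apply: (cvgn_le (scvg_snorm (v_cvg t0))) => k.
  by rewrite -snormN; apply: q_norm; rewrite ?invr_gt0.
apply: L_le => // h h0; rewrite /D (snorm_null_eq _ (u_shift (ltW t0) (ltW h0))).
by rewrite -(snormN ip (v t)); apply: S_lip0 => //; exact: v_sub.
Qed.

(** [- v (t + h)] is an approximate subgradient at [u t] of norm at most [L t], so [C_close]
    compares it with [- v t]. Half of the tolerance pays for the drop of the energy, half for moving
    the base point, which costs at most [h * L t ^+ 2]. *)
Let v_rcont t d : 0 < t -> 0 < d -> exists2 c, 0 < c &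
  forall h, 0 <= h -> h < c -> nrm (v (t + h) - v t) < d.
Proof.
move=> t0 d0; have [k Hk] := C_close t0 d0.
have e0 : 0 < (k.+1%:R^-1 : R) / 2 by rewrite divr_gt0// invr_gt0.
have [c c0 Hc] := f_rcont t0 e0.
have L0 := L_ge0 t0; have LL0 := mulr_ge0 L0 L0.
have L1 : 0 < L t * L t + 1 by lra.
exists (Num.min c (k.+1%:R^-1 / 2 / (L t * L t + 1))) => [|h].
  by rewrite lt_min c0/= divr_gt0.
rewrite le_eqVlt => /predU1P[<- _|h0]; first by rewrite addr0 subrr snorm0.
rewrite lt_min => /andP[hc]; rewrite ltr_pdivlMr// => hL.
have th0 : 0 < t + h by rewrite addr_gt0.
have Lth : L (t + h) <= L t by apply: L_decr => //; rewrite lerDl ltW.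
rewrite -snormN opprB addrC -[v t]opprK.
apply: (Hk (- v (t + h)) (- v t)); [|exact: sub_C (v_sub t0)|by rewrite snormN (v_norm th0)|by rewrite snormN (v_norm t0) lexx].
move=> w a Fw; have [b] := v_sub th0; rewrite fE// => -[<-] /(_ w a Fw) Hw.
have -> : w - u t = (w - u (t + h)) + (u (t + h) - u t) by rewrite addrA subrK.
rewrite ipDr; have h1 := ip_le_norm ip (- v (t + h)) (u (t + h) - u t).
rewrite snormN v_norm// -/(D h t) in h1.
have h2 := D_L t0 h0; have h3 := Hc h h0 hc.
have h4 : L (t + h) * D h t <= L t * (h * L t) by rewrite ler_pM ?L_ge0 ?D_ge0.
have h5 : L t * (h * L t) = h * (L t * L t) by ring.
apply: le_trans (lerD Hw (le_trans h1 h4)) _; rewrite h5; move: hL h3; rewrite mulrDr mulr1.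
clear h1 h2 h4 h5 Hw LL0 L1 Lth L0 e0; move: (k.+1%:R^-1) (h * _) => dd l; lra.
Qed.

(** The derivative is taken from the right and exists at every positive time. Its right continuity
    and decreasing norm replace an almost everywhere differentiation theorem for Lipschitz curves in
    [H]. *)
Theorem gradient_flow : exists u v : R -> H,
  [/\ nrm (u 0 - x0) = 0,
   forall t0 e, 0 <= t0 -> 0 < e -> exists2 d, 0 < d &
     forall t, 0 <= t -> `|t - t0| < d -> nrm (u t - u t0) < e,
   forall t, 0 < t -> sub_at (u t) (- v t),
   forall t, 0 < t -> forall e, 0 < e -> exists2 d, 0 < d &
     forall h, 0 < h -> h < d -> nrm (h^-1 *: (u (t + h) - u t) - v t) < e &
   [/\ forall t e, 0 < t -> 0 < e -> exists2 d, 0 < d &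
         forall h, 0 <= h -> h < d -> nrm (v (t + h) - v t) < e,
       forall s t, 0 < s -> s <= t -> nrm (v t) <= nrm (v s) &
       forall t h, 0 < t -> 0 <= h -> nrm (u (t + h) - u t) <= h * nrm (v t)]].
Proof.
exists u, v; split; [exact: S_0| |exact: v_sub|exact: v_lim|].
  by move=> t0 e t00 e0; exact: S_cont.
split; [exact: v_rcont| |].
- by move=> s t s0 st'; rewrite (v_norm s0) (v_norm (lt_le_trans s0 st')); exact: L_decr.
- move=> t h t0; rewrite le_eqVlt => /predU1P[<-|h0].
    by rewrite addr0 subrr snorm0 mul0r.
  by rewrite v_norm//; exact: D_L.
Qed.

End convex_functional.

(** * Square-integrable functions *)

Section real_integral.
Context d (T : measurableType d) (R : realType).
Variables (mu : {measure set T -> \bar R}) (D : set T) (mD : measurable D).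
Implicit Types f g h : T -> R.
Local Notation itg f := (mu.-integrable D (EFin \o f)).

Lemma itg_meas f : itg f -> measurable_fun D f.
Proof. by move=> /(measurable_int mu) /measurable_EFinP. Qed.

Lemma Rint_fin f : itg f -> (\int[mu]_(x in D) (f x)%:E = (\int[mu]_(x in D) f x)%:E)%E.
Proof. by move=> fi; rewrite fineK//; exact: integrable_fin_num. Qed.

Lemma itg_le f g : measurable_fun D f -> (forall x, D x -> `|f x| <= g x) ->
  itg g -> itg f.
Proof.
move=> mf fg; apply: le_integrable => //; first exact/measurable_EFinP.
move=> x Dx /=; rewrite lee_fin; apply: le_trans (fg x Dx) _; exact: ler_norm.
Qed.

(** Measurability of [g] is a hypothesis here and below because [mu] is not assumed complete. *)
Lemma itg_ae_eq f g : measurable_fun D g -> ae_eq mu D f g -> itg f -> itg g.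
Proof.
move=> mg fg fi; apply/integrableP; split; first exact/measurable_EFinP.
have /integrableP[mf] := fi; congr (_ < _)%E.
apply: ge0_ae_eq_integral => //; [exact: measurableT_comp| |].
  by apply: measurableT_comp => //; exact/measurable_EFinP.
by apply: filterS fg => x fgx Dx /=; rewrite fgx.
Qed.

Lemma Rint_ae_eq f g : measurable_fun D f -> measurable_fun D g ->
  ae_eq mu D f g -> \int[mu]_(x in D) f x = \int[mu]_(x in D) g x.
Proof.
move=> mf mg fg; rewrite /Rintegral; congr fine.
apply: ae_eq_integral => //; [exact/measurable_EFinP|exact/measurable_EFinP|].
by apply: filterS fg => x /[apply] ->.
Qed.

Lemma Rint_ae_le f g : itg f -> itg g -> {ae mu, forall x, D x -> f x <= g x} ->
  \int[mu]_(x in D) f x <= \int[mu]_(x in D) g x.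
Proof.
move=> fi gi fg; rewrite -subr_ge0 -RintegralB//.
(* Truncating at 0 turns the almost everywhere sign into a pointwise one. *)
rewrite (@Rint_ae_eq _ (fun x => Num.max 0 (g x - f x))).
- by apply: Rintegral_ge0 => x _; rewrite le_max lexx.
- by apply: measurable_funB; exact: itg_meas.
- apply: measurable_maxr; first exact: measurable_cst.
  by apply: measurable_funB; exact: itg_meas.
- by apply: filterS fg => x fgx Dx /=; rewrite max_r// subr_ge0 fgx.
Qed.

Lemma Rint_le f g : itg f -> itg g -> (forall x, D x -> f x <= g x) ->
  \int[mu]_(x in D) f x <= \int[mu]_(x in D) g x.
Proof. by move=> fi gi fg; apply: Rint_ae_le => //; exact: aeW. Qed.

Lemma itg_sum (I : Type) (s : seq I) (F : I -> T -> R) :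
  (forall i, itg (F i)) -> itg (fun x => \sum_(i <- s) F i x).
Proof.
move=> Fi; have := integrable_sum mD s (P := xpredT) (fun i _ => Fi i).
by apply: eq_integrable => // x _ /=; rewrite sumEFin.
Qed.

Lemma Rint_sum (I : Type) (s : seq I) (F : I -> T -> R) :
  (forall i, itg (F i)) -> \int[mu]_(x in D) (\sum_(i <- s) F i x) =
  \sum_(i <- s) \int[mu]_(x in D) F i x.
Proof.
move=> Fi; elim: s => [|i s IH].
  rewrite big_nil; under eq_Rintegral do rewrite big_nil.
  by rewrite /Rintegral integral0.
rewrite big_cons -IH -RintegralD//; last exact: itg_sum.
by apply: eq_Rintegral => x _; rewrite big_cons.
Qed.

Lemma Rint_cvg (f_ : nat -> T -> R) f g : (forall k, measurable_fun D (f_ k)) ->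
  measurable_fun D f -> {ae mu, forall x, D x -> (fun k => f_ k x) @ \oo --> f x} ->
  itg g -> {ae mu, forall x k, D x -> `|f_ k x| <= g x} ->
  itg f /\ (fun k => \int[mu]_(x in D) f_ k x) @ \oo --> \int[mu]_(x in D) f x.
Proof.
move=> mf_ mf cf gi fg.
have [fi _ cv] : [/\ itg f,
    [sequence \int[mu]_(x in D) `|(f_ k x)%:E - (f x)%:E|]_k @ \oo --> 0 &
    [sequence \int[mu]_(x in D) (f_ k x)%:E]_k @ \oo -->
      \int[mu]_(x in D) (f x)%:E]%E.
  apply: (@dominated_convergence _ _ _ mu D mD (fun k => EFin \o f_ k)
    (EFin \o f) (EFin \o g)) => //.
  - by move=> k; exact/measurable_EFinP.
  - exact/measurable_EFinP.
  - by apply: filterS cf => x /[apply] c; apply: cvg_EFin => //; exact: nearW.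
split => //; apply: (@fine_cvg _ _ _ _ (fun k => \int[mu]_(x in D) (f_ k x)%:E)%E).
by rewrite -Rint_fin.
Qed.

Lemma Rint_fatou (f_ : nat -> T -> R) f c : (forall k, itg (f_ k)) ->
  (forall k x, D x -> 0 <= f_ k x) -> (forall k, \int[mu]_(x in D) f_ k x <= c) ->
  measurable_fun D f -> {ae mu, forall x, D x -> (fun k => f_ k x) @ \oo --> f x} ->
  itg f /\ \int[mu]_(x in D) f x <= c.
Proof.
move=> fi f0 fc mf cf.
have mEf k : measurable_fun D (fun x => (f_ k x)%:E).
  by apply/measurable_EFinP; apply: itg_meas.
have h : (\int[mu]_(x in D) `|(f x)%:E| <= c%:E)%E.
  have F := @fatou _ _ _ mu D mD (fun k x => (f_ k x)%:E) mEf
    (fun k x Dx => f0 k x Dx).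
  rewrite (@ae_eq_integral _ _ _ _ D (fun x => limn_einf (fun k => (f_ k x)%:E)))//.
  - apply: le_trans F _; rewrite limn_einf_lim; apply: lime_le.
      exact: is_cvg_einfs.
    apply: nearW => k; apply: (@le_trans _ _ (\int[mu]_(x in D) (f_ k x)%:E)%E).
      by apply: ereal_inf_lbound; exists k => /=.
    by rewrite Rint_fin// lee_fin.
  - by apply: measurableT_comp => //; exact/measurable_EFinP.
  - apply: measurableT_comp => //; apply: measurable_fun_limn_esup => k.
    by apply: measurableT_comp.
  - apply: filterS cf => x cx Dx; have {}cx := cx Dx.
    have [-> _] := cvg_limn_einf_sup (cvg_EFin (nearW _ (fun k => erefl : is_true ((f_ k x)%:E \is a fin_num))) cx).
    rewrite /= ger0_norm// -oppr_le0; apply: (cvgn_le (cvgN cx)) => k.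
    by rewrite oppr_le0 f0.
have fi' : itg f.
  apply/integrableP; split; first exact/measurable_EFinP.
  by apply: le_lt_trans h _; rewrite ltry.
split => //; rewrite -lee_fin -Rint_fin//; apply: le_trans h.
apply: le_integral => //; first exact: integrable_abse.
by move=> x _; rewrite lee_fin ler_norm.
Qed.

Lemma Rint_eq0 f : itg f -> (forall x, D x -> 0 <= f x) ->
  \int[mu]_(x in D) f x = 0 -> ae_eq mu D f (cst 0).
Proof.
move=> fi f0 If; have : (\int[mu]_(x in D) `|(f x)%:E| = 0)%E.
  rewrite -[RHS]/((0 : R)%:E) -If -Rint_fin//.
  by apply: eq_integral => x /[!inE] Dx; rewrite /= ger0_norm// f0.
move=> /(ae_eq_integral_abs mu mD (measurable_int mu fi)).
by apply: filterS => x /[apply] -[].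
Qed.

Lemma itgD f g : itg f -> itg g -> itg (fun x => f x + g x).
Proof. by move=> fi gi; have := integrableD mD fi gi. Qed.

Lemma itgB f g : itg f -> itg g -> itg (fun x => f x - g x).
Proof. by move=> fi gi; have := integrableB mD fi gi. Qed.

Lemma itgZ c f : itg f -> itg (fun x => c * f x).
Proof. by move=> fi; have := integrableZl mD c fi. Qed.

Definition sqi f := measurable_fun D f /\ itg (fun x => f x ^+ 2).

Lemma sqi_mul f g : sqi f -> sqi g -> itg (fun x => f x * g x).
Proof.
move=> [mf fi] [mg gi]; apply: (@itg_le _ (fun x => f x ^+ 2 + g x ^+ 2)).
- exact: measurable_funM.
- move=> x _; rewrite ler_norml.
  have := sqr_ge0 (f x + g x); have := sqr_ge0 (f x - g x).
  have := sqr_ge0 (f x); have := sqr_ge0 (g x); rewrite sqrrB sqrrD; lra.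
- exact: itgD.
Qed.

Lemma sqiD f g : sqi f -> sqi g -> sqi (fun x => f x + g x).
Proof.
move=> hf hg; split; first by apply: measurable_funD; [exact: hf.1|exact: hg.1].
have := itgD (itgD hf.2 hg.2) (itgZ 2 (sqi_mul hf hg)).
by congr (_.-integrable _ _); apply/funext => x /=; congr EFin; ring.
Qed.

Lemma sqiZ c f : sqi f -> sqi (fun x => c * f x).
Proof.
move=> hf; split; first by apply: measurable_funM => //; exact: hf.1.
have := itgZ (c ^+ 2) hf.2.
by congr (_.-integrable _ _); apply/funext => x /=; congr EFin; ring.
Qed.

Lemma sqiB f g : sqi f -> sqi g -> sqi (fun x => f x - g x).
Proof.
move=> hf hg; have := sqiD hf (sqiZ (-1) hg).
by congr sqi; apply/funext => x; rewrite mulN1r.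
Qed.

Lemma sqi0 : sqi (fun=> 0).
Proof.
split; first exact: measurable_cst.
by rewrite (_ : (fun _ => _) = fun=> 0) ?expr0n//; exact: integrable0.
Qed.

Lemma sqi_ae_eq f g : measurable_fun D g -> ae_eq mu D f g -> sqi f -> sqi g.
Proof.
move=> mg fg [mf fi]; split => //; apply: itg_ae_eq fi.
  exact: measurable_funX.
by apply: filterS fg => x /[apply] ->.
Qed.

Lemma sqi_bounded f M : (mu D < +oo)%E -> measurable_fun D f ->
  {ae mu, forall x, D x -> `|f x| <= M} -> sqi f.
Proof.
move=> Dfin mf fM; have M0 : 0 <= `|M| by [].
(* The bound holds only almost everywhere; clamping gives a representative that satisfies it
   everywhere. *)
apply: (@sqi_ae_eq (fun x => Num.max (- `|M|) (Num.min `|M| (f x)))) => //.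
  apply: filterS fM => x h Dx; have := ler_norm M; have := h Dx.
  rewrite ler_norml => /andP[h1 h2] h3.
  by rewrite min_r ?max_r; lra.
have mg : measurable_fun D (fun x => Num.max (- `|M|) (Num.min `|M| (f x))).
  apply: measurable_maxr; first exact: measurable_cst.
  by apply: measurable_minr => //; exact: measurable_cst.
split => //; apply: measurable_bounded_integrable => //.
  exact: measurable_funX.
exists (`|M| ^+ 2); split; first exact: num_real.
move=> y Hy x _ /=; apply: le_trans (ltW Hy).
rewrite normrX ler_pXn2r ?nnegrE//.
rewrite ler_norml le_max lexx ge_max ge_min lexx andbT/=; lra.
Qed.

End real_integral.

Section L2_space.
Context d (T : measurableType d) (R : realType).
Variables (mu : {measure set T -> \bar R}) (D : set T) (mD : measurable D).
Variables p q : nat.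
Local Notation itg f := (mu.-integrable D (EFin \o f)).

Definition L2set : set (T -> 'M[R]_(p, q)) :=
  [set u | forall i j, sqi mu D (fun x => u x i j)].

Definition L2pred : {pred T -> 'M[R]_(p, q)} := fun u => `[< L2set u >].

Lemma L2_submod_closed : measurable D -> submod_closed L2pred.
Proof.
move=> mD'; split; first by apply/asboolP => i j; under eq_fun do rewrite mxE; exact: sqi0.
move=> a u v /asboolP hu /asboolP hv; apply/asboolP => i j.
have -> : (fun x => (a *: u + v) x i j) = fun x => a * u x i j + v x i j.
  by apply/funext => x; rewrite !mxE.
by apply: sqiD => //; exact: sqiZ.
Qed.
End L2_space.

(** A subtype of functions with [mD] as a parameter: closure under addition depends on the
    measurability of [D], and the module instance must find it in the type. *)
Record L2sp d (T : measurableType d) (R : realType) (mu : {measure set T -> \bar R})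
  (D : set T) (mD : measurable D) (p q : nat) := L2Sub {
  L2val :> T -> 'M[R]_(p, q); L2valP : L2val \in L2pred mu D (p := p) (q := q) }.

Section L2_instances.
Context d (T : measurableType d) (R : realType).
Variables (mu : {measure set T -> \bar R}) (D : set T) (mD : measurable D).
Variables p q : nat.
HB.instance Definition _ := GRing.isSubmodClosed.Build _ _ (@L2pred d T R mu D p q)
  (L2_submod_closed mu p q mD).
HB.instance Definition _ := [isSub for (@L2val d T R mu D mD p q)].
HB.instance Definition _ := [Choice of (@L2sp d T R mu D mD p q) by <:].
HB.instance Definition _ := [SubChoice_isSubLmodule of (@L2sp d T R mu D mD p q) by <:].
End L2_instances.

Lemma cvgn_sum (R : realType) (I : Type) (s : seq I) (F : I -> nat -> R) (l : I -> R) :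
  (forall i, F i @ \oo --> l i) ->
  (fun k => \sum_(i <- s) F i k) @ \oo --> \sum_(i <- s) l i.
Proof.
move=> Fl; elim: s => [|i s IH].
  by rewrite big_nil; under eq_fun do rewrite big_nil; exact: cvg_cst.
by rewrite big_cons; under eq_fun do rewrite big_cons; exact: cvgD.
Qed.

Section frob_theory.
Variables (R : realType) (p q : nat).
Implicit Types x y z : 'M[R]_(p, q).

Lemma frobC x y : frob x y = frob y x.
Proof. by apply: eq_bigr => i _; apply: eq_bigr => j _; rewrite mulrC. Qed.

Lemma frobDl x y z : frob (x + y) z = frob x z + frob y z.
Proof.
rewrite /frob -big_split; apply: eq_bigr => i _; rewrite -big_split.
by apply: eq_bigr => j _; rewrite mxE mulrDl.
Qed.

Lemma frobZl a x y : frob (a *: x) y = a * frob x y.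
Proof.
rewrite /frob mulr_sumr; apply: eq_bigr => i _; rewrite mulr_sumr.
by apply: eq_bigr => j _; rewrite mxE mulrA.
Qed.

Lemma frob_ge0 x : 0 <= frob x x.
Proof. by apply: sumr_ge0 => i _; apply: sumr_ge0 => j _; rewrite -expr2 sqr_ge0. Qed.

Definition frob_ip : semi_ip 'M[R]_(p, q) := SemiIp frobC frobDl frobZl frob_ge0.

Lemma frob_normE x : frob_norm x = snorm frob_ip x. Proof. by []. Qed.

Lemma sqr_entry_le_frob x i j : x i j ^+ 2 <= frob x x.
Proof.
rewrite /frob (bigD1 i)//= (bigD1 j)//= -expr2 -addrA lerDl addr_ge0//.
  by apply: sumr_ge0 => k _; rewrite -expr2 sqr_ge0.
by apply: sumr_ge0 => k _; apply: sumr_ge0 => l _; rewrite -expr2 sqr_ge0.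
Qed.

Lemma entry_le_frob_norm x i j : `|x i j| <= frob_norm x.
Proof. by rewrite -sqrtr_sqr ler_wsqrtr// sqr_entry_le_frob. Qed.

Lemma frob_cvg (u v : nat -> 'M[R]_(p, q)) x y :
  (forall i j, (fun k => u k i j) @ \oo --> x i j) ->
  (forall i j, (fun k => v k i j) @ \oo --> y i j) ->
  (fun k => frob (u k) (v k)) @ \oo --> frob x y.
Proof.
move=> ux vy; apply: cvgn_sum => i; apply: cvgn_sum => j; exact: cvgM.
Qed.

End frob_theory.

(** * The scalar product of L2 and its completeness *)

Section L2_hilbert.
Context d (T : measurableType d) (R : realType).
Variables (mu : {measure set T -> \bar R}) (D : set T) (mD : measurable D).
Variables p q : nat.
Local Notation itg f := (mu.-integrable D (EFin \o f)).
Local Notation L2 := (L2sp mu mD p q).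
Implicit Types u v w : L2.

Lemma L2spP u : L2set mu D (p := p) (q := q) u.
Proof. exact/asboolP/(valP u). Qed.

Definition toL2 (u : T -> 'M[R]_(p, q)) (hu : L2set mu D u) : L2 :=
  L2Sub mD (introT (asboolP _) hu).

Lemma L2spD u v x : (u + v : L2) x = u x + v x. Proof. by []. Qed.
Lemma L2spN u x : (- u : L2) x = - u x. Proof. by []. Qed.
Lemma L2spZ a u x : (a *: u : L2) x = a *: u x. Proof. by []. Qed.
Lemma L2sp0 x : (0 : L2) x = 0. Proof. by []. Qed.

Lemma L2_frob_itg (u v : T -> 'M[R]_(p, q)) : L2set mu D u -> L2set mu D v ->
  itg (fun x => frob (u x) (v x)).
Proof.
move=> hu hv; apply: itg_sum => // i; apply: itg_sum => // j.
exact: sqi_mul.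
Qed.

Let ipf u v := \int[mu]_(x in D) frob (u x) (v x).

Let ipfC u v : ipf u v = ipf v u.
Proof. by apply: eq_Rintegral => x _; rewrite frobC. Qed.

Let ipfD u v w : ipf (u + v) w = ipf u w + ipf v w.
Proof.
rewrite /ipf -RintegralD//; [|exact: L2_frob_itg (L2spP _) (L2spP _)..].
by apply: eq_Rintegral => x _; rewrite L2spD frobDl.
Qed.

Let ipfZ a u v : ipf (a *: u) v = a * ipf u v.
Proof.
rewrite /ipf -RintegralZl//; last exact: L2_frob_itg (L2spP _) (L2spP _).
by apply: eq_Rintegral => x _; rewrite L2spZ frobZl.
Qed.

Let ipf_ge0 u : 0 <= ipf u u.
Proof. by apply: Rintegral_ge0 => x _; exact: frob_ge0. Qed.

Definition L2_ip : semi_ip L2 := SemiIp ipfC ipfD ipfZ ipf_ge0.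

Lemma L2_ipE u v : L2_ip u v = \int[mu]_(x in D) frob (u x) (v x).
Proof. by []. Qed.

Lemma L2_null u : snorm L2_ip u = 0 -> ae_eq mu D (u : T -> _) (cst 0).
Proof.
move=> u0; have : \int[mu]_(x in D) frob (u x) (u x) = 0.
  by rewrite -L2_ipE -snorm_sqr u0 expr0n.
move=> /(Rint_eq0 mD (L2_frob_itg (L2spP u) (L2spP u)) (fun x _ => frob_ge0 _)).
apply: filterS => x /[apply] fx0; apply/matrixP => i j; rewrite mxE.
apply/eqP; rewrite -sqrf_eq0 eq_le sqr_ge0 andbT.
by rewrite (le_trans (sqr_entry_le_frob _ _ _))// fx0.
Qed.

Lemma L2_ip_ae u u' v : ae_eq mu D (u : T -> _) u' -> L2_ip u v = L2_ip u' v.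
Proof.
move=> uu'; rewrite !L2_ipE; apply: Rint_ae_eq => //.
- exact: itg_meas (L2_frob_itg (L2spP _) (L2spP _)).
- exact: itg_meas (L2_frob_itg (L2spP _) (L2spP _)).
- by apply: filterS uu' => x /[apply] ->.
Qed.

Lemma L2_snorm_ae u u' : ae_eq mu D (u : T -> _) u' -> snorm L2_ip (u - u') = 0.
Proof.
move=> uu'; rewrite /snorm (@L2_ip_ae _ 0) ?ip0l ?sqrtr0//.
by apply: filterS uu' => x /[apply] e; rewrite L2spD L2spN e subrr.
Qed.

(** Riesz-Fischer argument. Weighted by [4 ^+ k], the squared increments have integrals at most
    [2 ^- k], so their sum is finite almost everywhere, and at such points the increments are
    dominated by a geometric series. *)
Lemma L2_fast_cvg (u : nat -> L2) :
  (forall k, L2_ip (u k.+1 - u k) (u k.+1 - u k) <= (8^-1) ^+ k) ->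
  {ae mu, forall x, D x -> forall i j, cvgn (fun k => u k x i j)}.
Proof.
move=> hu; pose h k x := 4 ^+ k * frob ((u k.+1 - u k) x) ((u k.+1 - u k) x).
have h0 k x : 0 <= h k x by rewrite mulr_ge0 ?frob_ge0// exprn_ge0.
have hi k : itg (h k) by apply: itgZ => //; exact: L2_frob_itg (L2spP _) (L2spP _).
have mh k : measurable_fun D (fun x => (h k x)%:E) by exact: measurable_int (hi k).
have Hint : mu.-integrable D (fun x => \sum_(k <oo) (h k x)%:E)%E.
  apply/integrableP; split.
    apply: (@ge0_emeasurable_sum _ _ _ D (fun k x => (h k x)%:E) xpredT) => //.
    by move=> k x _ _; rewrite lee_fin.
  rewrite (eq_integral (fun x => \sum_(k <oo) (h k x)%:E)%E); last first.
    by move=> x _; rewrite gee0_abs// nneseries_ge0// => k _ _; rewrite lee_fin.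
  rewrite integral_nneseries//; last by move=> k x _; rewrite lee_fin.
  apply: (@le_lt_trans _ _ (\sum_(k <oo) (2 / (2 ^ k.+1)%:R)%:E)%E); last first.
    by apply: le_lt_trans (epsilon_trick0 _ _) _ => //; rewrite ltry.
  apply: lee_nneseries => [k _ _|k _]; first by apply: integral_ge0 => x _; rewrite lee_fin.
  rewrite Rint_fin// lee_fin /h RintegralZl//; last exact: L2_frob_itg (L2spP _) (L2spP _).
  rewrite -L2_ipE; apply: le_trans (ler_wpM2l _ (hu k)) _; first exact: exprn_ge0.
  rewrite -exprMn natrX exprS invfM mulrA divff// mul1r -exprVn.
  by rewrite (_ : 4 / 8 = 2^-1)//; field.
have := integrable_ae mD Hint; apply: filterS => x /[apply] fx i j.
set S := fine (\sum_(k <oo) (h k x)%:E)%E.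
have hS k : h k x <= S.
  rewrite -lee_fin /S fineK//.
  apply: le_trans (@nneseries_lim_ge _ _ _ 0 k.+1 _); last by move=> *; rewrite lee_fin.
  by rewrite big_nat_recr//= leeDr// sume_ge0// => *; rewrite lee_fin.
have S0 : 0 <= S by apply: le_trans (hS 0%N).
have dk k : `|u k.+1 x i j - u k x i j| <= Num.sqrt S * (2^-1) ^+ k.
  rewrite -(ler_pXn2r (n := 2)) ?nnegrE ?mulr_ge0 ?sqrtr_ge0 ?exprn_ge0//.
  rewrite real_normK ?num_real// exprMn sqr_sqrtr// -exprM mulnC exprM.
  have := sqr_entry_le_frob ((u k.+1 - u k) x) i j.
  rewrite L2spD L2spN !mxE => /le_trans; apply.
  have := hS k; rewrite /h mulrC -ler_pdivlMr ?exprn_gt0//.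
  by rewrite -exprVn expr2 -invfM -natrM.
have -> : (fun k => u k x i j) =
    [sequence u 0%N x i j + series (telescope (fun k => u k x i j)) k]_k.
  exact: (funext (eq_sum_telescope (fun k => u k x i j))).
apply: is_cvgD; first exact: is_cvg_cst.
apply: normed_cvg; apply: (@series_le_cvg _ _ (fun k => Num.sqrt S * (2^-1) ^+ k)) => //.
- by move=> k /=.
- apply: is_cvg_geometric_series.
  by rewrite ger0_norm ?invr_ge0// invf_lt1// ltr1n.
Qed.

Lemma L2_fast_subseq (u : nat -> L2) : scauchy L2_ip u -> exists2 s : nat -> nat,
  (forall k, (k <= s k)%N) &
  forall k, L2_ip (u (s k.+1) - u (s k)) (u (s k.+1) - u (s k)) <= (8^-1) ^+ k.
Proof.
move=> cu; have e0 k : 0 < (Num.sqrt 8^-1 : R) ^+ k.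
  by rewrite exprn_gt0// sqrtr_gt0 invr_gt0.
have [N HN] := choice (fun k => cu _ (e0 k)).
pose s k := (k + \sum_(i < k.+1) N i)%N.
exists s => [k|k]; first exact: leq_addr.
have Ns : (N k <= s k)%N by rewrite /s big_ord_recr/= addnA leq_addl.
have Ns1 : (N k <= s k.+1)%N.
  apply: leq_trans Ns _; rewrite /s [X in (_ <= _ + X)%N]big_ord_recr/= addnA.
  by apply: leq_trans (leq_addr _ _); rewrite leq_add2r.
have := HN k _ _ Ns1 Ns; rewrite snorm_lt_sqr ?(ltW (e0 k))//.
by rewrite -exprM mulnC exprM sqr_sqrtr ?invr_ge0// => /ltW.
Qed.

Lemma L2_complete_ae (u : nat -> L2) : scauchy L2_ip u -> exists s : nat -> nat,
  exists l : L2, [/\ forall k, (k <= s k)%N, scvg L2_ip u l &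
    {ae mu, forall x, D x -> forall i j, (fun k => u (s k) x i j) @ \oo --> (l : L2) x i j}].
Proof.
move=> cu; have [s ks us] := L2_fast_subseq cu; exists s.
have ae := L2_fast_cvg (u := u \o s) us.
(* The upper limit is measurable on all of [D], also where the subsequence fails to converge. *)
pose l x : 'M[R]_(p, q) := \matrix_(i, j) fine (limn_esup (fun k => (u (s k) x i j)%:E)).
have mu_ k i j : measurable_fun D (fun x => u k x i j) by have [] := L2spP (u k) i j.
have ml i j : measurable_fun D (fun x => l x i j).
  under eq_fun do rewrite mxE.
  apply: (measurableT_comp (f := fine)); first exact: fine_measurable.
  by apply: measurable_fun_limn_esup => k; exact/measurable_EFinP.
have lcv : {ae mu, forall x, D x -> forall i j, (fun k => u (s k) x i j) @ \oo --> l x i j}.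
  apply: filterS ae => x /[apply] h i j; have [a ua] := (cvg_ex _).1 (h i j).
  rewrite mxE.
  have [_ ->] := cvg_limn_einf_sup (cvg_EFin (nearW _ (fun k => erefl :
    is_true ((u (s k) x i j)%:E \is a fin_num))) ua).
  exact: ua.
clearbody l.
have frob_cv n : {ae mu, forall x, D x ->
    (fun k => frob (u n x - u (s k) x) (u n x - u (s k) x)) @ \oo -->
      frob (u n x - l x) (u n x - l x)}.
  apply: filterS lcv => x /[apply] h.
  have h' i j : (fun k => (u n x - u (s k) x) i j) @ \oo --> (u n x - l x) i j.
    under eq_fun do rewrite !mxE; rewrite !mxE; apply: cvgB; first exact: cvg_cst.
    exact: h.
  exact: frob_cvg.
(* Fatou's lemma carries the Cauchy estimate over to the limit, which gives both its square
   integrability and the convergence. *)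
have dist n e : (forall k, (n <= k)%N -> L2_ip (u n - u k) (u n - u k) <= e) ->
   itg (fun x => frob (u n x - l x) (u n x - l x)) /\
   \int[mu]_(x in D) frob (u n x - l x) (u n x - l x) <= e.
  move=> he; apply: (@Rint_fatou _ _ _ _ _ mD
      (fun k x => frob (u n x - u (s (n + k)%N) x) (u n x - u (s (n + k)%N) x))).
  - by move=> k; exact: L2_frob_itg (L2spP (u n - u (s (n + k)%N))) (L2spP (u n - u (s (n + k)%N))).
  - by move=> k x _; exact: frob_ge0.
  - by move=> k; apply: he; apply: leq_trans (ks _); exact: leq_addr.
  - apply: measurable_sum => i; apply: measurable_sum => j.
    by apply: measurable_funM; under eq_fun do rewrite !mxE; apply: measurable_funB.
  - apply: filterS (frob_cv n) => x /[apply] h.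
    by move: h; rewrite -(cvg_shiftn n); under eq_fun do rewrite addnC.
have hl : L2set mu D l.
  have [N HN] := cu 1 ltr01.
  have [|itgN _] := dist N 1.
    by move=> k Nk; have := HN N k (leqnn _) Nk; rewrite snorm_lt_sqr ?expr1n// => /ltW.
  move=> i j; have h1 : sqi mu D (fun x => u N x i j - l x i j).
    split; first exact: measurable_funB.
    apply: itg_le itgN => //; first by apply: measurable_funX; exact: measurable_funB.
    move=> x _; rewrite ger0_norm ?sqr_ge0//.
    by have := sqr_entry_le_frob (u N x - l x) i j; rewrite !mxE.
  have := sqiD mD (sqiZ mD (-1) h1) (L2spP (u N) i j).
  by congr (sqi _ _ _); apply/funext => x; ring.
exists (toL2 hl); split => //.
move=> e e0; have e20 : 0 < e / 2 by lra.
have [N HN] := cu _ e20; exists N => n Nn.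
apply: (@le_lt_trans _ _ (e / 2)); last by lra.
rewrite snorm_le_sqr ?(ltW e20)//.
apply: (proj2 (dist n _ _)) => k nk; have := HN n k Nn (leq_trans Nn nk).
by rewrite snorm_lt_sqr ?(ltW e20)// => /ltW.
Qed.

Lemma L2_complete : scomplete L2_ip.
Proof. by move=> u /L2_complete_ae[s [l [_ ? _]]]; exists l. Qed.

Lemma L2_cvg_ae (u : nat -> L2) l : scvg L2_ip u l -> exists2 s : nat -> nat,
  forall k, (k <= s k)%N &
  {ae mu, forall x, D x -> forall i j, (fun k => u (s k) x i j) @ \oo --> l x i j}.
Proof.
move=> ul; have [s [l' [ks ul' ae]]] := L2_complete_ae (scvg_cauchy ul).
exists s => //; have := L2_null (scvg_unique ul ul'); apply: filterS2 ae => x h e Dx i j.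
have -> : l x = l' x by apply/eqP; rewrite -subr_eq0 -L2spN -L2spD e.
exact: h.
Qed.

End L2_hilbert.

(** * Lebesgue measure on row vectors *)

Section mx_borel.
Variables (R : realType) (p q : nat).
Implicit Types x y : 'M[R]_(p, q).

Lemma mx_ballE x e y : ball x e y <-> 0 < e /\ forall i j, `|x i j - y i j| < e.
Proof. by split=> -[]. Qed.

Lemma mx_ballP x (e : R) : 0 < e ->
  ball x e = \bigcap_(ij in [set: 'I_p * 'I_q])
    [set y | `|x ij.1 ij.2 - y ij.1 ij.2| < e].
Proof.
move=> e0; apply/seteqP; split => y.
  by move=> /mx_ballE[_ h] [i j] _ /=.
by move=> h; apply/mx_ballE; split => // i j; exact: (h (i, j)).
Qed.

Lemma mx_ball_measurable x (e : R) : measurable (ball x e).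
Proof.
have [e0|e0] := ltP 0 e; last first.
  rewrite (_ : ball x e = set0)//; apply/seteqP; split => // y /mx_ballE[].
  by rewrite ltNge e0.
rewrite mx_ballP//; apply: fin_bigcap_measurable; first exact: finite_finset.
move=> [i j] _; rewrite -[X in measurable X]setTI.
exact: (measurable_mx_entry i j measurableT (measurable_ball (x i j) e)).
Qed.

Lemma mx_normP x (e : R) : 0 < e -> `|x| < e <-> forall i j, `|x i j| < e.
Proof.
move=> e0; have -> : `|x| < e <-> ball 0 e x.
  by rewrite mx_norm_ball /ball_/= sub0r normrN.
rewrite mx_ballE; split=> [[_ h] i j|h].
  by have := h i j; rewrite mxE sub0r normrN.
by split => // i j; rewrite mxE sub0r normrN.
Qed.

(** The sigma-algebra is generated by the entries; open sets belong to it because they are countable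
    unions of balls with rational centres, and balls of the sup norm are cubes. *)
Lemma mx_open_measurable (U : set 'M[R]_(p, q)) : open U -> measurable U.
Proof.
move=> oU.
pose F (qk : 'M[rat]_(p, q) * nat) : set 'M[R]_(p, q) :=
  let c : 'M[R]_(p, q) := map_mx ratr qk.1 in
  if `[< ball c (qk.2.+1%:R^-1 : R) `<=` U >]
  then ball c (qk.2.+1%:R^-1 : R) else set0.
have -> : U = \bigcup_qk F qk.
  apply/seteqP; split=> [x Ux|x [qk _]]; last first.
    by rewrite /F; case: asboolP => // h /h.
  have /nbhs_ballP[e /= e0 eU] := open_nbhs_nbhs (conj oU Ux).
  have [N HN] := invS_lt (divr_gt0 e0 (ltr0Sn R 1)).
  have d0 : 0 < N.+1%:R^-1 :> R by rewrite invr_gt0.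
  have /choice[r hr] : forall ij : 'I_p * 'I_q, exists r : rat,
      `|x ij.1 ij.2 - ratr r| < N.+1%:R^-1.
    move=> [i j]; have ne : ball (x i j) (N.+1%:R^-1 : R) !=set0.
      by exists (x i j); exact: ballxx.
    have [y [yb [r _ ry]]] := @dense_rat R _ ne (ball_open _ _).
    by exists r; rewrite ry; exact: yb.
  exists (\matrix_(i, j) r (i, j), N) => //=; rewrite /F/=.
  have xb : ball (map_mx ratr (\matrix_(i, j) r (i, j)) : 'M[R]_(p, q)) (N.+1%:R^-1 : R) x.
    by apply/mx_ballE; split => // i j; rewrite !mxE distrC; exact: (hr (i, j)).
  case: asboolP => // -[] y yb; apply: eU.
  have := ball_triangle (ball_sym xb) yb; apply: le_ball.
  by have := HN N (leqnn _); move: (N.+1%:R^-1) => u; lra.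
apply: countable_bigcupT_measurable; first exact: countableP.
by move=> qk; rewrite /F; case: asboolP => // _; exact: mx_ball_measurable.
Qed.

Lemma mx_closed_measurable (U : set 'M[R]_(p, q)) : closed U -> measurable U.
Proof.
by move=> cU; rewrite -[U]setCK; apply: measurableC; apply: mx_open_measurable;
  rewrite openC.
Qed.

Lemma mx_continuous_measurable (D : set 'M[R]_(p, q)) (f : 'M[R]_(p, q) -> R) :
  measurable D -> continuous f -> measurable_fun D f.
Proof.
move=> mD cf; apply: (measurable_funS measurableT (@subsetT _ D)).
apply: (measurability _ (@measurable_realfun.RGenOpens.measurableE R)) => //.
  move=> _ [_ [a [b ->]] <-]; rewrite setTI; apply: mx_open_measurable.
  by have /continuousP := cf; apply; exact: interval_open.
Qed.

Lemma mx_add_measurable (v : 'M[R]_(p, q)) :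
  measurable_fun [set: 'M[R]_(p, q)] (fun x => x + v).
Proof.
apply: measurable_fun_mx => i j; under eq_fun do rewrite mxE.
by apply: measurable_funD => //; exact: measurable_mx_entry.
Qed.

Lemma mx_sub_measurable :
  measurable_fun [set: 'M[R]_(p, q) * 'M[R]_(p, q)] (fun xy => xy.1 - xy.2).
Proof.
apply: measurable_fun_mx => i j; under eq_fun do rewrite !mxE.
apply: measurable_funB; apply: (measurableT_comp (f := fun M : 'M[R]_(p, q) => M i j)) => //;
  exact: measurable_mx_entry.
Qed.

End mx_borel.

Section invariant_integrals.
Context d (T : measurableType d) (R : realType) (mu : {measure set T -> \bar R}).
Variable phi : T -> T.
Hypothesis mphi : measurable_fun setT phi.
Hypothesis inv : forall A, measurable A -> mu (phi @^-1` A) = mu A.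

Lemma integral_invariant (f : T -> \bar R) :
  measurable_fun setT f -> (forall x, 0 <= f x)%E ->
  (\int[mu]_x f (phi x) = \int[mu]_x f x)%E.
Proof.
move=> mf f0.
pose F : {mfun T >-> T} := HB.pack phi (isMeasurableFun.Build _ _ _ _ _ mphi).
transitivity (\int[pushforward mu F]_x f x)%E.
  by rewrite (ge0_integral_pushforward mphi)// => x _; exact: f0.
by apply: eq_measure_integral => A mA _; exact: inv.
Qed.

Lemma integrable_invariant (f : T -> R) : mu.-integrable setT (EFin \o f) ->
  mu.-integrable setT (EFin \o (fun x => f (phi x))).
Proof.
move=> /integrableP[mf fi]; apply/integrableP; split; first exact: measurableT_comp mf mphi.
rewrite (integral_invariant (f := fun x => `|(f x)%:E|%E))//.
exact: measurableT_comp.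
Qed.

Lemma Rintegral_invariant (f : T -> R) : mu.-integrable setT (EFin \o f) ->
  \int[mu]_x f (phi x) = \int[mu]_x f x.
Proof.
move=> fi; have mf := measurable_int mu fi; rewrite /Rintegral; congr fine.
rewrite integralE [RHS]integralE; congr (_ - _)%E.
  have := integral_invariant (measurable_funepos mf) (funepos_ge0 _).
  by move=> <-; apply: eq_integral => x _; rewrite !funeposE.
have := integral_invariant (measurable_funeneg mf) (funeneg_ge0 _).
by move=> <-; apply: eq_integral => x _; rewrite !funenegE.
Qed.

End invariant_integrals.

(** Each quotient has integral 0 because [tau k] preserves [mu], and dominated convergence keeps
    this in the limit. Applied to translations in space and in time. *)
Lemma Rintegral_quotient0 d (T : measurableType d) (R : realType) (mu : {measure set T -> \bar R})
    (tau : nat -> T -> T) (c : nat -> R) (p q G : T -> R) :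
  (forall k, measurable_fun setT (tau k)) ->
  (forall k A, measurable A -> mu (tau k @^-1` A) = mu A) ->
  mu.-integrable setT (EFin \o p) -> mu.-integrable setT (EFin \o G) ->
  (forall k x, `|c k * (p (tau k x) - p x)| <= G x) ->
  (forall x, (fun k => c k * (p (tau k x) - p x)) @ \oo --> q x) -> \int[mu]_x q x = 0.
Proof.
move=> mt inv ip iG dG dq; pose d' k x := c k * (p (tau k x) - p x).
have di k : mu.-integrable setT (EFin \o d' k) /\ \int[mu]_x d' k x = 0.
  have i1 := integrable_invariant (mt k) (inv k) ip.
  split; first by apply: itgZ => //; exact: itgB.
  rewrite /d' RintegralZl//; last exact: itgB.
  by rewrite RintegralB// (Rintegral_invariant (mt k) (inv k))// subrr mulr0.
have md k := itg_meas (di k).1.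
have mq : measurable_fun setT q by apply: (measurable_fun_cvg md) => x _; exact: dq.
have c1 : {ae mu, forall x, setT x -> (fun k => d' k x) @ \oo --> q x}.
  by apply: aeW => x _; exact: dq.
have c2 : {ae mu, forall x k, setT x -> `|d' k x| <= G x} by apply: aeW => x k _; exact: dG.
have [_ cI] := Rint_cvg measurableT md mq c1 iG c2.
apply: (cvg_unique _ cI) => //.
by rewrite (_ : (fun k => _) = cst 0); [exact: cvg_cst|apply/funext => k; exact: (di k).2].
Qed.

Section lebesgue_rV_theory.
Variable R : realType.
Local Notation leb := (lebesgue_rV R).

(** The translated measure gives every half-open interval its length, so uniqueness of Lebesgue
    measure applies. *)
Lemma lebesgue_translate (a : R) (A : set R) : measurable A ->
  @lebesgue_measure R ((fun x => x + a) @^-1` A) = lebesgue_measure A.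
Proof.
move=> mA.
have mf : measurable_fun [set: R] ((fun x => x + a) : R -> measurableTypeR R).
  have mf : measurable_fun [set: R] (fun x : R => x + a) by exact: measurable_funD.
  exact: mf.
pose phi : {mfun R >-> measurableTypeR R} :=
  HB.pack (fun x : R => x + a) (isMeasurableFun.Build _ _ _ _ _ mf).
rewrite -[LHS]/(pushforward lebesgue_measure phi A).
apply/esym/lebesgue_measure_unique => //= _ [[b c] _ <-]; rewrite /pushforward/=.
have -> : (fun x => x + a) @^-1` `]b, c]%classic = `]b - a, c - a]%classic.
  by apply/seteqP; split => x /=; rewrite !in_itv/= ltrBlDr lerBrDr.
rewrite !lebesgue_measure_itv/= !lte_fin ltrD2r; case: ifPn => // _.
by rewrite -!EFinB; congr EFin; lra.
Qed.

Lemma leb0E : leb 0 = \d_(0 : 'rV[R]_0) :> (set _ -> _). Proof. by []. Qed.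

Lemma lebSE n A : leb n.+1 A = (@lebesgue_measure R \x leb n)%E (@row_cons R n @^-1` A).
Proof. by []. Qed.

Lemma row_consD n (x y : R) (v w : 'rV[R]_n) :
  row_cons (x + y, v + w) = row_cons (x, v) + row_cons (y, w).
Proof.
apply/rowP => j; rewrite [RHS]mxE /row_cons/=; case: (@split_ordP 1 n j) => k ->.
  by rewrite !(@row_mxEl _ 1 1 n) !mxE.
by rewrite !(@row_mxEr _ 1 1 n) !mxE.
Qed.

Lemma row_unconsK n : cancel (@row_uncons R n) (@row_cons R n).
Proof.
move=> w; apply/rowP => j; rewrite /row_cons /row_uncons/=.
case: (@split_ordP 1 n j) => k ->.
  by rewrite (@row_mxEl _ 1 1 n) mxE (ord1 k); congr (w _ _); exact/val_inj.
by rewrite (@row_mxEr _ 1 1 n) mxE.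
Qed.

(** Induction on the dimension: the sections are translated by the induction hypothesis, the first
    coordinate by invariance of the one-dimensional integral. *)
Lemma lebesgue_rV_translate n (v : 'rV[R]_n) (A : set 'rV[R]_n) : measurable A ->
  leb n ((fun x => x + v) @^-1` A) = leb n A.
Proof.
elim: n v A => [|n IH] v A mA.
  rewrite (_ : _ @^-1` A = A)//; apply/seteqP; split=> x /=;
    by have -> : x + v = x by apply/rowP => -[].
rewrite !lebSE; set B := @row_cons R n @^-1` A.
have mB : measurable B.
  by rewrite -[B]setTI; exact: measurable_row_cons.
rewrite -(row_unconsK v); set a := row_uncons v.
have -> : @row_cons R n @^-1` ((fun x => x + row_cons a) @^-1` A) =
    [set xw | B (xw.1 + a.1, xw.2 + a.2)].
  apply/seteqP; split => -[x w] /=.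
    by rewrite /B/= row_consD -[(a.1, a.2)]surjective_pairing.
  by rewrite /B/= row_consD -[(a.1, a.2)]surjective_pairing.
have mg : measurable_fun [set: R] (fun x => leb n (xsection B x)).
  exact: measurable_fun_xsection.
have mf : measurable_fun [set: R] (fun x : R => x + a.1) by exact: measurable_funD.
rewrite /product_measure1.
transitivity (\int[lebesgue_measure]_x leb n (xsection B (x + a.1)%R))%E.
  apply: eq_integral => x _ /=.
  have <- := IH a.2 (xsection B (x + a.1)) (measurable_xsection _ mB).
  congr (leb n _); apply/seteqP; split => w; rewrite /xsection/= !inE//.
apply: (@integral_invariant _ (measurableTypeR R) R lebesgue_measure
  (fun x : R => x + a.1) _ _ (fun x : R => leb n (xsection B x))) => //.
by move=> C mC; exact: lebesgue_translate.
Qed.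

Lemma lebesgue_rV_ball n (c : 'rV[R]_n) (r : R) : 0 < r ->
  leb n (ball c r) = ((2 * r) ^+ n)%:E.
Proof.
move=> r0; elim: n c => [|n IH] c.
  rewrite leb0E diracE expr0 mem_set//.
  by apply/mx_ballE; split => // i [].
rewrite lebSE.
have -> : @row_cons R n @^-1` ball c r = ball (row_uncons c).1 r `*` ball (row_uncons c).2 r.
  rewrite -{1}(row_unconsK c); move: (row_uncons c) => [a v] /=.
  apply/seteqP; split=> -[x w].
    move=> /mx_ballE[_ h]; split.
      by have := h 0 (lshift n (0 : 'I_1)); rewrite !(@row_mxEl _ 1 1 n) !mxE.
    apply/mx_ballE; split => // i j.
    by have := h i (rshift 1 j); rewrite !(@row_mxEr _ 1 1 n).
  move=> [h1 /mx_ballE[_ h2]]; apply/mx_ballE; split => // i j.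
  rewrite /row_cons; case: (@split_ordP 1 n j) => k ->.
    by rewrite !(@row_mxEl _ 1 1 n) !mxE.
  by rewrite !(@row_mxEr _ 1 1 n); exact: h2.
rewrite product_measure1E//; [|exact: measurable_ball|exact: mx_ball_measurable].
rewrite IH; have := @lebesgue_measure_ball R (row_uncons c).1 r (ltW r0).
by rewrite exprS EFinM mulr_natl => <-.
Qed.

Lemma lebesgue_rV_bounded n (A : set 'rV[R]_n) : measurable A -> bounded_set A ->
  (leb n A < +oo)%E.
Proof.
move=> mA [M [Mr HM]].
have r0 : 0 < `|M| + 2 by have := normr_ge0 M; lra.
apply: (@le_lt_trans _ _ (leb n (ball 0 (`|M| + 2)))).
  apply: le_measure; rewrite ?inE//; first exact: mx_ball_measurable.
  move=> x Ax; rewrite mx_norm_ball /ball_/= sub0r normrN.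
  apply: (@le_lt_trans _ _ (`|M| + 1)); last by lra.
  by apply: HM => //; have := ler_norm M; lra.
by rewrite lebesgue_rV_ball// ltry.
Qed.

Variable n : nat.

Lemma integrable_translate (v : 'rV[R]_n) (f : 'rV[R]_n -> R) :
  (leb n).-integrable setT (EFin \o f) ->
  (leb n).-integrable setT (EFin \o (fun x => f (x + v))).
Proof.
apply: (integrable_invariant (mx_add_measurable v)) => A mA.
exact: lebesgue_rV_translate.
Qed.

Lemma Rintegral_translate (v : 'rV[R]_n) (f : 'rV[R]_n -> R) :
  (leb n).-integrable setT (EFin \o f) ->
  \int[leb n]_x f (x + v) = \int[leb n]_x f x.
Proof.
apply: (Rintegral_invariant (mx_add_measurable v)) => A mA.
exact: lebesgue_rV_translate.
Qed.

Lemma sqi_translate (v : 'rV[R]_n) (f : 'rV[R]_n -> R) :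
  sqi (leb n) setT f -> sqi (leb n) setT (fun x => f (x + v)).
Proof.
move=> [mf f2]; split; last exact: (integrable_translate v f2).
by apply: (measurableT_comp mf); exact: mx_add_measurable.
Qed.

End lebesgue_rV_theory.

(** * Smooth functions and bumps *)

Section smooth_theory.
Variables (R : realType) (V : normedModType R).
Implicit Types f g : V -> R.

(** Coinduction for smoothness: a class of continuous functions that is closed under directional
    derivatives contains only smooth functions. *)
Lemma smooth_coind (P : set (V -> R)) : (forall f, P f -> continuous f) ->
  (forall f v, P f -> (forall x, derivable f x v) /\ P (fun x => 'D_v f x)) ->
  forall f, P f -> smooth f.
Proof.
move=> Pc Pd f Pf s; have Ps : P (iter_derive s f).
  by elim: s => //= v s IH; exact: (Pd _ v IH).2.
by split=> [|x v]; [exact: Pc|exact: (Pd _ v Ps).1].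
Qed.

Lemma smooth_continuous f : smooth f -> continuous f.
Proof. by move=> /(_ [::])[]. Qed.

Lemma smooth_derivable f x v : smooth f -> derivable f x v.
Proof. by move=> /(_ [::])[_]; exact. Qed.

Lemma smooth_derive f v : smooth f -> smooth (fun x => 'D_v f x).
Proof.
move=> sf s; have := sf (rcons s v).
by rewrite /iter_derive foldr_rcons.
Qed.

Lemma smooth_cst (c : R) : smooth (fun _ : V => c).
Proof.
apply: (@smooth_coind [set f | exists c, f = fun=> c]); last by exists c.
- by move=> _ [a ->] x; exact: cvg_cst.
- move=> _ v [a ->]; split=> [x|]; first exact: derivable_cst.
  by exists 0; apply/funext => x; exact: derive_cst.
Qed.

Lemma smoothD f g : smooth f -> smooth g -> smooth (fun x => f x + g x).
Proof.
move=> sf sg; apply: (@smooth_coind [set h | exists f g, [/\ smooth f, smooth g &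
  h = fun x => f x + g x]]); last by exists f, g.
- move=> _ [a [b [sa sb ->]]] x; apply: cvgD; exact: smooth_continuous.
- move=> _ v [a [b [sa sb ->]]]; split=> [x|].
    by apply: derivableD; exact: smooth_derivable.
  exists (fun x => 'D_v a x), (fun x => 'D_v b x); split; [exact: smooth_derive..|].
  by apply/funext => x; apply: deriveD; exact: smooth_derivable.
Qed.

(** Single products are not closed under differentiation; finite sums of products are, by the
    Leibniz rule, and so fit [smooth_coind]. *)
Inductive smooth_products : (V -> R) -> Prop :=
| smooth_products_mul f g : smooth f -> smooth g -> smooth_products (fun x => f x * g x)
| smooth_products_add f g : smooth_products f -> smooth_products g ->
    smooth_products (fun x => f x + g x).

Lemma smoothM f g : smooth f -> smooth g -> smooth (fun x => f x * g x).
Proof.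
move=> sf sg; apply: (@smooth_coind smooth_products); last exact: smooth_products_mul.
- move=> h Ph; elim: Ph => [a b sa sb|a b _ ca _ cb] x.
    by apply: cvgM; exact: smooth_continuous.
  by apply: cvgD; [exact: ca|exact: cb].
- move=> h v Ph; elim: Ph => [a b sa sb|a b _ [da Pa] _ [db Pb]]; split.
  + by move=> x; apply: derivableM; exact: smooth_derivable.
  + rewrite (_ : (fun x => _) = fun x => a x * 'D_v b x + b x * 'D_v a x).
      apply: (@smooth_products_add (fun x => a x * 'D_v b x) (fun x => b x * 'D_v a x)).
        exact: (smooth_products_mul sa (smooth_derive v sb)).
      exact: (smooth_products_mul sb (smooth_derive v sa)).
    by apply/funext => x; apply: deriveM; exact: smooth_derivable.
  + by move=> x; exact: derivableD.
  + rewrite (_ : (fun x => _) = fun x => 'D_v a x + 'D_v b x).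
      exact: smooth_products_add.
    by apply/funext => x; exact: deriveD.
Qed.

Lemma smoothZ (c : R) f : smooth f -> smooth (fun x => c * f x).
Proof. by move=> sf; exact: smoothM (smooth_cst c) sf. Qed.

Lemma smoothN f : smooth f -> smooth (fun x => - f x).
Proof.
by move=> /(smoothZ (-1)); congr smooth; apply/funext => x; rewrite mulN1r.
Qed.

Lemma smoothB f g : smooth f -> smooth g -> smooth (fun x => f x - g x).
Proof. by move=> sf sg; exact: smoothD sf (smoothN sg). Qed.

Lemma smooth_prod (I : Type) (s : seq I) (F : I -> V -> R) :
  (forall i, smooth (F i)) -> smooth (fun x => \prod_(i <- s) F i x).
Proof.
move=> sF; elim: s => [|i s IH].
  by under eq_fun do rewrite big_nil; exact: smooth_cst.
by under eq_fun do rewrite big_cons; exact: smoothM (sF i) IH.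
Qed.

Lemma smooth_sum (I : Type) (s : seq I) (F : I -> V -> R) :
  (forall i, smooth (F i)) -> smooth (fun x => \sum_(i <- s) F i x).
Proof.
move=> sF; elim: s => [|i s IH].
  by under eq_fun do rewrite big_nil; exact: smooth_cst.
by under eq_fun do rewrite big_cons; exact: smoothD (sF i) IH.
Qed.

End smooth_theory.

Section smooth_affine.
Variables (R : realType) (V W : normedModType R) (l : V -> W) (L : V -> W).
Hypothesis lL : forall h v x, l (h *: v + x) = h *: L v + l x.

Let quotient_affine (g : W -> R) x v :
  (fun h : R => h^-1 *: (((g \o l) \o shift x) (h *: v) - (g \o l) x)) =
  (fun h : R => h^-1 *: ((g \o shift (l x)) (h *: L v) - g (l x))).
Proof. by apply/funext => h /=; rewrite lL. Qed.

Lemma derivable_affine (g : W -> R) x v :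
  derivable (fun x => g (l x)) x v = derivable g (l x) (L v).
Proof. by rewrite /derivable -[fun x => g (l x)]/(g \o l) quotient_affine. Qed.

Lemma derive_affine (g : W -> R) x v : 'D_v (fun x => g (l x)) x = 'D_(L v) g (l x).
Proof. by rewrite /derive -[fun x => g (l x)]/(g \o l) quotient_affine. Qed.

Lemma smooth_affine (g : W -> R) : continuous l -> smooth g -> smooth (fun x => g (l x)).
Proof.
move=> cl sg; apply: (@smooth_coind _ _ [set f | exists2 h, smooth h & f = h \o l]).
- move=> _ [h sh ->] x; apply: continuous_comp; first exact: cl.
  exact: smooth_continuous.
- move=> _ v [h sh ->]; split=> [x|].
    by rewrite derivable_affine; exact: smooth_derivable.
  exists (fun y => 'D_(L v) h y); first exact: smooth_derive.
  by apply/funext => x; exact: derive_affine.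
- by exists g.
Qed.
End smooth_affine.

Lemma near_is_derive (R : realType) (V W : normedModType R) (f g : V -> W) a v df :
  {near a, g =1 f} -> is_derive a v g df -> is_derive a v f df.
Proof.
move=> fg [dg eg]; apply: DeriveDef; first exact: near_eq_derivable dg.
by rewrite -(near_eq_derive v fg).
Qed.

Section flat_function.
Variable R : realType.
Implicit Types (p : {poly R}) (t : R).

(** The classical flat function [exp (-1/t)] with a polynomial factor in [1/t], which makes the
    family closed under differentiation. *)
Definition flat p t : R := if 0 < t then p.[t^-1] * expR (- t^-1) else 0.

Lemma flat_bound p : exists K, 0 <= K /\ forall t, t <= 1 -> `|flat p t| <= K * `|t|.
Proof.
pose d := size p; pose C := \sum_(i < d) `|p`_i|.
have C0 : 0 <= C by exact: sumr_ge0.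
exists (C * d.+1%:R ^+ d.+1); split; first by rewrite mulr_ge0// exprn_ge0.
move=> t t1; rewrite /flat; case: ifPn => [t0|_]; last first.
  by rewrite normr0 !mulr_ge0// exprn_ge0.
set s := t^-1; have s0 : 0 < s by rewrite invr_gt0.
have s1 : 1 <= s by rewrite invf_ge1.
have ps : `|p.[s]| <= C * s ^+ d.
  rewrite horner_coef; apply: le_trans (ler_norm_sum _ _ _) _.
  rewrite mulr_suml; apply: ler_sum => i _; rewrite normrM ler_wpM2l//.
  rewrite ger0_norm ?exprn_ge0 ?(ltW s0)//; apply: ler_weXn2l => //.
  exact: ltnW.
(* From [expR s = expR (s / (d + 1)) ^+ (d + 1)] and [1 + a <= expR a]. One degree more than in the
   bound on the polynomial leaves a factor [s^-1 = t]. *)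
have es : s ^+ d.+1 / d.+1%:R ^+ d.+1 <= expR s.
  have -> : expR s = expR (s / d.+1%:R) ^+ d.+1.
    by rewrite -expRM_natl mulrC divfK// pnatr_eq0.
  rewrite -expr_div_n; rewrite ler_pXn2r ?nnegrE ?expR_ge0 ?divr_ge0 ?(ltW s0)//.
  by apply: le_trans (expR_ge1Dx _); rewrite lerDr.
rewrite normrM (ger0_norm (expR_ge0 _)) expRN.
apply: le_trans (ler_wpM2r _ ps) _; first by rewrite invr_ge0 expR_ge0.
rewrite ler_pdivrMr ?expR_gt0//.
apply: le_trans (ler_wpM2l _ es); last by rewrite !mulr_ge0// exprn_ge0.
have k0 : d.+1%:R ^+ d.+1 != 0 :> R by rewrite expf_neq0// pnatr_eq0.
rewrite (gtr0_norm t0) [leRHS](_ : _ = C * (s ^+ d.+1 * t)); last first.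
  by move: (_ ^+ _) k0 => k k0; move: (s ^+ _) => w; field.
by rewrite exprSr -mulrA mulVf ?gt_eqF// mulr1.
Qed.

(** With [s = 1/t], the derivative of [p(s) exp(-s)] in [t] is [s^2 (p(s) - p'(s)) exp(-s)]. *)
Let flatq p : {poly R} := 'X^2 * (p - p^`()).

Lemma flat_is_derive p t : is_derive t 1 (flat p) (flat (flatq p) t).
Proof.
have [t0|t0|->] := ltgtP t 0.
- have -> : flat (flatq p) t = 0 by rewrite /flat ltNge ltW.
  have hc : is_derive t (1 : R) (cst (0 : R)) 0 by exact: is_derive_cst.
  apply: near_is_derive hc.
  by near=> s; rewrite /flat ltNge ltW//; near: s; exact: lt_nbhsl.
- have tn0 : t != 0 by rewrite gt_eqF.
  have dV : is_derive t 1 (fun s : R => s^-1) (- t ^- 2).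
    by have := is_deriveV tn0 (@is_derive_id _ _ t (1 : R)); rewrite scaler1.
  have dN : is_derive t 1 (fun s : R => - s^-1) (t ^- 2).
    by have := is_deriveN dV; rewrite opprK.
  have dp := is_derive1_comp (is_derive_poly p t^-1) dV.
  have de := @is_derive1_comp R expR (fun s : R => - s^-1) t _ _ (is_derive_expR _) dN.
  have := is_deriveM dp de.
  have -> : flat (flatq p) t = (horner p \o (fun s => s^-1)) t *: (expR (- t^-1) * t ^- 2) +
     (expR \o (fun s => - s^-1)) t *: (p^`().[t^-1] * - t ^- 2).
    rewrite /flat t0 /flatq !hornerE /= /GRing.scale/= exprVn; ring.
  move=> h; apply: (near_is_derive _ h).
  by near=> s; rewrite /flat ifT//; near: s; exact: lt_nbhsr.
- have -> : flat (flatq p) 0 = 0 by rewrite /flat ltxx.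
  (* At 0 the difference quotient of [flat p] is again a flat function, with ['X * p] as polynomial,
     so it tends to 0 by [flat_bound]. *)
  have [K [K0 HK]] := flat_bound ('X * p).
  have cv : (fun h : R => h^-1 *: (flat p (h + 0) - flat p 0)) @ 0^' --> (0 : R).
    apply/cvgrPdist_lt => e e0; near=> h.
    have h0 : h != 0 by near: h; exact: nbhs_dnbhs_neq.
    rewrite sub0r normrN addr0 [flat p 0]/flat ltxx subr0.
    have -> : h^-1 *: flat p h = flat ('X * p) h.
      rewrite /flat; case: ifPn => _; last by rewrite scaler0.
      by rewrite /GRing.scale/= hornerM hornerX mulrA.
    apply: le_lt_trans (HK h _) _.
      by apply: (le_trans (ler_norm h)); near: h; apply: dnbhs0_le; exact: ltr01.
    have : `|h| < e / (K + 1).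
      by near: h; apply: dnbhs0_lt; rewrite divr_gt0//; lra.
    by rewrite ltr_pdivlMr; [have := normr_ge0 h; nra|lra].
  apply: DeriveDef.
    by apply/cvg_ex; exists 0; under eq_fun do rewrite /= scaler1.
  by apply: cvg_lim => //; under eq_fun do rewrite /= scaler1.
Unshelve. all: by end_near. Qed.

Lemma derive_line (f : R -> R) (x df v : R) : is_derive x (1 : R) f df ->
  derivable f x v /\ 'D_v f x = v * df.
Proof.
move=> D; have /derivable1_diffP fd : derivable f x 1 by apply: ex_derive.
split; first exact: diff_derivable.
rewrite deriveE// -[v in LHS]mulr1 -[v * 1]/(v *: (1 : R)) linearZ/= -deriveE//.
by rewrite derive_val.
Qed.

Lemma flat_derive p t v : derivable (flat p) t v /\
  'D_v (flat p) t = v * flat (flatq p) t.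
Proof. exact: derive_line (flat_is_derive p t). Qed.

Lemma flat_smooth p : smooth (flat p).
Proof.
apply: (@smooth_coind _ _ [set f | exists c p, f = fun t => c * flat p t]); last first.
- by exists 1, p; apply/funext => t; rewrite mul1r.
- move=> _ v [c [q ->]]; split=> [t|].
    by have [d _] := flat_derive q t v; have := @derivableZ _ _ _ (flat q) c t v d.
  exists (c * v), (flatq q); apply/funext => t; have [d e] := flat_derive q t v.
  by have := deriveZ c d; rewrite e /GRing.scale/= mulrA.
- move=> _ [c [q ->]] t; apply: cvgMl_tmp.
  have D := flat_is_derive q t.
  have /derivable1_diffP df : derivable (flat q) t 1 by apply: ex_derive.
  exact: differentiable_continuous.
Qed.

End flat_function.

Section bump.
Variable R : realType.

Definition bump1 (r t : R) := flat 1 (r + t) * flat 1 (r - t).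

Lemma bump1_smooth r : smooth (bump1 r).
Proof.
apply: smoothM.
  apply: (@smooth_affine _ _ _ (fun t => r + t) idfun _ (flat 1)).
  - by move=> h v x; rewrite addrCA.
  - by move=> x; apply: cvgD; [exact: cvg_cst|exact: cvg_id].
  - exact: flat_smooth.
apply: (@smooth_affine _ _ _ (fun t => r - t) -%R _ (flat 1)).
- by move=> h v x; rewrite opprD addrCA scalerN.
- by move=> x; apply: cvgB; [exact: cvg_cst|exact: cvg_id].
- exact: flat_smooth.
Qed.

Lemma flat1_ge0 t : 0 <= flat (1 : {poly R}) t.
Proof. by rewrite /flat; case: ifP => // _; rewrite hornerE mul1r expR_ge0. Qed.

Lemma flat1_gt0 t : (0 < flat (1 : {poly R}) t) = (0 < t).
Proof. by rewrite /flat; case: ifP => // _; rewrite ?hornerE ?mul1r ?expR_gt0// ltxx. Qed.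

Lemma bump1_ge0 r t : 0 <= bump1 r t.
Proof. by rewrite mulr_ge0// flat1_ge0. Qed.

Lemma bump1_gt0 r t : (0 < bump1 r t) = (`|t| < r).
Proof.
rewrite /bump1 ltr_norml; have := flat1_ge0 (r + t).
rewrite le_eqVlt => /predU1P[e|p].
  rewrite -e mul0r ltxx; apply/esym/negbTE/negP => /andP[h _].
  by have := flat1_gt0 (r + t); rewrite -e ltxx => /esym/negbT; rewrite -leNgt; lra.
rewrite pmulr_rgt0// flat1_gt0; rewrite flat1_gt0 in p.
by apply/idP/andP; [split|case]; lra.
Qed.

Lemma bump1N r t : bump1 r (- t) = bump1 r t.
Proof. by rewrite /bump1 opprK mulrC. Qed.

Definition bumpn n (r : R) (x : 'rV[R]_n) := \prod_(j < n) bump1 r (x 0 j).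

Lemma bumpn_smooth n (r : R) : smooth (@bumpn n r).
Proof.
apply: smooth_prod => j.
apply: (@smooth_affine _ _ _ (fun x : 'rV[R]_n => x 0 j) (fun x => x 0 j) _ (bump1 r)).
- by move=> h v x; rewrite !mxE.
- exact: coord_continuous.
- exact: bump1_smooth.
Qed.

Lemma bumpn_ge0 n r (x : 'rV[R]_n) : 0 <= bumpn r x.
Proof. by apply: prodr_ge0 => j _; exact: bump1_ge0. Qed.

Lemma bumpn_gt0 n r (x : 'rV[R]_n) : 0 < r -> 0 < bumpn r x <-> `|x| < r.
Proof.
move=> r0; rewrite mx_normP//; split=> [|h]; last first.
  by apply: prodr_gt0 => j _; rewrite bump1_gt0.
rewrite lt0r => /andP[/prodf_neq0 h _] i j; rewrite (ord1 i) -bump1_gt0.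
by rewrite lt0r bump1_ge0 andbT; exact: h.
Qed.

Lemma bumpnN n r (x : 'rV[R]_n) : bumpn r (- x) = bumpn r x.
Proof. by apply: eq_bigr => j _; rewrite mxE bump1N. Qed.

End bump.

(** * Test functions *)

Definition tsupp (R : realType) (V : normedModType R) (phi : V -> R) : set V :=
  closure [set x | phi x != 0].

Section test_function_theory.
Variables (R : realType) (V : normedModType R).
Implicit Types (phi psi : V -> R) (O K : set V).

Lemma tsupp_out phi x : ~ tsupp phi x -> phi x = 0.
Proof.
by move=> h; apply/eqP/negP => /negP n0; apply: h; exact: subset_closure.
Qed.

Lemma tsupp_out_near phi x : ~ tsupp phi x -> \forall y \near x, phi y = 0.
Proof.
move=> h; have oC : open (~` tsupp phi) by rewrite openC; exact: closed_closure.
by apply: filterS (open_nbhs_nbhs (conj oC h)) => y; exact: tsupp_out.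
Qed.

Lemma tsupp_sub phi K : closed K -> (forall x, phi x != 0 -> K x) -> tsupp phi `<=` K.
Proof. by move=> cK h; rewrite [X in _ `<=` X](iffLR (closure_id K) cK); exact: closure_subset. Qed.

Lemma test_in O K phi : smooth phi -> compact K -> (forall x, phi x != 0 -> K x) ->
  K `<=` O -> test_fun O phi.
Proof.
move=> sp cK h KO; have cl : closed K by apply: compact_closed => //; exact: norm_hausdorff.
have sK : tsupp phi `<=` K by exact: tsupp_sub.
split => //; last by apply: subset_trans KO.
by apply: subclosed_compact cK sK; exact: closed_closure.
Qed.

Lemma test_sub O U phi psi : test_fun O phi -> smooth psi ->
  (forall x, psi x != 0 -> tsupp phi x) -> tsupp phi `<=` U -> test_fun U psi.
Proof. by move=> [_ cp _] sp h hU; apply: (test_in sp cp). Qed.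

Lemma test_subset O U phi : O `<=` U -> test_fun O phi -> test_fun U phi.
Proof. by move=> OU [sp cp h]; split=> //; exact: subset_trans OU. Qed.

Lemma test_smooth O phi : test_fun O phi -> smooth phi. Proof. by case. Qed.

Lemma test_out O phi x : test_fun O phi -> ~ O x -> phi x = 0.
Proof. by move=> [_ _ h] nx; apply: tsupp_out => /h. Qed.

Lemma test_mul O phi psi : test_fun O phi -> smooth psi ->
  test_fun O (fun x => phi x * psi x).
Proof.
move=> tp sp; apply: (test_sub tp); last by case: tp.
  exact: smoothM (test_smooth tp) sp.
by move=> x h; apply: subset_closure; apply: contraNN h => /eqP ->; rewrite mul0r.
Qed.

Lemma testZ O c phi : test_fun O phi -> test_fun O (fun x => c * phi x).
Proof.
move=> tp; have := test_mul tp (@smooth_cst R V c).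
by congr test_fun; apply/funext => x; rewrite mulrC.
Qed.

Lemma test_derive O phi v : test_fun O phi -> test_fun O (fun x => 'D_v phi x).
Proof.
move=> tp; apply: (test_sub tp); last by case: tp.
  by apply: smooth_derive; exact: test_smooth tp.
move=> x; apply: contraNP => /tsupp_out_near h; apply/eqP.
have -> : 'D_v phi x = 'D_v (cst (0 : R)) x by exact: near_eq_derive.
exact: derive_cst.
Qed.

Lemma test_bounded O phi : test_fun O phi -> exists2 M, 0 <= M & forall x, `|phi x| <= M.
Proof.
move=> tp; have [sp cp _] := tp.
have : compact (phi @` tsupp phi).
  apply: continuous_compact => //; apply: continuous_subspaceT.
  exact: smooth_continuous.
move=> /compact_bounded[M0 [Mr HM]]; exists (`|M0| + 1); first by rewrite addr_ge0.
move=> x; have [px|/tsupp_out ->] := pselect (tsupp phi x); last first.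
  by rewrite normr0 addr_ge0.
apply: HM; last by exists x.
by rewrite (le_lt_trans (ler_norm _))// ltrDl.
Qed.

Lemma derive_seq phi x v : derivable phi x v ->
  (fun k => k.+1%:R * (phi (x + k.+1%:R^-1 *: v) - phi x)) @ \oo --> 'D_v phi x.
Proof.
move=> /cvgr_dnbhsP /(_ (fun k => k.+1%:R^-1)).
have h : (forall k, (k.+1%:R^-1 : R) != 0) /\ (fun k => k.+1%:R^-1) @ \oo --> (0 : R).
  by split; [|exact: cvg_invS].
move=> /(_ h).
rewrite (_ : (fun k => _) = fun k => k.+1%:R * (phi (x + k.+1%:R^-1 *: v) - phi x))//.
by apply/funext => k; rewrite invrK; congr (_ * (phi _ - _)); rewrite /shift/= addrC.
Qed.

Lemma test_lipschitz O phi v : test_fun O phi ->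
  exists2 L, 0 <= L & forall x s, `|phi (x + s *: v) - phi x| <= L * `|s|.
Proof.
move=> tp; have [L L0 HL] := test_bounded (test_derive v tp); exists L => // x s.
pose l (t : R) : V := t *: v + x.
have aff h w t : l (h *: w + t) = h *: (w *: v) + l t by rewrite /l scalerDl scalerA addrA.
have D (t : R) : is_derive t (1 : R) (phi \o l) ('D_v phi (l t)).
  apply: DeriveDef; first by rewrite (derivable_affine aff); exact/smooth_derivable/test_smooth/tp.
  by rewrite (derive_affine aff) scale1r.
have key a b : a <= b -> `|phi (l b) - phi (l a)| <= L * (b - a).
  move=> ab; have [c _ e] : exists2 c, c \in `[a, b]%R &
      (phi \o l) b - (phi \o l) a = 'D_v phi (l c) * (b - a).
    apply: MVT_segment => //; apply: continuous_subspaceT => t.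
    by apply: differentiable_continuous; apply/derivable1_diffP; exact: ex_derive.
  by rewrite -[phi (l b) - _]/((phi \o l) b - (phi \o l) a) e normrM (ger0_norm (_ : 0 <= b - a))
    ?subr_ge0//; apply: ler_wpM2r; rewrite ?subr_ge0.
have l0 : x = l 0 by rewrite /l scale0r add0r.
rewrite [x + _]addrC -/(l s) [X in _ - phi X]l0; have [s0|s0] := leP 0 s.
  by have := key _ _ s0; rewrite subr0 (ger0_norm s0).
by have := key _ _ (ltW s0); rewrite sub0r distrC (ltr0_norm s0).
Qed.

Lemma test0 O : test_fun O (fun _ : V => 0 : R).
Proof.
by apply: (@test_in _ set0) => //; [exact: smooth_cst|exact: compact0|move=> x; rewrite eqxx].
Qed.

End test_function_theory.

Section seq_continuity.
Variables (R : realType) (V : normedModType R) (f : V -> R) (x : V).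

(** Dominated convergence concerns sequences of functions; this turns it into continuity of a
    parameter integral. *)
Lemma seq_continuous :
  (forall u : nat -> V, u @ \oo --> x -> (fun k => f (u k)) @ \oo --> f x) ->
  f y @[y --> x] --> f x.
Proof.
move=> H; apply/cvgrPdist_lt => e e0; apply/nbhs_ballP.
apply: contrapT => hN.
have h (d : R) : ~ ([set e0 : R | 0 < e0] d /\ ball x d `<=` [set y | `|f x - f y| < e]).
  by move=> [d0 hd]; apply: hN; exists d.
have /choice[u Hu] : forall k : nat, exists y, `|x - y| < k.+1%:R^-1 /\ e <= `|f x - f y|.
  move=> k; have := h k.+1%:R^-1.
  move=> /not_andP[|]; first by rewrite /= invr_gt0 ltr0n.
  move=> /existsNP[y /not_implyP[yx /negP]]; rewrite -leNgt => hy.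
  by exists y; split => //; move: yx; rewrite -ball_normE.
have ux : u @ \oo --> x.
  apply/cvgrPdist_lt => d d0; have [N HN] := invS_lt d0.
  by exists N => // k /= /HN; apply: lt_trans; exact: (Hu k).1.
have /cvgrPdist_lt/(_ _ e0)[N _ HN] := H u ux.
by have := HN N (leqnn N); rewrite /= ltNge (Hu N).2.
Qed.
End seq_continuity.

Lemma itg_bounded_supp d (T : measurableType d) (R : realType)
    (mu : {measure set T -> \bar R}) (f : T -> R) M K :
  measurable K -> (mu K < +oo)%E -> measurable_fun setT f ->
  (forall x, `|f x| <= M) -> (forall x, ~ K x -> f x = 0) ->
  mu.-integrable setT (EFin \o f).
Proof.
move=> mK Kfin mf fM f0.
have -> : EFin \o f = (EFin \o f) \_ K.
  apply/funext => x; rewrite /patch; case: ifPn => //; rewrite notin_setE => h.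
  by rewrite /= f0.
apply/(integrable_mkcond _ mK).
apply: measurable_bounded_integrable => //; first exact: measurable_funS mf.
exists M; split; first exact: num_real.
by move=> y My x _ /=; apply: le_trans (ltW My).
Qed.

(** * Convolution, mollifiers and cut-off functions *)

Section rV_test.
Variables (R : realType) (n : nat).
Local Notation V := 'rV[R]_n.
Local Notation leb := (lebesgue_rV R n).
Implicit Types (O U K : set V) (phi psi : V -> R).

Lemma bounded_setU (A B : set V) : bounded_set A -> bounded_set B -> bounded_set (A `|` B).
Proof.
move=> [M [_ HM]] [N [_ HN]]; exists (`|M| + `|N|); split; first exact: num_real.
have := ler_norm M; have := ler_norm N; have := normr_ge0 M; have := normr_ge0 N.
move=> h1 h2 h3 h4 y hy x [|]; [apply: HM|apply: HN]; lra.
Qed.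

Lemma compactU_rV K U : compact K -> compact U -> compact (K `|` U).
Proof.
move=> cK cU; apply: bounded_closed_compact.
  by apply: bounded_setU; exact: compact_bounded.
by apply: closedU; apply: compact_closed => //; exact: norm_hausdorff.
Qed.

Lemma testD O phi psi : test_fun O phi -> test_fun O psi ->
  test_fun O (fun x => phi x + psi x).
Proof.
move=> [sp cp hp] [sq cq hq]; apply: (@test_in _ _ _ (tsupp phi `|` tsupp psi)).
- exact: smoothD.
- exact: compactU_rV.
- move=> x; apply: contraNP => /not_orP[/tsupp_out -> /tsupp_out ->].
  by rewrite addr0.
- by move=> x [/hp|/hq].
Qed.

Lemma smooth_meas phi : smooth phi -> measurable_fun setT phi.
Proof. by move=> sp; apply: mx_continuous_measurable => //; exact: smooth_continuous. Qed.

Lemma compact_rV_fin K : compact K -> measurable K /\ (leb K < +oo)%E.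
Proof.
move=> cK; have mK : measurable K.
  by apply: mx_closed_measurable; apply: compact_closed => //; exact: norm_hausdorff.
by split=> //; apply: lebesgue_rV_bounded => //; exact: compact_bounded.
Qed.

Lemma test_itg O phi : test_fun O phi -> leb.-integrable setT (EFin \o phi).
Proof.
move=> tp; have [M M0 hM] := test_bounded tp; have [sp cp _] := tp.
have [mK fK] := compact_rV_fin cp.
by apply: (itg_bounded_supp mK fK (smooth_meas sp) hM) => x; exact: tsupp_out.
Qed.

(** The kernel is reflected compared with the usual convolution, so derivatives fall on [rho] in the
    direction [- v]; the mollifiers are even, for them both forms agree. *)
Definition conv (rho g : V -> R) (x : V) : R := \int[leb]_y (rho (y - x) * g y).

Lemma shift_continuous (a : V) : continuous (fun x : V => x + a).
Proof. by move=> x; apply: (@continuousD _ _ _ id (cst a)); [exact: cvg_id|exact: cst_continuous]. Qed.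

Lemma smooth_shift phi (a : V) : smooth phi -> smooth (fun x => phi (x + a)).
Proof.
move=> sp; apply: (@smooth_affine _ _ _ (fun x => x + a) id) => //.
  by move=> h v x; rewrite addrA.
exact: shift_continuous.
Qed.

Lemma conv_itg rho g x M : smooth rho -> (forall x, `|rho x| <= M) ->
  leb.-integrable setT (EFin \o g) ->
  leb.-integrable setT (EFin \o (fun y => rho (y - x) * g y)).
Proof.
move=> sr rM gi; apply: (@itg_le _ _ _ _ _ measurableT _ (fun y => M * `|g y|)).
- apply: measurable_funM; last exact: itg_meas gi.
  exact: smooth_meas (smooth_shift (- x) sr).
- by move=> y _; rewrite normrM ler_wpM2r.
- apply: itgZ => //; have := integrable_norm gi.
  by apply: eq_integrable.
Qed.

Lemma conv_derive rho g x v : test_fun setT rho -> leb.-integrable setT (EFin \o g) ->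
  derivable (conv rho g) x v /\
  'D_v (conv rho g) x = conv (fun y => 'D_(- v) rho y) g x.
Proof.
move=> tr gi; have sr := test_smooth tr.
have [M M0 rM] := test_bounded tr.
have [M' M'0 rM'] := test_bounded (test_derive (- v) tr).
(* Restriction to a line: differentiation under the integral sign then concerns a real parameter in
   []-1, 1[], with the derivative dominated by [M' * |g|]. *)
pose l (s : R) : V := s *: v + x; pose L (s : R) : V := s *: v.
have lL h w s : l (h *: w + s) = h *: L w + l s.
  by rewrite /l /L scalerDl scalerA addrA.
pose f (s : R) (y : V) := rho (y - l s) * g y.
have l0 : l 0 = x by rewrite /l scale0r add0r.
have L1 : L 1 = v by rewrite /L scale1r.
have df s y : derivable (f ^~ y) s 1 /\ 'D_1 (f ^~ y) s = 'D_(- v) rho (y - l s) * g y.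
  have aff h w t : y - l (h *: w + t) = h *: (- L w) + (y - l t).
    by rewrite lL opprD addrCA scalerN.
  have d1 : derivable (fun s => rho (y - l s)) s 1.
    by rewrite (derivable_affine aff); exact: smooth_derivable.
  have e1 : 'D_1 (fun s => rho (y - l s)) s = 'D_(- v) rho (y - l s).
    by rewrite (derive_affine aff) L1.
  have fE : f ^~ y = g y *: (fun s => rho (y - l s)).
    by apply/funext => t; rewrite /f mulrC.
  rewrite fE; split; first exact: derivableZ.
  by rewrite deriveZ// e1 mulrC.
have h0 : (0 : R) \in `]-1, 1[ by rewrite in_itv/= ltrN10 ltr01.
have intf (s : R) : leb.-integrable setT (EFin \o f s) by exact: conv_itg rM gi.
have deriv1 s y : partial1of2 f s y = 'D_(- v) rho (y - l s) * g y.
  by rewrite partial1of2E (df s y).2.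
have dd (s : R) y : [set` `]-1, 1[%R] s -> setT y -> derivable (f ^~ y) s 1.
  by move=> _ _; exact: (df s y).1.
have Gi : leb.-integrable setT (EFin \o (fun y => M' * `|g y|)).
  apply: itgZ => //; have := integrable_norm gi.
  by apply: eq_integrable.
have G0 y : 0 <= M' * `|g y| by rewrite mulr_ge0.
have Gub (s : R) y : [set` `]-1, 1[%R] s -> setT y ->
    `|partial1of2 f s y| <= M' * `|g y|.
  by move=> _ _; rewrite deriv1 normrM ler_wpM2r.
have D1 := derivable_under_integral measurableT h0 (fun s _ => intf s) dd G0 Gi Gub.
have D2 := differentiation_under_integral measurableT h0 (fun s _ => intf s) dd G0 Gi Gub.
have cE : (fun s => \int[leb]_(y in setT) f s y) = (fun s => conv rho g (l s)) by [].
split.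
  by have := derivable_affine lL (conv rho g) 0 1; rewrite l0 L1 => <-.
have := derive_affine lL (conv rho g) 0 1; rewrite l0 L1 => <-.
rewrite -derive1E -cE D2; apply: eq_Rintegral => y _; by rewrite deriv1 l0.
Qed.

Lemma derive_opp phi x v : (forall v, derivable phi x v) -> 'D_(- v) phi x = - 'D_v phi x.
Proof.
move=> dp; pose l (w : V) (s : R) : V := s *: w + x.
have aff w h t s : l w (h *: t + s) = h *: (t *: w) + l w s.
  by rewrite /l scalerDl scalerA addrA.
have e w : 'D_1 (fun s => phi (l w s)) 0 = 'D_w phi x.
  by rewrite (derive_affine (aff w)) scale1r /l scale0r add0r.
have d : derivable (fun s => phi (l v s)) 0 1.
  by rewrite (derivable_affine (aff v)) scale1r /l scale0r add0r.
rewrite -e -(e v).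
have -> : (fun s => phi (l (- v) s)) = (fun s => phi (l v (- s))).
  by apply/funext => s; rewrite /l scalerN scaleNr.
have D1 : is_derive (- 0 : R) 1 (fun s => phi (l v s)) ('D_1 (fun s => phi (l v s)) (- 0)).
  by apply: derivableP; rewrite oppr0.
have D2 : is_derive (0 : R) (1 : R) (fun s : R => - s) (- 1).
  by apply: is_deriveN.
have D3 := @is_derive1_comp R (fun s => phi (l v s)) (fun s : R => - s) 0 _ _ D1 D2.
by rewrite [LHS](@derive_val _ _ _ _ _ _ _ D3) oppr0 mulrN1.
Qed.

Lemma conv_continuous rho g : test_fun setT rho -> leb.-integrable setT (EFin \o g) ->
  continuous (conv rho g).
Proof.
move=> tr gi x; have sr := test_smooth tr; have [M M0 rM] := test_bounded tr.
have mr (y : V) : measurable_fun setT (fun z : V => rho (z - y) * g z).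
  exact: itg_meas (conv_itg y sr rM gi).
apply: seq_continuous => u ux.
apply: (Rint_cvg measurableT (g := fun y => M * `|g y|) _ _ _ _ _).2 => //.
- apply: aeW => y _; apply: cvgMr_tmp.
  apply: (@cvg_comp _ _ _ (fun k => y - u k) rho _ (nbhs (y - x))).
    by apply: cvgB => //; exact: cvg_cst.
  exact: (smooth_continuous sr).
- by apply: itgZ => //; have := integrable_norm gi; apply: eq_integrable.
- by apply: aeW => y k _; rewrite normrM ler_wpM2r.
Qed.

Lemma conv_smooth rho g : test_fun setT rho -> leb.-integrable setT (EFin \o g) ->
  smooth (conv rho g).
Proof.
move=> tr gi; apply: (@smooth_coind _ _ [set f | exists2 r, test_fun setT r & f = conv r g]).
- by move=> _ [r hr ->]; exact: conv_continuous.
- move=> _ v [r hr ->]; split=> [x|]; first exact: (conv_derive x v hr gi).1.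
  exists (fun y => 'D_(- v) r y); first exact: test_derive.
  by apply/funext => x; exact: (conv_derive x v hr gi).2.
- by exists rho.
Qed.

(** A Lebesgue number: the radius is uniform over [K]. *)
Lemma near_compact K (U : set V) : compact K -> open U -> K `<=` U ->
  exists2 e, 0 < e & forall x, K x -> ball x e `<=` U.
Proof.
move=> cK oU KU.
have /compact_near_coveringP cK' := cK.
have := cK' R (0 : R)^'+ (fun e x => ball x e `<=` U) _.
case=> [x Kx|e /= e0 He].
  have /nbhs_ballP[e /= e0 xe] : nbhs x U by apply: open_nbhs_nbhs; split=> //; exact: KU.
  near=> y d; move=> z yz; apply: xe; apply: (@le_ball _ _ x (e / 2 + d)).
    have : d < e / 2 by near: d; apply: nbhs_right_lt; rewrite divr_gt0.
    by lra.
  apply: ball_triangle yz; near: y.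
  by apply: nbhsx_ballx; rewrite divr_gt0.
exists (e / 2); first by rewrite divr_gt0.
move=> x Kx; apply: (He (e / 2)) => //=; last by rewrite divr_gt0.
by rewrite sub0r normrN gtr0_norm ?divr_gt0//; lra.
Unshelve. all: by end_near. Qed.

Lemma bumpn_test (r : R) : 0 < r -> test_fun setT (@bumpn R n r).
Proof.
move=> r0; apply: (@test_in _ _ _ (closed_ball (0 : V) r)) => //.
- exact: bumpn_smooth.
- apply: bounded_closed_compact; last exact: closed_ball_closed.
  rewrite closed_ballE//; exists r; split; first exact: num_real.
  move=> M rM x; rewrite /closed_ball_/= sub0r normrN => /le_trans; apply; exact: ltW.
- move=> x; rewrite closed_ballE// /closed_ball_/= sub0r normrN => h.
  by apply/ltW/bumpn_gt0 => //; rewrite lt0r h bumpn_ge0.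
Qed.

Lemma bumpn_int_gt0 (r : R) : 0 < r -> 0 < \int[leb]_x bumpn r x.
Proof.
move=> r0; have bi := test_itg (bumpn_test r0).
rewrite lt_neqAle eq_sym; apply/andP; split; last first.
  by apply: Rintegral_ge0 => x _; exact: bumpn_ge0.
apply/negP => /eqP b0.
have := Rint_eq0 measurableT bi (fun x _ => bumpn_ge0 r x) b0.
move=> [N [mN N0 hN]].
have bN : ball (0 : V) r `<=` N.
  move=> x; rewrite -ball_normE/= sub0r normrN => /(bumpn_gt0 _ r0) h; apply: hN.
  by move=> /(_ I)/= e; rewrite e ltxx in h.
have z0 := subset_measure0 (mx_ball_measurable (0 : V) r) mN bN N0.
have /eqP := etrans (esym (lebesgue_rV_ball (0 : V) r0)) z0; rewrite eqe expf_eq0 mulf_eq0 pnatr_eq0/=.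
by rewrite gt_eqF// andbF.
Qed.

Definition moll (r : R) (x : V) := (\int[leb]_y bumpn r y)^-1 * bumpn r x.

Lemma moll_test r : 0 < r -> test_fun setT (moll r).
Proof. by move=> r0; apply: testZ; exact: bumpn_test. Qed.

Lemma moll_ge0 r x : 0 < r -> 0 <= moll r x.
Proof. by move=> r0; rewrite mulr_ge0 ?bumpn_ge0// invr_ge0 ltW// bumpn_int_gt0. Qed.

Lemma moll_neq0 r x : 0 < r -> moll r x != 0 -> `|x| < r.
Proof.
by move=> r0; rewrite mulf_eq0 negb_or => /andP[_ h]; apply/(bumpn_gt0 _ r0);
  rewrite lt0r h bumpn_ge0.
Qed.

Lemma mollN r x : moll r (- x) = moll r x.
Proof. by rewrite /moll bumpnN. Qed.

Lemma moll_int r x : 0 < r -> \int[leb]_y moll r (y - x) = 1.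
Proof.
move=> r0; rewrite (Rintegral_translate (- x) (f := moll r)); last exact: test_itg (moll_test r0).
rewrite RintegralZl//; last exact: test_itg (bumpn_test r0).
by rewrite mulVf// gt_eqF// bumpn_int_gt0.
Qed.

Lemma conv_moll_eq r g x c : 0 < r -> (forall y, `|y - x| < r -> g y = c) ->
  conv (moll r) g x = c.
Proof.
move=> r0 h; rewrite /conv (_ : (fun y => _) = fun y => c * moll r (y - x)); last first.
  apply/funext => y; have [->|/(moll_neq0 r0)/h ->] := eqVneq (moll r (y - x)) 0.
    by rewrite mulr0 mul0r.
  by rewrite mulrC.
rewrite RintegralZl ?moll_int ?mulr1//.
exact: (integrable_translate (- x) (test_itg (moll_test r0))).
Qed.

Lemma moll_shift_itg r x : 0 < r -> leb.-integrable setT (EFin \o (fun y : V => moll r (y - x))).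
Proof. by move=> r0; exact: (integrable_translate (- x) (test_itg (moll_test r0))). Qed.

Lemma conv_moll_itg r g x : 0 < r -> leb.-integrable setT (EFin \o g) ->
  leb.-integrable setT (EFin \o (fun y => moll r (y - x) * g y)).
Proof.
move=> r0 gi; have [M _ hM] := test_bounded (moll_test r0).
exact: conv_itg (test_smooth (moll_test r0)) hM gi.
Qed.

Lemma conv_moll_le r g x M : 0 < r -> leb.-integrable setT (EFin \o g) ->
  (forall y, g y <= M) -> conv (moll r) g x <= M.
Proof.
move=> r0 gi gM; rewrite -[M]mul1r -(moll_int x r0) -RintegralZr//; last exact: moll_shift_itg.
apply: Rint_le => //; first exact: conv_moll_itg.
  have := itgZ measurableT M (moll_shift_itg x r0).
  by apply: eq_integrable => // y _ /=; rewrite mulrC.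
by move=> y _; rewrite ler_wpM2l// moll_ge0.
Qed.

Lemma conv_moll_ge0 r g x : 0 < r -> (forall y, 0 <= g y) -> 0 <= conv (moll r) g x.
Proof.
by move=> r0 g0; apply: Rintegral_ge0 => y _; rewrite mulr_ge0// moll_ge0.
Qed.

Lemma cutoff K (O : set V) : compact K -> open O -> K `<=` O ->
  exists eta, [/\ test_fun O eta, forall x, 0 <= eta x <= 1 &
    exists2 W, open W & K `<=` W /\ forall x, W x -> eta x = 1].
Proof.
move=> cK oO KO; have [e e0 he] := near_compact cK oO KO.
pose N s := \bigcup_(x in K) ball x s.
have oN s : open (N s).
  apply: bigcup_open => x _; have [s0|s0] := ltP 0 s; first exact: ball_open.
  rewrite (_ : ball x s = set0); first exact: open0.
  by apply/seteqP; split=> // y /mx_ballE[]; rewrite ltNge s0.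
have bN s : bounded_set (N s).
  have [M [Mr HM]] := compact_bounded cK.
  exists (`|M| + 1 + `|s|); split; first exact: num_real.
  move=> M' hM' y [x Kx]; rewrite -ball_normE/= => xy.
  have := HM (`|M| + 1) _ x Kx; have := ler_norm M; have := ler_norm s.
  have := ler_normB x (x - y); rewrite opprB addrC subrK => h1 h2 h3 h4.
  have h5 : M < `|M| + 1 by lra.
  have : `|x| <= `|M| + 1 := h4 h5; rewrite /=; lra.
(* The indicator of the [2r]-neighbourhood is mollified at scale [r]: the result is 1 on the
   [r]-neighbourhood and lives in the closure of the [3r]-neighbourhood, which lies in the
   [4r]-neighbourhood and so in [O]. *)
pose r := e / 4; have r0 : 0 < r by rewrite /r; lra.
pose g : V -> R := \1_(N (2 * r)).
have cN : closure (N (3 * r)) `<=` N (4 * r).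
  move=> x /(_ (ball x r) (nbhsx_ballx _ _ r0))[y [[z Kz zy] xy]].
  exists z => //; rewrite (_ : 4 * r = 3 * r + r); last by ring.
  by apply: ball_triangle zy _; exact: ball_sym.
have mN : measurable (N (2 * r)) by exact: mx_open_measurable.
have gi : leb.-integrable setT (EFin \o g).
  apply: (@itg_bounded_supp _ _ _ _ g 1 (N (2 * r))) => //.
  - exact: lebesgue_rV_bounded.
  - exact: measurable_indic.
  - by move=> x; rewrite /g indicE; case: (_ \in _); rewrite ?normr1 ?normr0.
  - by move=> x h; rewrite /g indicE memNset.
have g1 y : g y <= 1 by rewrite /g indicE; case: (_ \in _).
exists (conv (moll r) g); split.
- apply: (@test_in _ _ _ (closure (N (3 * r)))).
  + by apply: conv_smooth => //; exact: moll_test.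
  + apply: bounded_closed_compact; last exact: closed_closure.
    have [M [Mr HM]] := bN (4 * r); exists M; split=> // M' hM' x cx.
    by apply: HM hM' x (cN x cx).
  + move=> x h; apply: subset_closure; apply: contrapT => nx.
    move/eqP: h; apply; apply: conv_moll_eq => // y yx.
    rewrite /g indicE memNset// => -[z Kz zy]; apply: nx; exists z => //.
    rewrite (_ : 3 * r = 2 * r + r); last by ring.
    by apply: ball_triangle zy _; rewrite -ball_normE.
  + move=> x /cN[z Kz]; rewrite (_ : 4 * r = e); last by rewrite /r; field.
    exact: he Kz _.
- by move=> x; rewrite conv_moll_ge0// conv_moll_le.
- exists (N r) => //; split=> [x Kx|x [z Kz zx]].
    by exists x => //; exact: ballxx.
  apply: conv_moll_eq => // y yx; rewrite /g indicE mem_set//; exists z => //.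
  rewrite (_ : 2 * r = r + r); last by ring.
  by apply: ball_triangle zx _; rewrite -ball_normE/= distrC.
Qed.

(** A two-set partition of unity: [eta] is a cut-off inside [U] of the part of the support of [phi]
    outside [W]. It serves both the subadditivity of the variation and the localisation of fields
    near the boundary. *)
Lemma test_split (O U W : set V) phi : open O -> open U -> open W -> test_fun O phi ->
  tsupp phi `<=` U `|` W -> exists eta, [/\ smooth eta, forall x, 0 <= eta x <= 1,
    test_fun (O `&` U) (fun x => phi x * eta x) &
    test_fun (O `&` W) (fun x => phi x * (1 - eta x))].
Proof.
move=> oO oU oW tp hUW; have [sp cp pO] := tp.
have cK : compact (tsupp phi `&` ~` W) by apply: compact_closedI => //; rewrite closedC.
have [|eta [te e01 [N oN [KN N1]]]] := cutoff cK oU.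
  by move=> x [/hUW[]].
have se := test_smooth te; exists eta; split; [exact: se|exact: e01| |].
- apply: (@test_in _ _ _ (tsupp phi `&` tsupp eta)).
  + exact: smoothM.
  + by apply: compact_closedI => //; exact: closed_closure.
  + move=> x; apply: contraNP => /not_andP[/tsupp_out ->|/tsupp_out ->];
      by rewrite ?mul0r ?mulr0.
  + by move=> x [/pO ? xe]; split => //; have [_ _] := te; exact.
- apply: (@test_in _ _ _ (tsupp phi `&` ~` N)).
  + exact: smoothM sp (smoothB (smooth_cst 1) se).
  + by apply: compact_closedI => //; rewrite closedC.
  + move=> x; apply: contraNP => /not_andP[/tsupp_out ->|/contrapT/N1 ->];
      by rewrite ?mul0r ?subrr ?mulr0.
  + move=> x [px nx]; split; first exact: pO.
    by apply: contrapT => nW; apply: nx; exact: KN.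
Qed.

End rV_test.

(** * Exhaustion by cut-offs, integration by parts, the du Bois-Reymond lemma *)

Section rV_calculus.
Variables (R : realType) (n : nat).
Local Notation V := 'rV[R]_n.
Local Notation leb := (lebesgue_rV R n).
Implicit Types (O U K : set V) (phi psi g : V -> R).

(** The cut-offs are 1 on a neighbourhood [W] of each compact set and not merely on the set, so that
    their derivatives vanish on it too. *)
Lemma exhaustion O : open O -> exists eta : nat -> V -> R,
  (forall k, test_fun O (eta k) /\ forall x, 0 <= eta k x <= 1) /\
  forall K, compact K -> K `<=` O -> exists N, forall k, (N <= k)%N ->
    exists2 W, open W & K `<=` W /\ forall x, W x -> eta k x = 1.
Proof.
move=> oO.
pose C (k : nat) := closed_ball (0 : V) k.+1%:R `&`
  ~` (\bigcup_(y in ~` O) ball y k.+1%:R^-1).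
have cC k : compact (C k).
  apply: bounded_closed_compact.
    exists k.+1%:R; split; first exact: num_real.
    move=> M hM x []; rewrite closed_ballE// /closed_ball_/= sub0r normrN => h _.
    exact: le_trans h (ltW hM).
  apply: closedI; first exact: closed_ball_closed.
  by rewrite closedC; apply: bigcup_open => y _; apply: ball_open; rewrite invr_gt0.
have CO k : C k `<=` O.
  move=> x [_ nx]; apply: contrapT => xO; apply: nx; exists x => //.
  by apply: ballxx; rewrite invr_gt0.
have /choice[eta Heta] k := cutoff (cC k) oO (CO k).
exists eta; split=> [k|K cK KO]; first by have [? ? _] := Heta k.
have [e e0 he] := near_compact cK oO KO.
have [N1 HN1] := invS_lt e0.
have [M [Mr HM]] := compact_bounded cK.
have [N2 HN2] : exists N2 : nat, `|M| + 1 <= N2%:R.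
  by exists (Num.bound (`|M| + 1)); rewrite ltW// archi_boundP// addr_ge0.
exists (maxn N1 N2) => k; rewrite geq_max => /andP[k1 k2].
have [_ _ [W oW [KW W1]]] := Heta k; exists W => //; split=> // x Kx; apply: KW.
split.
  rewrite closed_ballE// /closed_ball_/= sub0r normrN.
  apply: (@le_trans _ _ (`|M| + 1)).
    by apply: (HM (`|M| + 1)) => //; apply: le_lt_trans (ler_norm M) _; rewrite ltrDl.
  apply: le_trans HN2 _; rewrite ler_nat; exact: leq_trans k2 _.
move=> [y /= nOy yx]; apply: nOy; apply: (he x Kx).
apply: ball_sym; apply: le_ball yx; apply: ltW; exact: HN1.
Qed.

Lemma bounded_ball_rV (x : V) r : bounded_set (ball x r).
Proof.
exists (`|x| + `|r|); split; first exact: num_real.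
move=> M hM y; rewrite -ball_normE/= => xy.
have := ler_normB x (x - y); rewrite opprB addrC subrK.
have := ler_norm r; lra.
Qed.

Lemma integral_derive0 phi v : test_fun setT phi -> \int[leb]_x 'D_v phi x = 0.
Proof.
move=> tp; have [sp cp _] := tp; have [L L0 HL] := test_lipschitz v tp.
have [M [_ HM]] := compact_bounded cp.
(* This ball contains the supports of all translates [phi (x + s *: v)] with [|s| <= 1], hence of
   all the difference quotients. *)
pose B := ball (0 : V) (`|M| + 2 + `|v|); have mB : measurable B by exact: mx_ball_measurable.
have outB x s : `|s| <= 1 -> ~ B x -> phi (x + s *: v) = 0.
  move=> s1 nB; apply: tsupp_out => ps; apply: nB; rewrite /B -ball_normE/= sub0r normrN.
  have M1 : M < `|M| + 1 by apply: le_lt_trans (ler_norm M) _; rewrite ltrDl.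
  have /= h := HM _ M1 _ ps; rewrite -[x](addrK (s *: v)).
  apply: le_lt_trans (ler_normB _ _) _; rewrite normrZ.
  have : `|s| * `|v| <= `|v| by rewrite ler_piMl.
  by move: h; lra.
pose g : V -> R := \1_B.
have Bi : leb.-integrable setT (EFin \o g).
  apply: (@itg_bounded_supp _ _ _ _ g 1 B) => //.
  - by apply: lebesgue_rV_bounded => //; exact: bounded_ball_rV.
  - exact: measurable_indic.
  - by move=> x; rewrite /g indicE; case: (_ \in _); rewrite ?normr1 ?normr0.
  - by move=> x h; rewrite /g indicE memNset.
have dB k x : `|k.+1%:R * (phi (x + k.+1%:R^-1 *: v) - phi x)| <= L * g x.
  have k0 : 0 < k.+1%:R :> R by [].
  have k1 : k.+1%:R^-1 <= 1 :> R by rewrite invf_le1// ler1n.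
  have k2 : 0 <= k.+1%:R^-1 :> R by rewrite invr_ge0.
  rewrite /g indicE; have [xB|nB] := pselect (B x).
    rewrite mem_set// mulr1 normrM gtr0_norm// mulrC -ler_pdivlMr//.
    by have := HL x k.+1%:R^-1; rewrite [`|_^-1|]ger0_norm.
  rewrite memNset//; have := outB x 0; rewrite normr0 scale0r addr0 => ->//.
  rewrite outB//; first by rewrite subrr mulr0 normr0 mulr0.
  by rewrite ger0_norm.
apply: (@Rintegral_quotient0 _ V R leb (fun k x => x + k.+1%:R^-1 *: v) (fun k => k.+1%:R)
  phi _ (fun x => L * g x)) => [k|k A mA||||x].
- exact: mx_add_measurable.
- exact: lebesgue_rV_translate.
- exact: test_itg tp.
- exact: itgZ.
- exact: dB.
- exact/derive_seq/smooth_derivable.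
Qed.

Lemma integration_by_parts phi psi v : test_fun setT phi -> smooth psi ->
  \int[leb]_x (phi x * 'D_v psi x) = - \int[leb]_x ('D_v phi x * psi x).
Proof.
move=> tp sq; have tpq := test_mul tp sq.
have sp := test_smooth tp.
have i1 := test_itg (test_mul tp (smooth_derive v sq)).
have i2 := test_itg (test_mul (test_derive v tp) sq).
have := integral_derive0 v tpq.
have -> : (fun x => 'D_v (fun x => phi x * psi x) x) =
    (fun x => phi x * 'D_v psi x + 'D_v phi x * psi x).
  apply/funext => x; have := deriveM (@smooth_derivable _ _ phi x v sp) (@smooth_derivable _ _ psi x v sq).
  by rewrite /GRing.scale/= [psi x * _]mulrC.
by rewrite RintegralD// => /eqP; rewrite addr_eq0 => /eqP.
Qed.

(** The entries are continuous. With [mx_open_measurable] this identifies the entrywise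
    sigma-algebra with the Borel one, so that open sets form a generating pi-system. *)
Lemma mx_measurable_open p q (A : set 'M[R]_(p, q)) : measurable A -> <<s open >> A.
Proof.
apply: smallest_sub; first exact: smallest_sigma_algebra.
move=> _ [[i j] _ [B mB <-]].
pose T := g_sigma_algebraType (open : set (set 'M[R]_(p, q))).
have mf : measurable_fun [set: T] (fun M : T => (M : 'M[R]_(p, q)) i j).
  apply: (measurability _ (@measurable_realfun.RGenOpens.measurableE R)) => //.
  move=> _ [_ [a [b ->]] <-]; rewrite setTI; apply: sub_sigma_algebra.
  have := @coord_continuous R p q i j => /continuousP; apply; exact: interval_open.
by have := mf measurableT B mB; rewrite setTI.
Qed.

(** Dynkin's theorem: the sets over which [g] integrates to 0 form a Dynkin system that contains the
    open sets, so it contains all Borel sets. *)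
Lemma integral_open_eq0 g : leb.-integrable setT (EFin \o g) ->
  (forall U, open U -> \int[leb]_(x in U) g x = 0) -> ae_eq leb setT g (cst 0).
Proof.
move=> gi gU.
have gA (A : set V) : measurable A -> leb.-integrable A (EFin \o g).
  by move=> mA; apply: integrableS gi.
have hA (A : set V) : <<s open >> A -> measurable A /\ \int[leb]_(x in A) g x = 0.
  rewrite -(setI_closed_g_dynkin_g_sigma_algebra (@openI V)).
  suff H : <<d (open : set (set V)) >> `<=`
    [set A | measurable A /\ \int[leb]_(x in A) g x = 0] by exact: H.
  apply: smallest_sub; last by move=> U oU; split; [exact: mx_open_measurable|exact: gU].
  split.
  - by split=> //; exact: gU openT.
  - move=> B [mB B0]; split; first exact: measurableC.
    have := gU _ (@openT V); rewrite -(setUv B) Rintegral_setU ?B0 ?add0r//.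
    + exact: measurableC.
    + by rewrite setUv.
    + by apply/disj_set2P; rewrite setICr.
  - move=> F tF HF; have mF k : measurable (F k) := (HF k).1.
    split; first exact: bigcup_measurable.
    have fin k : \int[leb]_(x in \big[setU/set0]_(i < k) F i) g x = 0.
      elim: k => [|k IH]; first by rewrite big_ord0 Rintegral_set0.
      rewrite big_ord_recr/= Rintegral_setU//; first by rewrite IH (HF k).2 addr0.
      + exact: bigsetU_measurable.
      + by apply: gA; apply: measurableU => //; exact: bigsetU_measurable.
      + by apply/disj_set2P; rewrite (@trivIset_bigsetUI _ xpredT)// => i j _ _; exact: tF.
    have mP (B : set V) : measurable B -> measurable_fun setT (g \_ B).
      move=> mB; apply/measurable_restrict => //; rewrite setTI; exact: itg_meas (gA _ mB).
    have [|||||_] := @Rint_cvg _ _ _ leb setT measurableT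
      (fun k => g \_ (\big[setU/set0]_(i < k) F i)) (g \_ (\bigcup_k F k)) (fun x => `|g x|).
    + by move=> k; apply: mP; exact: bigsetU_measurable.
    + by apply: mP; exact: bigcup_measurable.
    + apply: aeW => x _; have [[i _ Fi]|nx] := pselect ((\bigcup_k F k) x).
        apply: cvg_near_cst; exists i.+1 => // k /= ik.
        rewrite !patchE !mem_set//; first by exists i.
        by rewrite -bigcup_mkord; exists i.
      rewrite patchE memNset//; apply: cvg_near_cst; exists 0%N => // k _.
      rewrite patchE memNset// -bigcup_mkord => -[i _ Fi]; apply: nx; by exists i.
    + by have := integrable_norm gi; apply: eq_integrable.
    + by apply: aeW => x k _; rewrite patchE; case: ifP => //; rewrite normr0.
    rewrite -Rintegral_mkcond; under eq_fun do rewrite -Rintegral_mkcond fin.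
    by move=> h; apply: (cvg_unique _ h (cvg_cst _)).
have := integral_ae_eq measurableT gi (@measurable_cst _ _ _ _ setT 0%E) _.
move=> /(_ _)/= H.
have {}H : ae_eq leb setT (EFin \o g) (cst 0%E).
  apply: H => E _ mE; rewrite integral0.
  have [_] := hA E (mx_measurable_open mE).
  by rewrite /Rintegral => e; rewrite -[LHS]fineK ?e//; exact: integrable_fin_num (gA _ mE).
by apply: filterS H => x /[apply] /= -[].
Qed.

(** Cut-offs exhausting [O] intersected with an open [U] turn the hypothesis into vanishing of the
    integral of [g] over that set, which brings the claim to [integral_open_eq0]. *)
Lemma du_bois_reymond O g : open O -> leb.-integrable O (EFin \o g) ->
  (forall psi, test_fun O psi -> \int[leb]_(x in O) (g x * psi x) = 0) ->
  ae_eq leb O g (cst 0).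
Proof.
move=> oO gi H; have mO := mx_open_measurable oO.
have gi' : leb.-integrable setT (EFin \o (g \_ O)).
  have /integrable_mkcond := gi => /(_ mO); congr (_.-integrable _ _).
  by apply/funext => x; rewrite /= !patchE; case: ifP.
have : ae_eq leb setT (g \_ O) (cst 0); last first.
  by apply: filterS => x /(_ I) /= e Ox; move: e; rewrite patchE mem_set.
apply: integral_open_eq0 => // U oU.
have [eta [Heta He]] := exhaustion (openI oO oU).
have mg := itg_meas gi'.
have [|||||_] := @Rint_cvg _ _ _ leb setT measurableT
  (fun k x => (g \_ O) x * eta k x) ((g \_ O) \_ U) (fun x => `|(g \_ O) x|).
- move=> k; apply: measurable_funM => //.
  by apply: smooth_meas; exact: test_smooth (Heta k).1.
- apply/measurable_restrict => //; first exact: mx_open_measurable.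
  by rewrite setTI; exact: measurable_funS mg.
- apply: aeW => x _; rewrite !patchE.
  have [xO|xO] := pselect (O x); last first.
    rewrite (memNset xO); under eq_fun do rewrite mul0r.
    by rewrite if_same; exact: cvg_cst.
  rewrite (mem_set xO); have [xU|xU] := pselect (U x).
    rewrite (mem_set xU); have [|N HN] := He _ (@compact_set1 _ x).
      by move=> _ ->.
    apply: cvg_near_cst; exists N => // k /= /HN[W _ [xW ->]]; rewrite ?mulr1//.
    exact: xW.
  rewrite (memNset xU); apply: cvg_near_cst; exists 0%N => // k _.
  rewrite (test_out (Heta k).1) ?mulr0// => -[_]; exact: xU.
- by have := integrable_norm gi'; apply: eq_integrable.
- apply: aeW => x k _; rewrite normrM ler_piMr//.
  by have /andP[? ?] := (Heta k).2 x; rewrite ger0_norm.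
rewrite -Rintegral_mkcond => h; apply: (cvg_unique _ h) => //.
rewrite (_ : (fun k => _) = cst 0); first exact: cvg_cst.
apply/funext => k; rewrite -[RHS](H (eta k)); last first.
  by apply: test_subset (Heta k).1 => x [].
rewrite [RHS]Rintegral_mkcond; apply: eq_Rintegral => x _.
by rewrite !patchE; case: ifP => //; rewrite mul0r.
Qed.

End rV_calculus.

(** * Density of test functions and mollification *)

Section riesz_subspace.
Variables (R : realType) (H : lmodType R) (ip : semi_ip H) (C : set H) (l : H -> R) (K : R).
Hypothesis C0 : C 0.
Hypothesis C_lin : forall a x y, C x -> C y -> C (a *: x + y).
Hypothesis l_lin : forall a x y, C x -> C y -> l (a *: x + y) = a * l x + l y.
Hypothesis l_bnd : forall x, C x -> l x <= K * snorm ip x.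

(* Minimise q x = |x|^2 - 2 l(x) over C; a minimising sequence is Cauchy by the
   parallelogram law, and its limit represents l. *)
Lemma riesz_subspace : exists c : nat -> H, [/\ forall k, C (c k), scauchy ip c &
  forall x, C x -> (fun k => ip (c k) x) @ \oo --> l x].
Proof.
pose q x := ip x x - 2 * l x.
have q_bnd x : C x -> - K ^+ 2 <= q x.
  move=> Cx; have := l_bnd Cx; rewrite /q -snorm_sqr; have := snorm_ge0 ip x.
  by move: (snorm ip x) => s s0 h; have := sqr_ge0 (s - K); nra.
pose E := [set q x | x in C].
have hE : has_inf E.
  split; first by exists (q 0), 0.
  by exists (- K ^+ 2) => _ [x Cx <-]; exact: q_bnd.
set m := inf E.
have mq x : C x -> m <= q x by move=> Cx; apply: ge_inf; [exact: hE.2|exists x].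
have /choice[c Hc] (k : nat) : exists x, C x /\ q x < m + k.+1%:R^-1.
  have [|_ [x Cx <-] h] := @inf_adherent _ E k.+1%:R^-1 _ hE; first by rewrite invr_gt0.
  by exists x.
have par x y : C x -> C y -> ip (x - y) (x - y) = 2 * q x + 2 * q y - 4 * q (2^-1 *: (x + y)).
  move=> Cx Cy; rewrite parallelogram /q.
  have -> : l (2^-1 *: (x + y)) = 2^-1 * (l x + l y).
    have Cxy : C (x + y) by rewrite -[x]scale1r; exact: C_lin.
    have l0 : l 0 = 0.
      by have := l_lin 1 C0 C0; rewrite scale1r addr0 mul1r; lra.
    rewrite -[2^-1 *: _]addr0 l_lin// l0 addr0; congr (_ * _).
    by rewrite -[x in LHS]scale1r l_lin// mul1r.
  by field.
exists c; split.
- by move=> k; exact: (Hc k).1.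
- move=> e e0; have [N HN] := @invS_lt R (e ^+ 2 / 4) (divr_gt0 (exprn_gt0 2 e0) (ltr0Sn _ 3)).
  exists N => i j /HN hi /HN hj; rewrite snorm_lt_sqr ?ltW//.
  have [Ci qi] := Hc i; have [Cj qj] := Hc j; rewrite par//.
  have : m <= q (2^-1 *: (c i + c j)).
    apply: mq; rewrite -[_ *: _]addr0; apply: C_lin => //.
    by rewrite -[c i]scale1r; exact: C_lin.
  move: (q (2^-1 *: _)) qi qj hi hj => z; move: (i.+1%:R^-1) (j.+1%:R^-1) (q (c i)) (q (c j)).
  move=> a b a' b'; lra.
- move=> x Cx; apply/cvgrPdist_lt => e e0.
  (* The extra 1 keeps the denominator positive when [x] has seminorm 0; [d / n] is then nearly the
     best multiple of [x] to add to [c k]. *)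
  pose n := ip x x + 1; have n1 : 0 < n by rewrite /n; have := ip_ge0 ip x; lra.
  have [N HN] := @invS_lt R (e ^+ 2 / n) (divr_gt0 (exprn_gt0 2 e0) n1).
  exists N => // k /= /HN hk; have [Ck qk] := Hc k.
  set d := l x - ip (c k) x.
  have key t : 0 <= k.+1%:R^-1 - 2 * t * d + t ^+ 2 * ip x x.
    have := mq _ (C_lin t Cx Ck); rewrite /q l_lin// !ipE (ipC ip x (c k)).
    move: qk; rewrite /q /d; move: (k.+1%:R^-1) (ip (c k) (c k)) (ip (c k) x) (l (c k)).
    move=> a b u w; nra.
  have := key (d / n); rewrite -(ltr_pXn2r (n := 2)) ?nnegrE ?(ltW e0)//.
  rewrite real_normK ?num_real// => h.
  have h2 : d ^+ 2 / n <= k.+1%:R^-1.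
    have e1 : 2 * (d / n) * d = 2 * (d ^+ 2 / n) by field; lra.
    have e2 : (d / n) ^+ 2 * ip x x = d ^+ 2 / n * (ip x x / n) by field; lra.
    have e3 : ip x x / n <= 1 by rewrite ler_pdivrMr// mul1r /n; lra.
    have e4 : 0 <= d ^+ 2 / n by rewrite divr_ge0 ?sqr_ge0// ltW.
    move: h; rewrite e1 e2; move: (d ^+ 2 / n) (ip x x / n) (k.+1%:R^-1) e3 e4 => s t a e3 e4.
    nra.
  have := le_lt_trans h2 hk.
  by rewrite ltr_pM2r ?invr_gt0.
Qed.
End riesz_subspace.

Section L2_density.
Variables (R : realType) (n : nat) (O : set 'rV[R]_n).
Local Notation leb := (lebesgue_rV R n).
Hypotheses (oO : open O) (fO : (leb O < +oo)%E).
Let mO : measurable O := mx_open_measurable oO.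

Lemma sqi_itg (f : 'rV[R]_n -> R) : sqi leb O f -> leb.-integrable O (EFin \o f).
Proof.
move=> hf; have h1 : sqi leb O (cst (1 : R)).
  by apply: (@sqi_bounded _ _ _ leb O mO _ 1) => //; apply: aeW => x _; rewrite normr1.
have := sqi_mul mO hf h1; apply: eq_integrable => // x _ /=.
by rewrite mulr1.
Qed.

Lemma test_sqi psi : test_fun O psi -> sqi leb O psi.
Proof.
move=> tp; have [M _ hM] := test_bounded tp.
apply: (@sqi_bounded _ _ _ leb O mO _ M) => //; last exact: aeW.
by apply: (measurable_funS measurableT) => //; exact: smooth_meas (test_smooth tp).
Qed.

Variables p q : nat.
Let H := L2sp leb mO p q.

Lemma test_dense (u : H) e : 0 < e -> exists psi : 'I_p -> 'I_q -> 'rV[R]_n -> R,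
  exists2 v : H, (forall i j, test_fun O (psi i j)) /\
    (forall x, v x = \matrix_(i, j) psi i j x) & snorm (L2_ip leb mO p q) (u - v) < e.
Proof.
move=> e0; pose ip := L2_ip leb mO p q.
pose C := [set v : H | exists psi : 'I_p -> 'I_q -> 'rV[R]_n -> R,
  (forall i j, test_fun O (psi i j)) /\ forall x, v x = \matrix_(i, j) psi i j x].
have [|||x _|c [Cc cc Hc]] := @riesz_subspace _ _ ip C (ip u) (snorm ip u).
- exists (fun _ _ _ => 0); split=> [i j|x]; first exact: test0.
  by apply/matrixP => i j; rewrite L2sp0 !mxE.
- move=> a x y [f [tf fE]] [g [tg gE]].
  exists (fun i j x => a * f i j x + g i j x); split=> [i j|z].
    by apply: testD => //; exact: testZ.
  by apply/matrixP => i j; rewrite L2spD L2spZ fE gE !mxE.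
- by move=> a x y _ _; rewrite !ipE.
- exact: ip_le_norm.
have [h ch] := L2_complete cc.
suff uh : snorm ip (u - h) = 0.
  have [N HN] := ch e e0; have := HN N (leqnn N) => {}HN.
  have [psi Hpsi] := Cc N; exists psi, (c N); first exact: Hpsi.
  apply: le_lt_trans (snormB_le ip _ h _) _.
  by rewrite -[X in _ + X]snormBC uh add0r.
have {Hc} Hc x : C x -> ip (u - h) x = 0.
  move=> Cx; rewrite ipBl; have := cvg_unique _ (Hc x Cx) (scvg_ip (y := x) ch).
  by move=> ->//; rewrite subrr.
apply: L2_snorm_ae.
have ae0 i j : ae_eq leb O (fun x => u x i j - h x i j) (cst 0).
  apply: du_bois_reymond => //.
    by apply: itgB => //; apply: sqi_itg; exact: L2spP.
  move=> psi tpsi.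
  pose P (k : 'I_p) (l : 'I_q) x : R := ((k == i) && (l == j))%:R * psi x.
  have tP k l : test_fun O (P k l) by apply: testZ.
  have hv : L2set leb O (fun x => \matrix_(k, l) P k l x).
    by move=> k l; under eq_fun do rewrite mxE; exact: test_sqi.
  have := Hc (toL2 mO hv) _; rewrite L2_ipE.
  have E x : frob ((u - h : H) x) (toL2 mO hv x) = (u x i j - h x i j) * psi x.
    rewrite /frob (bigD1 i)//= (bigD1 j)//= big1 => [|l lj]; last first.
      by rewrite mxE /P (negbTE lj) andbF mul0r mulr0.
    rewrite big1 => [|k ki]; last first.
      by apply: big1 => l _; rewrite mxE /P (negbTE ki) mul0r mulr0.
    transitivity ((u x - h x) i j * (\matrix_(k, l) P k l x) i j); first by rewrite !addr0.
    by rewrite !mxE /P !eqxx mul1r.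
  under eq_Rintegral do rewrite E; apply.
  by exists P; split.
have : {ae leb, forall x, forall i j, O x -> u x i j - h x i j = 0}.
  by apply: filter_forall => i; apply: filter_forall => j; exact: ae0.
apply: filterS => x hx Ox; apply/matrixP => i j; apply/eqP.
by rewrite -subr_eq0 hx.
Qed.

End L2_density.

(** * Mollification and translation in L2 *)

Section mollification.
Variables (R : realType) (n : nat).
Local Notation V := 'rV[R]_n.
Local Notation leb := (lebesgue_rV R n).
Implicit Types (phi psi g : V -> R).

Lemma sqr_sub_cvg0 (u : nat -> R) l : u @ \oo --> l ->
  (fun k => (u k - l) ^+ 2) @ \oo --> (0 : R).
Proof.
move=> ul; have h : (fun k => u k - l) @ \oo --> (0 : R).
  by rewrite -(subrr l); apply: cvgB => //; exact: cvg_cst.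
have := cvgM h h; rewrite mulr0 => H.
suff -> : (fun k => (u k - l) ^+ 2) = (fun k => u k - l) \* (fun k => u k - l) by exact: H.
by apply/funext => k; rewrite /= expr2.
Qed.

Lemma conv_moll_meas r g : 0 < r -> leb.-integrable setT (EFin \o g) ->
  measurable_fun setT (conv (moll r) g).
Proof. by move=> r0 gi; apply: smooth_meas; apply: conv_smooth => //; exact: moll_test. Qed.

(** Jensen's inequality for the probability density [moll r (y - x)], read off from the
    nonnegativity of the integral of [moll r (y - x) * (g y - c) ^+ 2] with [c] the mean. *)
Lemma conv_moll_jensen r g x : 0 < r -> leb.-integrable setT (EFin \o g) -> sqi leb setT g ->
  leb.-integrable setT (EFin \o (fun y => moll r (y - x) * g y ^+ 2)) /\
  conv (moll r) g x ^+ 2 <= \int[leb]_y (moll r (y - x) * g y ^+ 2).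
Proof.
move=> r0 gi [mg g2]; have i2 := conv_moll_itg x r0 g2; have i1 := conv_moll_itg x r0 gi.
have i0 := moll_shift_itg x r0; split=> //.
set c := conv (moll r) g x.
have i1c := itgZ measurableT (2 * c) i1; have i0c := itgZ measurableT (c ^+ 2) i0.
have : 0 <= \int[leb]_y (moll r (y - x) * (g y - c) ^+ 2).
  by apply: Rintegral_ge0 => y _; rewrite mulr_ge0 ?sqr_ge0// moll_ge0.
have -> : (fun y => moll r (y - x) * (g y - c) ^+ 2) = (fun y =>
    moll r (y - x) * g y ^+ 2 - 2 * c * (moll r (y - x) * g y) + c ^+ 2 * moll r (y - x)).
  by apply/funext => y; ring.
rewrite RintegralD//; last exact: (itgB measurableT i2 i1c).
rewrite RintegralB// [X in _ - X]RintegralZl// [X in _ + X]RintegralZl// moll_int//.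
have -> : \int[leb]_y (moll r (y - x) * g y) = c by [].
nra.
Qed.

(** Integrate Jensen's inequality and exchange the integrals; the kernel is even, so it has integral
    1 in the variable [x] as well. *)
Lemma conv_moll_contract r g : 0 < r -> leb.-integrable setT (EFin \o g) -> sqi leb setT g ->
  sqi leb setT (conv (moll r) g) /\
  \int[leb]_x (conv (moll r) g x ^+ 2) <= \int[leb]_x (g x ^+ 2).
Proof.
move=> r0 gi hg; have [mg g2] := hg; have mc := conv_moll_meas r0 gi.
pose f (xy : V * V) : \bar R := (moll r (xy.2 - xy.1) * g xy.2 ^+ 2)%:E.
have mm : measurable_fun setT (moll r : V -> R) by apply: smooth_meas; exact: test_smooth (moll_test n r0).
have f0 xy : (0 <= f xy)%E by rewrite lee_fin mulr_ge0 ?sqr_ge0// moll_ge0.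
have mf : measurable_fun setT f.
  apply/measurable_EFinP; apply: measurable_funM.
    apply: (measurableT_comp (f := moll r) (g := fun xy : V * V => xy.2 - xy.1)); first exact: mm.
    apply: (measurableT_comp (@mx_sub_measurable R 1 n) (g := fun xy : V * V => (xy.2, xy.1))).
    by apply: measurable_fun_pair; [exact: measurable_snd|exact: measurable_fst].
  apply: measurable_funX; exact: (measurableT_comp mg measurable_snd).
have le1 : (\int[leb]_x ((conv (moll r) g x ^+ 2)%:E) <= \int[leb]_x (g x ^+ 2)%:E)%E.
  apply: (@le_trans _ _ (\int[leb]_x \int[leb]_y f (x, y))%E).
    apply: ge0_le_integral => //.
    - by move=> x _; rewrite lee_fin sqr_ge0.
    - by apply/measurable_EFinP; exact: measurable_funX.
    - exact: measurable_fun_fubini_tonelli_F.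
    - move=> x _; have [i2 le2] := conv_moll_jensen x r0 gi hg.
      by rewrite /f /= Rint_fin.
  rewrite (fubini_tonelli (m1 := leb) (m2 := leb) f mf f0).
  rewrite le_eqVlt; apply/orP; left; apply/eqP; apply: eq_integral => y _.
  rewrite /f /=; under eq_integral do rewrite mulrC -mollN opprB EFinM.
  rewrite ge0_integralZl//.
  - rewrite Rint_fin//; last exact: moll_shift_itg.
    by rewrite moll_int// mule1.
  - apply/measurable_EFinP; exact: itg_meas (moll_shift_itg y r0).
  - by move=> x _; rewrite lee_fin moll_ge0.
  - by rewrite lee_fin sqr_ge0.
have ci : leb.-integrable setT (EFin \o (fun x => conv (moll r) g x ^+ 2)).
  apply/integrableP; split; first by apply/measurable_EFinP; exact: measurable_funX.
  under eq_integral do rewrite gee0_abs ?lee_fin ?sqr_ge0//.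
  by apply: le_lt_trans le1 _; rewrite Rint_fin// ltry.
split; first by split.
by move: le1; rewrite !Rint_fin.
Qed.

Lemma conv_moll_sub r f g x : 0 < r -> leb.-integrable setT (EFin \o f) ->
  leb.-integrable setT (EFin \o g) ->
  conv (moll r) (fun y => f y - g y) x = conv (moll r) f x - conv (moll r) g x.
Proof.
move=> r0 fi gi; rewrite /conv -RintegralB//; try exact: conv_moll_itg.
by apply: eq_Rintegral => y _; rewrite mulrBr.
Qed.

Lemma moll_cvg psi x : continuous psi -> leb.-integrable setT (EFin \o psi) ->
  (fun k => conv (moll k.+1%:R^-1) psi x) @ \oo --> psi x.
Proof.
move=> cp pi.
apply/cvgrPdist_le => e e0.
have := cp x; move=> /cvgrPdist_le/(_ _ e0).
move=> /nbhs_ballP[d /= d0 hd]; have [N HN] := invS_lt d0.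
exists N => // k /= /HN kd; have k0 : 0 < k.+1%:R^-1 :> R by rewrite invr_gt0.
have i0 := moll_shift_itg x k0; have i1 := conv_moll_itg x k0 pi.
have ic := itgZ measurableT (psi x) i0.
have {1}-> : psi x = \int[leb]_y (psi x * moll k.+1%:R^-1 (y - x)).
  by rewrite RintegralZl// moll_int// mulr1.
rewrite /conv -RintegralB//.
apply: le_trans (le_normr_Rintegral _ _) _ => //; first exact: (itgB measurableT ic i1).
have ie := itgZ measurableT e i0.
have -> : e = \int[leb]_y (e * moll k.+1%:R^-1 (y - x)).
  by rewrite RintegralZl// moll_int// mulr1.
apply: Rint_le => //.
  by have := integrable_norm (itgB measurableT ic i1); apply: eq_integrable.
move=> y _; rewrite -[psi x * _]mulrC -mulrBr normrM mulrC [`|moll _ _|]ger0_norm ?moll_ge0//.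
have [->|h] := eqVneq (moll k.+1%:R^-1 (y - x)) 0; first by rewrite !mulr0.
rewrite ler_wpM2r ?moll_ge0//; apply: hd.
by rewrite -ball_normE/= distrC; apply: lt_trans (moll_neq0 k0 h) _.
Qed.

Lemma sqi_ball_bounded (f : V -> R) M r : measurable_fun setT f -> (forall x, `|f x| <= M) ->
  (forall x, ~ ball 0 r x -> f x = 0) -> leb.-integrable setT (EFin \o f).
Proof.
move=> mf fM fB; apply: (itg_bounded_supp (mx_ball_measurable (0 : V) r) _ mf fM fB).
by apply: lebesgue_rV_bounded; [exact: mx_ball_measurable|exact: bounded_ball_rV].
Qed.

Lemma test_sqiT O psi : test_fun O psi -> sqi leb setT psi.
Proof.
move=> tp; split; first exact: smooth_meas (test_smooth tp).
by have := test_itg (test_mul tp (test_smooth tp)); under eq_fun do rewrite -expr2.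
Qed.

Lemma test_in_ball psi : test_fun setT psi -> exists2 r, 0 < r & forall x, ~ ball 0 r x -> psi x = 0.
Proof.
move=> [_ cp _]; have [M [Mr HM]] := compact_bounded cp.
exists (`|M| + 2); first by have := normr_ge0 M; lra.
move=> x nx; apply: tsupp_out => px; apply: nx; rewrite -ball_normE/= sub0r normrN.
have M1 : M < `|M| + 1 by apply: le_lt_trans (ler_norm M) _; rewrite ltrDl.
by have := HM _ M1 x px; rewrite /=; lra.
Qed.

Lemma moll_cvg_L2_test psi : test_fun setT psi ->
  (fun k => \int[leb]_x ((conv (moll k.+1%:R^-1) psi x - psi x) ^+ 2)) @ \oo --> (0 : R).
Proof.
move=> tp; have pi := test_itg tp; have [r r0 hr] := test_in_ball tp.
have [M M0 hM] := test_bounded tp; have mp := smooth_meas (test_smooth tp).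
(* The mollification radii are at most 1, so all mollified functions vanish off this ball, and a
   multiple of its indicator dominates. *)
pose B := ball (0 : V) (r + 1).
have k0 k : 0 < k.+1%:R^-1 :> R by rewrite invr_gt0.
have out k x : ~ B x -> conv (moll k.+1%:R^-1) psi x = 0.
  move=> nB; apply: conv_moll_eq => // y yx; apply: hr => yB; apply: nB.
  apply: ball_triangle yB _; rewrite -ball_normE/=; apply: lt_le_trans yx _.
  by rewrite invf_le1// ler1n.
have [|||||_] := @Rint_cvg _ _ _ leb setT measurableT
  (fun k x => (conv (moll k.+1%:R^-1) psi x - psi x) ^+ 2) (cst 0)
  (fun x => (2 * M) ^+ 2 * \1_B x).
- move=> k; apply: measurable_funX; apply: measurable_funB => //.
  exact: conv_moll_meas.
- exact: measurable_cst.
- by apply: aeW => x _; apply: sqr_sub_cvg0; apply: moll_cvg => //; exact: smooth_continuous (test_smooth tp).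
- apply: (@sqi_ball_bounded _ ((2 * M) ^+ 2) (r + 1)).
  + apply: measurable_funM => //; apply: measurable_indic; exact: mx_ball_measurable.
  + move=> x; rewrite normrM ger0_norm ?sqr_ge0// ler_piMr ?sqr_ge0// indicE.
    by case: (_ \in _); rewrite ?normr1 ?normr0.
  + by move=> x nB; rewrite indicE memNset ?mulr0.
- apply: aeW => x k _; rewrite ger0_norm ?sqr_ge0//.
  have [xB|xB] := pselect (B x); last first.
    rewrite out// hr ?subr0 ?expr0n ?mulr_ge0 ?sqr_ge0// => xr; apply: xB.
    by apply: le_ball xr; rewrite lerDl.
  rewrite indicE mem_set// mulr1 -[X in X <= _](real_normK (num_real _)) ler_pXn2r ?nnegrE ?mulr_ge0//.
  apply: le_trans (ler_normB _ _) _; rewrite mulrDl mul1r lerD// ler_norml.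
  rewrite conv_moll_le ?andbT//; last by move=> y; apply: le_trans (ler_norm _) _.
  rewrite lerNl (_ : - conv _ _ _ = conv (moll k.+1%:R^-1) (fun y => 0 - psi y) x).
    apply: conv_moll_le => //.
      by apply: itgB => //; exact: integrable0.
    by move=> y; rewrite sub0r; apply: le_trans (ler_norm _) _; rewrite normrN.
  rewrite (conv_moll_sub x (k0 k) (integrable0 _ _) pi) (_ : conv _ (fun _ => 0) x = 0) ?sub0r//.
  exact: conv_moll_eq.
by rewrite Rintegral_cst// mul0r.
Qed.

(* Density of test functions upgrades L2-convergence from test functions to all
   of L2 for uniformly bounded linear T_k. *)
Lemma L2_cvg_of_dense (T : nat -> (V -> R) -> V -> R) (D : set (V -> R)) g :
  (forall k f h x, D f -> D h -> T k (fun y => f y - h y) x = T k f x - T k h x) ->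
  (forall f h, D f -> D h -> D (fun y => f y - h y)) ->
  (forall f, D f -> sqi leb setT f) ->
  (forall k f, D f -> sqi leb setT (T k f) /\
    \int[leb]_x (T k f x ^+ 2) <= \int[leb]_x (f x ^+ 2)) ->
  D g ->
  (forall e, 0 < e -> exists psi, [/\ D psi, \int[leb]_x ((g x - psi x) ^+ 2) < e &
     (fun k => \int[leb]_x ((T k psi x - psi x) ^+ 2)) @ \oo --> (0 : R)]) ->
  (fun k => \int[leb]_x ((T k g x - g x) ^+ 2)) @ \oo --> (0 : R).
Proof.
move=> TB DB D2 Tc Dg dense; apply/cvgrPdist_lt => e e0.
(* The tolerance is [e / 9]: three terms, each with the factor 3 of
   [(a + b + c)^2 <= 3 (a^2 + b^2 + c^2)]. *)
have [psi [Dp gp /cvgrPdist_lt/(_ _ (divr_gt0 e0 (ltr0Sn _ 8)))[N _ HN]]] :=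
  dense _ (divr_gt0 e0 (ltr0Sn R 8)).
exists N => // k /= /HN /=; rewrite !sub0r !normrN.
have I0 f : 0 <= \int[leb]_x (f x ^+ 2) by apply: Rintegral_ge0 => x _; rewrite sqr_ge0.
rewrite !ger0_norm// => kp.
have Dd := DB _ _ Dg Dp; have [s1 c1] := Tc k _ Dd.
have s2 : sqi leb setT (fun x => T k psi x - psi x).
  by have := sqiB measurableT (Tc k _ Dp).1 (D2 _ Dp).
have s3 := D2 _ Dd.
have sg : sqi leb setT (fun x => T k g x - g x).
  by have := sqiB measurableT (Tc k _ Dg).1 (D2 _ Dg).
have : \int[leb]_x ((T k g x - g x) ^+ 2) <= \int[leb]_x
   (3 * (T k (fun y => g y - psi y) x ^+ 2) + 3 * (T k psi x - psi x) ^+ 2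
    + 3 * (g x - psi x) ^+ 2).
  apply: Rint_le => //; first exact: sg.2.
    by apply: itgD => //; [apply: itgD => //|]; apply: itgZ => //;
      [exact: s1.2|exact: s2.2|exact: s3.2].
  move=> x _; rewrite (TB k _ _ x Dg Dp).
  by move: (T k g x) (T k psi x) (g x) (psi x) => a b c d; have := sqr_ge0 (a - b - (b - d));
    have := sqr_ge0 (a - b + (c - d)); have := sqr_ge0 (b - d + (c - d)); nra.
have i1 := itgZ measurableT 3 s1.2; have i2 := itgZ measurableT 3 s2.2.
have i3 := itgZ measurableT 3 s3.2.
rewrite RintegralD//; last exact: (itgD measurableT i1 i2).
rewrite RintegralD// !RintegralZl//; [|exact: s3.2|exact: s2.2|exact: s1.2].
move: c1 kp gp; move: (\int[leb]_x (T k g x - g x) ^+ 2).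
move: (\int[leb]_x T k (fun y => g y - psi y) x ^+ 2) => a.
move: (\int[leb]_x (T k psi x - psi x) ^+ 2) (\int[leb]_x (g x - psi x) ^+ 2) => b c d.
lra.
Qed.

Lemma ext_dense (O : set V) g e : open O -> (leb O < +oo)%E -> sqi leb setT g ->
  (forall x, ~ O x -> g x = 0) -> 0 < e ->
  exists2 psi, test_fun O psi & \int[leb]_x ((g x - psi x) ^+ 2) < e.
Proof.
move=> oO fO [mg g2] gO e0; have mO := mx_open_measurable oO.
have hg : L2set leb O (fun x => \matrix_(i < 1, j < 1) g x).
  move=> i j; under eq_fun do rewrite mxE; split; first exact: measurable_funS mg.
  exact: integrableS g2.
have [|psi [v [tp vE] uv]] := @test_dense R n O oO fO 1 1 (toL2 (mx_open_measurable oO) hg) (Num.sqrt e).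
  by rewrite sqrtr_gt0.
exists (psi 0 0) => //.
have : snorm (L2_ip leb (mx_open_measurable oO) 1 1) (toL2 (mx_open_measurable oO) hg - v) ^+ 2 < e.
  by rewrite -[X in _ < X](sqr_sqrtr (ltW e0)) ltr_pXn2r ?nnegrE ?snorm_ge0 ?sqrtr_ge0.
rewrite snorm_sqr L2_ipE; congr (_ < _); rewrite Rintegral_mkcond.
apply: eq_Rintegral => x _; rewrite patchE; case: ifPn => [xO|].
  rewrite /frob !big_ord1 -expr2; congr (_ ^+ 2).
  rewrite -[LHS]/(((\matrix_(i < 1, j < 1) g x) - v x) 0 0) vE !mxE//.
rewrite notin_setE => xO; rewrite gO// (test_out (tp 0 0))// subrr expr0n//.
Qed.

Lemma moll_cvg_L2 (O : set V) g : open O -> (leb O < +oo)%E -> sqi leb setT g ->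
  (forall x, ~ O x -> g x = 0) -> leb.-integrable setT (EFin \o g) ->
  (fun k => \int[leb]_x ((conv (moll k.+1%:R^-1) g x - g x) ^+ 2)) @ \oo --> (0 : R).
Proof.
move=> oO fO hg gO gi; have k0 k : 0 < k.+1%:R^-1 :> R by rewrite invr_gt0.
apply: (@L2_cvg_of_dense (fun k => conv (moll k.+1%:R^-1))
  [set f | sqi leb setT f /\ leb.-integrable setT (EFin \o f)]) => //.
- by move=> k f h x [_ fi] [_ hi]; exact: conv_moll_sub.
- by move=> f h [f2 fi] [h2 hi]; split; [exact: sqiB|exact: itgB].
- by move=> f [].
- by move=> k f [f2 fi]; exact: conv_moll_contract.
- move=> e e0; have [psi tp hp] := ext_dense oO fO hg gO e0.
  have tp' := test_subset (@subsetT _ O) tp.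
  exists psi; split => //; last exact: moll_cvg_L2_test.
  by split; [exact: test_sqiT tp|exact: test_itg tp].
Qed.

Lemma translate_cvg_L2 (O : set V) g (h : nat -> V) : open O -> (leb O < +oo)%E ->
  sqi leb setT g -> (forall x, ~ O x -> g x = 0) -> h @ \oo --> (0 : V) ->
  (fun k => \int[leb]_x ((g (x + h k) - g x) ^+ 2)) @ \oo --> (0 : R).
Proof.
move=> oO fO hg gO h0.
apply: (@L2_cvg_of_dense (fun k f x => f (x + h k)) (sqi leb setT)) => //.
- by move=> f k; exact: sqiB.
- move=> k f f2; split; first exact: sqi_translate.
  by rewrite (Rintegral_translate (h k) (f := fun x => f x ^+ 2))//; exact: f2.2.
move=> e e0; have [psi tp hp] := ext_dense oO fO hg gO e0.
exists psi; split => //; first exact: test_sqiT tp.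
have tpT := test_subset (@subsetT _ O) tp.
have [r r0 hr] := test_in_ball tpT; have [M M0 hM] := test_bounded tp.
have [N HN] : exists N, forall k, (N <= k)%N -> `|h k| < 1.
  have /cvgrPdist_lt/(_ _ ltr01)[N _ HN] := h0; exists N => k /HN /=.
  by rewrite sub0r normrN.
rewrite -(cvg_shiftn N).
pose B := ball (0 : V) (r + 1).
have mp := smooth_meas (test_smooth tp).
have [|||||_] := @Rint_cvg _ _ _ leb setT measurableT
  (fun k x => (psi (x + h (k + N)%N) - psi x) ^+ 2) (cst 0)
  (fun x => (2 * M) ^+ 2 * \1_B x).
- move=> k; apply: measurable_funX; apply: measurable_funB => //.
  by apply: (measurableT_comp mp); exact: mx_add_measurable.
- exact: measurable_cst.
- apply: aeW => x _; apply: sqr_sub_cvg0.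
  apply: (@cvg_comp _ _ _ (fun k => x + h (k + N)%N) psi _ (nbhs x)).
    have : (fun k => x + h (k + N)%N) @ \oo --> x + 0.
      by apply: cvgD; [exact: cvg_cst|rewrite (cvg_shiftn N)].
    by rewrite addr0.
  exact: (smooth_continuous (test_smooth tp)).
- apply: (@sqi_ball_bounded _ ((2 * M) ^+ 2) (r + 1)).
  + apply: measurable_funM => //; apply: measurable_indic; exact: mx_ball_measurable.
  + move=> x; rewrite normrM ger0_norm ?sqr_ge0// ler_piMr ?sqr_ge0// indicE.
    by case: (_ \in _); rewrite ?normr1 ?normr0.
  + by move=> x nB; rewrite indicE memNset ?mulr0.
- apply: aeW => x k _; rewrite ger0_norm ?sqr_ge0//.
  have [xB|xB] := pselect (B x); last first.
    rewrite !hr ?subr0 ?expr0n ?mulr_ge0 ?sqr_ge0// => xr; apply: xB.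
      by apply: le_ball xr; rewrite lerDl.
    rewrite /B; apply: (ball_triangle xr); rewrite -ball_normE/= addrAC subrr add0r.
    by apply: HN; exact: leq_addl.
  rewrite indicE mem_set// mulr1 -[X in X <= _](real_normK (num_real _)) ler_pXn2r ?nnegrE ?mulr_ge0//.
  by apply: le_trans (ler_normB _ _) _; rewrite mulrDl mul1r lerD.
by rewrite Rintegral_cst// mul0r.
Qed.

End mollification.

(** * Riesz representation of bounded distributions *)

Lemma max_subN (R : realType) (a : R) : Num.max a 0 - Num.max (- a) 0 = a.
Proof. by case: (lerP a 0) => h1; case: (lerP (- a) 0) => h2; lra. Qed.

Lemma finite_measure_of (d : measure_display) (T : measurableType d) (R : realType)
    (m : set T -> \bar R) : m set0 = 0%E -> (forall A, 0 <= m A)%E ->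
  semi_sigma_additive m -> fin_num_fun m ->
  exists nu : {finite_measure set T -> \bar R}, forall A, nu A = m A.
Proof.
move=> m0 m_ge0 m_add m_fin.
pose m1 : {measure set T -> \bar R} := HB.pack m (isMeasure.Build _ _ _ m m0 m_ge0 m_add).
have m1_fin : fin_num_fun m1 by [].
pose m2 : {finite_measure set T -> \bar R} := HB.pack (Measure.sort m1)
  (Measure_isFinite.Build _ _ _ m1 m1_fin).
by exists m2.
Qed.

Section density_measure.
Variables (d : measure_display) (T : measurableType d) (R : realType).
Variables (nu : {finite_measure set T -> \bar R}) (h : T -> R).
Hypotheses (h_ge0 : forall x, 0 <= h x) (h_itg : nu.-integrable setT (EFin \o h)).

(** The indefinite integral of [h] is a finite measure. Its Radon-Nikodym derivative equals [h]
    almost everywhere, which transfers the change of variables formula to [h]. *)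
Lemma density_measure : exists m : {finite_measure set T -> \bar R},
  forall f : T -> R, measurable_fun setT f -> (forall x, 0 <= f x) ->
    (\int[m]_x (f x)%:E = \int[nu]_x (f x * h x)%:E)%E.
Proof.
pose m0 (A : set T) := (\int[nu]_(x in A) (h x)%:E)%E.
have mh : measurable_fun setT (EFin \o h) := measurable_int nu h_itg.
have m00 : m0 set0 = 0%E by rewrite /m0 integral_set0.
have m0_ge0 A : (0 <= m0 A)%E by apply: integral_ge0 => x _; rewrite lee_fin.
have m0_add : semi_sigma_additive m0.
  move=> F mF tF mUF; rewrite /m0 ge0_integral_bigcup//.
  - by apply: is_cvg_nneseries => i _ _; exact: m0_ge0.
  - exact: measurable_funS mh.
  - by move=> x _; rewrite lee_fin.
have m0_fin : fin_num_fun m0.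
  by move=> A mA; apply: integrable_fin_num => //; exact: integrableS h_itg.
have [m mE] := finite_measure_of m00 m0_ge0 m0_add m0_fin.
exists m => f mf f0.
have dom : m `<< nu.
  apply/null_content_dominatesP => A mA A0; rewrite mE /m0.
  by apply: null_set_integral => //; exact: measurable_funS mh.
rewrite -(Radon_Nikodym_SigmaFinite.change_of_variables dom)//; last first.
  exact/measurable_EFinP.
have gi := Radon_Nikodym_SigmaFinite.f_integrable dom.
have gh : ae_eq nu setT (Radon_Nikodym_SigmaFinite.f m nu) (EFin \o h).
  apply: integral_ae_eq => // B _ mB.
  by rewrite -(Radon_Nikodym_SigmaFinite.f_integral dom)// mE.
apply: ae_eq_integral => //.
- apply: emeasurable_funM; first exact/measurable_EFinP.
  exact: measurable_int gi.
- apply/measurable_EFinP; apply: measurable_funM => //; exact/measurable_EFinP.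
- by apply: filterS gh => x /(_ I) /= -> _.
Qed.

End density_measure.

Section slabs.
Variable R : realType.

(** Only the integer part of [t] and its successor can be at distance less than 1 from [t]. This
    bounds the overlap of the slabs in [variation_bound]. *)
Lemma slab_count (n : nat) (t : R) : 0 <= t ->
  \sum_(k < n) ((`|k%:R - t| < 1)%R)%:R <= 2 :> R.
Proof.
move=> t0; pose j := Num.truncn t.
have /andP[jt tj] : j%:R <= t < j.+1%:R by exact: truncn_itv.
have H (i : nat) : \sum_(k < n) (k == i :> nat)%:R <= 1 :> R.
  have [ni|ni] := leqP n i.
    rewrite big1 ?ler01// => k _; case: eqP => // ki.
    by have := ltn_ord k; rewrite ki ltnNge ni.
  rewrite (bigD1 (Ordinal ni))//= eqxx big1 ?addr0// => k /negbTE.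
  by rewrite -val_eqE /= => ->.
rewrite (_ : 2 = 1 + 1); last by [].
apply: le_trans (lerD (H j) (H j.+1)); rewrite -big_split/=.
apply: ler_sum => k _; rewrite -natrD ler_nat; case: ltP => // kt.
rewrite ltr_norml in kt; move/andP: kt => [k1 k2].
have jk : (j <= k)%N.
  by rewrite -ltnS -(ltr_nat R); rewrite -[k.+1%:R]natr1; lra.
have kj : (k < j.+2)%N.
  by rewrite -(ltr_nat R) -[j.+2%:R]natr1; lra.
have [//|kj'] := eqVneq (k : nat) j.
by have -> : (k : nat) == j.+1 by rewrite eqn_leq -ltnS kj ltn_neqAle eq_sym kj'.
Qed.

End slabs.

(** * The total variation of a bounded distribution *)

Section variation.
Variables (R : realType) (n : nat) (O : set 'rV[R]_n).
Local Notation V := 'rV[R]_n.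
Hypothesis oO : open O.
Variables (T : (V -> R) -> R) (C : R).
Hypothesis T_lin : forall a phi psi, test_fun O phi -> test_fun O psi ->
  T (fun x => a * phi x + psi x) = a * T phi + T psi.
Hypothesis T_bnd : forall phi, test_fun O phi -> (forall x, `|phi x| <= 1) -> T phi <= C.

Let T0 : T (fun=> 0) = 0.
Proof.
have := T_lin 1 (test0 O) (test0 O).
rewrite (_ : (fun x => _) = fun=> 0); first lra.
by apply/funext => x; rewrite mulr0 addr0.
Qed.

Let TZ a phi : test_fun O phi -> T (fun x => a * phi x) = a * T phi.
Proof.
move=> tp; have := T_lin a tp (test0 O); rewrite T0 addr0 => <-.
by congr T; apply/funext => x; rewrite addr0.
Qed.

Let TD phi psi : test_fun O phi -> test_fun O psi ->
  T (fun x => phi x + psi x) = T phi + T psi.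
Proof.
move=> tp tq; have := T_lin 1 tp tq; rewrite mul1r => <-.
by congr T; apply/funext => x; rewrite mul1r.
Qed.

Definition unit_tests (U : set V) : set (V -> R) :=
  [set phi | test_fun (O `&` U) phi /\ forall x, `|phi x| <= 1].

Definition variation (U : set V) : R := sup [set T phi | phi in unit_tests U].

Let tO U phi : test_fun (O `&` U) phi -> test_fun O phi.
Proof. by apply: test_subset => x []. Qed.

Let has_sup_var U : has_sup [set T phi | phi in unit_tests U].
Proof.
split; first by exists (T (fun=> 0)), (fun=> 0) => //; split;
  [exact: test0|move=> x; rewrite normr0].
by exists C => _ [phi [tp p1] <-]; apply: T_bnd => //; exact: tO tp.
Qed.

Lemma variation_ge U phi : unit_tests U phi -> T phi <= variation U.
Proof. by move=> h; apply: sup_upper_bound => //; exists phi. Qed.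

Lemma variation_le U c : (forall phi, unit_tests U phi -> T phi <= c) -> variation U <= c.
Proof.
move=> h; apply: sup_le_ub; first exact: (has_sup_var U).1.
by move=> _ [phi hp <-]; exact: h.
Qed.

Lemma variation_ge0 U : 0 <= variation U.
Proof.
by rewrite -T0; apply: variation_ge; split; [exact: test0|move=> x; rewrite normr0].
Qed.

Lemma variation_mono U W : U `<=` W -> variation U <= variation W.
Proof.
move=> UW; apply: variation_le => phi [tp p1]; apply: variation_ge; split => //.
by apply: test_subset tp => x [? /UW].
Qed.

Lemma variation_scale U c phi : test_fun (O `&` U) phi -> 0 <= c ->
  (forall x, `|phi x| <= c) -> T phi <= c * variation U.
Proof.
move=> tp c0 pc; have [c00|cn0] := eqVneq c 0.
  rewrite c00 in pc *; rewrite mul0r (_ : phi = fun=> 0) ?T0//; apply/funext => x; apply/eqP.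
  by rewrite -normr_eq0 eq_le normr_ge0 pc.
have c1 : 0 < c by rewrite lt0r cn0.
have -> : phi = fun x => c * (c^-1 * phi x).
  by apply/funext => x; rewrite mulrA divff// mul1r.
rewrite TZ; last by apply: testZ; exact: tO tp.
rewrite ler_pM2l//; apply: variation_ge; split; first exact: testZ.
by move=> x; rewrite normrM gtr0_norm ?invr_gt0// mulrC ler_pdivrMr// mul1r.
Qed.

(** Peels off one open set at a time with [test_split]. The weights [c k] let the bound on [phi]
    differ from set to set, as the level slabs in [variation_bound] require. *)
Lemma variation_sum (U : nat -> set V) (c : nat -> R) N phi :
  (forall k, open (U k)) -> (forall k, 0 <= c k) ->
  test_fun (O `&` (\bigcup_(k in `I_N) U k)) phi ->
  (forall k x, (k < N)%N -> U k x -> `|phi x| <= c k) ->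
  T phi <= \sum_(k < N) c k * variation (U k).
Proof.
move=> oU c0; elim: N phi => [|N IH] phi tp pc.
  rewrite big_ord0 (_ : phi = fun=> 0) ?T0//; apply/funext => x.
  by apply: (test_out tp) => -[_ []].
have oB : open (\bigcup_(k in `I_N) U k) by apply: bigcup_open => k _; exact: oU.
have [_ _ sp] := tp.
have [|eta [se e01 t1 t2]] := test_split oO oB (oU N) (tO tp).
  move=> x /sp[_ [k /= kN Ux]]; move: kN; rewrite ltnS leq_eqVlt => /predU1P[kN|kN].
    by right; rewrite -kN.
  by left; exists k.
rewrite (_ : phi = fun x => phi x * eta x + phi x * (1 - eta x)); last first.
  by apply/funext => x; ring.
rewrite (TD (tO t1) (tO t2)).
rewrite big_ord_recr/=; apply: lerD.
  apply: IH => // k x kN Ux; rewrite normrM.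
  apply: le_trans (pc k x (ltnW kN : (k < N.+1)%N) Ux).
  by have /andP[a b] := e01 x; rewrite ler_piMr// ger0_norm.
apply: variation_scale => // x.
have [xU|xU] := pselect (U N x); last first.
  by rewrite (test_out t2) ?normr0// => -[].
rewrite normrM; apply: le_trans (pc N x (ltnSn N) xU).
have /andP[a b] := e01 x; rewrite ler_piMr// ger0_norm ?subr_ge0//; lra.
Qed.

(** The support of a single test function is compact and meets the cover in finitely many sets, so
    the finite estimate suffices. *)
Lemma variation_sigma (U : nat -> set V) : (forall k, open (U k)) ->
  ((variation (\bigcup_k U k))%:E <= \sum_(k <oo) (variation (U k))%:E)%E.
Proof.
move=> oU.
have v0 k : (0 <= (variation (U k))%:E)%E by rewrite lee_fin variation_ge0.
have key phi : unit_tests (\bigcup_k U k) phi ->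
    ((T phi)%:E <= \sum_(k <oo) (variation (U k))%:E)%E.
  move=> [tp p1]; have [sp cp hp] := tp.
  have [N HN] : exists N, tsupp phi `<=` \bigcup_(k in `I_N) U k.
    have /compact_near_coveringP/(_ nat \oo
      (fun N x => (\bigcup_(k in `I_N) U k) x)) := cp.
    case=> [x /hp[_ [k _ Ux]]|N _ /(_ N (leqnn N))]; last by exists N.
    exists (U k, [set N | (k < N)%N]) => /=; first split.
    - by apply: open_nbhs_nbhs; split.
    - by exists k.+1.
    - by move=> [y N] /= [Uy kN]; exists k.
  apply: (@le_trans _ _ (\sum_(0 <= k < N) (variation (U k))%:E)%E); last first.
    by apply: nneseries_lim_ge => k _ _.
  rewrite sumEFin lee_fin big_mkord.
  under eq_bigr do rewrite -[variation _]mul1r.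
  apply: (@variation_sum U (fun=> 1) N phi oU (fun=> ler01)); last by move=> k x _ _; exact: p1.
  by split => // x px; split; [exact: (hp x px).1|exact: HN].
have [sfin|soo] := boolP ((\sum_(k <oo) (variation (U k))%:E)%E \is a fin_num).
  rewrite -(fineK sfin) lee_fin; apply: variation_le => phi /key.
  by rewrite -[X in (_ <= X)%E](fineK sfin) lee_fin.
have S0 : (0 <= \sum_(k <oo) (variation (U k))%:E)%E by apply: nneseries_ge0 => k _ _.
move: soo; rewrite ge0_fin_numE// -leNgt leye_eq => /eqP ->; exact: leey.
Qed.

Definition outer_variation (E : set V) : R :=
  inf [set variation U | U in [set U | open U /\ E `<=` U]].

Let has_inf_out E : has_inf [set variation U | U in [set U | open U /\ E `<=` U]].
Proof.
split; first by exists (variation setT), setT => //; split; [exact: openT|].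
by exists 0 => _ [U _ <-]; exact: variation_ge0.
Qed.

Lemma outer_variation_le E U : open U -> E `<=` U -> outer_variation E <= variation U.
Proof. by move=> oU EU; apply: ge_inf; [exact: (has_inf_out E).2|exists U]. Qed.

Lemma outer_variation_ge E c :
  (forall U, open U -> E `<=` U -> c <= variation U) -> c <= outer_variation E.
Proof.
move=> h; apply: lb_le_inf; first exact: (has_inf_out E).1.
by move=> _ [U [oU EU] <-]; exact: h.
Qed.

Lemma outer_variation_open U : open U -> outer_variation U = variation U.
Proof.
move=> oU; apply/eqP; rewrite eq_le outer_variation_le//=.
by apply: outer_variation_ge => W _; exact: variation_mono.
Qed.

Lemma outer_variation_near E e : 0 < e ->
  exists U, [/\ open U, E `<=` U & variation U < outer_variation E + e].
Proof.
move=> e0; have [_ [U [oU EU] <-] h] := inf_adherent e0 (has_inf_out E).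
by exists U.
Qed.

Lemma outer_variation_ge0 E : 0 <= outer_variation E.
Proof. by apply: outer_variation_ge => U _ _; exact: variation_ge0. Qed.

Lemma outer_variation_mono E F : E `<=` F -> outer_variation E <= outer_variation F.
Proof.
move=> EF; apply: outer_variation_ge => U oU FU; apply: outer_variation_le => //.
exact: subset_trans FU.
Qed.

Let ov (E : set V) : \bar R := (outer_variation E)%:E.

Let ov0 : ov set0 = 0%E.
Proof.
rewrite /ov outer_variation_open; last exact: open0.
apply/eqP; rewrite eqe eq_le variation_ge0 andbT; apply: variation_le => phi [tp _].
by rewrite (_ : phi = fun=> 0) ?T0//; apply/funext => x; apply: (test_out tp) => -[].
Qed.

Let ov_sigma : sigma_subadditive ov.
Proof.
move=> F; apply/lee_addgt0Pr => e e0.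
have /choice[U HU] k : exists U, [/\ open U, F k `<=` U &
    variation U < outer_variation (F k) + e / (2 ^ k.+1)%:R].
  by apply: outer_variation_near; rewrite divr_gt0// ltr0n expn_gt0.
have U1 k : open (U k) by have [] := HU k.
apply: (@le_trans _ _ (variation (\bigcup_k U k))%:E).
  rewrite lee_fin; apply: outer_variation_le; first exact: bigcup_open.
  by move=> x [k _ Fx]; exists k => //; have [_ h _] := HU k; exact: h.
apply: le_trans (variation_sigma U1) _.
have ov_ge0 k : (0 <= ov (F k))%E by rewrite lee_fin outer_variation_ge0.
apply: le_trans (epsilon_trick xpredT ov_ge0 (ltW e0)).
apply: lee_nneseries => [k _ _|k _]; first by rewrite lee_fin variation_ge0.
by rewrite -EFinD lee_fin; have [_ _ /ltW] := HU k.
Qed.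

Let ov_mono : {homo ov : A B / A `<=` B >-> (A <= B)%E}.
Proof. by move=> A B AB; rewrite lee_fin; exact: outer_variation_mono. Qed.

Let ov_ge0 A : (0 <= ov A)%E. Proof. by rewrite lee_fin outer_variation_ge0. Qed.

Let mu : {outer_measure set V -> \bar R} := HB.pack ov
  (isOuterMeasure.Build _ _ ov ov0 ov_ge0 ov_mono ov_sigma).

(** Given a competitor [phi] in the intersection of [G] and [U], any competitor [psi] in [G] off its
    support can be added without exceeding 1. Take the supremum over [psi], then over [phi]. *)
Let open_cara U : open U -> mu.-caratheodory U.
Proof.
move=> oU; apply: le_caratheodory_measurable => X; rewrite -EFinD lee_fin.
apply: outer_variation_ge => G oG XG.
rewrite -lerBrDr; apply: (@le_trans _ _ (variation (G `&` U))).
  apply: outer_variation_le; first exact: openI.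
  by move=> x [/XG].
apply: variation_le => phi [tp p1]; rewrite lerBrDr.
have [sp cp hp] := tp.
have oK : open (G `&` ~` tsupp phi).
  by apply: openI => //; rewrite openC; exact: closed_closure.
apply: (@le_trans _ _ (T phi + variation (G `&` ~` tsupp phi))).
  rewrite lerD2l; apply: outer_variation_le => // x [/XG Gx nU]; split => // /hp[_ []].
  by [].
rewrite addrC -lerBrDr; apply: variation_le => psi [tq q1]; rewrite lerBrDr addrC.
rewrite -(TD (tO tp) (tO tq)); apply: variation_ge; split.
  apply: testD; first by apply: test_subset tp => x [? []].
  by apply: test_subset tq => x [? []].
move=> x; have [px|/tsupp_out ->] := pselect (tsupp phi x); last by rewrite add0r.
by rewrite (test_out tq) ?addr0// => -[_ []].
Qed.

Let borel_cara (A : set V) : measurable A -> mu.-caratheodory A.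
Proof.
suff H : <<s (open : set (set V)) >> `<=` [set A | mu.-caratheodory A].
  by move=> /mx_measurable_open/H.
apply: smallest_sub; last by move=> U; exact: open_cara.
split.
- exact: caratheodory_measurable_set0.
- by move=> B cB; rewrite setTD; exact: caratheodory_measurable_setC.
- by move=> F; exact: caratheodory_measurable_bigcup.
Qed.

(* The Caratheodory restriction of the outer variation, i.e. |T|. *)
Lemma variation_measure : exists nu : {finite_measure set V -> \bar R},
  forall U, open U -> nu U = (variation U)%:E.
Proof.
have ov_add : semi_sigma_additive (ov : set V -> \bar R).
  move=> F mF tF mUF; apply: (@caratheodory_measure_sigma_additive R V mu) => //.
  - by move=> k; exact: borel_cara.
  - exact: borel_cara.
have ov_fin : fin_num_fun (ov : set V -> \bar R) by move=> A _.
have [nu nuE] := finite_measure_of ov0 ov_ge0 ov_add ov_fin.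
by exists nu => U oU; rewrite nuE /ov outer_variation_open.
Qed.

Variable nu : {finite_measure set V -> \bar R}.
Hypothesis nuE : forall U, open U -> nu U = (variation U)%:E.

Lemma test_itg_fin (m : {finite_measure set V -> \bar R}) (phi : V -> R) (M : R) : measurable_fun setT phi ->
  (forall x, `|phi x| <= M) -> m.-integrable setT (EFin \o phi).
Proof.
move=> mp pM; apply: (itg_bounded_supp measurableT _ mp pM) => [|x []//].
by rewrite ltey_eq fin_num_measure.
Qed.

(** Cut the domain into open slabs on which [phi] varies by less than [2 e], and apply
    [variation_sum]. At most two slabs meet at a point, whence the factor 2; it is harmless, since
    only continuity of [T] is needed from this bound. *)
Lemma variation_bound phi : test_fun O phi -> T phi <= 2 * \int[nu]_x `|phi x|.
Proof.
move=> tp; have [sp cp hp] := tp; have [M M0 pM] := test_bounded tp.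
have mp := smooth_meas sp.
have mn : measurable_fun setT (fun x => `|phi x|) by exact: measurableT_comp.
have in1 : nu.-integrable setT (EFin \o (fun x => `|phi x|)).
  by apply: (@test_itg_fin nu _ M) => // x; rewrite normr_id.
suff H e : 0 < e -> T phi <= 2 * \int[nu]_x `|phi x| + 4 * fine (nu setT) * e.
  apply/ler_addgt0Pr => e e0; have f0 : 0 <= fine (nu setT) by rewrite fine_ge0.
  have d0 : 0 < 4 * fine (nu setT) + 1 by lra.
  have := H (e / (4 * fine (nu setT) + 1)) (divr_gt0 e0 d0).
  move=> /le_trans; apply; rewrite lerD2l mulrCA ler_piMr ?(ltW e0)//.
  by rewrite ler_pdivrMr// mul1r lerDl.
move=> e0.
have [N HN] : exists N : nat, M / e < N%:R.
  by exists (Num.bound (M / e)); rewrite archi_boundP// divr_ge0// ltW.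
have MN : M < N%:R * e by rewrite -ltr_pdivrMr.
(* Shifted and rescaled values of [phi], nonnegative and below [2 N]; on the slab [U k] the value of
   [phi] is within [e] of [(k - N) e]. *)
pose t x := (phi x + N%:R * e) / e.
have t_ge0 x : 0 <= t x.
  rewrite divr_ge0 ?(ltW e0)//; have := pM x; rewrite ler_norml => /andP[]; lra.
have phiE x : phi x = (t x - N%:R) * e.
  by rewrite /t; field; lra.
pose U (k : nat) := [set x | `|k%:R - t x| < 1].
have st : smooth t := smoothM (smoothD sp (smooth_cst (N%:R * e))) (smooth_cst e^-1).
have oU k : open (U k).
  have -> : U k = (fun x => k%:R - t x) @^-1` (ball 0 1).
    by apply/seteqP; split => x; rewrite /U -ball_normE/= sub0r normrN.
  apply: open_comp; last exact: ball_open.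
  by move=> x _; exact: (smooth_continuous (smoothB (smooth_cst k%:R) st)).
pose c (k : nat) : R := (`|k%:R - N%:R| + 1) * e.
have c0 k : 0 <= c k by rewrite mulr_ge0 ?addr_ge0// ltW.
have Uc k x : U k x -> `|phi x| <= c k /\ c k <= `|phi x| + 2 * e.
  rewrite /U /= => h; rewrite phiE /c normrM (gtr0_norm e0).
  have h1 : `|t x - N%:R| <= `|k%:R - N%:R| + `|k%:R - t x|.
    have := ler_normB (k%:R - N%:R) (k%:R - t x).
    by rewrite (_ : k%:R - N%:R - (k%:R - t x) = t x - N%:R)//; ring.
  have h2 : `|k%:R - N%:R| <= `|t x - N%:R| + `|k%:R - t x|.
    have := ler_normD (t x - N%:R) (k%:R - t x).
    by rewrite (_ : t x - N%:R + (k%:R - t x) = k%:R - N%:R)//; ring.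
  rewrite -mulrDl !ler_pM2r//; split; lra.
have cover x : (\bigcup_(k in `I_(N + N).+1) U k) x.
  have tN : t x < (N + N)%:R.
    rewrite natrD; have := pM x; rewrite ler_norml => /andP[_ h].
    by rewrite /t ltr_pdivrMr// mulrDl ltrD2r; apply: le_lt_trans h MN.
  have /andP[jt tj] := truncn_itv (t_ge0 x).
  exists (Num.truncn (t x)) => /=.
    by rewrite ltnS -(ler_nat R); apply: ltW; exact: le_lt_trans jt tN.
  by rewrite /U /= ltr_norml; move: tj; rewrite -[_.+1%:R]natr1 => tj; apply/andP; split; lra.
have mU k : measurable (U k) by exact: mx_open_measurable.
have iU k : nu.-integrable setT (EFin \o (\1_(U k) : V -> R)) by exact: integrable_indic.
have ivar k : c k * variation (U k) = \int[nu]_x (c k * \1_(U k) x).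
  rewrite RintegralZl//; congr (_ * _).
  rewrite /Rintegral integral_indic// setIT.
  exact: (congr1 fine (esym (nuE (oU k)))).
apply: le_trans (@variation_sum U c (N + N).+1 phi oU c0 _ _) _.
- by split=> // x /hp Ox; split.
- by move=> k x _ /Uc[].
under eq_bigr do rewrite ivar.
rewrite -(@Rint_sum _ _ _ nu _ measurableT _ (index_enum _) (fun k : 'I_(N + N).+1 => fun x => c k * \1_(U k) x)); last first.
  by move=> k; exact: itgZ.
have i2 : nu.-integrable setT (EFin \o (fun x => 2 * `|phi x|)) := itgZ measurableT 2 in1.
have i4 : nu.-integrable setT (EFin \o (cst (4 * e) : V -> R)).
  by apply: (@test_itg_fin nu _ `|4 * e|) => //; exact: measurable_cst.
have -> : 4 * fine (nu setT) * e = \int[nu]_x (cst (4 * e) x).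
  by rewrite Rintegral_cst//; ring.
rewrite -RintegralZl// -RintegralD//; apply: Rint_le => //.
- by apply: itg_sum => // k; exact: itgZ.
- exact: itgD.
move=> x _ /=.
apply: (@le_trans _ _ (\sum_(k < (N + N).+1) (`|phi x| + 2 * e) * ((`|k%:R - t x| < 1)%R)%:R)).
  apply: ler_sum => k _; rewrite indicE; case: ltP => h.
    by rewrite mem_set// !mulr1; exact: (Uc k x h).2.
  by rewrite memNset ?mulr0//= /U/= ltNge h.
rewrite -mulr_sumr.
have := slab_count (N + N).+1 (t_ge0 x) => h.
have : (`|phi x| + 2 * e) * \sum_(k < (N + N).+1) ((`|k%:R - t x| < 1)%R)%:R <= (`|phi x| + 2 * e) * 2.
  by rewrite ler_wpM2l// addr_ge0// mulr_ge0// ltW.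
lra.
Qed.

End variation.

Section riesz_markov.
Variables (R : realType) (n : nat) (O : set 'rV[R]_n).
Local Notation V := 'rV[R]_n.
Hypothesis oO : open O.
Variables (T : (V -> R) -> R) (C : R).
Hypothesis T_lin : forall a phi psi, test_fun O phi -> test_fun O psi ->
  T (fun x => a * phi x + psi x) = a * T phi + T psi.
Hypothesis T_bnd : forall phi, test_fun O phi -> (forall x, `|phi x| <= 1) -> T phi <= C.

(* T is bounded in L1(|T|), hence in L2(|T|), so T = h |T| for some h in L2(|T|). *)
Theorem riesz_markov : is_bounded_measure O T.
Proof.
have [nu nuE] := variation_measure oO T_lin T_bnd.
have bnd := variation_bound oO T_lin T_bnd nuE.
have nufin : (nu setT < +oo)%E by rewrite ltey_eq fin_num_measure.
have mT := @measurableT _ V.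
pose H := L2sp nu mT 1 1; pose ip := L2_ip nu mT 1 1.
pose emb (phi : V -> R) (x : V) : 'M[R]_1 := const_mx (phi x).
have Hemb (phi : V -> R) M : measurable_fun setT phi -> (forall x, `|phi x| <= M) ->
    L2set nu setT (emb phi).
  move=> mp pM i j; under eq_fun do rewrite mxE.
  by apply: (@sqi_bounded _ _ _ nu setT mT _ M) => //; exact: aeW.
pose C0 := [set v : H | exists2 phi, test_fun O phi & forall x, v x = emb phi x].
pose l (v : H) := T (fun x => v x 0 0).
have lE phi (v : H) : (forall x, v x = emb phi x) -> l v = T phi.
  by move=> vE; congr T; apply/funext => x; rewrite vE mxE.
have one : L2set nu setT (emb (fun=> 1)).
  by apply: (Hemb _ 1) => // x; rewrite normr1.
have [|||v [phi tp vE]|c [Cc cc Hc]] :=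
  @riesz_subspace _ _ ip C0 l (2 * snorm ip (toL2 mT one)).
- exists (fun=> 0); first exact: test0.
  by move=> x; apply/matrixP => i j; rewrite L2sp0 !mxE.
- move=> a u v [f tf fE] [g tg gE]; exists (fun x => a * f x + g x).
    by apply: testD => //; exact: testZ.
  by move=> x; apply/matrixP => i j; rewrite L2spD L2spZ fE gE !mxE.
- move=> a u v [f tf fE] [g tg gE]; rewrite (lE f u)// (lE g v)// -T_lin//.
  by apply: lE => x; apply/matrixP => i j; rewrite L2spD L2spZ fE gE !mxE.
- rewrite (lE phi v)//; apply: le_trans (bnd _ tp) _; rewrite -mulrA ler_pM2l//.
  have [M M0 pM] := test_bounded tp; have mp := smooth_meas (test_smooth tp).
  have ma : L2set nu setT (emb (fun x => `|phi x|)).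
    apply: (Hemb _ M); first exact: measurableT_comp.
    by move=> x; rewrite normr_id.
  have -> : \int[nu]_x `|phi x| = ip (toL2 mT one) (toL2 mT ma).
    by rewrite L2_ipE; apply: eq_Rintegral => x _; rewrite /frob !big_ord1 !mxE mul1r.
  apply: le_trans (ip_le_norm _ _ _) _; rewrite ler_wpM2l ?snorm_ge0//.
  rewrite /snorm ler_wsqrtr// !L2_ipE le_eqVlt; apply/orP; left; apply/eqP.
  apply: eq_Rintegral => x _; rewrite vE /frob !big_ord1 !mxE.
  by rewrite -normrM ger0_norm// -expr2 sqr_ge0.
have [h ch] := L2_complete cc.
have hT phi : test_fun O phi -> T phi = \int[nu]_x (h x 0 0 * phi x).
  move=> tp; have [M M0 pM] := test_bounded tp.
  have mp := Hemb _ _ (smooth_meas (test_smooth tp)) pM.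
  have Cp : C0 (toL2 mT mp) by exists phi.
  have := cvg_unique _ (Hc _ Cp) (scvg_ip (y := toL2 mT mp) ch).
  rewrite (lE phi)// => ->//; rewrite L2_ipE; apply: eq_Rintegral => x _.
  by rewrite /frob !big_ord1 !mxE.
have h2 : sqi nu setT (fun x => h x 0 0) := L2spP h 0 0.
have h1 : nu.-integrable setT (EFin \o (fun x => h x 0 0)).
  have s1 : sqi nu setT (cst (1 : R)).
    by apply: (@sqi_bounded _ _ _ nu setT mT _ 1) => //; apply: aeW => x _; rewrite normr1.
  by have := sqi_mul mT h2 s1; apply: eq_integrable => // x _ /=; rewrite mulr1.
have mh := h2.1.
(* The positive and negative parts of the density give the two finite measures. *)
pose hp x := Num.max (h x 0 0) 0; pose hm x := Num.max (- h x 0 0) 0.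
have mhp : measurable_fun setT hp by exact: measurable_maxr.
have mhm : measurable_fun setT hm by apply: measurable_maxr => //; exact: measurableT_comp.
have hi0 : nu.-integrable setT (EFin \o (fun x => `|h x 0 0|)).
  by have := integrable_norm h1; apply: eq_integrable.
have hpi : nu.-integrable setT (EFin \o hp).
  apply: (itg_le mT mhp _ hi0) => x _; rewrite /hp; case: (lerP 0 (h x 0 0)) => hx.
    by [].
  by rewrite normr0.
have hmi : nu.-integrable setT (EFin \o hm).
  apply: (itg_le mT mhm _ hi0) => x _; rewrite /hm; case: (lerP 0 (- h x 0 0)) => hx.
    by rewrite normrN.
  by rewrite normr0.
have hp0 x : 0 <= hp x by rewrite /hp le_max lexx orbT.
have hm0 x : 0 <= hm x by rewrite /hm le_max lexx orbT.
have [mup Hp] := density_measure hp0 hpi; have [mum Hm] := density_measure hm0 hmi.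
exists mup, mum => phi tp; rewrite hT//.
have mp := smooth_meas (test_smooth tp); have [M M0 pM] := test_bounded tp.
have onO (m : {finite_measure set V -> \bar R}) : \int[m]_(x in O) phi x = \int[m]_x phi x.
  rewrite Rintegral_mkcond; apply: eq_Rintegral => x _; rewrite patchE.
  by case: ifPn => //; rewrite notin_setE => /(test_out tp) ->.
rewrite !onO.
pose pp x := Num.max (phi x) 0; pose pm x := Num.max (- phi x) 0.
have pE x : phi x = pp x - pm x.
  by rewrite /pp /pm max_subN.
have pp0 x : 0 <= pp x by rewrite /pp le_max lexx orbT.
have pm0 x : 0 <= pm x by rewrite /pm le_max lexx orbT.
have mpp : measurable_fun setT pp by exact: measurable_maxr.
have mpm : measurable_fun setT pm by apply: measurable_maxr => //; exact: measurableT_comp.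
have ppM x : `|pp x| <= M.
  rewrite ger0_norm//; apply: le_trans (pM x); rewrite /pp ge_max normr_ge0 andbT.
  exact: ler_norm.
have pmM x : `|pm x| <= M.
  rewrite ger0_norm//; apply: le_trans (pM x); rewrite /pm ge_max normr_ge0 andbT -normrN.
  exact: ler_norm.
have key (m : {finite_measure set V -> \bar R}) (w : V -> R) :
    nu.-integrable setT (EFin \o w) ->
    (forall f : V -> R, measurable_fun setT f -> (forall x, 0 <= f x) ->
      (\int[m]_x (f x)%:E = \int[nu]_x (f x * w x)%:E)%E) ->
    nu.-integrable setT (EFin \o (fun x => phi x * w x)) /\
    \int[m]_x phi x = \int[nu]_x (phi x * w x).
  move=> wi Hw; have bi (f : V -> R) (b : R) : measurable_fun setT f -> (forall x, `|f x| <= b) ->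
      nu.-integrable setT (EFin \o (fun x => f x * w x)).
    move=> mf fb; apply: (@itg_le _ _ _ _ _ mT _ (fun x => b * `|w x|)).
    - by apply: measurable_funM => //; exact: itg_meas wi.
    - by move=> x _; rewrite normrM ler_wpM2r.
    - by apply: itgZ => //; have := integrable_norm wi; apply: eq_integrable.
  split; first exact: bi pM.
  under eq_Rintegral do rewrite pE; rewrite RintegralB//; try exact: test_itg_fin ppM;
    try exact: test_itg_fin pmM.
  under [RHS]eq_Rintegral do rewrite pE mulrBl.
  rewrite RintegralB//; [|exact: bi ppM|exact: bi pmM].
  by rewrite /Rintegral !Hw.
have [ip1 ->] := key mup hp hpi Hp; have [im1 ->] := key mum hm hmi Hm.
rewrite -RintegralB//; apply: eq_Rintegral => x _; rewrite -mulrBr mulrC; congr (_ * _).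
by rewrite /hp /hm max_subN.
Qed.

End riesz_markov.

(** * Bounded fields with square-integrable divergence *)

Section support_integrals.
Variables (R : realType) (n : nat).
Local Notation V := 'rV[R]_n.
Local Notation leb := (lebesgue_rV R n).
Implicit Types (D : set V) (f : V -> R).

Lemma restrict_supp D f : (forall x, ~ D x -> f x = 0) -> f \_ D = f.
Proof.
move=> h; apply/funext => x; rewrite patchE; case: ifPn => //.
by rewrite notin_setE => /h.
Qed.

Lemma Rint_supp D f : (forall x, ~ D x -> f x = 0) ->
  \int[leb]_(x in D) f x = \int[leb]_x f x.
Proof. by move=> h; rewrite Rintegral_mkcond restrict_supp. Qed.

Lemma itg_supp D f : measurable D -> (forall x, ~ D x -> f x = 0) ->
  leb.-integrable D (EFin \o f) <-> leb.-integrable setT (EFin \o f).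
Proof.
move=> mD h; rewrite (integrable_mkcond _ mD) (_ : (EFin \o f) \_ D = EFin \o f)//.
by apply/funext => x; rewrite patchE; case: ifPn => //; rewrite notin_setE => /h /= ->.
Qed.

Lemma itg_restrict D f : measurable D -> leb.-integrable D (EFin \o f) <->
  leb.-integrable setT (EFin \o (f \_ D)).
Proof.
move=> mD; rewrite (integrable_mkcond _ mD) (_ : (EFin \o f) \_ D = EFin \o (f \_ D))//.
by apply/funext => x; rewrite /= !patchE; case: ifP.
Qed.

Lemma sqi_restrict D f : measurable D -> sqi leb D f -> sqi leb setT (f \_ D).
Proof.
move=> mD [mf f2]; split; first by apply/measurable_restrict => //; rewrite setTI.
have /(itg_restrict _ mD) := f2; apply: eq_integrable => // x _ /=.
by rewrite !patchE; case: ifP; rewrite ?expr0n.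
Qed.

Lemma sqiS D f : measurable D -> sqi leb setT f -> sqi leb D f.
Proof.
by move=> mD [mf f2]; split; [exact: measurable_funS mf|exact: integrableS f2].
Qed.

Lemma bounded_mul_sqi f g M : measurable_fun setT f -> (forall x, `|f x| <= M) ->
  sqi leb setT g -> sqi leb setT (fun x => f x * g x).
Proof.
move=> mf fM [mg g2]; split; first exact: measurable_funM.
have i2 := itgZ measurableT (M ^+ 2) g2.
apply: (itg_le measurableT _ _ i2).
  by apply: measurable_funX; exact: measurable_funM.
move=> x _; rewrite ger0_norm ?sqr_ge0// exprMn ler_wpM2r ?sqr_ge0//.
by rewrite -[f x ^+ 2](real_normK (num_real _)) lerXn2r// nnegrE ?normr_ge0//
  (le_trans (normr_ge0 _) (fM x)).
Qed.

Lemma bounded_mul_itg D f g M : measurable D -> measurable_fun D f ->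
  (forall x, D x -> `|f x| <= M) -> leb.-integrable D (EFin \o g) ->
  leb.-integrable D (EFin \o (fun x => f x * g x)).
Proof.
move=> mD mf fM gi; apply: (@itg_le _ _ _ _ _ mD _ (fun x => M * `|g x|)).
- by apply: measurable_funM => //; exact: itg_meas gi.
- by move=> x Dx; rewrite normrM ler_wpM2r// fM.
- by apply: itgZ => //; have := integrable_norm gi; apply: eq_integrable.
Qed.

End support_integrals.

Section linear_matrix_map.
Variables (R : realType) (m n : nat) (A : {linear 'M[R]_(m, n) -> 'M[R]_(m, n)}).

Lemma linear_entry (y : 'M[R]_(m, n)) i j :
  A y i j = \sum_k \sum_l y k l * A (delta_mx k l) i j.
Proof.
rewrite {1}[y]matrix_sum_delta linear_sum summxE; apply: eq_bigr => k _.
by rewrite linear_sum summxE; apply: eq_bigr => l _; rewrite linearZ mxE.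
Qed.

Hypothesis A_sym : forall y y', frob (A y) y' = frob y (A y').

Lemma frob_delta (y : 'M[R]_(m, n)) i j : frob y (delta_mx i j) = y i j.
Proof.
rewrite /frob (bigD1 i)//= (bigD1 j)//= mxE !eqxx mulr1 !big1 ?addr0// => [k ki|l lj].
  by apply: big1 => l _; rewrite mxE (negbTE ki) mulr0.
by rewrite mxE (negbTE lj) andbF mulr0.
Qed.

Lemma A_entry_sym k l (y : 'M[R]_(m, n)) :
  \sum_i \sum_j A (delta_mx k l) i j * y i j = A y k l.
Proof. by rewrite -[LHS]/(frob _ _) A_sym frobC frob_delta. Qed.

End linear_matrix_map.

Section fields.
Variables (R : realType) (m n : nat).
Local Notation V := 'rV[R]_n.
Local Notation leb := (lebesgue_rV R n).
Local Notation partial j phi x := ('D_(delta_mx 0 j : V) phi x).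
Variable A : {linear 'M[R]_(m, n) -> 'M[R]_(m, n)}.

(** The weak divergence is taken on the whole space, so a field that vanishes off Omega has no
    boundary part in its divergence. Bound and constraint hold at every point, which lets
    mollification and translation proceed without null sets. *)
Record wfield (M : R) (z : V -> 'M[R]_(m, n)) (p : V -> 'rV[R]_m) : Prop := Wfield {
  wf_meas : forall i j, measurable_fun setT (fun x => z x i j);
  wf_bnd : forall x, frob_norm (z x) <= M;
  wf_A : forall x, A (z x) = z x;
  wf_L2 : L2set leb setT p;
  wf_div : is_weak_div setT z p }.

Definition vanishes_off (K : set V) (z : V -> 'M[R]_(m, n)) (p : V -> 'rV[R]_m) :=
  forall x, ~ K x -> z x = 0 /\ p x = 0.

Definition mul_div (eta : V -> R) (z : V -> 'M[R]_(m, n)) (p : V -> 'rV[R]_m) (x : V) : 'rV[R]_m :=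
  eta x *: p x + \row_i \sum_j partial j eta x * z x i j.

Lemma mul_divE eta z p x i : mul_div eta z p x 0 i = eta x * p x 0 i + \sum_j partial j eta x * z x i j.
Proof. by rewrite /mul_div !mxE. Qed.

Lemma entry_bnd M z i j : (forall x : V, frob_norm (z x : 'M[R]_(m, n)) <= M) ->
  forall x, `|z x i j| <= M.
Proof. by move=> h x; apply: le_trans (entry_le_frob_norm _ _ _) (h x). Qed.

Lemma test_mul_meas_bnd (U : set V) (phi f : V -> R) (M : R) : test_fun U phi -> measurable_fun setT f ->
  (forall x, `|f x| <= M) -> leb.-integrable setT (EFin \o (fun x => f x * phi x)).
Proof.
by move=> tp mf fM; apply: (bounded_mul_itg measurableT mf _ (test_itg tp)) => x _.
Qed.

Lemma vanish_tsupp (U : set V) (phi : V -> R) x : test_fun U phi -> ~ tsupp phi x ->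
  phi x = 0 /\ forall v, 'D_v phi x = 0.
Proof.
move=> [sp cp _] nx; split; first exact: tsupp_out.
have tp : test_fun (tsupp phi) phi by split.
by move=> v; exact: (test_out (test_derive v tp) nx).
Qed.

(* Leibniz rule: div (eta z) = eta div z + z grad eta. *)
Lemma field_mul (U : set V) (M : R) (z : V -> 'M[R]_(m, n)) (p : V -> 'rV[R]_m) (eta : V -> R) (c : R) : measurable U ->
  (forall i j, measurable_fun setT (fun x => z x i j)) ->
  (forall x, frob_norm (z x) <= M) -> (forall x, A (z x) = z x) ->
  L2set leb setT p -> is_weak_div U z p -> test_fun U eta -> (forall x, `|eta x| <= c) ->
  wfield (c * M) (fun x => eta x *: z x) (mul_div eta z p) /\
  vanishes_off (tsupp eta) (fun x => eta x *: z x) (mul_div eta z p).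
Proof.
move=> mU mz bz Az L2p dz te ec; have se := test_smooth te; have me := smooth_meas se.
have M0 : 0 <= M by apply: le_trans (bz 0); exact: snorm_ge0 (frob_ip R m n) _.
have zb i j := @entry_bnd M z i j bz.
split; last first.
  move=> x nx; have [e0 d0] := vanish_tsupp te nx; rewrite e0 scale0r; split => //.
  by apply/rowP => i; rewrite mul_divE e0 mul0r add0r mxE big1// => j _; rewrite d0 mul0r.
split.
- by move=> i j; under eq_fun do rewrite mxE; exact: measurable_funM.
- move=> x; rewrite frob_normE snormZ -frob_normE.
  by apply: ler_pM => //; exact: snorm_ge0 (frob_ip R m n) _.
- by move=> x; rewrite linearZ /= Az.
- move=> i j; rewrite (ord1 i); under eq_fun do rewrite mul_divE.
  apply: sqiD => //; first exact: bounded_mul_sqi (L2p 0 j).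
  elim: (index_enum _) => [|k s IH].
    by under eq_fun do rewrite big_nil; exact: sqi0.
  under eq_fun do rewrite big_cons.
  apply: sqiD => //; have := test_sqiT (test_derive (delta_mx 0 k) te).
  move=> /(bounded_mul_sqi (mz j k) (zb j k)); congr sqi.
  by apply/funext => x; rewrite mulrC.
move=> psi tpsi i; have spsi := test_smooth tpsi.
have tep := test_mul te spsi.
have := dz _ tep i.
have D1 j x : 'D_(delta_mx 0 j : V) (fun x => eta x * psi x) x =
    eta x * partial j psi x + psi x * partial j eta x.
  have := deriveM (@smooth_derivable _ _ eta x (delta_mx 0 j) se)
                  (@smooth_derivable _ _ psi x (delta_mx 0 j) spsi).
  by [].
under eq_Rintegral do under eq_bigr do rewrite D1.
have out x : ~ U x -> eta x = 0 /\ forall v, 'D_v eta x = 0.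
  move=> nx; apply: (vanish_tsupp te) => xe; apply: nx; have [_ _] := te; exact.
rewrite Rint_supp; last first.
  move=> x /out[e0 d0]; apply: big1 => j _; rewrite e0 d0; ring.
rewrite [X in _ = X]Rint_supp; last by move=> x /out[-> _]; ring.
have tej j := test_mul te (smooth_derive (delta_mx 0 j) spsi).
have tpj j := test_mul (test_derive (delta_mx 0 j) te) spsi.
have i1 j : leb.-integrable setT (EFin \o (fun x => z x i j * (eta x * partial j psi x))).
  exact: test_mul_meas_bnd (tej j) (mz i j) (zb i j).
have i2 j : leb.-integrable setT (EFin \o (fun x => z x i j * (partial j eta x * psi x))).
  exact: test_mul_meas_bnd (tpj j) (mz i j) (zb i j).
have -> : (fun x => \sum_j z x i j * (eta x * partial j psi x + psi x * partial j eta x)) =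
  (fun x => \sum_j z x i j * (eta x * partial j psi x) +
            \sum_j z x i j * (partial j eta x * psi x)).
  by apply/funext => x; rewrite -big_split; apply: eq_bigr => j _ /=; ring.
have s1 : leb.-integrable setT (EFin \o (fun x => \sum_j z x i j * (eta x * partial j psi x))).
  by apply: itg_sum.
have s2 : leb.-integrable setT (EFin \o (fun x => \sum_j z x i j * (partial j eta x * psi x))).
  by apply: itg_sum.
rewrite RintegralD// => H.
have -> : (fun x => \sum_j (eta x *: z x) i j * partial j psi x) =
    (fun x => \sum_j z x i j * (eta x * partial j psi x)).
  by apply/funext => x; apply: eq_bigr => j _; rewrite mxE; ring.
have i3 : leb.-integrable setT (EFin \o (fun x => p x 0 i * (eta x * psi x))).
  exact: sqi_mul (L2p 0 i) (test_sqiT tep).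
have -> : (fun x => mul_div eta z p x 0 i * psi x) =
    (fun x => p x 0 i * (eta x * psi x) + \sum_j z x i j * (partial j eta x * psi x)).
  apply/funext => x; rewrite mul_divE mulrDl mulr_suml; congr (_ + _); first by ring.
  by apply: eq_bigr => j _; ring.
rewrite RintegralD//; lra.
Qed.

Lemma wfield_translate M z p v : wfield M z p ->
  wfield M (fun x => z (x + v)) (fun x => p (x + v)).
Proof.
move=> [mz bz Az L2p dz].
split => //.
- by move=> i j; apply: (measurableT_comp (mz i j)); exact: mx_add_measurable.
- by move=> i j; exact: sqi_translate (L2p i j).
move=> psi tpsi i; have spsi := test_smooth tpsi.
pose chi x := psi (x - v).
have schi : smooth chi by exact: smooth_shift.
have dchi j x : partial j chi x = partial j psi (x - v).
  have aff h w (y : V) : h *: w + y - v = h *: w + (y - v) by rewrite addrA.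
  exact: (derive_affine aff).
have tchi : test_fun setT chi.
  have [_ cp _] := tpsi; apply: (@test_in _ _ _ ((fun x => x + v) @` tsupp psi)) => //.
  - apply: continuous_compact => //; apply: continuous_subspaceT.
    exact: shift_continuous.
  - move=> x h; exists (x - v); last by rewrite subrK.
    exact: subset_closure.
have := dz _ tchi i.
have zb j := @entry_bnd M z i j bz.
rewrite -(Rintegral_translate v (f := fun x => \sum_j z x i j * partial j chi x)); last first.
  apply: itg_sum => // j; exact: test_mul_meas_bnd (test_derive _ tchi) (mz i j) (zb j).
rewrite -(Rintegral_translate v (f := fun x => p x 0 i * chi x)); last first.
  exact: sqi_mul (L2p 0 i) (test_sqiT tchi).
under eq_Rintegral do under eq_bigr do rewrite dchi addrK.
by under [X in _ = X -> _]eq_Rintegral do rewrite /chi addrK.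
Qed.

Lemma wfield_lin M N z p y q a b : wfield M z p -> wfield N y q ->
  wfield (`|a| * M + `|b| * N) (fun x => a *: z x + b *: y x) (fun x => a *: p x + b *: q x).
Proof.
move=> [mz bz Az L2p dz] [my bY Ay L2q dy]; split.
- move=> i j; under eq_fun do rewrite !mxE.
  by apply: measurable_funD; apply: measurable_funM.
- move=> x; rewrite frob_normE; apply: le_trans (snormD _ _ _) _; rewrite !snormZ.
  by rewrite -!frob_normE lerD// ler_wpM2l.
- by move=> x; rewrite linearD !linearZ /= Az Ay.
- by move=> i j; under eq_fun do rewrite !mxE; apply: sqiD => //; exact: sqiZ.
move=> psi tpsi i.
have i1 j : leb.-integrable setT (EFin \o (fun x => z x i j * partial j psi x)).
  exact: test_mul_meas_bnd (test_derive _ tpsi) (mz i j) (@entry_bnd M z i j bz).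
have i2 j : leb.-integrable setT (EFin \o (fun x => y x i j * partial j psi x)).
  exact: test_mul_meas_bnd (test_derive _ tpsi) (my i j) (@entry_bnd N y i j bY).
have i3 : leb.-integrable setT (EFin \o (fun x => p x 0 i * psi x)).
  exact: sqi_mul (L2p 0 i) (test_sqiT tpsi).
have i4 : leb.-integrable setT (EFin \o (fun x => q x 0 i * psi x)).
  exact: sqi_mul (L2q 0 i) (test_sqiT tpsi).
have -> : (fun x => \sum_j (a *: z x + b *: y x) i j * partial j psi x) =
  (fun x => a * (\sum_j z x i j * partial j psi x) + b * (\sum_j y x i j * partial j psi x)).
  apply/funext => x; rewrite !mulr_sumr -big_split; apply: eq_bigr => j _; rewrite !mxE.
  by rewrite /=; ring.
have -> : (fun x => (a *: p x + b *: q x) 0 i * psi x) =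
  (fun x => a * (p x 0 i * psi x) + b * (q x 0 i * psi x)).
  by apply/funext => x; rewrite !mxE; ring.
have s1 := itg_sum measurableT (index_enum _) i1.
have s2 := itg_sum measurableT (index_enum _) i2.
have := dz _ tpsi i; have := dy _ tpsi i => e2 e1.
rewrite RintegralD//; [|exact: itgZ|exact: itgZ].
rewrite [RHS]RintegralD//; [|exact: itgZ|exact: itgZ].
rewrite [X in - (X + _)]RintegralZl// [X in - (_ + X)]RintegralZl//.
rewrite [X in _ = X + _]RintegralZl// [X in _ = _ + X]RintegralZl//.
rewrite -e1 -e2; ring.
Qed.

Lemma wfield0 : wfield 0 (fun=> 0) (fun=> 0).
Proof.
split.
- by move=> i j; under eq_fun do rewrite mxE; exact: measurable_cst.
- by move=> x; rewrite frob_normE snorm0.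
- by move=> x; rewrite linear0.
- by move=> i j; under eq_fun do rewrite mxE; exact: sqi0.
move=> psi _ i; rewrite (_ : (fun x => \sum_j _) = fun=> 0); last first.
  by apply/funext => x; apply: big1 => j _; rewrite mxE mul0r.
rewrite (_ : (fun x => _ * _) = fun=> 0); last by apply/funext => x; rewrite mxE mul0r.
by rewrite Rintegral_cst// mul0r oppr0.
Qed.

Lemma wfield_le M N z p : M <= N -> wfield M z p -> wfield N z p.
Proof. by move=> MN [mz bz Az L2p dz]; split => // x; exact: le_trans (bz x) MN. Qed.

End fields.

(** * Mollification of compactly supported fields *)

Section field_mollification.
Variables (R : realType) (m n : nat).
Local Notation V := 'rV[R]_n.
Local Notation leb := (lebesgue_rV R n).
Local Notation partial j phi x := ('D_(delta_mx 0 j : V) phi x).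
Local Notation rad k := (k.+1%:R^-1 : R).

Lemma compact_nbhd (K : set V) (s t : R) : compact K -> 0 < s -> s < t ->
  exists C, [/\ compact C, forall z x, K z -> ball z s x -> C x &
    forall x, C x -> exists2 z, K z & ball z t x].
Proof.
move=> cK s0 st; pose N := \bigcup_(z in K) ball z s.
exists (closure N); split.
- apply: bounded_closed_compact; last exact: closed_closure.
  have [M [Mr HM]] := compact_bounded cK.
  exists (`|M| + 1 + t); split; first exact: num_real.
  move=> M' hM' x /(_ (ball x (t - s)) (nbhsx_ballx _ _ _)); rewrite subr_gt0.
  move=> /(_ st)[y [[z Kz zy] xy]].
  have zx : ball z t x.
    by rewrite (_ : t = s + (t - s)); [apply: ball_triangle zy _; exact: ball_sym|ring].
  have M1 : M < `|M| + 1 by apply: le_lt_trans (ler_norm M) _; rewrite ltrDl.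
  have := HM _ M1 z Kz; rewrite -ball_normE/= in zx; move=> /= h.
  have := ler_normB z (z - x); rewrite opprB addrC subrK; lra.
- by move=> z x Kz zx; apply: subset_closure; exists z.
- move=> x /(_ (ball x (t - s)) (nbhsx_ballx _ _ _)); rewrite subr_gt0.
  move=> /(_ st)[y [[z Kz zy] xy]]; exists z => //.
  by rewrite (_ : t = s + (t - s)); [apply: ball_triangle zy _; exact: ball_sym|ring].
Qed.

Lemma conv_moll_test (K O : set V) g r : compact K -> 0 < r -> (forall x, ~ K x -> g x = 0) ->
  leb.-integrable setT (EFin \o g) -> (forall x, K x -> ball x (2 * r) `<=` O) ->
  test_fun O (conv (moll r) g).
Proof.
move=> cK r0 gK gi KO; have r2 : r < 2 * r by lra.
have [C [cC KC CK]] := compact_nbhd cK r0 r2.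
apply: (@test_in _ _ _ C) => //.
- by apply: conv_smooth => //; exact: moll_test.
- move=> x; apply: contraNP => nC; apply/eqP; apply: conv_moll_eq => // y yx.
  apply: gK => Ky; apply: nC; apply: (KC y) => //; by rewrite -ball_normE/=.
- by move=> x /CK[z Kz zx]; exact: KO zx.
Qed.

Lemma conv_moll_norm_le r g h x : 0 < r -> leb.-integrable setT (EFin \o g) ->
  leb.-integrable setT (EFin \o h) -> (forall y, `|g y| <= h y) ->
  `|conv (moll r) g x| <= conv (moll r) h x.
Proof.
move=> r0 gi hi gh; have i1 := conv_moll_itg x r0 gi; have i2 := conv_moll_itg x r0 hi.
apply: le_trans (le_normr_Rintegral _ _) _ => //; apply: Rint_le => //.
  by have := integrable_norm i1; apply: eq_integrable.
by move=> y _; rewrite normrM ger0_norm ?moll_ge0// ler_wpM2l// moll_ge0.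
Qed.

Lemma conv_moll_sum r (I : finType) (a : I -> R) (g : I -> V -> R) x : 0 < r ->
  (forall i, leb.-integrable setT (EFin \o g i)) ->
  conv (moll r) (fun y => \sum_i a i * g i y) x = \sum_i a i * conv (moll r) (g i) x.
Proof.
move=> r0 gi; have ig i := itgZ measurableT (a i) (conv_moll_itg x r0 (gi i)).
rewrite /conv (_ : (fun y => _) = fun y => \sum_i a i * (moll r (y - x) * g i y)); last first.
  by apply/funext => y; rewrite mulr_sumr; apply: eq_bigr => i _; ring.
rewrite Rint_sum//; apply: eq_bigr => i _; rewrite RintegralZl//.
exact: conv_moll_itg.
Qed.

(** Young's inequality with weight [s] on the difference and [s^-1] on [g]. *)
Lemma L2_weak_cvg (D : set V) (f_ : nat -> V -> R) f g : measurable D ->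
  (forall k, sqi leb D (f_ k)) -> sqi leb D f -> sqi leb D g ->
  (fun k => \int[leb]_(x in D) ((f_ k x - f x) ^+ 2)) @ \oo --> (0 : R) ->
  (fun k => \int[leb]_(x in D) (f_ k x * g x)) @ \oo --> \int[leb]_(x in D) (f x * g x).
Proof.
move=> mD h_ h hg cv; apply/cvgrPdist_lt => e e0.
set G := \int[leb]_(x in D) (g x ^+ 2).
have G0 : 0 <= G by apply: Rintegral_ge0 => x _; exact: sqr_ge0.
(* Large enough for [s^-1 * G <= e / 2], also when [G = 0]. *)
pose s := 2 * G / e + 1; have s0 : 0 < s by rewrite /s ltr_wpDl// mulr_ge0 ?invr_ge0 ?(ltW e0)// mulr_ge0.
have sG : s^-1 * G <= e / 2.
  rewrite mulrC ler_pdivrMr// /s.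
  rewrite (_ : e / 2 * _ = G + e / 2); last by field; rewrite gt_eqF.
  by rewrite lerDl divr_ge0// ltW.
have es : 0 < e / (2 * s) by rewrite divr_gt0// mulr_gt0.
move/cvgrPdist_lt : cv => /(_ _ es)[N _ HN]; exists N => // k /HN /=.
have I0 : 0 <= \int[leb]_(x in D) ((f_ k x - f x) ^+ 2).
  by apply: Rintegral_ge0 => x _; exact: sqr_ge0.
rewrite sub0r normrN ger0_norm// => hk.
have hd : sqi leb D (fun x => f x - f_ k x).
  by have := sqiB mD h (h_ k).
have i1 := sqi_mul mD h hg; have i2 := sqi_mul mD (h_ k) hg.
have i3 := sqi_mul mD hd hg.
have id : leb.-integrable D (EFin \o (fun x => s * (f_ k x - f x) ^+ 2)).
  apply: itgZ => //; have := hd.2; apply: eq_integrable => // x _ /=.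
  by rewrite -sqrrN opprB.
have ig := itgZ mD s^-1 hg.2.
rewrite -RintegralB// (_ : (fun x => _) = fun x => (f x - f_ k x) * g x); last first.
  by apply/funext => x; rewrite mulrBl.
apply: le_lt_trans (le_normr_Rintegral _ _) _ => //.
apply: (@le_lt_trans _ _ (\int[leb]_(x in D)
    (s * (f_ k x - f x) ^+ 2 + s^-1 * g x ^+ 2))).
  apply: Rint_le => //; [by have := integrable_norm i3; apply: eq_integrable|exact: itgD|].
  move=> x _ /=; rewrite -[(f_ k x - f x) ^+ 2]sqrrN opprB normrM.
  rewrite -[X in s * X](real_normK (num_real _)) -[X in s^-1 * X](real_normK (num_real _)).
  move: (`|f x - f_ k x|) (`|g x|) (normr_ge0 (f x - f_ k x)) (normr_ge0 (g x)) => a b a0 b0.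
  have : 0 <= s^-1 * (s * a - b) ^+ 2 by rewrite mulr_ge0 ?invr_ge0 ?sqr_ge0// ltW.
  rewrite (_ : s^-1 * (s * a - b) ^+ 2 = s * a ^+ 2 - 2 * (a * b) + s^-1 * b ^+ 2); last first.
    by field; rewrite gt_eqF.
  have := mulr_ge0 a0 b0; lra.
rewrite RintegralD// !RintegralZl//; last 2 first.
- exact: hg.2.
- have := hd.2; apply: eq_integrable => // x _ /=; by rewrite -sqrrN opprB.
rewrite -/G; have : s * \int[leb]_(x in D) ((f_ k x - f x) ^+ 2) < e / 2.
  rewrite mulrC -ltr_pdivlMr// (_ : e / 2 / s = e / (2 * s))//; field; rewrite gt_eqF//.
lra.
Qed.

Variable A : {linear 'M[R]_(m, n) -> 'M[R]_(m, n)}.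

Definition moll_field k (z : V -> 'M[R]_(m, n)) i j : V -> R := conv (moll (rad k)) (fun y => z y i j).
Definition moll_divergence k (p : V -> 'rV[R]_m) i : V -> R := conv (moll (rad k)) (fun y => p y 0 i).

Section one_field.
Variables (M : R) (z : V -> 'M[R]_(m, n)) (p : V -> 'rV[R]_m) (K : set V).
Hypotheses (wz : wfield A M z p) (cK : compact K) (zK : vanishes_off K z p).

Let rad0 k : 0 < rad k. Proof. by rewrite invr_gt0. Qed.

Lemma field_itg i j : leb.-integrable setT (EFin \o (fun y => z y i j)).
Proof.
have [mK fK] := compact_rV_fin cK; have [mz bz _ _ _] := wz.
apply: (itg_bounded_supp mK fK (mz i j) (entry_bnd i j bz)) => x /zK[-> _].
by rewrite mxE.
Qed.

Lemma divergence_itg i : leb.-integrable setT (EFin \o (fun y => p y 0 i)).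
Proof.
have [mK fK] := compact_rV_fin cK; have [_ _ _ L2p _] := wz.
apply/(itg_supp mK); first by move=> x /zK[_ ->]; rewrite mxE.
have hp := sqiS mK (L2p 0 i).
have h1 : sqi leb K (cst (1 : R)).
  by apply: (@sqi_bounded _ _ _ leb K mK _ 1) => //; apply: aeW => x _; rewrite normr1.
by have := sqi_mul mK hp h1; apply: eq_integrable => // x _ /=; rewrite mulr1.
Qed.

(** The translated kernel is itself a test function for the weak divergence; the reflection in
    [conv] produces the sign of the integration by parts. *)
Lemma moll_field_div k i x :
  \sum_j partial j (moll_field k z i j) x = moll_divergence k p i x.
Proof.
have tm := moll_test n (rad0 k).
have [mz bz _ _ dz] := wz.
pose psi (y : V) := moll (rad k) (y - x).
have spsi : smooth psi by apply: smooth_shift; exact: test_smooth tm.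
have dpsi j y : partial j psi y = partial j (moll (rad k)) (y - x).
  have aff h w (y' : V) : h *: w + y' - x = h *: w + (y' - x) by rewrite addrA.
  exact: (derive_affine aff).
have tpsi : test_fun setT psi.
  have [sm cm _] := tm; apply: (@test_in _ _ _ ((fun y => y + x) @` tsupp (moll (rad k) : V -> R))) => //.
  - apply: continuous_compact => //; apply: continuous_subspaceT.
    exact: shift_continuous.
  - by move=> y h; exists (y - x); [exact: subset_closure|rewrite subrK].
have := dz _ tpsi i.
rewrite Rint_sum//; last first.
  by move=> j; exact: test_mul_meas_bnd (test_derive _ tpsi) (mz i j) (entry_bnd i j bz).
rewrite /moll_divergence /conv -sumrN.
under [X in _ = X]eq_Rintegral do rewrite mulrC.
move=> <-; apply: eq_bigr => j _.
rewrite (conv_derive x (delta_mx 0 j) tm (field_itg i j)).2 /conv.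
rewrite -[RHS]mulN1r -RintegralZl//; last first.
  exact: test_mul_meas_bnd (test_derive _ tpsi) (mz i j) (entry_bnd i j bz).
apply: eq_Rintegral => y _; rewrite derive_opp ?dpsi; first by ring.
by move=> v; exact: smooth_derivable (test_smooth tm).
Qed.

(** The constraint [A z = z] has constant coefficients, so it survives averaging. *)
Lemma moll_field_A k x : A (\matrix_(i, j) moll_field k z i j x) = \matrix_(i, j) moll_field k z i j x.
Proof.
have [_ _ Az _ _] := wz.
apply/matrixP => i j; rewrite linear_entry mxE.
have -> : moll_field k z i j x = conv (moll (rad k))
    (fun y => \sum_(kl : 'I_m * 'I_n) A (delta_mx kl.1 kl.2) i j * z y kl.1 kl.2) x.
  congr conv; apply/funext => y; rewrite -{1}Az linear_entry pair_bigA/=.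
  by apply: eq_bigr => -[a b] _ /=; rewrite mulrC.
rewrite conv_moll_sum//; last by move=> kl; exact: field_itg.
rewrite pair_bigA/=; apply: eq_bigr => -[a b] _ /=; by rewrite mxE mulrC.
Qed.

Lemma moll_field_test (O : set V) : open O -> K `<=` O ->
  exists N, forall k i j, (N <= k)%N -> test_fun O (moll_field k z i j).
Proof.
move=> oO KO; have [e e0 he] := near_compact cK oO KO.
have [N HN] := @invS_lt R (e / 2) (divr_gt0 e0 (ltr0Sn _ 1)).
exists N => k i j /HN hk; apply: (conv_moll_test cK (rad0 k)).
- by move=> x /zK[-> _]; rewrite mxE.
- exact: field_itg.
- move=> x Kx; apply: subset_trans (he x Kx); apply: le_ball.
  by apply: ltW; rewrite mulrC -ltr_pdivlMr.
Qed.

Lemma moll_divergence_sqi k i : sqi leb setT (moll_divergence k p i).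
Proof.
have [_ _ _ L2p _] := wz.
exact: (conv_moll_contract (rad0 k) (divergence_itg i) (L2p 0 i)).1.
Qed.

Lemma moll_divergence_cvg (O : set V) i : open O -> (leb O < +oo)%E -> K `<=` O ->
  (fun k => \int[leb]_x ((moll_divergence k p i x - p x 0 i) ^+ 2)) @ \oo --> (0 : R).
Proof.
move=> oO fO KO; have [_ _ _ L2p _] := wz.
apply: (moll_cvg_L2 oO fO (L2p 0 i)); last exact: divergence_itg.
move=> x nO; have [|_ ->] := zK (x := x); last by rewrite mxE.
by move/KO.
Qed.

Lemma field_sqi i j : sqi leb setT (fun y => z y i j).
Proof.
have [mz bz _ _ _] := wz; split; first exact: mz.
have := bounded_mul_itg measurableT (mz i j) (fun x _ => entry_bnd i j bz x) (field_itg i j).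
by apply: eq_integrable => // x _; rewrite /= expr2.
Qed.

Lemma moll_field_cvg (O : set V) i j : open O -> (leb O < +oo)%E -> K `<=` O ->
  (fun k => \int[leb]_x ((moll_field k z i j x - z x i j) ^+ 2)) @ \oo --> (0 : R).
Proof.
move=> oO fO KO; apply: (moll_cvg_L2 oO fO (field_sqi i j)); last exact: field_itg.
move=> x nO; have [|-> _] := zK (x := x); last by rewrite mxE.
by move/KO.
Qed.

End one_field.
End field_mollification.

Section pair_ip.
Variables (R : realType) (H1 H2 : lmodType R) (ip1 : semi_ip H1) (ip2 : semi_ip H2).

Let val (x y : H1 * H2) : R := ip1 x.1 y.1 + ip2 x.2 y.2.

Let valC x y : val x y = val y x.
Proof. by rewrite /val ipC (ipC ip2). Qed.

Let valD (x y z : H1 * H2) : val (x + y) z = val x z + val y z.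
Proof. by rewrite /val !ipDl addrACA. Qed.

Let valZ a (x y : H1 * H2) : val (a *: x) y = a * val x y.
Proof. by rewrite /val !ipZl mulrDr. Qed.

Let val_ge0 x : 0 <= val x x.
Proof. by rewrite addr_ge0// ip_ge0. Qed.

Definition pair_ip := SemiIp valC valD valZ val_ge0.

Lemma pair_ipE x y : pair_ip x y = ip1 x.1 y.1 + ip2 x.2 y.2. Proof. by []. Qed.

Lemma pair_scauchy x : scauchy pair_ip x ->
  scauchy ip1 (fun k => (x k).1) /\ scauchy ip2 (fun k => (x k).2).
Proof.
move=> cx; split=> e e0; have [N HN] := cx e e0; exists N => i j Ni Nj;
  apply: le_lt_trans (HN i j Ni Nj); rewrite ler_wsqrtr// pair_ipE.
  by rewrite lerDl ip_ge0.
by rewrite lerDr ip_ge0.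
Qed.
End pair_ip.

(** * Weak time derivatives and uniqueness *)

Section bochner.
Variables (R : realType) (H : lmodType R) (ip : semi_ip H).
Local Notation nrm := (snorm ip).
Local Notation TR := (measurableTypeR R).
Local Notation lam := (@lebesgue_measure R).
Variable D : set TR.
Hypothesis mD : measurable D.
Implicit Types (s : seq (set TR * H)) (t : TR) (h : H).

Definition sval s t : H := \sum_(Eh <- s) \1_(Eh.1) t *: Eh.2.
Definition sint s : H := \sum_(Eh <- s) fine (lam Eh.1) *: Eh.2.
Definition steps s := forall k, (k < size s)%N -> let Eh := nth (set0, 0) s k in
  [/\ measurable Eh.1, Eh.1 `<=` D & (lam Eh.1 < +oo)%E].

Lemma steps_cons Eh s : steps (Eh :: s) ->
  [/\ measurable Eh.1, Eh.1 `<=` D, (lam Eh.1 < +oo)%E & steps s].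
Proof. by move=> hs; have [] := hs 0%N isT; split => // k ks; exact: (hs k.+1). Qed.

Lemma sval_cons Eh s t : sval (Eh :: s) t = \1_(Eh.1) t *: Eh.2 + sval s t.
Proof. by rewrite /sval big_cons. Qed.

Lemma sint_cons Eh s : sint (Eh :: s) = fine (lam Eh.1) *: Eh.2 + sint s.
Proof. by rewrite /sint big_cons. Qed.

Lemma indic_itg (E : set TR) : measurable E -> E `<=` D -> (lam E < +oo)%E ->
  lam.-integrable D (EFin \o \1_E) /\ \int[lam]_(t in D) \1_E t = fine (lam E).
Proof.
move=> mE ED fE; have e := integral_indic lam mD mE.
have eI : E `&` D = E by apply/setIidl.
rewrite eI in e; split; last by rewrite /Rintegral e.
apply/integrableP; split; first by apply/measurable_EFinP; exact: measurable_indic.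
under eq_integral do rewrite /= ger0_norm ?indicE//.
by under eq_integral do rewrite -indicE; rewrite e.
Qed.

Lemma sval_ip s h : steps s -> lam.-integrable D (EFin \o (fun t => ip (sval s t) h)) /\
  \int[lam]_(t in D) ip (sval s t) h = ip (sint s) h.
Proof.
elim: s => [_|Eh s IH /steps_cons[mE ED fE hs]].
  rewrite /sint /sval; under eq_fun do rewrite big_nil ip0l.
  by rewrite big_nil ip0l; split; [exact: integrable0|rewrite Rintegral_cst// mul0r].
have [i1 e1] := IH hs; have [i2 e2] := indic_itg mE ED fE.
have E t : ip (sval (Eh :: s) t) h = ip Eh.2 h * \1_(Eh.1) t + ip (sval s t) h.
  by rewrite sval_cons ipDl ipZl mulrC.
rewrite (funext E).
split; first by apply: itgD => //; exact: itgZ.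
by rewrite RintegralD//; [rewrite RintegralZl// e1 e2 sint_cons ipDl ipZl mulrC|exact: itgZ].
Qed.

Lemma sval_ip_meas s (g : TR -> H) : steps s -> (forall h, measurable_fun D (fun t => ip h (g t))) ->
  measurable_fun D (fun t => ip (sval s t) (g t)).
Proof.
move=> + mg; elim: s => [_|Eh s IH /steps_cons[mE ED fE hs]].
  by rewrite /sval; under eq_fun do rewrite big_nil ip0l; exact: measurable_cst.
under eq_fun do rewrite sval_cons ipDl ipZl; apply: measurable_funD; last exact: IH.
by apply: measurable_funM => //; exact: measurable_indic.
Qed.

Lemma sval_nrm_meas s s' : steps s -> steps s' ->
  measurable_fun D (fun t => nrm (sval s t - sval s' t)).
Proof.
move=> hs hs'; have m1 s1 s2 : steps s1 -> steps s2 ->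
    measurable_fun D (fun t => ip (sval s1 t) (sval s2 t)).
  move=> h1 h2; apply: sval_ip_meas => // h; under eq_fun do rewrite ipC.
  exact: itg_meas (sval_ip h h2).1.
apply: (@measurableT_comp _ _ _ _ _ _ (@Num.sqrt R)).
  apply: continuous_measurable_fun; exact: sqrt_continuous.
under eq_fun do rewrite ipBl !ipBr.
by do ![apply: measurable_funB|exact: m1].
Qed.

Lemma sval_nrm_le s t : nrm (sval s t) <= \sum_(Eh <- s) nrm Eh.2 * \1_(Eh.1) t.
Proof.
elim: s => [|Eh s IH]; first by rewrite /sval !big_nil snorm0.
rewrite sval_cons big_cons; apply: le_trans (snormD _ _ _) _; apply: lerD => //.
by rewrite snormZ indicE ger0_norm ?ler0n// mulrC.
Qed.

Lemma sval_sub_itg s s' : steps s -> steps s' ->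
  lam.-integrable D (EFin \o (fun t => nrm (sval s t - sval s' t))).
Proof.
move=> hs hs'.
have key s1 : steps s1 -> lam.-integrable D (EFin \o (fun t => \sum_(Eh <- s1) nrm Eh.2 * \1_(Eh.1) t)).
  elim: s1 => [_|Eh s1 IH /steps_cons[mE ED fE h1]].
    by under eq_fun do rewrite big_nil; exact: integrable0.
  under eq_fun do rewrite big_cons; apply: itgD => //; last exact: IH.
  by apply: itgZ => //; have [] := indic_itg mE ED fE.
apply: (itg_le mD (sval_nrm_meas hs hs') _ (itgD mD (key _ hs) (key _ hs'))) => t _.
rewrite ger0_norm ?snorm_ge0//; apply: le_trans (snormB _ _ _) _.
by apply: lerD; exact: sval_nrm_le.
Qed.

(** Testing against [x = sint s - sint s'] itself brings the estimate to a scalar integral. *)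
Lemma sint_nrm s s' : steps s -> steps s' ->
  nrm (sint s - sint s') <= \int[lam]_(t in D) nrm (sval s t - sval s' t).
Proof.
move=> hs hs'; set x := sint s - sint s'.
have [i1 e1] := sval_ip x hs; have [i2 e2] := sval_ip x hs'.
have i3 := sval_sub_itg hs hs'.
have h : nrm x * nrm x <= (\int[lam]_(t in D) nrm (sval s t - sval s' t)) * nrm x.
  rewrite -expr2 snorm_sqr {1}/x ipBl -e1 -e2 -RintegralB// mulrC -RintegralZl//.
  apply: Rint_le => //; [exact: itgB|exact: itgZ|].
  by move=> t _; rewrite -ipBl mulrC; exact: ip_le_norm.
have := snorm_ge0 ip x; rewrite le_eqVlt => /predU1P[<-|x0].
  by apply: Rintegral_ge0 => t _; exact: snorm_ge0.
by move: h; rewrite ler_pM2r.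
Qed.

Section limit_of_steps.
Hypothesis Hc : scomplete ip.
Variables (g : TR -> H) (S : nat -> seq (set TR * H)) (G : TR -> R).
Hypotheses (hS : forall k, steps (S k)) (Gi : lam.-integrable D (EFin \o G)).
Hypothesis gG : forall k t, D t -> nrm (g t - sval (S k) t) <= G t.
Hypothesis gS : forall t, D t -> (fun k => nrm (g t - sval (S k) t)) @ \oo --> (0 : R).
Let err k t := nrm (g t - sval (S k) t).

Lemma err_meas k : measurable_fun D (err k).
Proof.
apply: (@measurable_fun_cvg _ _ _ D (fun l t => nrm (sval (S l) t - sval (S k) t)) (err k)) => [l|t Dt]; first exact: sval_nrm_meas.
have -> : err k t = nrm (g t - sval (S k) t) by [].
have c : scvg ip (fun l => sval (S l) t - sval (S k) t) (g t - sval (S k) t).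
  apply: scvgB; last exact: scvg_cst.
  by apply/scvgP; under eq_fun do rewrite snormBC; exact: gS.
exact: scvg_snorm c.
Qed.

Lemma err_itg k : lam.-integrable D (EFin \o err k).
Proof.
apply: (itg_le mD (err_meas k) _ Gi) => t Dt.
by rewrite ger0_norm ?snorm_ge0//; exact: gG.
Qed.

Lemma err_cvg : (fun k => \int[lam]_(t in D) err k t) @ \oo --> (0 : R).
Proof.
have -> : 0 = \int[lam]_(t in D) (cst 0 t) :> R by rewrite Rintegral_cst// mul0r.
apply: (Rint_cvg mD (g := G) _ _ _ _ _).2 => //.
- by move=> k; exact: err_meas.
- by apply: aeW => t Dt; exact: gS.
- by apply: aeW => t k Dt; rewrite ger0_norm ?snorm_ge0//; exact: gG.
Qed.

(** The step integrals are Cauchy because the errors tend to 0 in mean. The exchange of integral and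
    scalar product is recorded along with existence, since it is how the integrals are computed
    later. *)
Lemma bochner_exists : exists J, scvg ip (fun k => sint (S k)) J /\
  forall h, lam.-integrable D (EFin \o (fun t => ip (g t) h)) /\
    ip J h = \int[lam]_(t in D) ip (g t) h.
Proof.
have cS : scauchy ip (fun k => sint (S k)).
  move=> e e0; have [N _ HN] := (cvgrPdist_lt _ _).1 err_cvg _ (divr_gt0 e0 (ltr0Sn _ 1)).
  have Hl l : (N <= l)%N -> \int[lam]_(t in D) err l t < e / 2.
    by move=> /HN /=; rewrite sub0r normrN => /(le_lt_trans (ler_norm _)).
  exists N.
  move=> i j Ni Nj.
  have hi := Hl _ Ni; have hj := Hl _ Nj.
  apply: le_lt_trans (sint_nrm (@hS i) (@hS j)) _.
  apply: (@le_lt_trans _ _ (\int[lam]_(t in D) err i t + \int[lam]_(t in D) err j t)).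
    rewrite -RintegralD//; [|exact: err_itg|exact: err_itg].
    apply: Rint_le => //; [exact: sval_sub_itg|by apply: itgD => //; exact: err_itg|].
    move=> t _; rewrite /err (snormBC _ (g t)); exact: snormB_le.
  by move: hi hj; lra.
have [J hJ] := Hc cS; exists J; split => // h.
have mg : measurable_fun D (fun t => ip (g t) h).
  apply: (measurable_fun_cvg (fun l => itg_meas (sval_ip h (@hS l)).1)) => t Dt.
  by apply: scvg_ip; apply/scvgP; under eq_fun do rewrite snormBC; exact: gS.
have d k t : `|ip (g t) h - ip (sval (S k) t) h| <= nrm h * err k t.
  by rewrite -ipBl mulrC; exact: ip_le.
have i0 := (sval_ip h (@hS 0%N)).1.
have gi : lam.-integrable D (EFin \o (fun t => ip (g t) h)).
  apply: (@itg_le _ _ _ _ _ mD _ (fun t => `|ip (sval (S 0%N) t) h| + nrm h * err 0%N t)) => //.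
    move=> t Dt; have := d 0%N t; move: (ip (g t) h) (ip (sval (S 0%N) t) h) => a b hab.
    have := ler_normD (a - b) b; rewrite subrK => h2; apply: le_trans h2 _.
    by rewrite addrC lerD2l.
  apply: itgD => //; last by apply: itgZ => //; exact: err_itg.
  by have := integrable_norm i0; apply: eq_integrable.
split => //; apply: (cvg_unique _ (scvg_ip (y := h) hJ)) => //.
rewrite (_ : (fun k => ip _ h) = (fun k => \int[lam]_(t in D) ip (sval (S k) t) h)) /=; last first.
  by apply/funext => k; rewrite (sval_ip h (@hS k)).2.
apply/cvgrPdist_le => e e0.
have c : (fun k => nrm h * \int[lam]_(t in D) err k t) @ \oo --> nrm h * 0.
  by apply: cvgMl_tmp; exact: err_cvg.
rewrite mulr0 in c; have [N _ HN] := (cvgrPdist_le _ _).1 c _ e0; exists N => // k /HN /=.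
rewrite sub0r normrN => /(le_trans (ler_norm _)); apply: le_trans.
have ik := (sval_ip h (@hS k)).1.
rewrite -RintegralB//; apply: le_trans (le_normr_Rintegral _ _) _ => //; first exact: itgB.
rewrite -RintegralZl//; last exact: err_itg.
apply: (Rint_le mD _ (itgZ mD (nrm h) (err_itg k))) => [|t _]; last exact: d.
by have := integrable_norm (itgB mD gi ik); apply: eq_integrable.
Qed.

End limit_of_steps.

Definition approximates (g : TR -> H) (S : nat -> seq (set TR * H)) J :=
  let err k t := nrm (g t - sval (S k) t) in
  [/\ forall k, steps (S k) /\ measurable_fun D (err k),
      (fun k => \int[lam]_(t in D) (err k t)%:E)%E @ \oo --> 0%E &
      scvg ip (fun k => sint (S k)) J].

Lemma approximates_err g S J : approximates g S J -> exists N, (forall k, (N <= k)%N ->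
    lam.-integrable D (EFin \o (fun t => nrm (g t - sval (S k) t)))) /\
  (fun k => \int[lam]_(t in D) nrm (g t - sval (S k) t)) @ \oo --> (0 : R).
Proof.
move=> [hS ce _]; have [fin cf] := (fine_cvgP _ _).1 ce.
have [N _ HN] := fin; exists N; split => // k /HN /= fk.
apply/integrableP; split; first by apply/measurable_EFinP; have [] := hS k.
under eq_integral do rewrite /= ger0_norm ?snorm_ge0//.
by rewrite ltey_eq fk.
Qed.

(* Monotonicity of the Bochner integral tested against h; g itself may fail to be
   Borel on a null set, so it is not written as an integral of ip (g t) h. *)
Lemma bochner_le (g1 g2 : TR -> H) S1 S2 J1 J2 h (c : TR -> R) : approximates g1 S1 J1 -> approximates g2 S2 J2 ->
  lam.-integrable D (EFin \o c) -> {ae lam, forall t, D t -> ip (g1 t - g2 t) h <= c t} ->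
  ip (J1 - J2) h <= \int[lam]_(t in D) c t.
Proof.
move=> a1 a2 ci gc; have [N1 [i1 c1]] := approximates_err a1; have [N2 [i2 c2]] := approximates_err a2.
have [h1 _ s1] := a1; have [h2 _ s2] := a2.
have cL : (fun k => ip (sint (S1 k) - sint (S2 k)) h) @ \oo --> ip (J1 - J2) h.
  by apply: scvg_ip; exact: scvgB.
have cR : (fun k => \int[lam]_(t in D) c t + nrm h * (\int[lam]_(t in D) nrm (g1 t - sval (S1 k) t) +
    \int[lam]_(t in D) nrm (g2 t - sval (S2 k) t))) @ \oo --> \int[lam]_(t in D) c t.
  rewrite -[X in _ --> X]addr0 -(mulr0 (nrm h)) -(addr0 (0 : R)).
  apply: cvgD; first exact: cvg_cst.
  by apply: cvgMl_tmp; exact: cvgD.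
apply: (ler_cvg_to cL cR); exists (maxn N1 N2) => // k /=; rewrite geq_max => /andP[k1 k2].
have [j1 e1] := sval_ip h (h1 k).1; have [j2 e2] := sval_ip h (h2 k).1.
have m1 := i1 _ k1; have m2 := i2 _ k2.
rewrite ipBl -e1 -e2 -RintegralB// -RintegralD// -RintegralZl//; last exact: itgD.
have i4 := itgZ mD (nrm h) (itgD mD m1 m2).
rewrite -RintegralD//; apply: Rint_ae_le => //; [exact: itgB|exact: itgD|].
apply: filterS gc => t ht Dt; rewrite -ipBl.
have -> : sval (S1 k) t - sval (S2 k) t =
    (g1 t - g2 t) - (g1 t - sval (S1 k) t) + (g2 t - sval (S2 k) t).
  by rewrite opprB (addrC (g1 t - g2 t)) (addrA (_ - g1 t)) subrK addrA subrK.
rewrite ipDl ipBl -addrA lerD//; first exact: ht.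
rewrite mulrDr; apply: lerD.
  rewrite -ipNl mulrC -(snormN _ (g1 t - _)); exact: ip_le_norm.
by rewrite mulrC; exact: ip_le_norm.
Qed.

End bochner.

(** * Bochner integrals of right-continuous functions by Riemann sums *)

Section riemann_steps.
Variables (R : realType) (H : lmodType R) (ip : semi_ip H).
Local Notation nrm := (snorm ip).
Local Notation TR := (measurableTypeR R).
Local Notation lam := (@lebesgue_measure R).
Local Notation D := ([set` `]0%R, +oo[ ] : set TR).
Variables (g : TR -> H) (B : nat) (M : R).
Hypothesis gM : forall t : R, 0 < t -> nrm (g t) <= M.
Hypothesis gB : forall t : R, B%:R <= t -> g t = 0.
Hypothesis gr : forall t e : R, 0 < t -> 0 < e -> exists2 d, 0 < d &
  forall s, t <= s -> s < t + d -> nrm (g s - g t) < e.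

Lemma half_lineE (t : R) : D t = (0 < t) :> Prop.
Proof. by rewrite /= in_itv/= andbT. Qed.

Lemma bounded_itv_fin b1 b2 (x y : R) :
  (lam [set` Interval (BSide b1 x) (BSide b2 y)] < +oo)%E.
Proof. by rewrite lebesgue_measure_itv/=; case: ifP => // _; rewrite -EFinB ltry. Qed.

Let node k i : R := i%:R / k.+1%:R.
Let cell k i : set TR := [set` `[node k i, node k i.+1[ ] `&` D.
(** Each cell carries the value at its right end point: the integrand is only known to be continuous
    from the right. *)
Let S k := [seq (cell k i, g (node k i.+1)) | i <- iota 0 (B * k.+1)].

Lemma riemann_steps k : steps D (S k).
Proof.
move=> i; rewrite size_map size_iota => iN.
rewrite (nth_map 0%N) ?size_iota// nth_iota// add0n /=; split.
- by apply: measurableI; exact: measurable_itv.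
- exact: subIsetr.
- apply: le_lt_trans (le_measure _ _ _ (@subIsetl _ _ _)) _; rewrite ?inE.
  + by apply: measurableI; exact: measurable_itv.
  + exact: measurable_itv.
  + exact: bounded_itv_fin.
Qed.

Lemma riemann_val k t : 0 < t ->
  exists s, [/\ t <= s, s <= t + k.+1%:R^-1 & sval (S k) t = g s].
Proof.
move=> t0; have k0 : 0 < k.+1%:R :> R by [].
pose j := Num.truncn (t * k.+1%:R).
have tk : 0 <= t * k.+1%:R by rewrite mulr_ge0 ?ltW.
have /andP[jl ju] := truncn_itv tk.
have cE i : \1_(cell k i) t = (i == j)%:R :> R.
  rewrite indicE; congr ((nat_of_bool _)%:R); apply/idP/eqP.
    rewrite inE => -[]; rewrite /= in_itv/= ler_pdivrMr// ltr_pdivlMr// => ij _.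
    by apply/esym/eqP; rewrite truncn_eq.
  move=> ->; rewrite inE; split; rewrite /= in_itv/=; last by rewrite t0.
  by rewrite ler_pdivrMr// ltr_pdivlMr// jl.
have -> : sval (S k) t = if (j < B * k.+1)%N then g (node k j.+1) else 0.
  rewrite /sval big_map; under eq_bigr do rewrite cE.
  case: ifPn => [jN|jN].
    rewrite (bigD1_seq j) ?iota_uniq ?mem_iota//= eqxx scale1r big1 ?addr0//.
    by move=> i /negbTE ->; rewrite scale0r.
  rewrite big1_seq// => i /andP[_]; rewrite mem_iota => /andP[_ iN].
  by case: eqP => [ij|]; [move: jN; rewrite -ij iN|rewrite scale0r].
case: ifPn => [jN|]; last first.
  rewrite -leqNgt => Bj; exists t; split; rewrite ?lerDl ?invr_ge0//.
  rewrite gB//; have := le_trans _ jl; move=> /(_ (B * k.+1)%:R).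
  by rewrite ler_nat Bj natrM ler_pM2r//; exact.
exists (node k j.+1); split=> //.
  by rewrite /node ler_pdivlMr// ltW.
by rewrite /node ler_pdivrMr// mulrDl mulVf ?gt_eqF// -natr1 lerD2r.
Qed.

Lemma riemann_exists : scomplete ip -> exists S J, approximates ip D g S J /\
  forall h, lam.-integrable D (EFin \o (fun t => ip (g t) h)) /\
    ip J h = \int[lam]_(t in D) ip (g t) h.
Proof.
move=> Hc; have mD : measurable D by exact: measurable_itv.
pose E : set TR := [set` `]0%R, B%:R] ].
have mE : measurable E by exact: measurable_itv.
have [Gi _] : lam.-integrable D (EFin \o \1_E) /\ \int[lam]_(t in D) \1_E t = fine (lam E).
  apply: indic_itg => //.
    by move=> t; rewrite half_lineE /E /= in_itv/= => /andP[].
  exact: bounded_itv_fin.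
have Gi2 := itgZ mD (M + M) Gi.
have gG k t : D t -> nrm (g t - sval (S k) t) <= (M + M) * \1_E t.
  rewrite half_lineE => t0; have [s [ts _ ->]] := riemann_val k t0.
  have [tB|Bt] := leP t B%:R; last first.
    rewrite (gB (ltW Bt)) (gB (le_trans (ltW Bt) ts)) subrr snorm0.
    by rewrite mulr_ge0 ?indicE// addr_ge0//; apply: le_trans (gM t0); exact: snorm_ge0.
  have -> : \1_E t = 1 :> R by rewrite indicE mem_set// /E /= in_itv/= t0.
  rewrite mulr1; apply: le_trans (snormB _ _ _) _.
  by apply: lerD; apply: gM => //; exact: lt_le_trans ts.
have gS t : D t -> (fun k => nrm (g t - sval (S k) t)) @ \oo --> (0 : R).
  rewrite half_lineE => t0; apply/cvgrPdist_lt => e e0.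
  have [d d0 hd] := gr t0 e0; have [N HN] := invS_lt d0; exists N => // k /HN kd /=.
  have [s [ts sk ->]] := riemann_val k t0.
  rewrite sub0r normrN ger0_norm ?snorm_ge0// snormBC; apply: hd => //.
  by apply: le_lt_trans sk _; rewrite ltrD2l.
have [J [cJ hJ]] := bochner_exists mD Hc riemann_steps Gi2 gG gS.
exists S, J; split=> //; split=> // [k|].
  split; [exact: riemann_steps|exact: (err_meas mD riemann_steps gS)].
apply: cvg_EFin (err_cvg mD riemann_steps Gi2 gG gS); apply: nearW => k.
by rewrite Rint_fin//; exact: (err_itg mD riemann_steps Gi2 gG gS).
Qed.

End riemann_steps.

Section half_line.
Variable R : realType.
Local Notation TR := (measurableTypeR R).
Local Notation lam := (@lebesgue_measure R).
Local Notation D := ([set` `]0%R, +oo[ ] : set TR).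

Lemma itv_itg (E : set TR) b1 b2 (x y : R) : measurable E ->
  lam.-integrable E (EFin \o \1_[set` Interval (BSide b1 x) (BSide b2 y)]).
Proof.
move=> mE; set I := [set` _]; have mI : measurable (I : set TR) by exact: measurable_itv.
apply/integrableP; split; first by apply/measurable_EFinP; exact: measurable_indic.
under eq_integral do rewrite /= ger0_norm ?indicE//.
under eq_integral do rewrite -indicE; rewrite (integral_indic lam mE mI).
apply: le_lt_trans (bounded_itv_fin b1 b2 x y).
by apply: le_measure; rewrite ?inE//; exact: measurableI.
Qed.

Lemma bounded_supp_itg (E : set TR) (p : TR -> R) (a b M : R) : measurable E -> measurable_fun E p ->
  (forall t, `|p t| <= M) -> (forall t, ~~ (a <= t <= b) -> p t = 0) ->
  lam.-integrable E (EFin \o p).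
Proof.
move=> mE mp pM p0; apply: (itg_le mE mp _ (itgZ mE M (itv_itg true false a b mE))) => t _.
rewrite indicE; case: (boolP (a <= t <= b)) => [h|/p0 ->].
  by rewrite mem_set/= ?in_itv// mulr1.
by rewrite normr0 mulr_ge0// (le_trans _ (pM t)).
Qed.

Lemma shift_measurable (h : R) : measurable_fun [set: TR] ((fun t => t + h) : TR -> TR).
Proof.
have mf : measurable_fun [set: R] (fun x : R => x + h) by exact: measurable_funD.
exact: mf.
Qed.

Lemma shift_integral (p : TR -> R) (h : R) : lam.-integrable setT (EFin \o p) ->
  lam.-integrable setT (EFin \o (fun t => p (t + h))) /\
  \int[lam]_t p (t + h) = \int[lam]_t p t.
Proof.
have i A : measurable A -> lam ((fun t : TR => t + h) @^-1` A) = lam A.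
  exact: lebesgue_translate.
by move=> pi; split; [exact: (integrable_invariant (shift_measurable h) i)|
  exact: (Rintegral_invariant (shift_measurable h) i)].
Qed.

Lemma lipschitz_measurable (p : TR -> R) (E : set TR) L : measurable E ->
  (forall s t, `|p t - p s| <= L * `|t - s|) -> measurable_fun E p.
Proof.
move=> mE pL; have L0 : 0 <= L.
  by have := le_trans (normr_ge0 _) (pL 0 1); rewrite subr0 normr1 mulr1.
have c : continuous (p : R -> R).
  move=> x; apply/cvgrPdist_lt => e e0; near=> y.
  apply: le_lt_trans (pL _ _) _; apply: (@le_lt_trans _ _ ((L + 1) * `|x - y|)).
    by apply: ler_wpM2r; rewrite ?lerDl.
  rewrite mulrC -ltr_pdivlMr ?ltr_wpDl//; near: y.
  by apply: cvgr_dist_lt; rewrite ?divr_gt0 ?ltr_wpDl//; exact: cvg_id.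
apply: (measurable_funS measurableT (@subsetT _ E)).
exact: continuous_measurable_fun c.
Unshelve. all: end_near.
Qed.

(* The difference quotients of p have integral 0 by translation invariance. *)
Lemma right_derivative_integral (p q : TR -> R) (a b L : R) :
  a <= b -> (forall s t, `|p t - p s| <= L * `|t - s|) ->
  (forall t, ~~ (a <= t <= b) -> p t = 0) ->
  (forall t, (fun k => k.+1%:R * (p (t + k.+1%:R^-1) - p t)) @ \oo --> q t) ->
  \int[lam]_t q t = 0.
Proof.
move=> ab pL p0 pq; have L0 : 0 <= L.
  by have := le_trans (normr_ge0 _) (pL 0 1); rewrite subr0 normr1 mulr1.
have mp : measurable_fun [set: TR] p by exact: lipschitz_measurable pL.
have pM t : `|p t| <= L * (b - a + 1).
  case: (boolP (a <= t <= b)) => [/andP[h1 h2]|/[dup] h /p0 ->].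
    have := pL (b + 1) t; rewrite (p0 (b + 1)) ?subr0; last first.
      by rewrite negb_and -!ltNge ltrDl ltr01 orbT.
    move=> /le_trans; apply; apply: ler_wpM2l => //.
    by rewrite distrC ger0_norm; lra.
  by rewrite normr0 mulr_ge0//; lra.
have pi := bounded_supp_itg measurableT mp pM p0.
(* The steps are at most 1, so all the quotients vanish off [[a - 1, b]] and are bounded by [L]
   there. *)
have dL k (t : TR) : `|k.+1%:R * (p (t + k.+1%:R^-1) - p t)| <= L * \1_([set` `[a - 1, b]] : set TR) t.
  have k0 : 0 < k.+1%:R :> R by [].
  rewrite indicE; case: (boolP (a - 1 <= t <= b)) => [h|h].
    rewrite mem_set/= ?in_itv// mulr1 normrM (gtr0_norm k0).
    apply: (@le_trans _ _ (k.+1%:R * (L * k.+1%:R^-1))).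
      apply: ler_wpM2l; first exact: ltW.
      by have := pL t (t + k.+1%:R^-1); rewrite addrAC subrr add0r [`|_^-1|]ger0_norm ?invr_ge0.
    by rewrite mulrCA divff ?gt_eqF// mulr1.
  have k1 : k.+1%:R^-1 <= 1 :> R by rewrite invf_le1// ler1n.
  have k2 : 0 < k.+1%:R^-1 :> R by rewrite invr_gt0.
  rewrite !p0 ?subrr ?mulr0 ?normr0 ?mulr_ge0//; apply: contraNN h => /andP[];
    move: k1 k2; move: (k.+1%:R^-1 : R) => y *; apply/andP; split; lra.
apply: (Rintegral_quotient0 (tau := fun k (t : TR) => t + k.+1%:R^-1) _ _ pi
  (itgZ measurableT L (itv_itg true false (a - 1) b measurableT)) dL pq) => k.
  exact: shift_measurable.
exact: lebesgue_translate.
Qed.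

End half_line.

Section half_line_tests.
Variable R : realType.

Lemma max_lipschitz (a x y : R) : `|Num.max a x - Num.max a y| <= `|x - y|.
Proof.
have := ler_norm (x - y); have := ler_norm (y - x); rewrite distrC.
move: (`|x - y|) => z h1 h2; rewrite ler_norml.
by case: (leP a x); case: (leP a y) => *; apply/andP; split; lra.
Qed.

Lemma min_lipschitz (a x y : R) : `|Num.min a x - Num.min a y| <= `|x - y|.
Proof.
have := ler_norm (x - y); have := ler_norm (y - x); rewrite distrC.
move: (`|x - y|) => z h1 h2; rewrite ler_norml.
by case: (leP a x); case: (leP a y) => *; apply/andP; split; lra.
Qed.

Implicit Types (phi : R -> R) (O : set R).

(** The support stays away from 0, where no bound on the derivative of the flow is available. *)
Lemma test_half_line phi : test_fun (`]0, +oo[ : set R) phi -> exists a b, [/\ 0 < a, a <= b &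
  forall t, ~~ (a <= t <= b) -> phi t = 0 /\ 'D_1 phi t = 0].
Proof.
move=> tp; have [_ cp sp] := tp.
have [M0 [Mr HM]] := compact_bounded cp.
have nK0 : ~ tsupp phi 0 by move=> /sp /=; rewrite in_itv/= ltxx.
have oC : open (~` tsupp phi) by rewrite openC; exact: closed_closure.
have /nbhs_ballP[a /= a0 Ha] := open_nbhs_nbhs (conj oC nK0).
exists a, (Num.max a (`|M0| + 1)); split => //; first by rewrite le_max lexx.
move=> t h; suff nt : ~ tsupp phi t.
  have tK : test_fun (tsupp phi) phi by have [sm cm _] := tp; split.
  by split; [exact: tsupp_out|exact: (test_out (test_derive (1 : R) tK) nt)].
apply: contraNnot h => kt; have t0 := sp _ kt; rewrite /= in_itv/= andbT in t0.
rewrite leNgt le_max; apply/andP; split.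
  apply/negP => ta; apply: (Ha t) kt; rewrite /ball/= sub0r normrN gtr0_norm//.
apply/orP; right; apply: le_trans (ler_norm _) _; apply: HM kt.
by rewrite (le_lt_trans (ler_norm _))// ltrDl.
Qed.

End half_line_tests.

(** * The right derivative is a weak derivative *)

Section weak_derivative.
Variables (R : realType) (H : lmodType R) (ip : semi_ip H).
Hypothesis Hc : scomplete ip.
Local Notation nrm := (snorm ip).
Local Notation TR := (measurableTypeR R).
Local Notation lam := (@lebesgue_measure R).
Local Notation D := ([set` `]0%R, +oo[ ] : set TR).

Definition weak_deriv (U V : R -> H) := forall phi, test_fun (`]0, +oo[ : set R) phi ->
  exists S1 J S2 K, [/\ approximates ip D (fun t => 'D_1 phi t *: U t) S1 J,
    approximates ip D (fun t => phi t *: V t) S2 K & nrm (J + K) = 0].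

Lemma bochner_prod (psi : R -> R) (w : R -> H) (a b M N : R) : 0 < a -> continuous psi ->
  (forall t, ~~ (a <= t <= b) -> psi t = 0) -> (forall t, `|psi t| <= M) ->
  (forall t, a <= t <= b -> nrm (w t) <= N) ->
  (forall t e, 0 < t -> 0 < e -> exists2 d, 0 < d &
     forall h, 0 <= h -> h < d -> nrm (w (t + h) - w t) < e) ->
  exists S J, approximates ip D (fun t => psi t *: w t) S J /\
    forall h, lam.-integrable D (EFin \o (fun t => ip (psi t *: w t) h)) /\
      ip J h = \int[lam]_(t in D) ip (psi t *: w t) h.
Proof.
move=> a0 cpsi psi0 psiM wN wr.
apply: (@riemann_exists _ _ ip _ (Num.truncn b).+1 (M * Num.max 0 N) _ _ _ Hc) => [t t0|t bt|t e t0 e0].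
- have M0 := le_trans (normr_ge0 _) (psiM t).
  rewrite snormZ; case: (boolP (a <= t <= b)) => [/wN h|/psi0 ->].
    by apply: ler_pM; rewrite ?snorm_ge0// le_max h orbT.
  by rewrite normr0 mul0r mulr_ge0// le_max lexx.
- rewrite psi0 ?scale0r// negb_and -!ltNge (lt_le_trans _ bt) ?orbT//.
  exact: truncnS_gt.
- have M1 : 0 < M + 1 by rewrite ltr_wpDl// (le_trans (normr_ge0 _) (psiM t)).
  have n1 : 0 < nrm (w t) + 1 by rewrite ltr_wpDl// snorm_ge0.
  have e2 : 0 < e / 2 by rewrite divr_gt0.
  have [d1 d10 H1] := wr t _ t0 (divr_gt0 e2 M1).
  have /cvgrPdist_lt/(_ _ (divr_gt0 e2 n1))/nbhs_ballP[d2 /= d20 H2] := cpsi t.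
  exists (Num.min d1 d2); first by rewrite lt_min d10.
  move=> s ts; rewrite -ltrBlDl lt_min => /andP[s1 s2].
  have -> : psi s *: w s - psi t *: w t = psi s *: (w s - w t) + (psi s - psi t) *: w t.
    by rewrite scalerBr scalerBl addrA subrK.
  apply: le_lt_trans (snormD _ _ _) _; rewrite !snormZ (splitr e); apply: ltr_leD.
    have := H1 (s - t); rewrite (addrC t (s - t)) subrK subr_ge0 => /(_ ts s1); rewrite ltr_pdivlMr// => h.
    apply: le_lt_trans h; rewrite mulrC; apply: ler_wpM2l; first exact: snorm_ge0.
    by rewrite (le_trans (psiM s))// lerDl.
  have := H2 s; rewrite /ball/= distrC ger0_norm ?subr_ge0// => /(_ s2).
  rewrite distrC ltr_pdivlMr// => /ltW; apply: le_trans.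
  by apply: ler_wpM2l => //; rewrite lerDl.
Qed.

Variables u v : R -> H.
Hypothesis v_lim : forall t, 0 < t -> forall e, 0 < e -> exists2 d, 0 < d &
  forall h, 0 < h -> h < d -> nrm (h^-1 *: (u (t + h) - u t) - v t) < e.
Hypothesis v_rc : forall t e, 0 < t -> 0 < e -> exists2 d, 0 < d &
  forall h, 0 <= h -> h < d -> nrm (v (t + h) - v t) < e.
Hypothesis v_decr : forall s t, 0 < s -> s <= t -> nrm (v t) <= nrm (v s).
Hypothesis u_lip : forall t h, 0 < t -> 0 <= h -> nrm (u (t + h) - u t) <= h * nrm (v t).

Lemma u_lip2 a s t : 0 < a -> a <= s -> a <= t -> nrm (u t - u s) <= nrm (v a) * `|t - s|.
Proof.
move=> a0; wlog st : s t / s <= t.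
  move=> h hs ht; have [/h|/ltW/h h2] := leP s t; first exact.
  by rewrite snormBC distrC; exact: h2.
move=> hs ht; have s0 := lt_le_trans a0 hs.
have := u_lip (h := t - s) s0; rewrite (addrC s (t - s)) subrK subr_ge0 => /(_ st) /le_trans; apply.
by rewrite mulrC ger0_norm ?subr_ge0//; apply: ler_wpM2r; rewrite ?subr_ge0//; exact: v_decr.
Qed.

Lemma ip_u_seq t h : 0 < t ->
  (fun k => ip (u (t + k.+1%:R^-1)) h) @ \oo --> ip (u t) h /\
  (fun k => k.+1%:R * (ip (u (t + k.+1%:R^-1)) h - ip (u t) h)) @ \oo --> ip (v t) h.
Proof.
move=> t0; split.
  apply: scvg_ip => e e0; have n1 : 0 < nrm (v t) + 1 by rewrite ltr_wpDl// snorm_ge0.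
  have [N HN] := invS_lt (divr_gt0 e0 n1); exists N => k /HN; rewrite ltr_pdivlMr// => he.
  apply: le_lt_trans (u_lip t0 _) _; first by rewrite invr_ge0.
  by apply: le_lt_trans he; apply: ler_wpM2l; rewrite ?invr_ge0// lerDl.
have -> : (fun k => k.+1%:R * (ip (u (t + k.+1%:R^-1)) h - ip (u t) h)) =
    (fun k => ip (k.+1%:R^-1^-1 *: (u (t + k.+1%:R^-1) - u t)) h).
  by apply/funext => k; rewrite invrK ipZl ipBl.
apply: scvg_ip => e e0; have [d d0 Hd] := v_lim t0 e0; have [N HN] := invS_lt d0.
by exists N => k /HN kd; apply: Hd kd; rewrite invr_gt0.
Qed.

(** Tested against the vector [h = J + K] itself, the claim concerns the scalar function
    [phi t * ip (u t) h], which is Lipschitz with a right derivative everywhere and compact support,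
    so that this derivative has integral 0. *)
Lemma flow_weak_derivative : weak_deriv u v.
Proof.
move=> phi tp; have [a [b [a0 ab supp]]] := test_half_line tp; have td := test_derive (1 : R) tp.
have [M1 M10 HM1] := test_bounded td; have [M M0 HM] := test_bounded tp.
have [sp sd] := (test_smooth tp, test_smooth td); have [L L0 HL1] := test_lipschitz (1 : R) tp.
have HL s t : `|phi t - phi s| <= L * `|t - s|.
  by have := HL1 s (t - s); rewrite [_ *: _]mulr1 (addrC s) subrK.
pose N := nrm (u a) + nrm (v a) * (b - a).
have uN t : a <= t <= b -> nrm (u t) <= N.
  move=> /andP[ta tb]; apply: le_trans (snorm_leB ip _ (u a)) _; rewrite lerD2l.
  apply: le_trans (u_lip2 a0 (lexx a) ta) _; rewrite ger0_norm ?subr_ge0//.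
  by apply: ler_wpM2l; rewrite ?lerD2r// snorm_ge0.
have [S1 [J [aJ hJ]]] : exists S J, approximates ip D (fun t => 'D_1 phi t *: u t) S J /\
    forall h, lam.-integrable D (EFin \o (fun t => ip ('D_1 phi t *: u t) h)) /\
    ip J h = \int[lam]_(t in D) ip ('D_1 phi t *: u t) h.
  apply: (@bochner_prod _ u a b M1 N) => //; [exact: smooth_continuous|by move=> t /supp[]|].
  move=> t e t0 e0; have n1 : 0 < nrm (v t) + 1 by rewrite ltr_wpDl// snorm_ge0.
  exists (e / (nrm (v t) + 1)); first exact: divr_gt0.
  move=> h h0; rewrite ltr_pdivlMr// => he; apply: le_lt_trans (u_lip t0 h0) _.
  by apply: le_lt_trans he; apply: ler_wpM2l => //; rewrite lerDl.
have [S2 [K [aK hK]]] : exists S K, approximates ip D (fun t => phi t *: v t) S K /\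
    forall h, lam.-integrable D (EFin \o (fun t => ip (phi t *: v t) h)) /\
    ip K h = \int[lam]_(t in D) ip (phi t *: v t) h.
  apply: (@bochner_prod _ v a b M (nrm (v a))) => //; [exact: smooth_continuous|by move=> t /supp[]|].
  by move=> t /andP[h _]; exact: v_decr.
exists S1, J, S2, K; split=> //; set h := J + K.
have [i1 e1] := hJ h; have [i2 e2] := hK h; have mD : measurable D by exact: measurable_itv.
suff : ip h h = 0 by move=> h0; apply/eqP; rewrite -sqrf_eq0 snorm_sqr h0.
rewrite {1}/h ipDl e1 e2 -RintegralD//.
pose q t := 'D_1 phi t * ip (u t) h + phi t * ip (v t) h.
have q0 t : ~~ (a <= t <= b) -> q t = 0 by move=> /supp[f0 f1]; rewrite /q f0 f1 !mul0r addr0.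
have -> : \int[lam]_(t in D) (ip ('D_1 phi t *: u t) h + ip (phi t *: v t) h) = \int[lam]_t q t.
  rewrite Rintegral_mkcond; apply: eq_Rintegral => t _; rewrite patchE; case: ifPn => [_|nD].
    by rewrite !ipZl.
  rewrite q0//; apply: contraNN nD => /andP[ta _]; rewrite inE /= in_itv/= andbT.
  exact: lt_le_trans ta.
apply: (@right_derivative_integral _ (fun t => phi t * ip (u t) h) q a b
  (L * (N * nrm h) + M * (nrm (v a) * nrm h)) ab).
(* Clamping to [[a, b]] makes the estimate global: [u] has a uniform Lipschitz constant only away
   from 0, and [phi] vanishes outside [[a, b]]. *)
- pose cl t := Num.max a (Num.min b t).
  have clab t : a <= cl t <= b.
    by rewrite /cl le_max lexx ge_max ab ge_min lexx.
  have cl_lip s t : `|cl t - cl s| <= `|t - s|.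
    by apply: le_trans (max_lipschitz a _ _) _; exact: min_lipschitz.
  have clE t : phi t * ip (u t) h = phi t * ip (u (cl t)) h.
    case: (boolP (a <= t <= b)) => [/andP[h1 h2]|/supp[-> _]]; last by rewrite !mul0r.
    by rewrite /cl (min_idPr h2) (max_idPr h1).
  move=> s t; rewrite !clE.
  have -> : phi t * ip (u (cl t)) h - phi s * ip (u (cl s)) h =
      (phi t - phi s) * ip (u (cl t)) h + phi s * ip (u (cl t) - u (cl s)) h.
    by rewrite ipBl; ring.
  apply: le_trans (ler_normD _ _) _; rewrite !normrM mulrDl; apply: lerD.
    rewrite mulrAC; apply: ler_pM => //; apply: le_trans (ip_le ip _ _) _.
    by apply: ler_wpM2r; [exact: snorm_ge0|exact: uN].
  rewrite -mulrA; apply: ler_pM => //; apply: le_trans (ip_le ip _ _) _.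
  rewrite mulrAC; apply: ler_wpM2r; first exact: snorm_ge0.
  have /andP[h1 _] := clab t; have /andP[h2 _] := clab s.
  apply: le_trans (u_lip2 a0 h2 h1) _; apply: ler_wpM2l; first exact: snorm_ge0.
  exact: cl_lip.
- by move=> t /supp[-> _]; rewrite mul0r.
- move=> t; have [ta|at_] := ltP t a.
    have at0 : 0 < a - t by rewrite subr_gt0.
    rewrite q0 -?ltNge ?negb_and -?ltNge ?ta//.
    apply/cvgrPdist_lt => e e0; have [k0 Hk] := invS_lt at0; exists k0 => // k /Hk /= ka.
    rewrite (supp t _).1 ?negb_and -?ltNge ?ta// (supp (t + _) _).1.
      by rewrite !mul0r subrr mulr0 subrr normr0.
    by rewrite negb_and -ltNge -ltrBrDl ka.
  have t0 := lt_le_trans a0 at_; have [c1 c2] := ip_u_seq h t0.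
  have -> : (fun k => k.+1%:R * (phi (t + k.+1%:R^-1) * ip (u (t + k.+1%:R^-1)) h - phi t * ip (u t) h)) =
    (fun k => k.+1%:R * (phi (t + k.+1%:R^-1) - phi t) * ip (u (t + k.+1%:R^-1)) h +
      phi t * (k.+1%:R * (ip (u (t + k.+1%:R^-1)) h - ip (u t) h))).
    by apply/funext => k; ring.
  have c3 := derive_seq (@smooth_derivable _ _ _ t (1 : R) sp).
  apply: cvgD; first by apply: cvgM => //; under eq_fun do rewrite -[_^-1]mulr1.
  exact: cvgMl_tmp.
Qed.

End weak_derivative.

(** * Smooth transitions from 0 to 1 *)

Section smooth_steps.
Variable R : realType.
Local Notation TR := (measurableTypeR R).
Local Notation lam := (@lebesgue_measure R).

Lemma bump1_out (r t : R) : ~~ (- r <= t <= r) -> bump1 r t = 0.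
Proof.
move=> h; apply/eqP; rewrite eq_le bump1_ge0 andbT leNgt bump1_gt0.
by apply: contraNN h; rewrite -ler_norml => /ltW.
Qed.

Lemma bump1_itg (E : set TR) (r : R) : measurable E -> lam.-integrable E (EFin \o bump1 r).
Proof.
move=> mE; have c := smooth_continuous (bump1_smooth r).
have [M HM] : exists M, forall t, `|bump1 r t| <= M.
  have t1 : test_fun [set: R] (bump1 r).
    apply: (test_in (K := [set` `[- r, r]])) => //; first exact: bump1_smooth.
      exact: segment_compact.
    move=> t; apply: contraNP => h; apply/eqP/bump1_out.
    by apply/negP => h2; apply: h; rewrite /= in_itv.
  by have [M _ HM] := test_bounded t1; exists M.
apply: (bounded_supp_itg mE _ HM (@bump1_out r)).
apply: (measurable_funS measurableT (@subsetT _ E)).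
exact: continuous_measurable_fun c.
Qed.

(** [Phi] is the normalised primitive of a bump, and [rho] is its derivative, a probability density
    on [[-r, r]]. Differences of translates of [Phi] give the smooth trapezoids. *)
Lemma smooth_step (r : R) : 0 < r -> exists rho Phi : R -> R,
  [/\ smooth Phi /\ (forall t, 'D_1 Phi t = rho t),
      (forall t, 0 <= rho t) /\ (forall t, ~~ (- r <= t <= r) -> rho t = 0),
      lam.-integrable [set: TR] (EFin \o rho) /\ \int[lam]_t rho t = 1,
      {homo Phi : s t / s <= t} /\ (forall t, 0 <= Phi t <= 1) &
      (forall t, t <= - r -> Phi t = 0) /\ (forall t, r <= t -> Phi t = 1)].
Proof.
move=> r0; pose b := bump1 r; have ib := bump1_itg r measurableT.
pose I x : set TR := [set` `]-oo, x] ].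
have mI x : measurable (I x) by exact: measurable_itv.
pose P0 (x : R) := \int[lam]_(t in I x) b t; pose c := \int[lam]_t b t.
have iI x : lam.-integrable [set: TR] (EFin \o (fun t => b t * \1_(I x) t)).
  apply: (itg_le measurableT _ _ ib) => [|t _].
    by apply: measurable_funM; [exact: itg_meas ib|exact: measurable_indic].
  by rewrite normrM ger0_norm ?bump1_ge0// indicE; case: (_ \in _); rewrite ?normr1 ?normr0 ?mulr1 ?mulr0 ?bump1_ge0.
have P0E x : P0 x = \int[lam]_t (b t * \1_(I x) t).
  rewrite /P0 Rintegral_mkcond; apply: eq_Rintegral => t _.
  by rewrite patchE indicE; case: ifP => _; rewrite ?mulr1 ?mulr0.
have P00 x : 0 <= P0 x by apply: Rintegral_ge0 => t _; exact: bump1_ge0.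
have P0c x : P0 x <= c.
  by rewrite P0E; apply: Rint_le => // t _; rewrite ler_piMr ?bump1_ge0.
have P0m s t : s <= t -> P0 s <= P0 t.
  move=> st; rewrite !P0E; apply: Rint_le => // p _; apply: ler_wpM2l; first exact: bump1_ge0.
  rewrite !indicE ler_nat; case: (boolP (p \in I s)) => //; rewrite inE /I/= in_itv/= => ps.
  by rewrite mem_set// /I/= in_itv/= (le_trans ps).
have P0l x : x <= - r -> P0 x = 0.
  move=> xr; rewrite P0E (_ : (fun t => _) = cst 0) ?Rintegral_cst ?mul0r//.
  apply/funext => t; rewrite indicE; case: (boolP (t \in I x)); rewrite ?mulr0// inE /I/= in_itv/= => tx.
  rewrite mulr1; apply/eqP; rewrite eq_le bump1_ge0 andbT leNgt bump1_gt0 -leNgt.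
  by rewrite ler_normr; apply/orP; right; lra.
have P0r x : r <= x -> P0 x = c.
  move=> xr; rewrite P0E; apply: eq_Rintegral => t _; rewrite indicE.
  case: (boolP (t \in I x)); rewrite ?mulr1// notin_setE /I/= in_itv/= => /negP; rewrite -ltNge => tx.
  rewrite mulr0; apply/esym/eqP; rewrite eq_le bump1_ge0 andbT leNgt bump1_gt0 -leNgt.
  by rewrite ler_normr; apply/orP; left; lra.
have dP (x : R) : is_derive x (1 : R) P0 (b x).
  have [d e] : derivable P0 x 1 /\ derive1 P0 x = b x.
    apply: (@continuous_FTC1 R b -oo%O x (x + 1)); rewrite ?ltrDl//.
      exact: bump1_itg.
    by rewrite /= ltNyr.
    exact: smooth_continuous (bump1_smooth r) x.
  by apply: DeriveDef; [exact: d|rewrite -derive1E; exact: e].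
(* If the integral were 0, the primitive would vanish identically, but its derivative at 0 is
   [bump1 r 0 > 0]. *)
have c0 : 0 < c.
  rewrite lt_neqAle (le_trans (P00 0))// andbT eq_sym; apply/eqP => c0.
  have P0z : P0 = cst 0 by apply/funext => x; apply/eqP; rewrite eq_le P00 andbT -c0 P0c.
  have := bump1_gt0 r 0; rewrite normr0 r0 => b0.
  have := dP 0; rewrite P0z => -[_]; rewrite derive_cst => b00.
  by move: b0; rewrite -/b -b00 ltxx.
exists (fun t => c^-1 * b t), (fun t => c^-1 * P0 t); split.
- have dv x v := derive_line v (dP x).
  have sP0 : smooth P0.
    apply: (@smooth_coind _ _ [set f | f = P0 \/ smooth f]); last by left.
    - move=> f [->|/smooth_continuous//] x; apply: differentiable_continuous.
      by apply/derivable1_diffP; exact: (dv x 1).1.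
    - move=> f v [->|sf]; last first.
        by split; [move=> x; exact: smooth_derivable|right; exact: smooth_derive].
      split; first by move=> x; exact: (dv x v).1.
      right; rewrite (funext (fun x => (dv x v).2)); apply: smoothZ; exact: bump1_smooth.
  split; first exact: smoothZ.
  by move=> t; rewrite deriveZ; [rewrite (dv t 1).2 mul1r|exact: (dv t 1).1].
- split => t; first by rewrite mulr_ge0 ?invr_ge0 ?bump1_ge0 ?(ltW c0).
  by move=> h; rewrite /b bump1_out// mulr0.
- split; first exact: itgZ.
  by rewrite RintegralZl// mulVf// gt_eqF.
- split=> [s t st|t]; first by apply: ler_wpM2l; [rewrite invr_ge0 ltW|exact: P0m].
  rewrite mulr_ge0 ?invr_ge0 ?(ltW c0)//= mulrC ler_pdivrMr// mul1r; exact: P0c.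
- by split=> t h; [rewrite P0l// mulr0|rewrite P0r// mulVf// gt_eqF].
Qed.

End smooth_steps.

(** Over [N.+1] equal parts the increments add up to at most [C (t - s)^2 / (N + 1)], which tends to
    0. It stands in for a chain rule for the squared norm. *)
Lemma decr_of_quadratic (R : realType) (f : R -> R) (s t C : R) : s <= t ->
  (forall a b, s <= a -> a <= b -> b <= t -> f b - f a <= C * (b - a) ^+ 2) -> f t <= f s.
Proof.
move=> st fC; pose x N k : R := s + k%:R * ((t - s) / N.+1%:R).
have step N k : (k <= N.+1)%N -> f (x N k) - f s <= k%:R * (C * ((t - s) / N.+1%:R) ^+ 2).
  have d0 : 0 <= (t - s) / N.+1%:R by rewrite divr_ge0// subr_ge0.
  elim: k => [_|k IH kN]; first by rewrite /x !mul0r addr0 subrr.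
  have xx : x N k.+1 - x N k = (t - s) / N.+1%:R by rewrite /x -natr1; ring.
  have := fC (x N k) (x N k.+1); rewrite xx.
  have h1 : s <= x N k by rewrite lerDl mulr_ge0.
  have h2 : x N k <= x N k.+1 by rewrite -subr_ge0 xx.
  have h3 : x N k.+1 <= t.
    rewrite /x -lerBrDl mulrA ler_pdivrMr// mulrC; apply: ler_wpM2l; first by rewrite subr_ge0.
    by rewrite ler_nat.
  move=> /(_ h1 h2 h3); have := IH (ltnW kN); have -> : k.+1%:R = k%:R + 1 :> R by rewrite natr1.
  move: (f (x N k)) (f (x N k.+1)) (f s) (C * ((t - s) / N.+1%:R) ^+ 2) => a b d q.
  rewrite mulrDl mul1r; lra.
rewrite -subr_le0; have := step _ _ (leqnn _); move=> {}step.
have c : (fun N => C * (t - s) ^+ 2 * N.+1%:R^-1) @ \oo --> C * (t - s) ^+ 2 * 0.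
  by apply: cvgMl_tmp; exact: cvg_invS.
rewrite mulr0 in c; apply: (ler_cvg_to (cvg_cst (f t - f s)) c); apply: nearW => N.
have N0 : N.+1%:R != 0 :> R by [].
have := step N; rewrite /x (_ : s + _ = t); last by field.
by rewrite (_ : N.+1%:R * _ = C * (t - s) ^+ 2 * N.+1%:R^-1)//; field.
Qed.

(** * Uniqueness for monotone evolutions *)

Section weak_uniqueness.
Variables (R : realType) (H : lmodType R) (ip : semi_ip H).
Local Notation nrm := (snorm ip).
Local Notation TR := (measurableTypeR R).
Local Notation lam := (@lebesgue_measure R).
Local Notation D := ([set` `]0%R, +oo[ ] : set TR).
Let mD : measurable D. Proof. exact: measurable_itv. Qed.

Lemma shift_half_line (p : R -> R) (r s : R) : r < s -> lam.-integrable [set: TR] (EFin \o p) ->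
  (forall t, ~~ (- r <= t <= r) -> p t = 0) ->
  lam.-integrable D (EFin \o (fun t => p (t - s))) /\
  \int[lam]_(t in D) p (t - s) = \int[lam]_t p t.
Proof.
move=> rs pi p0; have [i1 e1] := shift_integral (- s) pi; split.
  exact: integrableS i1.
rewrite -e1 Rintegral_mkcond; apply: eq_Rintegral => t _; rewrite patchE; case: ifPn => // nD.
rewrite p0//; apply: contraNN nD => /andP[h _]; rewrite inE /= in_itv/= andbT; lra.
Qed.

Definition half_line_continuous (U : R -> H) := forall t e, 0 <= t -> 0 < e -> exists2 d, 0 < d &
  forall s, 0 <= s -> `|s - t| < d -> nrm (U s - U t) < e.

Definition locally_bounded (V : R -> H) := forall a b, 0 < a -> exists M : R,
  {ae lam, forall p : TR, a <= p <= b -> nrm (V p) <= M}.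

Variables U1 V1 U2 V2 : R -> H.
Hypotheses (w1 : weak_deriv ip U1 V1) (w2 : weak_deriv ip U2 V2).
Hypotheses (c1 : half_line_continuous U1) (c2 : half_line_continuous U2).
Let y t := U1 t - U2 t.
Let z t := V1 t - V2 t.

Lemma diff_continuous : half_line_continuous y.
Proof.
move=> t e t0 e0; have e2 : 0 < e / 2 by rewrite divr_gt0.
have [d1 d10 H1] := c1 t0 e2; have [d2 d20 H2] := c2 t0 e2.
exists (Num.min d1 d2); first by rewrite lt_min d10.
move=> s s0; rewrite lt_min => /andP[s1 s2].
have -> : y s - y t = (U1 s - U1 t) - (U2 s - U2 t) by rewrite /y !opprB addrACA [RHS]addrACA [- U2 s - _]addrC.
apply: le_lt_trans (snormB _ _ _) _; rewrite (splitr e).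
by apply: ltrD; [exact: H1|exact: H2].
Qed.

Let y_cont q e : 0 < q -> 0 < e -> exists2 d, 0 < d & forall p, `|p - q| < d -> nrm (y p - y q) < e.
Proof.
move=> q0 e0; have [d d0 Hd] := diff_continuous (ltW q0) e0.
exists (Num.min d q); first by rewrite lt_min d0.
move=> p; rewrite lt_min => /andP[p1 p2]; apply: Hd => //.
by move: p2; rewrite ltr_distl => /andP[]; lra.
Qed.

(* Test with a smooth trapezoid that rises from 0 to 1 around s and falls back around t. *)
Lemma weak_deriv_le_window (s t r c e : R) h : 0 < r -> r < s -> s <= t -> 0 <= c ->
  (forall p, `|p - s| <= r -> ip (y p) h <= ip (y s) h + e) ->
  (forall p, `|p - t| <= r -> ip (y t) h - e <= ip (y p) h) ->
  {ae lam, forall p : TR, s - r <= p <= t + r -> ip (z p) h <= c} ->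
  ip (y t - y s) h <= c * (t - s + 2 * r) + 2 * e.
Proof.
move=> r0 rs st c0 ys yt zc.
have [rho [Phi [[sP dP] [rho0 rho_out] [rhoi rho1] [Pm P01] [Pl Pr]]]] := smooth_step r0.
have dsub a x v : derivable (fun p => Phi (p - a)) x v /\
    'D_v (fun p => Phi (p - a)) x = 'D_v Phi (x - a).
  have q (k v' x' : R) : (k *: v' + x') - a = k *: v' + (x' - a) by rewrite addrA.
  split; first by rewrite (derivable_affine q); exact: smooth_derivable.
  exact: (derive_affine q).
have sPa a : smooth (fun p => Phi (p - a)).
  apply: (@smooth_affine _ _ _ (fun p => p - a) idfun _ Phi) => //.
    by move=> h' v x; rewrite addrA.
  by move=> x; apply: cvgB; [exact: cvg_id|exact: cvg_cst].
pose phi p := Phi (p - s) - Phi (p - t).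
have dphi p : 'D_1 phi p = rho (p - s) - rho (p - t).
  rewrite (_ : phi = (fun p => Phi (p - s)) - (fun p => Phi (p - t)))//.
  rewrite deriveB; [|exact: (dsub s p 1).1|exact: (dsub t p 1).1].
  by rewrite (dsub s p 1).2 (dsub t p 1).2 !dP.
have phi_out p : ~~ (s - r <= p <= t + r) -> phi p = 0.
  rewrite negb_and -!ltNge => /orP[h1|h1]; rewrite /phi.
    by rewrite !Pl ?subrr//; lra.
  by rewrite !Pr ?subrr//; lra.
have phi1 p : 0 <= phi p <= 1.
  rewrite /phi; have /andP[h1 h2] := P01 (p - s); have /andP[h3 h4] := P01 (p - t).
  have h5 := Pm (p - t) (p - s); have h6 : p - t <= p - s by rewrite lerB.
  by move: (h5 h6); lra.
have tphi : test_fun (`]0, +oo[ : set R) phi.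
  apply: (test_in (K := [set` `[s - r, t + r]])); first exact: smoothB (sPa s) (sPa t).
  - exact: segment_compact.
  - by move=> p; apply: contraNP => h1; apply/eqP/phi_out/negP => h2; apply: h1; rewrite /= in_itv.
  - move=> p; rewrite /= !in_itv/= andbT => /andP[h1 _]; lra.
have [S1 [J1 [T1 [K1 [aJ1 aK1 n1]]]]] := w1 tphi.
have [S2 [J2 [T2 [K2 [aJ2 aK2 n2]]]]] := w2 tphi.
have [is_ es] := shift_half_line rs rhoi rho_out.
have [it et] := shift_half_line (lt_le_trans rs st) rhoi rho_out.
(* The derivative of [phi] is a unit mass near [s] minus a unit mass near [t], so [J1 - J2] is a
   difference of averages of [y] around the two times. *)
have hJ : ip (J1 - J2) h <= ip (y s) h - ip (y t) h + 2 * e.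
  have ci := itgB mD (itgZ mD (ip (y s) h + e) is_) (itgZ mD (ip (y t) h - e) it).
  apply: le_trans (bochner_le mD (h := h) aJ1 aJ2 ci _) _.
    apply: aeW => p Dp; rewrite -scalerBr ipZl dphi mulrBl; apply: lerB.
      rewrite mulrC; case: (boolP (- r <= p - s <= r)) => [hp|/rho_out ->].
        by apply: ler_wpM2r => //; apply: ys; rewrite ler_norml.
      by rewrite !mulr0.
    rewrite mulrC; case: (boolP (- r <= p - t <= r)) => [hp|/rho_out ->].
      by apply: ler_wpM2l => //; apply: yt; rewrite ler_norml.
    by rewrite !(mulr0, mul0r).
  rewrite RintegralB//; [|exact: itgZ|exact: itgZ].
  rewrite !RintegralZl// es et rho1; lra.
have hK : ip (K1 - K2) h <= c * (t - s + 2 * r).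
  have ci := itgZ mD c (itv_itg true false (s - r) (t + r) mD).
  apply: le_trans (bochner_le mD (h := h) aK1 aK2 ci _) _.
    apply: filterS zc => p zp Dp; rewrite -scalerBr ipZl indicE.
    case: (boolP (s - r <= p <= t + r)) => [hp|hp].
      rewrite mem_set/= ?in_itv// mulr1; have /andP[f0 f1] := phi1 p.
      apply: le_trans (ler_wpM2l f0 (zp hp)) _; by rewrite ler_piMl.
    by rewrite phi_out// mul0r mulr_ge0.
  rewrite RintegralZl//; last exact: itv_itg.
  apply: ler_wpM2l => //; rewrite (indic_itg _ _ _ _).2//.
  - rewrite lebesgue_measure_itv/= lte_fin; case: ifP => [_|]; last by move/negbT; lra.
    by rewrite -EFinB /=; lra.
  - by move=> p /=; rewrite !in_itv/= andbT => /andP[h1 _]; lra.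
  - exact: bounded_itv_fin.
have : ip (J1 - J2) h + ip (K1 - K2) h = 0.
  rewrite -ipDl addrACA -opprD.
  have a0 x : nrm x = 0 -> ip x h = 0.
    by move=> x0; apply/eqP; rewrite -normr_le0 (le_trans (ip_le _ _ _))// x0 mul0r.
  by rewrite ipBl !a0// subrr.
rewrite [ip (y t - y s) h]ipBl; move: hJ hK.
move: (ip (J1 - J2) h) (ip (K1 - K2) h) (ip (y t) h) (ip (y s) h) (c * _) => a b a' b' q *; lra.
Qed.

Lemma weak_deriv_le (s' s t t' c : R) h : 0 < s' -> s' < s -> s <= t -> t < t' -> 0 <= c ->
  {ae lam, forall p : TR, s' < p < t' -> ip (z p) h <= c} -> ip (y t - y s) h <= c * (t - s).
Proof.
move=> s0 ss st tt c0 zc; apply/ler_addgt0Pr => e e0.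
have s1 := lt_trans s0 ss; have t1 := lt_le_trans s1 st.
have n1 : 0 < nrm h + 1 by rewrite ltr_wpDl// snorm_ge0.
have e4 : 0 < e / 4 by rewrite divr_gt0.
have [d1 d10 H1] := y_cont s1 (divr_gt0 e4 n1).
have [d2 d20 H2] := y_cont t1 (divr_gt0 e4 n1).
have cp1 : 0 < c + 1 by lra.
(* Keeps both averaging windows within the continuity radii and inside []s', t'[], and makes the
   excess [2 * r * c] at most [e / 2]; the two errors [e / 4] account for the other half. *)
pose r := Num.min (Num.min (d1 / 2) (d2 / 2)) (Num.min (Num.min ((s - s') / 2) ((t' - t) / 2)) (e / 4 / (c + 1))).
have r0 : 0 < r by rewrite !lt_min !divr_gt0// ?subr_gt0.
have [r1 r2 r3 r4 r5] : [/\ r <= d1 / 2, r <= d2 / 2, r <= (s - s') / 2, r <= (t' - t) / 2 &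
    r * (c + 1) <= e / 4].
  by rewrite -ler_pdivlMr//; split; rewrite !ge_min lexx ?orbT.
have near_le q a : nrm (y q - y a) < e / 4 / (nrm h + 1) -> `|ip (y q) h - ip (y a) h| <= e / 4 .
  rewrite ltr_pdivlMr// => hq; rewrite -ipBl; apply: le_trans (ip_le _ _ _) _.
  apply: le_trans (ltW hq); apply: ler_wpM2l; [exact: snorm_ge0|by rewrite lerDl].
apply: le_trans (@weak_deriv_le_window s t r c (e / 4) h r0 _ st c0 _ _ _) _.
- by move: r3 s0; lra.
- move=> q hq; have /near_le : nrm (y q - y s) < e / 4 / (nrm h + 1).
    by apply: H1; apply: le_lt_trans hq _; move: r1 d10; lra.
  by rewrite ler_distl => /andP[]; lra.
- move=> q hq; have /near_le : nrm (y q - y t) < e / 4 / (nrm h + 1).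
    by apply: H2; apply: le_lt_trans hq _; move: r2 d20; lra.
  by rewrite ler_distl => /andP[]; lra.
- by apply: filterS zc => q hq /andP[q1 q2]; apply: hq; apply/andP; split; move: r3 r4; lra.
- by rewrite mulrDr; move: r5 r0 c0; nra.
Qed.

(** The scalar estimate with the vector [h = y t - y s]. *)
Lemma weak_deriv_lip (s' s t t' M : R) : 0 < s' -> s' < s -> s <= t -> t < t' -> 0 <= M ->
  {ae lam, forall p : TR, s' < p < t' -> nrm (z p) <= M} -> nrm (y t - y s) <= M * (t - s).
Proof.
move=> s0 ss st tt M0 zM; set h := y t - y s.
have c0 : 0 <= M * nrm h by rewrite mulr_ge0// snorm_ge0.
have : ip h h <= M * nrm h * (t - s).
  apply: (weak_deriv_le s0 ss st tt c0); apply: filterS zM => p hp /hp zp.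
  by apply: le_trans (ip_le_norm _ _ _) _; apply: ler_wpM2r => //; exact: snorm_ge0.
rewrite -snorm_sqr mulrAC expr2; have := snorm_ge0 ip h; rewrite le_eqVlt => /predU1P[<-|h0].
  by rewrite mulr_ge0// subr_ge0.
by rewrite ler_pM2r.
Qed.

Hypotheses (b1 : locally_bounded V1) (b2 : locally_bounded V2).
Hypothesis mono : {ae lam, forall p : TR, 0 < p -> ip (V1 p - V2 p) (U1 p - U2 p) <= 0}.

(** With [y] the difference of the two solutions, [|y b|^2 - |y a|^2 <= 2 ip (y b - y a) (y b)]. On
    a window around [[a, b]] the derivative against [y b] is its product with [y p], nonpositive by
    monotonicity, plus an error of order [b - a]; the increment is therefore quadratic and
    [decr_of_quadratic] applies. *)
Lemma diff_norm_decr s t : 0 < s -> s <= t -> ip (y t) (y t) <= ip (y s) (y s).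
Proof.
move=> s0 st; pose s' := s / 2; pose t' := t + 1.
have s'0 : 0 < s' by rewrite divr_gt0.
have [M1 HM1] := b1 t' s'0; have [M2 HM2] := b2 t' s'0.
pose M := Num.max 0 (M1 + M2); have M0 : 0 <= M by rewrite le_max lexx.
have zM : {ae lam, forall p : TR, s' < p < t' -> nrm (z p) <= M}.
  apply: filterS2 HM1 HM2 => p h1 h2 /andP[p1 p2]; apply: le_trans (snormB _ _ _) _.
  by rewrite le_max; apply/orP; right; apply: lerD; [apply: h1|apply: h2]; rewrite !ltW.
have lip p q : s' < p -> p < t' -> s' < q -> q < t' -> nrm (y q - y p) <= M * `|q - p|.
  move=> p1 p2 q1 q2; have [pq|/ltW qp] := leP p q.
    rewrite ger0_norm ?subr_ge0//; exact: (weak_deriv_lip s'0 p1 pq q2 M0 zM).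
  rewrite snormBC distrC ger0_norm ?subr_ge0//; exact: (weak_deriv_lip s'0 q1 qp p2 M0 zM).
apply: (@decr_of_quadratic _ (fun t => ip (y t) (y t)) s t (4 * (M * M)) st) => a b sa ab bt.
move: (ab); rewrite le_eqVlt => /predU1P[<-|lab]; first by rewrite !subrr expr0n mulr0.
pose a' := Num.max s' (a - (b - a)); pose b' := Num.min t' (b + (b - a)).
have ss : s' < s by rewrite /s'; move: s0; lra.
have a'0 : 0 < a' by rewrite lt_max s'0.
have a'a : a' < a by rewrite gt_max (lt_le_trans ss sa)/=; move: lab; lra.
have bb' : b < b' by rewrite lt_min /t'; apply/andP; split; move: lab bt; lra.
have k0 : 0 <= M * (M * (2 * (b - a))) by rewrite !mulr_ge0 ?subr_ge0.
(* The window extends [[a, b]] by at most its own length on either side, so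
   [|b - p| <= 2 * (b - a)]; one factor [M] bounds [z p], the other is the Lipschitz constant of
   [y]. *)
have zb : {ae lam, forall p : TR, a' < p < b' -> ip (z p) (y b) <= M * (M * (2 * (b - a)))}.
  apply: filterS2 zM mono => p hz hm; rewrite gt_max lt_min => /andP[/andP[p1 p2] /andP[p3 p4]].
  have zp : nrm (z p) <= M by apply: hz; rewrite p1.
  rewrite -[y b](subrK (y p)) ipDr -[leRHS]addr0; apply: lerD.
    apply: le_trans (ip_le_norm _ _ _) _; apply: ler_pM; rewrite ?snorm_ge0//.
    apply: le_trans (lip _ _ p1 p3 _ _) _.
    - exact: lt_le_trans ss (le_trans sa ab).
    - by rewrite /t'; move: bt; lra.
    - by apply: ler_wpM2l => //; rewrite ler_norml; apply/andP; split; move: p2 p4 lab; lra.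
  exact/hm/(lt_trans s'0).
have : ip (y b - y a) (y b) <= M * (M * (2 * (b - a))) * (b - a).
  by have h0 := weak_deriv_le a'0 a'a ab bb' k0 zb; exact: h0.
move: (y a) (y b) => ya yb; have := ip_ge0 ip (yb - ya); rewrite !ipE (ipC ip yb ya).
rewrite (_ : M * _ * _ = 2 * (M * M * (b - a) ^+ 2)); last by ring.
rewrite -[4 * _ * _]mulrA.
move: (ip yb yb) (ip ya yb) (ip ya ya) (M * M * _) => f1 f2 f3 f4; lra.
Qed.

(** Monotonicity is available for positive times only; continuity at 0 carries it to the initial
    time. *)
Lemma evolution_unique t : nrm (y 0) = 0 -> 0 <= t -> nrm (y t) = 0.
Proof.
move=> y0; rewrite le_eqVlt => /predU1P[<-//|t0].
apply/eqP; rewrite eq_le snorm_ge0 andbT; apply/ler_addgt0Pr => e e0; rewrite add0r.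
have [d d0 Hd] := diff_continuous (lexx 0) e0.
pose s := Num.min (d / 2) t; have s0 : 0 < s by rewrite lt_min t0 divr_gt0.
have st : s <= t by rewrite ge_min lexx orbT.
have : nrm (y t) <= nrm (y s).
  rewrite snorm_le_sqr ?snorm_ge0// snorm_sqr; exact: diff_norm_decr.
move=> /le_trans; apply; apply: le_trans (snorm_leB ip _ (y 0)) _; rewrite y0 add0r; apply: ltW.
apply: Hd; first exact: ltW.
rewrite subr0 gtr0_norm//; apply: (@le_lt_trans _ _ (d / 2)); first by rewrite ge_min lexx.
by move: d0; lra.
Qed.

End weak_uniqueness.

(** * Transfer between curves of functions and the abstract setting *)

Section bochner_L2.
Variables (R : realType) (m n : nat) (Omega : set 'rV[R]_n).
Hypothesis oO : open Omega.
Local Notation V := 'rV[R]_n.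
Local Notation leb := (lebesgue_rV R n).
Let mO := mx_open_measurable oO.
Local Notation H := (L2sp leb mO 1 m).
Local Notation ip := (L2_ip leb mO 1 m).
Local Notation nrm := (snorm ip).
Local Notation TR := (measurableTypeR R).
Local Notation lam := (@lebesgue_measure R).
Local Notation D := ([set` `]0%R, +oo[ ] : set TR).

(** Total, with default value 0: the values of a competing solution at negative times need not be
    square-integrable. *)
Definition toH (h : V -> 'rV[R]_m) : H :=
  if pselect (L2 Omega h) is left hh then toL2 mO hh else 0.

Lemma toHE h : L2 Omega h -> (toH h : V -> 'rV[R]_m) = h.
Proof. by move=> hh; rewrite /toH; case: pselect. Qed.

Lemma L2_norm_snorm (u : H) : L2_norm Omega (u : V -> 'rV[R]_m) = nrm u.
Proof. by []. Qed.

Definition unpack (S : seq (set TR * H)) : seq (set R * (V -> 'rV[R]_m)) :=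
  map (fun Eh : set TR * H => (Eh.1 : set R, Eh.2 : V -> 'rV[R]_m)) S.

Lemma step_val_unpack S t x : step_val (unpack S) t x = (sval S t : V -> 'rV[R]_m) x.
Proof.
rewrite /step_val /unpack big_map /sval; elim: S => [|Eh S IH]; first by rewrite !big_nil.
by rewrite !big_cons L2spD L2spZ IH.
Qed.

Lemma step_int_unpack S x : step_int (unpack S) x = (sint S : V -> 'rV[R]_m) x.
Proof.
rewrite /step_int /unpack big_map /sint; elim: S => [|Eh S IH]; first by rewrite !big_nil.
by rewrite !big_cons L2spD L2spZ IH.
Qed.

Lemma step_err S (g : H) t :
  L2_norm Omega (fun x => (g : V -> 'rV[R]_m) x - step_val (unpack S) t x) = nrm (g - sval S t).
Proof.
rewrite -L2_norm_snorm; congr L2_norm; apply/funext => x.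
by rewrite step_val_unpack.
Qed.

Lemma int_err S (J : H) :
  L2_norm Omega (fun x => step_int (unpack S) x - (J : V -> 'rV[R]_m) x) = nrm (sint S - J).
Proof.
by rewrite -L2_norm_snorm; congr L2_norm; apply/funext => x; rewrite step_int_unpack.
Qed.

Lemma bochner_of_approximates (g : R -> H) S J : approximates ip D g S J ->
  is_bochner_integral Omega `]0, +oo[ (fun t => g t : V -> 'rV[R]_m) J.
Proof.
move=> [hS cS cJ]; split; first exact: L2spP.
have eE k : (fun t => L2_norm Omega (fun x => (g t : V -> 'rV[R]_m) x - step_val (unpack (S k)) t x)) =
    (fun t => nrm (g t - sval (S k) t)) by apply/funext => t; rewrite step_err.
exists (fun k => unpack (S k)); split.
- move=> k; have [sk mk] := hS k; split.
    move=> i; rewrite size_map => iS; rewrite (nth_map (set0, 0))//.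
    by have [? ? ?] := sk i iS; split => //=; exact: L2spP.
  by rewrite eE.
- have -> : (fun k => \int[lam]_(t in D)
      (L2_norm Omega (fun x => (g t : V -> 'rV[R]_m) x - step_val (unpack (S k)) t x))%:E)%E =
      (fun k => \int[lam]_(t in D) (nrm (g t - sval (S k) t))%:E)%E; last exact: cS.
    by apply/funext => k; apply: eq_integral => t _; rewrite step_err.
- rewrite (_ : (fun k => _) = fun k => nrm (sint (S k) - J)); first exact/scvgP.
  by apply/funext => k; rewrite int_err.
Qed.

Lemma approximates_of_bochner (g : R -> V -> 'rV[R]_m) (G : R -> H) J :
  (forall t, 0 < t -> (G t : V -> 'rV[R]_m) = g t) ->
  is_bochner_integral Omega `]0, +oo[ g J -> exists S, approximates ip D G S (toH J).
Proof.
move=> Gg [J2 [s [hs cs cJ]]].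
pose S k : seq (set TR * H) := [seq (Eh.1, toH Eh.2) | Eh <- s k].
have sE k : s k = unpack (S k).
  apply: (@eq_from_nth _ (set0, fun=> 0)); first by rewrite !size_map.
  move=> i ik; rewrite /unpack /S -map_comp (nth_map (set0, fun=> 0))//=.
  by have [_ _ _ h2] := (hs k).1 i ik; rewrite toHE//; case: nth.
have eE k t : D t -> L2_norm Omega (fun x => g t x - step_val (s k) t x) = nrm (G t - sval (S k) t).
  by rewrite half_lineE => t0; rewrite -(Gg _ t0) sE step_err.
exists S; split.
- move=> k; have [h1 h2] := hs k; split; last first.
    by apply: eq_measurable_fun h2 => t /set_mem Dt; exact: eE.
  move=> i; rewrite size_map => ik; rewrite (nth_map (set0, fun=> 0))//.
  by have [? ? ? _] := h1 i ik.
- have <- : (fun k => \int[lam]_(t in D) (L2_norm Omega (fun x => g t x - step_val (s k) t x))%:E)%E =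
      (fun k => \int[lam]_(t in D) (nrm (G t - sval (S k) t))%:E)%E.
    by apply/funext => k; apply: eq_integral => t /set_mem Dt; rewrite eE.
  exact: cs.
- apply/scvgP; have <- : (fun k => L2_norm Omega (fun x => step_int (s k) x - J x)) =
      (fun k => nrm (sint (S k) - toH J)).
    by apply/funext => k; rewrite -int_err -sE toHE.
  exact: cJ.
Qed.

Lemma weak_time_derivative_of (U W : R -> H) : weak_deriv ip U W ->
  is_weak_time_derivative Omega (fun t => U t : V -> 'rV[R]_m) (fun t => W t : V -> 'rV[R]_m).
Proof.
move=> w phi tp; have [S1 [J [S2 [K [aJ aK jk]]]]] := w phi tp.
exists J, K; split.
- rewrite (_ : (fun t x => _) = (fun t => ('D_1 phi t *: U t : H) : V -> 'rV[R]_m)).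
    exact: bochner_of_approximates aJ.
  by apply/funext => t; apply/funext => x; rewrite derive1E.
- exact: bochner_of_approximates aK.
- have := L2_null jk; apply: filterS => x h Ox; have := h Ox; rewrite L2spD => /eqP.
  by rewrite addr_eq0 => /eqP.
Qed.

Lemma weak_deriv_of (u v : R -> V -> 'rV[R]_m) : (forall t, 0 < t -> L2 Omega (u t)) ->
  (forall t, 0 < t -> L2 Omega (v t)) -> is_weak_time_derivative Omega u v ->
  weak_deriv ip (fun t => toH (u t)) (fun t => toH (v t)).
Proof.
move=> u2 v2 w phi tp; have [J [K [bJ bK jk]]] := w phi tp.
have [S1 a1] : exists S, approximates ip D (fun t => 'D_1 phi t *: toH (u t)) S (toH J).
  apply: approximates_of_bochner bJ => t t0; apply/funext => x.
  by rewrite L2spZ toHE ?derive1E//; exact: u2.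
have [S2 a2] : exists S, approximates ip D (fun t => phi t *: toH (v t)) S (toH K).
  apply: approximates_of_bochner bK => t t0; apply/funext => x.
  by rewrite L2spZ toHE//; exact: v2.
exists S1, (toH J), S2, (toH K); split; [exact: a1|exact: a2|].
rewrite -[toH K]opprK; apply: L2_snorm_ae; apply: filterS jk => x h Ox.
by rewrite L2spN !toHE ?h//; [case: bK|case: bJ].
Qed.

Lemma half_line_continuousP (u : R -> V -> 'rV[R]_m) : (forall t, 0 <= t -> L2 Omega (u t)) ->
  (forall t0, 0 <= t0 -> L2_norm Omega (fun x => u t x - u t0 x) @[t --> within `[0, +oo[ (nbhs t0)]
      --> (0 : R)) <-> half_line_continuous ip (fun t => toH (u t)).
Proof.
move=> u2; have E s t : 0 <= s -> 0 <= t ->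
    L2_norm Omega (fun x => u s x - u t x) = nrm (toH (u s) - toH (u t)).
  move=> s0 t0; rewrite -L2_norm_snorm; congr L2_norm; apply/funext => x.
  by rewrite L2spD L2spN !toHE//; exact: u2.
split=> [c t e t0 e0|c t0 t00].
  have /cvgrPdist_lt/(_ _ e0) := c t t0.
  rewrite near_withinE => /nbhs_ballP[d /= d0 Hd]; exists d => // s s0 sd.
  have := Hd s; rewrite /ball/= distrC sub0r normrN => /(_ sd).
  rewrite /= in_itv/= andbT => /(_ s0); rewrite E//; apply: le_lt_trans; exact: ler_norm.
apply/cvgrPdist_lt => e e0; have [d d0 Hd] := c t0 e t00 e0.
rewrite near_withinE; apply/nbhs_ballP; exists d => //= s.
rewrite /ball/= distrC => sd; rewrite /= in_itv/= andbT => s0.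
by rewrite sub0r normrN E// ger0_norm ?snorm_ge0//; exact: Hd.
Qed.

End bochner_L2.

(** * The dual functional *)

Lemma derive_big (R : realType) (V : normedModType R) (I : Type) (s : seq I)
    (F : I -> V -> R) v x : (forall i, smooth (F i)) ->
  'D_v (fun y => \sum_(i <- s) F i y) x = \sum_(i <- s) 'D_v (F i) x.
Proof.
move=> sF; elim: s => [|i s IH].
  by rewrite big_nil; under eq_fun do rewrite big_nil; exact: derive_cst.
under eq_fun do rewrite big_cons; rewrite big_cons -IH.
by apply: deriveD; apply: smooth_derivable => //; exact: smooth_sum.
Qed.

Section dual_functional.
Variables (R : realType) (m n : nat) (Omega : set 'rV[R]_n).
Local Notation V := 'rV[R]_n.
Local Notation W := 'M[R]_(m, n).
Local Notation leb := (lebesgue_rV R n).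
Local Notation partial j phi x := ('D_(delta_mx 0 j : V) phi x).
Hypotheses (oO : open Omega) (bO : bounded_set Omega).
Variable A : {linear 'M[R]_(m, n) -> 'M[R]_(m, n)}.
Hypothesis A_sym : forall y y', frob (A y) y' = frob y (A y').

Let mO : measurable Omega := mx_open_measurable oO.
Let fO : (leb Omega < +oo)%E. Proof. exact: lebesgue_rV_bounded. Qed.

(** For each entry of Aw, [mu true - mu false] represents it. The two measures are not assumed
    mutually singular, so their sum dominates the variation. *)
Definition gradient_measures (w : V -> 'rV[R]_m)
    (mu : bool -> 'I_m -> 'I_n -> {finite_measure set V -> \bar R}) :=
  forall i j, represents Omega (fun phi => A (distr_grad Omega w phi) i j)
    (mu true i j) (mu false i j).

Lemma BVA_measures w : BVA Omega A w -> exists mu, gradient_measures w mu.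
Proof.
move=> [_ Hw].
have /choice[mu Hmu] (ij : 'I_m * 'I_n) : exists mu : bool -> {finite_measure set V -> \bar R},
    represents Omega (fun phi => A (distr_grad Omega w phi) ij.1 ij.2) (mu true) (mu false).
  have [mup [mum h]] := Hw ij.1 ij.2.
  by exists (fun b => if b then mup else mum).
by exists (fun b i j => mu (i, j) b) => i j; exact: (Hmu (i, j)).
Qed.

Lemma L2_cvg_sub D (f_ : nat -> V -> R) : measurable D ->
  (fun k => \int[leb]_x (f_ k x ^+ 2)) @ \oo --> (0 : R) ->
  (forall k, sqi leb setT (f_ k)) ->
  (fun k => \int[leb]_(x in D) (f_ k x ^+ 2)) @ \oo --> (0 : R).
Proof.
move=> mD cv f2; apply: (@squeeze_cvgr _ _ _ _ (cst 0) _ _ _ _ _ cv) => //; last exact: cvg_cst.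
apply: nearW => k; apply/andP; split.
  by apply: Rintegral_ge0 => x _; exact: sqr_ge0.
rewrite Rintegral_mkcond; apply: Rint_le => //.
- have := integrableS measurableT mD (@subsetT _ D) (f2 k).2.
  by move=> /(itg_restrict _ mD).
- exact: (f2 k).2.
- by move=> x _; rewrite patchE; case: ifP => // _; exact: sqr_ge0.
Qed.

Lemma test_bounded_meas U (phi : V -> R) : test_fun U phi -> exists M, [/\ 0 <= M,
  measurable_fun setT phi & forall x, `|phi x| <= M].
Proof.
move=> tp; have [M M0 hM] := test_bounded tp; exists M; split => //.
exact: smooth_meas (test_smooth tp).
Qed.

Lemma fin_itg (mu : {finite_measure set V -> \bar R}) (f : V -> R) M D : measurable D ->
  measurable_fun setT f -> (forall x, `|f x| <= M) -> mu.-integrable D (EFin \o f).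
Proof.
by move=> mD mf fM; have := test_itg_fin mu mf fM; exact: integrableS.
Qed.

(** * Estimates for a function whose Aw is a measure *)

Section one_function.
Variables (w : V -> 'rV[R]_m) (mu : bool -> 'I_m -> 'I_n -> {finite_measure set V -> \bar R}).
Hypotheses (w2 : L2 Omega w) (wmu : gradient_measures w mu).

(* The integral of g against the sum of the variations of the entries of Aw. *)
Definition gradient_mass (g : V -> R) : R :=
  \sum_i \sum_j (\int[mu true i j]_(x in Omega) g x + \int[mu false i j]_(x in Omega) g x).

Lemma gradient_mass_sum (g : V -> R) : gradient_mass g = \sum_(ijb : ('I_m * 'I_n) * bool)
  \int[mu ijb.2 ijb.1.1 ijb.1.2]_(x in Omega) g x.
Proof.
rewrite -(pair_bigA _ (fun (ij : 'I_m * 'I_n) b => \int[mu b ij.1 ij.2]_(x in Omega) g x))/=.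
rewrite /gradient_mass pair_bigA/=; apply: eq_bigr => -[i j] _.
by rewrite big_bool.
Qed.

Lemma gradient_mass_cvg (g_ : nat -> V -> R) (g : V -> R) (M : R) :
  (forall k, measurable_fun setT (g_ k)) -> (forall k x, `|g_ k x| <= M) ->
  measurable_fun setT g -> (forall x, Omega x -> (fun k => g_ k x) @ \oo --> g x) ->
  (fun k => gradient_mass (g_ k)) @ \oo --> gradient_mass g.
Proof.
move=> mg_ gM mg cv; under eq_fun do rewrite gradient_mass_sum.
rewrite gradient_mass_sum; apply: cvgn_sum => -[[i j] b] /=.
apply: (Rint_cvg mO (g := cst M) _ _ _ _ _).2.
- by move=> k; exact: measurable_funS (mg_ k).
- exact: measurable_funS mg.
- by apply: aeW => x Ox; exact: cv.
- by apply: (@fin_itg _ _ `|M|) => //; exact: measurable_cst.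
- by apply: aeW => x k _; exact: gM.
Qed.

Lemma gradient_mass_le (g h : V -> R) M : measurable_fun setT g -> measurable_fun setT h ->
  (forall x, `|g x| <= M) -> (forall x, `|h x| <= M) -> (forall x, g x <= h x) ->
  gradient_mass g <= gradient_mass h.
Proof.
move=> mg mh gM hM gh; rewrite !gradient_mass_sum; apply: ler_sum => -[[i j] b] _ /=.
by apply: Rint_le => //; exact: fin_itg.
Qed.

Lemma gradient_massD (g h : V -> R) M : measurable_fun setT g -> measurable_fun setT h ->
  (forall x, `|g x| <= M) -> (forall x, `|h x| <= M) ->
  gradient_mass (fun x => g x + h x) = gradient_mass g + gradient_mass h.
Proof.
move=> mg mh gM hM; rewrite !gradient_mass_sum -big_split; apply: eq_bigr => -[[i j] b] _ /=.
by rewrite RintegralD//; exact: fin_itg.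
Qed.

Lemma L2_domain_itg i psi : test_fun Omega psi ->
  leb.-integrable Omega (EFin \o (fun x => w x 0 i * psi x)).
Proof. by move=> tp; exact: sqi_mul (w2 0 i) (test_sqi oO fO tp). Qed.

(** Only the entries of Aw are measures, not those of Dw. Since [A psi = psi] and [A] is symmetric,
    [A] can be moved from the field onto the gradient of [w]. *)
Lemma test_field_integral (psi : 'I_m -> 'I_n -> V -> R) : (forall i j, test_fun Omega (psi i j)) ->
  (forall x, A (\matrix_(i, j) psi i j x) = \matrix_(i, j) psi i j x) ->
  - (\int[leb]_(x in Omega) (\sum_i w x 0 i * \sum_j partial j (psi i j) x)) =
  \sum_i \sum_j (\int[mu true i j]_(x in Omega) psi i j x -
                 \int[mu false i j]_(x in Omega) psi i j x).
Proof.
move=> tp Ap.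
pose a i j k l := A (delta_mx k l) i j.
pose I i j k l := \int[leb]_(x in Omega) (w x 0 i * partial j (psi k l) x).
have iI i j k l : leb.-integrable Omega (EFin \o (fun x => w x 0 i * partial j (psi k l) x)).
  by apply: L2_domain_itg; exact: test_derive.
have dE i j x : partial j (psi i j) x = \sum_(kl : 'I_m * 'I_n) a i j kl.1 kl.2 * partial j (psi kl.1 kl.2) x.
  have -> : psi i j = fun y => \sum_(kl : 'I_m * 'I_n) (a i j kl.1 kl.2 * psi kl.1 kl.2 y).
    apply/funext => y; have := congr1 (fun B : 'M[R]_(m, n) => B i j) (Ap y).
    rewrite linear_entry mxE => <-; rewrite pair_bigA/=.
    by apply: eq_bigr => kl _; rewrite mxE mulrC.
  rewrite derive_big => [|kl]; last exact: smoothZ (test_smooth (tp _ _)).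
  apply: eq_bigr => kl _.
  exact: (deriveZ _ (smooth_derivable (test_smooth (tp kl.1 kl.2)))).
have L : \int[leb]_(x in Omega) (\sum_i w x 0 i * \sum_j partial j (psi i j) x) =
    \sum_(ij : 'I_m * 'I_n) \sum_(kl : 'I_m * 'I_n) a ij.1 ij.2 kl.1 kl.2 * I ij.1 ij.2 kl.1 kl.2.
  transitivity (\int[leb]_(x in Omega) (\sum_(ij : 'I_m * 'I_n) \sum_(kl : 'I_m * 'I_n)
      a ij.1 ij.2 kl.1 kl.2 * (w x 0 ij.1 * partial ij.2 (psi kl.1 kl.2) x))).
    apply: eq_Rintegral => x _; rewrite -(pair_bigA _ (fun i j => \sum_(kl : 'I_m * 'I_n)
      a i j kl.1 kl.2 * (w x 0 i * partial j (psi kl.1 kl.2) x)))/=.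
    apply: eq_bigr => i _; rewrite mulr_sumr; apply: eq_bigr => j _.
    by rewrite dE mulr_sumr; apply: eq_bigr => kl _; ring.
  rewrite Rint_sum//; last by move=> ij; apply: itg_sum => // kl; exact: itgZ.
  apply: eq_bigr => ij _; rewrite Rint_sum//; last by move=> kl; exact: itgZ.
  by apply: eq_bigr => kl _; rewrite RintegralZl.
rewrite L exchange_big/= -sumrN pair_bigA/=.
apply: eq_bigr => -[k l] _ /=.
rewrite -(wmu k l (tp k l)) -(A_entry_sym A_sym) -sumrN pair_bigA/=.
by apply: eq_bigr => -[i j] _ /=; rewrite mxE mulrN.
Qed.

(** Mollify [z] and [|phi|] with the same kernel: the pointwise domination survives, the mollified
    field is a test field, and its integral is bounded through the measures. Continuity of [phi]
    gives pointwise convergence on the right; a divergence in L2 gives the limit on the left. *)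
Lemma field_domination M z p K (phi : V -> R) B c : wfield A M z p -> compact K -> K `<=` Omega ->
  vanishes_off K z p -> continuous phi -> leb.-integrable setT (EFin \o phi) ->
  (forall x, `|phi x| <= B) -> 0 <= c -> (forall x i j, `|z x i j| <= c * `|phi x|) ->
  `|\int[leb]_(x in Omega) frob (p x) (w x)| <= c * gradient_mass (fun x => `|phi x|).
Proof.
move=> wz cK KO zK cphi iphi phiB c0 zphi.
have iaphi : leb.-integrable setT (EFin \o (fun x => `|phi x|)).
  by have := integrable_norm iphi; apply: eq_integrable.
have caphi : continuous (fun x => `|phi x|).
  by move=> x; apply: continuous_comp; [exact: cphi|exact: norm_continuous].
have B0 : 0 <= B := le_trans (normr_ge0 _) (phiB 0).
have r0 k : 0 < k.+1%:R^-1 :> R by rewrite invr_gt0.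
pose g k := conv (moll k.+1%:R^-1) (fun x : V => `|phi x|).
have mg k : measurable_fun setT (g k) by exact: conv_moll_meas.
have g0 k x : 0 <= g k x by exact: conv_moll_ge0.
have gB k x : `|g k x| <= B.
  by rewrite ger0_norm//; apply: conv_moll_le.
have mphi : measurable_fun setT phi := itg_meas iphi.
have maphi : measurable_fun setT (fun x => `|phi x|) by exact: measurableT_comp.
have cvR : (fun k => c * gradient_mass (g k)) @ \oo --> c * gradient_mass (fun x => `|phi x|).
  apply: cvgMl_tmp; apply: (@gradient_mass_cvg _ _ B) => // x _.
  by apply: moll_cvg.
pose P k x : 'rV[R]_m := \row_i moll_divergence k p i x.
have [_ _ _ L2p _] := wz.
have cvL : (fun k => `|\int[leb]_(x in Omega) frob (P k x) (w x)|) @ \oo -->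
    `|\int[leb]_(x in Omega) frob (p x) (w x)|.
  apply: cvg_norm.
  have E (q : V -> 'rV[R]_m) : (forall i, sqi leb Omega (fun x => q x 0 i)) ->
      \int[leb]_(x in Omega) frob (q x) (w x) = \sum_i \int[leb]_(x in Omega) (q x 0 i * w x 0 i).
    move=> q2; rewrite -Rint_sum//; last by move=> i; exact: sqi_mul (q2 i) (w2 0 i).
    by apply: eq_Rintegral => x _; rewrite /frob big_ord1.
  have P2 k i : sqi leb Omega (fun x => P k x 0 i).
    under eq_fun do rewrite mxE; apply: sqiS => //.
    exact: moll_divergence_sqi wz cK zK k i.
  have p2 i : sqi leb Omega (fun x => p x 0 i) by apply: sqiS => //; exact: L2p.
  under eq_fun do rewrite E//; rewrite E//.
  apply: cvgn_sum => i; apply: (L2_weak_cvg mO (fun k => P2 k i) (p2 i) (w2 0 i)).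
  have := moll_divergence_cvg wz cK zK i oO fO KO.
  move=> /(L2_cvg_sub mO); under [X in _ -> X @ _ --> _]eq_fun do under eq_Rintegral do rewrite mxE.
  by apply=> k; exact: sqiB (moll_divergence_sqi wz cK zK k i) (L2p 0 i).
have [N HN] := moll_field_test wz cK zK oO KO.
apply: (ler_cvg_to cvL cvR); exists N => // k /= Nk.
have tz i j := HN k i j Nk.
have E : \int[leb]_(x in Omega) frob (P k x) (w x) =
    \int[leb]_(x in Omega) (\sum_i w x 0 i * \sum_j partial j (moll_field k z i j) x).
  apply: eq_Rintegral => x _; rewrite /frob big_ord1; apply: eq_bigr => i _.
  by rewrite mxE (moll_field_div wz cK zK) mulrC.
have bt i j x : `|moll_field k z i j x| <= c * g k x.
  have -> : c * g k x = conv (moll k.+1%:R^-1) (fun y => c * `|phi y|) x.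
    rewrite /conv -RintegralZl//; last exact: conv_moll_itg.
    by apply: eq_Rintegral => y _; ring.
  apply: conv_moll_norm_le => //; [exact: field_itg wz cK zK i j|exact: itgZ].
rewrite -normrN E (test_field_integral tz); last by move=> x; exact: moll_field_A wz cK zK k x.
apply: le_trans (ler_norm_sum _ _ _) _; rewrite /gradient_mass mulr_sumr.
apply: ler_sum => i _; apply: le_trans (ler_norm_sum _ _ _) _; rewrite mulr_sumr.
apply: ler_sum => j _; rewrite mulrDr; apply: le_trans (ler_normB _ _) _.
have mt : measurable_fun setT (moll_field k z i j) := smooth_meas (test_smooth (tz i j)).
have cg x : `|c * g k x| <= c * B by rewrite normrM (ger0_norm c0) ler_wpM2l.
have tB x : `|moll_field k z i j x| <= c * B.
  by apply: le_trans (bt i j x) _; rewrite ler_wpM2l//; have := gB k x; rewrite ger0_norm.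
have key (nu : {finite_measure set V -> \bar R}) :
    `|\int[nu]_(x in Omega) moll_field k z i j x| <= c * \int[nu]_(x in Omega) g k x.
  have i1 : nu.-integrable Omega (EFin \o moll_field k z i j) by exact: fin_itg tB.
  have i2 : nu.-integrable Omega (EFin \o g k) by exact: fin_itg (gB k).
  apply: le_trans (le_normr_Rintegral _ _) _ => //.
  rewrite -RintegralZl//; apply: Rint_le => //; last exact: itgZ.
  by have := integrable_norm i1; apply: eq_integrable.
by apply: lerD; exact: key.
Qed.

End one_function.

Implicit Types (z : V -> 'M[R]_(m, n)) (p w : V -> 'rV[R]_m) (phi : V -> R).

(** Unlike [wfield], the divergence is tested inside Omega only, so the extension by zero may have a
    singular part on the boundary. *)
Record bounded_field M z p : Prop := BoundedField {
  bf_meas : forall i j, measurable_fun setT (fun x => z x i j);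
  bf_bnd : forall x, frob_norm (z x) <= M;
  bf_A : forall x, A (z x) = z x;
  bf_L2 : L2set leb setT p;
  bf_div : is_weak_div Omega z p }.

Lemma bounded_field_ge0 M z p : bounded_field M z p -> 0 <= M.
Proof. by move=> [_ bz _ _ _]; apply: le_trans (bz 0); exact: snorm_ge0 (frob_ip R m n) _. Qed.

Lemma wfield_bounded M z p : wfield A M z p -> bounded_field M z p.
Proof.
move=> [mz bz Az L2p dz]; split => // psi tp i.
have := dz psi (test_subset (@subsetT _ _) tp) i.
have out x : ~ Omega x -> psi x = 0 /\ forall v, 'D_v psi x = 0.
  move=> nx; apply: (vanish_tsupp tp) => xe; apply: nx; have [_ _] := tp; exact.
rewrite -(@Rint_supp _ _ Omega (fun x => \sum_j z x i j * partial j psi x)); last first.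
  by move=> x /out[_ d0]; apply: big1 => j _; rewrite d0 mulr0.
rewrite -(@Rint_supp _ _ Omega (fun x => p x 0 i * psi x))//.
by move=> x /out[-> _]; rewrite mulr0.
Qed.

Lemma weak_div_unique z p q : L2 Omega p -> L2 Omega q -> is_weak_div Omega z p ->
  is_weak_div Omega z q -> ae_eq leb Omega p q.
Proof.
move=> p2 q2 dp dq.
have ae0 i : ae_eq leb Omega (fun x => p x 0 i - q x 0 i) (cst 0).
  have ip := sqi_itg oO fO (p2 0 i); have iq := sqi_itg oO fO (q2 0 i).
  apply: du_bois_reymond => //; first exact: itgB.
  move=> psi tp; have := dp psi tp i; rewrite (dq psi tp i) => e.
  have i1 := sqi_mul mO (p2 0 i) (test_sqi oO fO tp).
  have i2 := sqi_mul mO (q2 0 i) (test_sqi oO fO tp).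
  by under eq_Rintegral do rewrite mulrBl; rewrite RintegralB// e subrr.
have : {ae leb, forall x, forall i, Omega x -> p x 0 i - q x 0 i = 0}.
  by apply: filter_forall => i; exact: ae0.
apply: filterS => x hx Ox; apply/rowP => i; apply/eqP; by rewrite -subr_eq0 hx.
Qed.

Lemma divergenceP z : (exists g, L2 Omega g /\ is_weak_div Omega z g) ->
  L2 Omega (divergence Omega z) /\ is_weak_div Omega z (divergence Omega z).
Proof. by move=> h; have := getPex h. Qed.

Lemma weak_div_ae z z' p : (forall i j, measurable_fun Omega (fun x => z x i j)) ->
  (forall i j, measurable_fun Omega (fun x => z' x i j)) ->
  ae_eq leb Omega z z' -> is_weak_div Omega z p -> is_weak_div Omega z' p.
Proof.
move=> mz mz' zz' dz psi tp i; rewrite -(dz psi tp i); congr (- _).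
have md j : measurable_fun Omega (fun x => partial j psi x).
  by apply: (measurable_funS measurableT) => //; exact: smooth_meas (test_smooth (test_derive _ tp)).
apply: Rint_ae_eq => //.
- by apply: measurable_sum => j; exact: measurable_funM.
- by apply: measurable_sum => j; exact: measurable_funM.
- by apply: filterS zz' => x h Ox; rewrite (h Ox).
Qed.

Definition rep_on z z' p := [/\ vanishes_off Omega z' p, ae_eq leb Omega z' z &
  forall x, Omega x -> p x = divergence Omega z x].

(* Values of z may be changed on a null set to make the bound and the constraint
   A z = z hold everywhere, with z and div z extended by 0. *)
Lemma X2_rep z (M0 : R) : X2 Omega A z -> {ae leb, forall x, Omega x -> frob_norm (z x) <= M0} ->
  exists z' p, bounded_field `|M0| z' p /\ rep_on z z' p.
Proof.
move=> [[mz _] Az hg] bz; have [g2 dg] := divergenceP hg; set g := divergence Omega z in g2 dg *.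
pose M := `|M0|.
pose S := [set x | Omega x /\ (A (z x) = z x /\ frob (z x) (z x) <= M ^+ 2)].
have mA i j : measurable_fun Omega (fun x => A (z x) i j).
  under eq_fun do rewrite linear_entry.
  by apply: measurable_sum => k; apply: measurable_sum => l; exact: measurable_funM.
have mfrob (y : V -> 'M[R]_(m, n)) : (forall i j, measurable_fun Omega (fun x => y x i j)) ->
    measurable_fun Omega (fun x => frob (y x) (y x)).
  move=> my; apply: measurable_sum => i; apply: measurable_sum => j; exact: measurable_funM.
have mS : measurable S.
  have m1 : measurable_fun Omega (fun x => frob (A (z x) - z x) (A (z x) - z x)).
    by apply: mfrob => i j; under eq_fun do rewrite !mxE; exact: measurable_funB.
  have m2 := mfrob z mz.
  rewrite (_ : S = (Omega `&` (fun x => frob (A (z x) - z x) (A (z x) - z x)) @^-1` [set 0]) `&`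
    (Omega `&` (fun x => frob (z x) (z x)) @^-1` [set` `]-oo, M ^+ 2]])).
    by apply: measurableI; [apply: m1|apply: m2].
  apply/seteqP; split => x /=.
    by move=> [Ox [e h]]; rewrite e subrr in_itv/=; split; split => //; exact: (ip0l (frob_ip R m n)).
  move=> [[Ox e] [_]]; rewrite in_itv/= => h; split => //; split => //.
  apply/matrixP => i j; apply/eqP; rewrite -subr_eq0.
  have := sqr_entry_le_frob (A (z x) - z x) i j; rewrite e !mxE => h2.
  by rewrite -sqrf_eq0 eq_le h2 sqr_ge0.
pose z' x : 'M[R]_(m, n) := \1_S x *: z x.
pose p x : 'rV[R]_m := \1_Omega x *: g x.
have z'E i j : (fun x => z' x i j) = (fun x => z x i j) \_ S.
  apply/funext => x; rewrite mxE indicE patchE; case: ifP => _; rewrite ?mul1r ?mul0r//.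
have pE j : (fun x => p x 0 j) = (fun x => g x 0 j) \_ Omega.
  apply/funext => x; rewrite mxE indicE patchE; case: ifP => _; rewrite ?mul1r ?mul0r//.
have SO : S `<=` Omega by move=> x [].
have mz' i j : measurable_fun setT (fun x => z' x i j).
  rewrite z'E; apply/measurable_restrict => //; rewrite setTI.
  exact: measurable_funS (mz i j).
have z'z : ae_eq leb Omega z' z.
  apply: filterS2 bz Az => x h1 h2 Ox; rewrite /z' indicE mem_set ?scale1r//.
  split=> //; split; first exact: h2.
  have := h1 Ox; rewrite frob_normE => h3; have -> : frob (z x) (z x) = snorm (frob_ip R m n) (z x) ^+ 2.
    by rewrite snorm_sqr.
  apply: lerXn2r; rewrite ?nnegrE ?snorm_ge0 ?normr_ge0//; exact: le_trans h3 (ler_norm _).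
exists z', p; split; last first.
  split => //.
  - move=> x nx; rewrite /z' /p !indicE (memNset nx) memNset ?scale0r//.
    by move/SO.
  - by move=> x Ox; rewrite /p indicE mem_set// scale1r.
split => //.
- move=> x; rewrite /z' indicE; case: (boolP (x \in S)) => [|_].
    rewrite inE scale1r => -[_ [_ h]].
    by rewrite frob_normE snorm_le_sqr ?normr_ge0.
  by rewrite scale0r frob_normE snorm0 normr_ge0.
- move=> x; rewrite linearZ /= /z' indicE; case: (boolP (x \in S)) => [|_].
    by rewrite inE => -[_ [-> _]].
  by rewrite !scale0r.
- move=> i j; rewrite (ord1 i) pE; exact: sqi_restrict (g2 0 j).
- have d1 : is_weak_div Omega z' g.
    apply: (weak_div_ae (z := z)) => //.
      by move=> i j; exact: measurable_funS (mz' i j).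
    by apply: filterS z'z => x h /h.
  move=> psi tp i; rewrite (d1 psi tp i); apply: eq_Rintegral => x.
  by rewrite inE => Ox; rewrite /p indicE mem_set// scale1r.
Qed.

(** The pairing is [- \int <div (phi z), w>], here for representatives whose bound and constraint
    hold everywhere. *)
Definition pairing_of z p w phi : R :=
  - \int[leb]_(x in Omega) frob (mul_div phi z p x) (w x).

Lemma pairingE z z' p w phi : X2 Omega A z -> (forall i j, measurable_fun setT (fun x => z' x i j)) ->
  rep_on z z' p -> L2 Omega w -> test_fun Omega phi ->
  pairing Omega z w phi = pairing_of z' p w phi.
Proof.
move=> [[mz _] _ hg] mz' [_ z'z pg] w2 tp; have [g2 _] := divergenceP hg.
rewrite /pairing /pairing_of; congr (- _).
have mphi : measurable_fun Omega phi.
  by apply: (measurable_funS measurableT) => //; exact: smooth_meas (test_smooth tp).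
have md j : measurable_fun Omega (fun x => partial j phi x).
  by apply: (measurable_funS measurableT) => //; exact: smooth_meas (test_smooth (test_derive _ tp)).
have mw i : measurable_fun Omega (fun x => w x 0 i) := (w2 0 i).1.
have mg i : measurable_fun Omega (fun x => divergence Omega z x 0 i) := (g2 0 i).1.
transitivity (\int[leb]_(x in Omega) (phi x * (\sum_i divergence Omega z x 0 i * w x 0 i)
    + \sum_i \sum_j partial j phi x * z x i j * w x 0 i)).
  by apply: eq_Rintegral => x _; rewrite /frob big_ord1.
transitivity (\int[leb]_(x in Omega) (phi x * (\sum_i divergence Omega z x 0 i * w x 0 i)
    + \sum_i \sum_j partial j phi x * z' x i j * w x 0 i)).
  have mm (y : V -> 'M[R]_(m, n)) : (forall i j, measurable_fun Omega (fun x => y x i j)) ->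
      measurable_fun Omega (fun x => phi x * (\sum_i divergence Omega z x 0 i * w x 0 i)
      + \sum_i \sum_j partial j phi x * y x i j * w x 0 i).
    move=> my; apply: measurable_funD.
      apply: measurable_funM => //; apply: measurable_sum => i; exact: measurable_funM.
    apply: measurable_sum => i; apply: measurable_sum => j; apply: measurable_funM => //.
    exact: measurable_funM.
  apply: Rint_ae_eq => //; [exact: mm|apply: mm|].
    by move=> i j; exact: measurable_funS (mz' i j).
  by apply: filterS z'z => x h Ox; rewrite (h Ox).
apply: eq_Rintegral => x; rewrite inE => Ox; rewrite /frob big_ord1 mulr_sumr -big_split.
apply: eq_bigr => i _ /=; rewrite mul_divE pg// mulrDl mulr_suml mulrA; congr (_ + _).
Qed.

(** * The pairing as a measure and its total mass *)

Section with_w.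
Variables (w : V -> 'rV[R]_m) (mu : bool -> 'I_m -> 'I_n -> {finite_measure set V -> \bar R}).
Hypotheses (w2 : L2 Omega w) (wmu : gradient_measures w mu).

Local Notation mass := (gradient_mass mu).

(** The field [phi z] has compact support and [|z| <= M], so [field_domination] applies: the pairing
    is at most [M] times the variation of Aw. *)
Lemma pairing_of_bound M z p phi : bounded_field M z p -> test_fun Omega phi ->
  `|pairing_of z p w phi| <= M * mass (fun x => `|phi x|).
Proof.
move=> bf tp; have M0 := bounded_field_ge0 bf; have [mz bz Az L2p dz] := bf.
have [B B0 phiB] := test_bounded tp; have [sp cp hp] := tp.
have [wf vf] := field_mul mO mz bz Az L2p dz tp phiB.
rewrite /pairing_of normrN.
apply: (field_domination w2 wmu wf cp hp vf _ (test_itg tp) phiB M0).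
  exact: smooth_continuous.
move=> x i j; rewrite mxE normrM mulrC ler_wpM2r//; exact: entry_bnd.
Qed.

Lemma mul_div_L2 M z p phi : bounded_field M z p -> test_fun Omega phi ->
  L2set leb Omega (mul_div phi z p).
Proof.
move=> bf tp; have [mz bz Az L2p dz] := bf; have [B B0 phiB] := test_bounded tp.
have [[_ _ _ h _] _] := field_mul mO mz bz Az L2p dz tp phiB.
by move=> i j; apply: sqiS.
Qed.

Lemma pairing_of_lin M z p a phi psi : bounded_field M z p -> test_fun Omega phi ->
  test_fun Omega psi -> pairing_of z p w (fun x => a * phi x + psi x) =
    a * pairing_of z p w phi + pairing_of z p w psi.
Proof.
move=> bf tp tq.
have i1 := L2_frob_itg mO (mul_div_L2 bf tp) w2.
have i2 := L2_frob_itg mO (mul_div_L2 bf tq) w2.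
rewrite /pairing_of mulrN -opprD -RintegralZl// -RintegralD//; last exact: itgZ.
congr (- _); apply: eq_Rintegral => x _; rewrite -frobZl -frobDl; congr frob.
apply/rowP => i; rewrite [RHS]mxE [X in X + _]mxE !mul_divE.
have D j : 'D_(delta_mx 0 j : V) (fun x => a * phi x + psi x) x =
    a * partial j phi x + partial j psi x.
  have d1 := @smooth_derivable _ _ phi x (delta_mx 0 j) (test_smooth tp).
  have d2 := @smooth_derivable _ _ psi x (delta_mx 0 j) (test_smooth tq).
  by have := deriveD (@derivableZ _ _ _ phi a x _ d1) d2; rewrite (deriveZ a d1).
under eq_bigr do rewrite D mulrDl -mulrA.
by rewrite big_split/= -mulr_sumr; ring.
Qed.

Lemma pairing_of_measure M z p : bounded_field M z p -> is_bounded_measure Omega (pairing_of z p w).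
Proof.
move=> bf; apply: (@riesz_markov _ _ _ oO _ (M * mass (fun=> 1))).
  by move=> a phi psi; exact: pairing_of_lin bf.
move=> phi tp p1; apply: le_trans (ler_norm _) _.
apply: le_trans (pairing_of_bound bf tp) _; rewrite ler_wpM2l ?(bounded_field_ge0 bf)//.
apply: (gradient_mass_le mu (M := 1)) => //.
- by apply: measurableT_comp => //; exact: smooth_meas (test_smooth tp).
- by move=> x; rewrite normr_id.
- by move=> x; rewrite normr1.
Qed.

Definition exhausts (eta : nat -> V -> R) :=
  (forall k, test_fun Omega (eta k) /\ forall x, 0 <= eta k x <= 1) /\
  forall K, compact K -> K `<=` Omega -> exists N, forall k, (N <= k)%N ->
    exists2 W, open W & K `<=` W /\ forall x, W x -> eta k x = 1.

Lemma exhausts_bnd eta k x : exhausts eta -> `|eta k x| <= 1.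
Proof. by move=> [h _]; have /andP[? ?] := (h k).2 x; rewrite ger0_norm. Qed.

Lemma exhausts_cvg eta x : exhausts eta -> Omega x -> (fun k => eta k x) @ \oo --> (1 : R).
Proof.
move=> [_ h] Ox; have [|N HN] := h _ (@compact_set1 _ x); first by move=> _ ->.
by apply: cvg_near_cst; exists N => // k /= /HN[W _ [xW ->]] //; exact: xW.
Qed.

(** The mass is a limit of values of [T], hence the same for every representing pair of measures;
    this settles the choice made in [total_mass]. *)
Lemma represents_mass T mup mum eta : represents Omega T mup mum -> exhausts eta ->
  (fun k => T (eta k)) @ \oo --> fine (mup Omega) - fine (mum Omega).
Proof.
move=> HT He.
rewrite (_ : (fun k => T (eta k)) = fun k =>
  \int[mup]_(x in Omega) eta k x - \int[mum]_(x in Omega) eta k x); last first.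
  by apply/funext => k; apply: HT; exact: (He.1 k).1.
have key (nu : {finite_measure set V -> \bar R}) :
    (fun k => \int[nu]_(x in Omega) eta k x) @ \oo --> fine (nu Omega).
  have -> : fine (nu Omega) = \int[nu]_(x in Omega) (cst 1 x) by rewrite Rintegral_cst// mul1r.
  apply: (Rint_cvg mO (g := cst 1) _ _ _ _ _).2 => //.
  - move=> k; apply: (measurable_funS measurableT) => //.
    exact: smooth_meas (test_smooth (He.1 k).1).
  - by apply: aeW => x Ox; exact: exhausts_cvg.
  - by apply: (@fin_itg _ _ 1) => // x; rewrite normr1.
  - by apply: aeW => x k _; exact: exhausts_bnd.
by apply: cvgB; exact: key.
Qed.

Lemma total_mass_cvg T eta : is_bounded_measure Omega T -> exhausts eta ->
  (fun k => T (eta k)) @ \oo --> total_mass Omega T.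
Proof.
move=> [mup [mum h]] He; have := getPex (ex_intro (fun l => exists mup mum,
  represents Omega T mup mum /\ l = fine (mup Omega) - fine (mum Omega)) _
  (ex_intro _ mup (ex_intro _ mum (conj h erefl)))).
by move=> [m1 [m2 [h' e]]]; rewrite /total_mass /= e; exact: represents_mass.
Qed.

Lemma total_mass_eq T T' : is_bounded_measure Omega T ->
  (forall phi, test_fun Omega phi -> T phi = T' phi) -> total_mass Omega T = total_mass Omega T'.
Proof.
move=> hT TT'; have [eta He] := exhaustion oO.
have hT' : is_bounded_measure Omega T'.
  by have [mup [mum h]] := hT; exists mup, mum => phi tp; rewrite -TT'//; exact: h.
have c1 := total_mass_cvg hT He; have c2 := total_mass_cvg hT' He.
rewrite (_ : (fun k => T (eta k)) = fun k => T' (eta k)) in c1; last first.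
  by apply/funext => k; apply: TT'; exact: (He.1 k).1.
exact: (cvg_unique _ c1 c2).
Qed.

(** Eventually the cut-off is 1 near the support of the field, so its gradient contributes nothing
    there. *)
Lemma pairing_of_compact M z p K : bounded_field M z p -> compact K -> K `<=` Omega ->
  vanishes_off K z p -> forall eta, exhausts eta -> exists N, forall k, (N <= k)%N ->
    pairing_of z p w (eta k) = - \int[leb]_(x in Omega) frob (p x) (w x).
Proof.
move=> bf cK KO zK eta He; have [N HN] := He.2 K cK KO.
exists N => k /HN[W oW [KW W1]]; congr (- _); apply: eq_Rintegral => x _; congr frob.
apply/rowP => i; rewrite mul_divE; have [xK|/zK[-> ->]] := pselect (K x); last first.
  by rewrite !mxE mulr0 add0r big1// => j _; rewrite mxE mulr0.
rewrite W1 ?mul1r; last exact: KW.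
rewrite big1 ?addr0// => j _.
have -> : partial j (eta k) x = partial j (cst (1 : R)) x.
  apply: near_eq_derive; apply: filterS (open_nbhs_nbhs (conj oW (KW x xK))) => y; exact: W1.
by rewrite derive_cst mul0r.
Qed.

(* The mass outside a compact set is controlled by |Aw| uniformly in k, so no mass
   escapes to the boundary in the limit. *)
Lemma total_mass_limit M z p (zk : nat -> V -> 'M[R]_(m, n)) (pk : nat -> V -> 'rV[R]_m) K :
  bounded_field M z p -> (forall k, bounded_field M (zk k) (pk k)) ->
  (forall k, [/\ compact (K k), K k `<=` Omega & vanishes_off (K k) (zk k) (pk k)]) ->
  (forall i j, (fun k => \int[leb]_(x in Omega) ((zk k x i j - z x i j) ^+ 2)) @ \oo --> (0 : R)) ->
  (forall i, (fun k => \int[leb]_(x in Omega) ((pk k x 0 i - p x 0 i) ^+ 2)) @ \oo --> (0 : R)) ->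
  total_mass Omega (pairing_of z p w) = - \int[leb]_(x in Omega) frob (p x) (w x).
Proof.
move=> bf bk HK cz cp; have [eta He] := exhaustion oO.
have M0 := bounded_field_ge0 bf.
have te k := (He.1 k).1.
have p2 i : sqi leb Omega (fun x => p x 0 i) by apply: sqiS => //; exact: (bf_L2 bf).
have pk2 k i : sqi leb Omega (fun x => pk k x 0 i) by apply: sqiS => //; exact: (bf_L2 (bk k)).
have E (q : V -> 'rV[R]_m) : (forall i, sqi leb Omega (fun x => q x 0 i)) ->
    \int[leb]_(x in Omega) frob (q x) (w x) = \sum_i \int[leb]_(x in Omega) (q x 0 i * w x 0 i).
  move=> q2; rewrite -Rint_sum//; last by move=> i; exact: sqi_mul (q2 i) (w2 0 i).
  by apply: eq_Rintegral => x _; rewrite /frob big_ord1.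
have cI : (fun k => \int[leb]_(x in Omega) frob (pk k x) (w x)) @ \oo -->
    \int[leb]_(x in Omega) frob (p x) (w x).
  under eq_fun do rewrite E//; rewrite E//; apply: cvgn_sum => i.
  exact: (L2_weak_cvg mO (fun k => pk2 k i) (p2 i) (w2 0 i) (cp i)).
(* With the cut-off fixed, the pairing is continuous in the field and in its divergence for L2
   convergence. *)
have cP l : (fun k => pairing_of (zk k) (pk k) w (eta l)) @ \oo --> pairing_of z p w (eta l).
  have [B B0 eB] := test_bounded (te l).
  have E2 N y q : bounded_field N y q -> pairing_of y q w (eta l) =
      - \sum_i (\int[leb]_(x in Omega) (q x 0 i * (eta l x * w x 0 i)) +
        \sum_j \int[leb]_(x in Omega) (y x i j * (partial j (eta l) x * w x 0 i))).
    move=> [my by_ _ q2 _]; congr (- _).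
    have i1 i : leb.-integrable Omega (EFin \o (fun x => q x 0 i * (eta l x * w x 0 i))).
      have := sqi_mul mO (sqiS mO (bounded_mul_sqi (smooth_meas (test_smooth (te l))) eB (q2 0 i))) (w2 0 i).
      by apply: eq_integrable => // x _ /=; congr EFin; ring.
    have i2 i j : leb.-integrable Omega (EFin \o (fun x => y x i j * (partial j (eta l) x * w x 0 i))).
      have td := test_sqiT (test_derive (delta_mx 0 j) (te l)).
      have := sqi_mul mO (sqiS mO (bounded_mul_sqi (my i j) (entry_bnd i j by_) td)) (w2 0 i).
      by apply: eq_integrable => // x _ /=; congr EFin; ring.
    have i3 i : leb.-integrable Omega (EFin \o (fun x => \sum_j y x i j * (partial j (eta l) x * w x 0 i))).
      by apply: itg_sum.
    transitivity (\int[leb]_(x in Omega) (\sum_i (q x 0 i * (eta l x * w x 0 i)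
      + \sum_j y x i j * (partial j (eta l) x * w x 0 i)))).
      apply: eq_Rintegral => x _; rewrite /frob big_ord1; apply: eq_bigr => i _.
      rewrite mul_divE mulrDl mulr_suml; congr (_ + _); first by ring.
      by apply: eq_bigr => j _; ring.
    rewrite Rint_sum//; last by move=> i; exact: itgD.
    apply: eq_bigr => i _; rewrite RintegralD//; congr (_ + _); rewrite Rint_sum//.
  rewrite (E2 _ _ _ bf); under eq_fun do rewrite (E2 _ _ _ (bk _)).
  have w1 (g : V -> R) (C : R) : measurable_fun setT g -> (forall x, `|g x| <= C) -> forall i,
      sqi leb Omega (fun x => g x * w x 0 i).
    move=> mg gC i; have [mw w2i] := w2 0 i.
    split; first by apply: measurable_funM => //; exact: measurable_funS mg.
    have := bounded_mul_itg mO (f := fun x => g x ^+ 2) (M := C ^+ 2) _ _ w2i.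
    under [X in (_ -> _ -> _.-integrable _ X) -> _]eq_fun do rewrite -exprMn.
    apply; first by apply: measurable_funX; exact: measurable_funS mg.
    by move=> x _; rewrite normrX lerXn2r// ?nnegrE// (le_trans (normr_ge0 _) (gC x)).
  apply: cvgN; apply: cvgn_sum => i; apply: cvgD.
    apply: (L2_weak_cvg mO (fun k => pk2 k i) (p2 i) _ (cp i)).
    exact: w1 (smooth_meas (test_smooth (te l))) eB i.
  apply: cvgn_sum => j.
  have [B' _ eB'] := test_bounded (test_derive (delta_mx 0 j) (te l)).
  have zs N y q : bounded_field N y q -> sqi leb Omega (fun x => y x i j).
    move=> [my by_ _ _ _]; apply: (sqi_bounded mO (M := N) fO).
      exact: measurable_funS (my i j).
    by apply: aeW => x _; exact: entry_bnd.
  apply: (L2_weak_cvg mO (fun k => zs _ _ _ (bk k)) (zs _ _ _ bf) _ (cz i j)).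
  exact: w1 (smooth_meas (test_smooth (test_derive _ (te l)))) eB' i.
pose rho l := mass (fun x => 1 - eta l x).
have m1e l : measurable_fun setT (fun x => 1 - eta l x).
  by apply: measurable_funB => //; exact: smooth_meas (test_smooth (te l)).
have b1e l x : `|1 - eta l x| <= 1.
  by have /andP[? ?] := (He.1 l).2 x; rewrite ger0_norm ?subr_ge0//; lra.
have crho : rho @ \oo --> (0 : R).
  have <- : mass (fun=> 0) = 0.
    rewrite /gradient_mass big1// => i _; rewrite big1// => j _.
    by rewrite !Rintegral_cst// !mul0r addr0.
  apply: (@gradient_mass_cvg mu (fun l x => 1 - eta l x) (fun=> 0) 1) => // x Ox.
  rewrite -(subrr (1 : R)); apply: cvgB; [exact: cvg_cst|exact: exhausts_cvg].
(* For large [L] the pairing with [eta L] is exactly the integral term, because [zk k] has compact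
   support. What remains is the pairing with [eta l - eta L], bounded in modulus by
   [(1 - eta l) + (1 - eta L)], and [rho L] tends to 0. *)
have bnd k l : `|pairing_of (zk k) (pk k) w (eta l) +
    \int[leb]_(x in Omega) frob (pk k x) (w x)| <= M * rho l.
  have [cK KO vK] := HK k.
  have [N HN] := pairing_of_compact (bk k) cK KO vK He.
  have cr : (fun L => M * (rho l + rho L)) @ \oo --> M * rho l.
    rewrite -[X in _ --> M * X]addr0; apply: cvgMl_tmp; apply: cvgD => //; exact: cvg_cst.
  have cc : (fun L : nat => `|pairing_of (zk k) (pk k) w (eta l) +
    \int[leb]_(x in Omega) frob (pk k x) (w x)|) @ \oo --> `|pairing_of (zk k) (pk k) w (eta l) +
    \int[leb]_(x in Omega) frob (pk k x) (w x)| by exact: cvg_cst.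
  apply: (ler_cvg_to cc cr); exists N => // L /= /HN e.
  rewrite -[\int[leb]_(x in Omega) _]opprK -e.
  have -> : pairing_of (zk k) (pk k) w (eta l) - pairing_of (zk k) (pk k) w (eta L) =
      pairing_of (zk k) (pk k) w (fun x => (-1) * eta L x + eta l x).
    by rewrite (pairing_of_lin (-1) (bk k) (te L) (te l)) mulN1r addrC.
  have tt : test_fun Omega (fun x => (-1) * eta L x + eta l x).
    by apply: testD => //; exact: testZ.
  apply: le_trans (pairing_of_bound (bk k) tt) _; rewrite ler_wpM2l//.
  rewrite /rho -(gradient_massD mu (M := 1))//.
  apply: (gradient_mass_le mu (M := 2)) => //.
  + by apply: measurableT_comp => //; exact: smooth_meas (test_smooth tt).
  + exact: measurable_funD.
  + move=> x; rewrite normr_id; have /andP[? ?] := (He.1 l).2 x.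
    by have /andP[? ?] := (He.1 L).2 x; rewrite ler_norml; apply/andP; split; lra.
  + move=> x; have /andP[? ?] := (He.1 l).2 x.
    by have /andP[? ?] := (He.1 L).2 x; rewrite ler_norml; apply/andP; split; lra.
  + move=> x; have /andP[? ?] := (He.1 l).2 x.
    by have /andP[? ?] := (He.1 L).2 x; rewrite ler_norml; apply/andP; split; lra.
have bnd' l : `|pairing_of z p w (eta l) + \int[leb]_(x in Omega) frob (p x) (w x)| <= M * rho l.
  apply: (@cvgn_le _ _ _ _ (cvg_norm (cvgD (cP l) cI))) => k; exact: bnd.
apply: (cvg_unique _ (total_mass_cvg (pairing_of_measure bf) He)) => //.
apply/cvgrPdist_le => e e0.
have : (fun l => M * rho l) @ \oo --> M * 0 by apply: cvgMl_tmp.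
rewrite mulr0 => /cvgrPdist_le/(_ _ e0)[N _ HN]; exists N => // l /HN /=.
rewrite sub0r normrN => h; rewrite -normrN opprB opprK.
exact: le_trans (bnd' l) (le_trans (ler_norm _) h).
Qed.

End with_w.

Lemma bounded_sqi (f : V -> R) (M : R) : measurable_fun setT f -> (forall x, `|f x| <= M) -> sqi leb Omega f.
Proof.
move=> mf fM; apply: (sqi_bounded mO (M := M) fO); first exact: measurable_funS mf.
exact: aeW.
Qed.

(** Truncate [G] at height [T]. The truncation is bounded, so L2 convergence handles it; the rest is
    small in L1, where the uniform bound [M] is enough. *)
Lemma L1_weak_cvg (f_ : nat -> V -> R) (f G : V -> R) (M : R) : (forall k, measurable_fun setT (f_ k)) ->
  measurable_fun setT f -> (forall k x, `|f_ k x| <= M) -> (forall x, `|f x| <= M) ->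
  (fun k => \int[leb]_(x in Omega) ((f_ k x - f x) ^+ 2)) @ \oo --> (0 : R) ->
  leb.-integrable Omega (EFin \o G) ->
  (fun k => \int[leb]_(x in Omega) (f_ k x * G x)) @ \oo --> \int[leb]_(x in Omega) (f x * G x).
Proof.
move=> mf_ mf f_M fM cv Gi; have mG := itg_meas Gi.
have M0 : 0 <= M := le_trans (normr_ge0 _) (fM 0).
pose S (T : nat) := Omega `&` (fun x => `|G x|) @^-1` [set` `]-oo, T%:R]].
have mS T : measurable (S T) by apply: (measurableT_comp (@normr_measurable R setT) mG).
pose GT (T : nat) x : R := G x * \1_(S T) x.
have m1 T : measurable_fun Omega (\1_(S T) : V -> R).
  by apply: (measurable_funS measurableT) => //; exact: measurable_indic.
have mGT T : measurable_fun Omega (GT T) by exact: measurable_funM.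
have bGT T x : Omega x -> `|GT T x| <= T%:R.
  move=> Ox; rewrite /GT indicE; case: (boolP (x \in S T)) => [|_].
    by rewrite inE mulr1 => -[_] /=; rewrite in_itv.
  by rewrite mulr0 normr0.
have sGT T : sqi leb Omega (GT T).
  by apply: (sqi_bounded mO (M := T%:R) fO) => //; apply: aeW => x; exact: bGT.
have aGi : leb.-integrable Omega (EFin \o (fun x => `|G x|)).
  by have := integrable_norm Gi; apply: eq_integrable.
have dGT T x : `|G x - GT T x| <= `|G x|.
  by rewrite /GT indicE; case: (_ \in _); rewrite ?mulr1 ?subrr ?normr0// mulr0 subr0.
have iGT T : leb.-integrable Omega (EFin \o GT T).
  apply: (itg_le mO (mGT T) _ aGi) => x _; rewrite /GT normrM indicE.
  by case: (_ \in _); rewrite ?normr1 ?normr0 ?mulr1// mulr0.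
have idGT T : leb.-integrable Omega (EFin \o (fun x => `|G x - GT T x|)).
  by have := integrable_norm (itgB mO Gi (iGT T)); apply: eq_integrable.
have cT : (fun T => \int[leb]_(x in Omega) `|G x - GT T x|) @ \oo --> (0 : R).
  have -> : 0 = \int[leb]_(x in Omega) (cst 0 x) :> R by rewrite Rintegral_cst// mul0r.
  apply: (Rint_cvg mO (g := fun x => `|G x|) _ _ _ _ _).2 => //.
  - by move=> T; exact: itg_meas (idGT T).
  - apply: aeW => x Ox; apply: cvg_near_cst.
    exists (Num.bound `|G x|) => // T /= hT; rewrite /GT indicE mem_set ?mulr1 ?subrr ?normr0//.
    split=> //=; rewrite in_itv/=; apply: ltW; apply: lt_le_trans (archi_boundP (normr_ge0 _)) _.
    by rewrite ler_nat.
  - by apply: aeW => x T _; rewrite normr_id.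
have itf (h g : V -> R) : measurable_fun setT h -> (forall x, `|h x| <= M) ->
    leb.-integrable Omega (EFin \o g) -> leb.-integrable Omega (EFin \o (fun x => h x * g x)).
  move=> mh hM gi; apply: (bounded_mul_itg mO _ _ gi); first exact: measurable_funS mh.
  by move=> x _; exact: hM.
apply/cvgrPdist_lt => e e0.
have e1 : 0 < e / (4 * M + 1) by rewrite divr_gt0//; lra.
move/cvgrPdist_lt : cT => /(_ _ e1)[T _ /(_ T (leqnn T))] /=.
rewrite sub0r normrN ger0_norm ?Rintegral_ge0// => hT.
have := L2_weak_cvg mO (fun k => bounded_sqi (mf_ k) (f_M k)) (bounded_sqi mf fM) (sGT T) cv.
move=> /cvgrPdist_lt/(_ _ (divr_gt0 e0 (ltr0Sn R 1)))[N _ HN].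
exists N => // k /HN /= hN.
have i1 := itf _ _ mf fM Gi; have i2 := itf _ _ (mf_ k) (f_M k) Gi.
have i3 := itf _ _ mf fM (iGT T); have i4 := itf _ _ (mf_ k) (f_M k) (iGT T).
have i5 := itf _ _ mf fM (itgB mO Gi (iGT T)).
have i6 := itf _ _ (mf_ k) (f_M k) (itgB mO Gi (iGT T)).
have E (h : V -> R) : leb.-integrable Omega (EFin \o (fun x => h x * GT T x)) ->
    leb.-integrable Omega (EFin \o (fun x => h x * (G x - GT T x))) ->
    \int[leb]_(x in Omega) (h x * G x) = \int[leb]_(x in Omega) (h x * GT T x) +
      \int[leb]_(x in Omega) (h x * (G x - GT T x)).
  move=> h1 h2; rewrite -RintegralD//; apply: eq_Rintegral => x _; ring.
have B (h : V -> R) : (forall x, `|h x| <= M) ->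
    leb.-integrable Omega (EFin \o (fun x => h x * (G x - GT T x))) ->
    `|\int[leb]_(x in Omega) (h x * (G x - GT T x))| <= M * \int[leb]_(x in Omega) `|G x - GT T x|.
  move=> hM h2; apply: le_trans (le_normr_Rintegral _ _) _ => //.
  rewrite -RintegralZl//; apply: Rint_le => //.
  - by have := integrable_norm h2; apply: eq_integrable.
  - exact: (itgZ mO M (idGT T)).
  - by move=> x _; rewrite normrM ler_wpM2r.
rewrite (E _ i3 i5) (E _ i4 i6).
have := B _ fM i5; have := B _ (f_M k) i6.
have : 0 <= \int[leb]_(x in Omega) `|G x - GT T x| by exact: Rintegral_ge0.
move: hT hN.
move: (\int[leb]_(x in Omega) (f x * (G x - GT T x))) (\int[leb]_(x in Omega) (f_ k x * (G x - GT T x))).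
move: (\int[leb]_(x in Omega) (f x * GT T x)) (\int[leb]_(x in Omega) (f_ k x * GT T x)).
move: (\int[leb]_(x in Omega) `|G x - GT T x|) => d a b c c' hd.
rewrite ltr_pdivlMr in hd; last by lra.
move=> hab d0 h1 h2; have : `|a + c - (b + c')| <= `|a - b| + `|c| + `|c'|.
  rewrite (_ : a + c - (b + c') = (a - b) + c - c'); last by ring.
  apply: le_trans (ler_normB _ _) _; rewrite lerD2r; exact: ler_normD.
have : M * d <= e / 4 by nra.
move: hab h1 h2; lra.
Qed.

(** Limits of compactly supported fields with a common bound: the working form of a vanishing normal
    trace, under which integration by parts has no boundary term. *)
Definition inner_limit z p := exists M zk pk K,
  [/\ forall k : nat, wfield A M (zk k) (pk k),
     forall k, [/\ compact (K k), K k `<=` Omega & vanishes_off (K k) (zk k) (pk k)],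
     forall i j, (fun k => \int[leb]_(x in Omega) ((zk k x i j - z x i j) ^+ 2)) @ \oo --> (0 : R) &
     forall i, (fun k => \int[leb]_(x in Omega) ((pk k x 0 i - p x 0 i) ^+ 2)) @ \oo --> (0 : R)].

(** The entries of the mollified field are eventually test functions on Omega, so the weak gradient
    of [phi] can be tested with them and the identity is exact. [G] is merely integrable, which is
    why its term passes to the limit by [L1_weak_cvg]. *)
Lemma compact_zero_trace (M : R) z p (K : set V) (phi : V -> 'rV[R]_m) (G : V -> 'M[R]_(m, n)) : wfield A M z p -> compact K -> K `<=` Omega ->
  vanishes_off K z p -> L2 Omega phi -> L1 Omega G -> is_weak_grad Omega phi G ->
  \int[leb]_(x in Omega) (frob (p x) (phi x) + frob (z x) (G x)) = 0.
Proof.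
move=> wz cK KO zK phi2 G1 gr; have [mz bz Az L2p dz] := wz.
have p2 i : sqi leb Omega (fun x => p x 0 i) by apply: sqiS.
have E (q : V -> 'rV[R]_m) (y : V -> 'M[R]_(m, n)) : (forall i, sqi leb Omega (fun x => q x 0 i)) ->
    (forall i j, measurable_fun setT (fun x => y x i j)) ->
    (forall i j (x : V), `|y x i j| <= M) ->
    \int[leb]_(x in Omega) (frob (q x) (phi x) + frob (y x) (G x)) =
    \sum_i \int[leb]_(x in Omega) (q x 0 i * phi x 0 i) +
    \sum_i \sum_j \int[leb]_(x in Omega) (y x i j * G x i j).
  move=> q2 my yM.
  have i1 i : leb.-integrable Omega (EFin \o (fun x => q x 0 i * phi x 0 i)).
    exact: sqi_mul (q2 i) (phi2 0 i).
  have i2 i j : leb.-integrable Omega (EFin \o (fun x => y x i j * G x i j)).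
    apply: (bounded_mul_itg mO _ _ (G1 i j)); first exact: measurable_funS (my i j).
    by move=> x _; exact: yM.
  transitivity (\int[leb]_(x in Omega) ((\sum_i q x 0 i * phi x 0 i) +
      \sum_i \sum_j y x i j * G x i j)).
    by apply: eq_Rintegral => x _; rewrite /frob big_ord1.
  rewrite RintegralD//; last 2 first.
  - exact: itg_sum.
  - by apply: itg_sum => // i; exact: itg_sum.
  rewrite Rint_sum// Rint_sum//; last by move=> i; exact: itg_sum.
  by congr (_ + _); apply: eq_bigr => i _; rewrite Rint_sum.
pose P k x : 'rV[R]_m := \row_i moll_divergence k p i x.
pose Z k x : 'M[R]_(m, n) := \matrix_(i, j) moll_field k z i j x.
have r0 k : 0 < k.+1%:R^-1 :> R by rewrite invr_gt0.
have P2 k i : sqi leb Omega (fun x => P k x 0 i).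
  under eq_fun do rewrite mxE; apply: sqiS => //; exact: moll_divergence_sqi wz cK zK k i.
have mZ k i j : measurable_fun setT (fun x => Z k x i j).
  by under eq_fun do rewrite mxE; apply: conv_moll_meas => //; exact: field_itg wz cK zK i j.
have zM i j x : `|z x i j| <= M by exact: entry_bnd.
have ZM k i j x : `|Z k x i j| <= M.
  have zi := field_itg wz cK zK i j.
  rewrite mxE ler_norml; apply/andP; split; last first.
    by apply: conv_moll_le => // y; apply: le_trans (ler_norm _) _; exact: zM.
  rewrite lerNl (_ : - moll_field k z i j x = conv (moll k.+1%:R^-1) (fun y => - z y i j) x).
    apply: conv_moll_le => //; first by have := itgZ measurableT (-1) zi; apply: eq_integrable => // y _ /=; rewrite mulN1r.
    by move=> y; apply: le_trans (ler_norm _) _; rewrite normrN.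
  rewrite /moll_field /conv -mulN1r -RintegralZl//; last exact: conv_moll_itg.
  by apply: eq_Rintegral => y _; ring.
have cP i : (fun k => \int[leb]_(x in Omega) ((P k x 0 i - p x 0 i) ^+ 2)) @ \oo --> (0 : R).
  have := moll_divergence_cvg wz cK zK i oO fO KO.
  move=> /(L2_cvg_sub mO); under [X in _ -> X @ _ --> _]eq_fun do under eq_Rintegral do rewrite mxE.
  by apply=> k; exact: sqiB (moll_divergence_sqi wz cK zK k i) (L2p 0 i).
have cZ i j : (fun k => \int[leb]_(x in Omega) ((Z k x i j - z x i j) ^+ 2)) @ \oo --> (0 : R).
  have := moll_field_cvg wz cK zK i j oO fO KO.
  move=> /(L2_cvg_sub mO); under [X in _ -> X @ _ --> _]eq_fun do under eq_Rintegral do rewrite mxE.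
  have zs := field_sqi wz cK zK i j.
  by apply=> k; exact: sqiB (conv_moll_contract (r0 k) (field_itg wz cK zK i j) zs).1 zs.
rewrite E//.
have cv : (fun k => \sum_i \int[leb]_(x in Omega) (P k x 0 i * phi x 0 i) +
    \sum_i \sum_j \int[leb]_(x in Omega) (Z k x i j * G x i j)) @ \oo -->
    \sum_i \int[leb]_(x in Omega) (p x 0 i * phi x 0 i) +
    \sum_i \sum_j \int[leb]_(x in Omega) (z x i j * G x i j).
  apply: cvgD.
    by apply: cvgn_sum => i; exact: (L2_weak_cvg mO (fun k => P2 k i) (p2 i) (phi2 0 i) (cP i)).
  apply: cvgn_sum => i; apply: cvgn_sum => j.
  exact: (L1_weak_cvg (fun k => mZ k i j) (mz i j) (fun k => ZM k i j) (zM i j) (cZ i j) (G1 i j)).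
apply: (cvg_unique _ cv) => //.
have [N HN] := moll_field_test wz cK zK oO KO.
apply: cvg_near_cst; exists N => // k /= Nk.
have tZ i j := HN k i j Nk.
have dZ i j : \int[leb]_(x in Omega) (Z k x i j * G x i j) =
    - \int[leb]_(x in Omega) (phi x 0 i * partial j (moll_field k z i j) x).
  have := gr _ (tZ i j) i j; rewrite /distr_grad mxE => ->.
  by apply: eq_Rintegral => x _; rewrite mxE mulrC.
have dP i : \int[leb]_(x in Omega) (P k x 0 i * phi x 0 i) =
    \sum_j \int[leb]_(x in Omega) (phi x 0 i * partial j (moll_field k z i j) x).
  rewrite -Rint_sum//; last first.
    by move=> j; apply: sqi_mul => //; exact: (test_sqi oO fO (test_derive _ (tZ i j))).
  apply: eq_Rintegral => x _; rewrite mxE -(moll_field_div wz cK zK) mulrC mulr_sumr.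
  by [].
under eq_bigr do rewrite dP.
under [X in _ + X]eq_bigr do under eq_bigr do rewrite dZ.
by rewrite -big_split big1// => i _ /=; rewrite -big_split big1// => j _ /=; rewrite subrr.
Qed.

Lemma inner_limit_zero_trace z p (phi : V -> 'rV[R]_m) (G : V -> 'M[R]_(m, n)) (M : R) : inner_limit z p ->
  (forall i j, measurable_fun setT (fun x => z x i j)) -> (forall x, frob_norm (z x) <= M) ->
  (forall i, sqi leb Omega (fun x => p x 0 i)) ->
  L2 Omega phi -> L1 Omega G -> is_weak_grad Omega phi G ->
  \int[leb]_(x in Omega) (frob (p x) (phi x) + frob (z x) (G x)) = 0.
Proof.
move=> [N [zk [pk [K [wk HK cz cp]]]]] mz bz p2 phi2 G1 gr.
pose B := Num.max M N.
have zB i j x : `|z x i j| <= B.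
  by apply: le_trans (entry_bnd i j bz x) _; rewrite le_max lexx.
have zkB k i j x : `|zk k x i j| <= B.
  have [_ b _ _ _] := wk k; apply: le_trans (entry_bnd i j b x) _.
  by rewrite le_max lexx orbT.
have mzk k i j : measurable_fun setT (fun x => zk k x i j) by have [h] := wk k.
have pk2 k i : sqi leb Omega (fun x => pk k x 0 i).
  by have [_ _ _ h _] := wk k; apply: sqiS.
have E (q : V -> 'rV[R]_m) (y : V -> 'M[R]_(m, n)) : (forall i, sqi leb Omega (fun x => q x 0 i)) ->
    (forall i j, measurable_fun setT (fun x => y x i j)) ->
    (forall i j (x : V), `|y x i j| <= B) ->
    \int[leb]_(x in Omega) (frob (q x) (phi x) + frob (y x) (G x)) =
    \sum_i \int[leb]_(x in Omega) (q x 0 i * phi x 0 i) +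
    \sum_i \sum_j \int[leb]_(x in Omega) (y x i j * G x i j).
  move=> q2 my yM.
  have i1 i : leb.-integrable Omega (EFin \o (fun x => q x 0 i * phi x 0 i)).
    exact: sqi_mul (q2 i) (phi2 0 i).
  have i2 i j : leb.-integrable Omega (EFin \o (fun x => y x i j * G x i j)).
    apply: (bounded_mul_itg mO _ _ (G1 i j)); first exact: measurable_funS (my i j).
    by move=> x _; exact: yM.
  transitivity (\int[leb]_(x in Omega) ((\sum_i q x 0 i * phi x 0 i) +
      \sum_i \sum_j y x i j * G x i j)).
    by apply: eq_Rintegral => x _; rewrite /frob big_ord1.
  rewrite RintegralD//; last 2 first.
  - exact: itg_sum.
  - by apply: itg_sum => // i; exact: itg_sum.
  rewrite Rint_sum// Rint_sum//; last by move=> i; exact: itg_sum.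
  by congr (_ + _); apply: eq_bigr => i _; rewrite Rint_sum.
rewrite E//.
have cv : (fun k => \sum_i \int[leb]_(x in Omega) (pk k x 0 i * phi x 0 i) +
    \sum_i \sum_j \int[leb]_(x in Omega) (zk k x i j * G x i j)) @ \oo -->
    \sum_i \int[leb]_(x in Omega) (p x 0 i * phi x 0 i) +
    \sum_i \sum_j \int[leb]_(x in Omega) (z x i j * G x i j).
  apply: cvgD.
    by apply: cvgn_sum => i; exact: (L2_weak_cvg mO (fun k => pk2 k i) (p2 i) (phi2 0 i) (cp i)).
  apply: cvgn_sum => i; apply: cvgn_sum => j.
  exact: (L1_weak_cvg (fun k => mzk k i j) (mz i j) (fun k => zkB k i j) (zB i j) (cz i j) (G1 i j)).
apply: (cvg_unique _ cv) => //; apply: cvg_near_cst; exists 0%N => // k _ /=.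
have [cK KO vK] := HK k.
by rewrite -E// (compact_zero_trace (wk k) cK KO vK).
Qed.

(** * Pushing fields inward across a Lipschitz boundary *)

Hypothesis lO : lipschitz_boundary Omega.

Lemma closure_domain_compact : compact (closure Omega).
Proof.
apply: bounded_closed_compact; last exact: closed_closure.
have [M [Mr hM]] := bO; exists M; split => // N MN x /= cx; case: leP => // Nx; exfalso.
have nb : nbhs x [set y : V | N < `|y|].
  exact: (cvgr_gt (`|x|) (@norm_continuous _ _ x) _ Nx).
by have [y [Oy /=]] := cx _ nb; rewrite ltNge (hM N MN y Oy).
Qed.

Lemma lipschitz_continuous (g : V -> R) : lipschitz g -> continuous g.
Proof.
move=> [k [kr hk]] x; pose k' : R := `|k| + 1.
have k'0 : 0 < k' by rewrite /k' ltr_pwDr.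
have kk' : k < k' by have := ler_norm k; rewrite /k'; lra.
have h := hk _ kk'.
have fx : Filter (nbhs x) by exact: nbhs_filter.
apply/cvgrPdist_lt => e e0; have := nbhsx_ballx x _ (divr_gt0 e0 k'0).
apply: filterS => y; rewrite -ball_normE /= ltr_pdivlMr// mulrC => xy.
exact: le_lt_trans (h (x, y) (conj I I)) xy.
Qed.

Lemma frob_continuous (e : V) : continuous (fun y : V => frob y e).
Proof.
have E (y : V) : frob y e = \sum_j e ord0 j * y ord0 j.
  by rewrite /frob big_ord1; apply: eq_bigr => j _; rewrite mulrC.
rewrite (_ : (fun y : V => frob y e) = fun y => \sum_j e ord0 j * y ord0 j); last exact/funext.
elim: (index_enum _) => [|k s IH].
  by under eq_fun do rewrite big_nil; exact: cst_continuous.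
under eq_fun do rewrite big_cons; move=> x.
apply: (@continuousD _ _ _ (fun y : V => e ord0 k * y ord0 k)); last exact: IH.
apply: (@continuousM _ _ (fun=> e ord0 k)); first exact: cst_continuous.
exact: coord_continuous.
Qed.

(** In a chart Omega lies strictly above a graph in the direction [e], so small shifts along [e]
    move the closure into Omega, uniformly near [x0]. *)
Lemma inward_direction x0 : closure Omega x0 -> exists (r tau : R) (e : V),
  [/\ 0 < r, 0 < tau & forall x t, closure Omega x -> ball x0 r x -> 0 < t < tau ->
    Omega (x + t *: e)].
Proof.
move=> cx0; have [ix0|nx0] := pselect (interior Omega x0).
  have := oO (interior_subset ix0) => /nbhs_ballP[r /= r0 hr].
  (* At an interior point the zero direction serves. *)
  exists r, 1, 0; split => // x t _ xr _; rewrite scaler0 addr0; exact: hr.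
have [e [g [r [e1 lg r0 H]]]] := lO (conj cx0 nx0).
pose P (y : V) : V := y - frob y e *: e.
have cP : continuous P.
  move=> x; have c := @continuousZr_tmp R V V (fun y => frob y e) e x (@frob_continuous e x).
  exact: (@continuousB R V V id (fun y => frob y e *: e) x).
have cg : continuous (fun y => g (P y) - frob y e).
  move=> x; have cgP : {for P x, continuous g} := @lipschitz_continuous g lg (P x).
  have c := continuous_comp (cP x) cgP.
  exact: (@continuousB R R^o V (g \o P) (fun y => frob y e) x c (@frob_continuous e x)).
exists (r / 2), (r / 2), e; split; [by rewrite divr_gt0|by rewrite divr_gt0|].
move=> x t cx xr /andP[t0 tr].
have eb i j : `|e i j| <= 1.
  apply: le_trans (entry_le_frob_norm e i j) _; by rewrite /frob_norm e1 sqrtr1.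
have xr2 : ball x0 r x by apply: le_ball xr; lra.
have xtr : ball x0 r (x + t *: e).
  apply/mx_ballE; split => // i j; have /mx_ballE[_ /(_ i j) h] := xr.
  rewrite !mxE opprD addrA; apply: le_lt_trans (ler_normB _ _) _.
  rewrite normrM gtr0_norm//; have : t * `|e i j| <= t by rewrite ler_piMr// ltW.
  move: h; lra.
apply: (H _ xtr).2; rewrite frobDl frobZl e1 mulr1.
(* The projection [P] ignores the shift along [e] while the height grows by [t]: the weak inequality
   valid on the closure becomes strict. *)
have -> : x + t *: e - (frob x e + t) *: e = P x.
  by rewrite scalerDl opprD addrACA subrr addr0.
suff : g (P x) <= frob x e by move: t0; lra.
rewrite leNgt; apply/negP => hlt.
have d0 : 0 < g (P x) - frob x e by rewrite subr_gt0.
have n1 : nbhs x [set y | 0 < g (P y) - frob y e].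
  have h := cvgr_gt _ (cg x) _ d0; exact: h.
have n2 : nbhs x (ball x0 r) by apply: open_nbhs_nbhs; split => //; exact: ball_open.
have nb := filterI n1 n2.
have [y [Oy [/= h1 h2]]] := cx _ (nb (nbhs_filter x)).
by have := (H y h2).1 Oy; rewrite -/(P y); move: h1; lra.
Qed.

Lemma inner_limit0 : inner_limit (fun=> 0) (fun=> 0).
Proof.
exists 0, (fun _ _ => 0), (fun _ _ => 0), (fun=> set0); split.
- by move=> k; exact: wfield0.
- by move=> k; split => //; exact: compact0.
- move=> i j; under eq_fun do under eq_Rintegral do rewrite !mxE subrr expr0n.
  by rewrite Rintegral_cst// mul0r; exact: cvg_cst.
- move=> i; under eq_fun do under eq_Rintegral do rewrite !mxE subrr expr0n.
  by rewrite Rintegral_cst// mul0r; exact: cvg_cst.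
Qed.

Lemma L2_cvgD (f_ g_ : nat -> V -> R) (f g : V -> R) :
  (forall k, sqi leb Omega (f_ k)) -> (forall k, sqi leb Omega (g_ k)) ->
  sqi leb Omega f -> sqi leb Omega g ->
  (fun k => \int[leb]_(x in Omega) ((f_ k x - f x) ^+ 2)) @ \oo --> (0 : R) ->
  (fun k => \int[leb]_(x in Omega) ((g_ k x - g x) ^+ 2)) @ \oo --> (0 : R) ->
  (fun k => \int[leb]_(x in Omega) ((f_ k x + g_ k x - (f x + g x)) ^+ 2)) @ \oo --> (0 : R).
Proof.
move=> f_2 g_2 f2 g2 cf cg.
have c2 : (fun k => 2 * \int[leb]_(x in Omega) ((f_ k x - f x) ^+ 2) +
    2 * \int[leb]_(x in Omega) ((g_ k x - g x) ^+ 2)) @ \oo --> (0 : R).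
  have -> : 0 = 2 * 0 + 2 * 0 :> R by rewrite !mulr0 addr0.
  by apply: cvgD; apply: cvgMl_tmp.
apply: (@squeeze_cvgr _ _ _ _ (cst 0) _ _ _ _ _ c2) => //; last exact: cvg_cst.
apply: nearW => k; apply/andP; split.
  by apply: Rintegral_ge0 => x _; exact: sqr_ge0.
have i1 := (sqiB mO (f_2 k) f2).2; have i2 := (sqiB mO (g_2 k) g2).2.
rewrite -!RintegralZl// -RintegralD//; [|exact: itgZ|exact: itgZ].
apply: Rint_le => //.
- have := (sqiB mO (sqiD mO (f_2 k) (g_2 k)) (sqiD mO f2 g2)).2; exact.
- by apply: itgD => //; exact: itgZ.
move=> x _; have -> : f_ k x + g_ k x - (f x + g x) = (f_ k x - f x) + (g_ k x - g x) by ring.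
move: (f_ k x - f x) (g_ k x - g x) => a b; have := sqr_ge0 (a - b); rewrite sqrrB sqrrD; lra.
Qed.

Lemma inner_limitD M N z p y q : wfield A M z p -> wfield A N y q ->
  inner_limit z p -> inner_limit y q ->
  inner_limit (fun x => z x + y x) (fun x => p x + q x).
Proof.
move=> wz wy [M1 [zk [pk [K [wk hK cz cp]]]]] [M2 [yk [qk [L [vk hL cy cq]]]]].
have zs C (z' : V -> 'M[R]_(m, n)) p' i j : wfield A C z' p' -> sqi leb Omega (fun x => z' x i j).
  move=> [mz' bz' _ _ _]; apply: (sqi_bounded mO (M := C) fO).
    exact: measurable_funS (mz' i j).
  by apply: aeW => x _; exact: entry_bnd.
have ps C (z' : V -> 'M[R]_(m, n)) p' i : wfield A C z' p' -> sqi leb Omega (fun x => p' x 0 i).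
  by move=> [_ _ _ h _]; apply: sqiS.
exists (`|1| * M1 + `|1| * M2), (fun k x => zk k x + yk k x), (fun k x => pk k x + qk k x),
  (fun k => K k `|` L k); split.
- move=> k; have := wfield_lin 1 1 (wk k) (vk k).
  by under eq_fun do rewrite !scale1r; under [X in wfield _ _ _ X]eq_fun do rewrite !scale1r.
- move=> k; have [cK KO zK] := hK k; have [cL LO yL] := hL k; split.
  + exact: compactU_rV.
  + by move=> x [/KO|/LO].
  + move=> x nKL; have [-> ->] : zk k x = 0 /\ pk k x = 0 by apply: zK => ?; apply: nKL; left.
    have [-> ->] : yk k x = 0 /\ qk k x = 0 by apply: yL => ?; apply: nKL; right.
    by rewrite !addr0.
- move=> i j; under eq_fun do under eq_Rintegral do rewrite !mxE.
  by apply: L2_cvgD => // [k|k||]; [exact: zs (wk k)|exact: zs (vk k)|exact: zs wz|exact: zs wy].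
- move=> i; under eq_fun do under eq_Rintegral do rewrite !mxE.
  by apply: L2_cvgD => // [k|k||]; [exact: ps (wk k)|exact: ps (vk k)|exact: ps wz|exact: ps wy].
Qed.

Lemma sqi_shift_sub (f : V -> R) v : sqi leb setT f -> sqi leb setT (fun x => f (x + v) - f x).
Proof.
by move=> hf; exact: sqiB (sqi_translate v hf) hf.
Qed.

Section localisation.
Variables (M : R) (z : V -> 'M[R]_(m, n)) (p : V -> 'rV[R]_m).
Hypotheses (wz : wfield A M z p) (vz : vanishes_off Omega z p).

Lemma localised_wfield U phi : test_fun U phi ->
  exists N, wfield A N (fun x => phi x *: z x) (mul_div phi z p) /\
    vanishes_off (tsupp phi `&` Omega) (fun x => phi x *: z x) (mul_div phi z p).
Proof.
move=> tp; have [B _ pB] := test_bounded tp; have [mz bz Az L2p dz] := wz.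
have [wf vf] := field_mul measurableT mz bz Az L2p dz (test_subset (@subsetT _ _) tp) pB.
exists (B * M); split => // x nx; have [xp|/vf//] := pselect (tsupp phi x).
have [z0 p0] : z x = 0 /\ p x = 0 by apply: vz => Ox; apply: nx.
rewrite z0 scaler0; split => //; apply/rowP => i.
by rewrite mul_divE p0 !mxE mulr0 add0r z0 big1// => j _; rewrite mxE mulr0.
Qed.

(** Translating [phi z] along [e] moves its support into Omega, keeps bound, constraint and
    divergence, and converges in L2 by continuity of translations. *)
Lemma inner_limit_chart x0 (r tau : R) (e : V) phi : 0 < tau ->
  (forall x t, closure Omega x -> ball x0 r x -> 0 < t < tau -> Omega (x + t *: e)) ->
  test_fun (ball x0 r) phi ->
  inner_limit (fun x => phi x *: z x) (mul_div phi z p).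
Proof.
move=> tau0 He tp; have [N [wf vf]] := localised_wfield tp.
set Y := (fun x => _) in wf vf *; set q := mul_div _ _ _ in wf vf *.
pose t (k : nat) := tau / 2 * k.+1%:R^-1.
have t01 k : 0 < t k < tau.
  have k1 : 0 < k.+1%:R^-1 :> R by rewrite invr_gt0.
  have k2 : k.+1%:R^-1 <= 1 :> R by rewrite invf_le1// ler1n.
  move: k1 k2; rewrite /t; move: (k.+1%:R^-1) => a a0 a1.
  by rewrite mulr_gt0 ?divr_gt0//=; nra.
have ct : (fun k => - (t k *: e)) @ \oo --> (0 : V).
  have ct0 : (fun k => - t k) @ \oo --> (0 : R).
    rewrite -oppr0; apply: cvgN; rewrite -(mulr0 (tau / 2)).
    exact: (@cvgMl_tmp _ _ _ _ _ (tau / 2) _ (@cvg_invS R)).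
  have := @cvgZr_tmp R V nat \oo _ _ _ e ct0 => /(_ _); rewrite scale0r.
  by under eq_fun do rewrite scaleNr; exact.
have [_ cp sp] := tp.
exists N, (fun k x => Y (x - t k *: e)), (fun k x => q (x - t k *: e)),
  (fun k => (fun x => x + t k *: e) @` (tsupp phi `&` closure Omega)); split.
- by move=> k; exact: wfield_translate.
- move=> k; split.
  + apply: continuous_compact.
      by apply: continuous_subspaceT; exact: shift_continuous.
    by apply: compact_closedI => //; exact: closed_closure.
  + by move=> _ [x [xp cx] <-]; apply: He => //; exact: sp.
  + move=> x nx; apply: vf => -[h1 h2]; apply: nx; exists (x - t k *: e); last by rewrite subrK.
    by split; [exact: h1|exact: subset_closure h2].
- have [mY bY _ _ _] := wf => i j.
  have Ys : sqi leb setT (fun x => Y x i j).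
    have h : sqi leb Omega (fun x => Y x i j).
      apply: (sqi_bounded mO (M := N) fO); first exact: measurable_funS (mY i j).
      by apply: aeW => x _; exact: entry_bnd.
    have := sqi_restrict mO h; rewrite restrict_supp// => x nx.
    by have [|-> _] := vf x; [case|rewrite mxE].
  apply: L2_cvg_sub => //.
    apply: (translate_cvg_L2 oO fO Ys _ ct) => x nx.
    by have [|-> _] := vf x; [case|rewrite mxE].
  move=> k; exact: sqi_shift_sub.
- have [_ _ _ q2 _] := wf => i; have qs := q2 0 i.
  apply: L2_cvg_sub => //.
    apply: (translate_cvg_L2 oO fO qs _ ct) => x nx.
    by have [|_ ->] := vf x; [case|rewrite mxE].
  move=> k; exact: sqi_shift_sub.
Qed.

Lemma inner_limit_empty phi : test_fun set0 phi ->
  inner_limit (fun x => phi x *: z x) (mul_div phi z p).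
Proof.
move=> [sp cp p0]; have phi0 : phi = fun=> 0.
  by apply/funext => x; apply: contrapT => /eqP nx; apply: (p0 x); exact: subset_closure.
have := inner_limit0; congr inner_limit; apply/funext => x; first by rewrite phi0 scale0r.
apply/rowP => i; rewrite mul_divE phi0 mxE mul0r add0r big1// => j _.
by rewrite derive_cst mul0r.
Qed.

(** Partition of unity by induction on the finite cover: [test_split] separates one chart from the
    others. *)
Lemma inner_limit_local (s : seq V) (U : V -> set V) phi :
  (forall x psi, test_fun (U x) psi ->
    inner_limit (fun x => psi x *: z x) (mul_div psi z p)) ->
  (forall x, open (U x)) -> test_fun (\big[setU/set0]_(x <- s) U x) phi ->
  inner_limit (fun x => phi x *: z x) (mul_div phi z p).
Proof.
move=> hU oU; elim: s phi => [|x0 s IH] phi.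
  by rewrite big_nil; exact: inner_limit_empty.
rewrite big_cons => tp.
have oW : open (\big[setU/set0]_(x <- s) U x) by rewrite -bigcup_seq; exact: bigcup_open.
have [_ _ sU] := tp.
have [eta [seta _ t1 t2]] := test_split openT (oU x0) oW (test_subset (@subsetT _ _) tp) sU.
rewrite !setTI in t1 t2.
have [N1 [w1 _]] := localised_wfield t1; have [N2 [w2 _]] := localised_wfield t2.
have := inner_limitD w1 w2 (hU _ _ t1) (IH _ t2).
congr inner_limit; apply/funext => x; first by rewrite -scalerDl -mulrDr addrC subrK mulr1.
apply/rowP => i; rewrite [LHS]mxE !mul_divE addrACA -mulrDl -mulrDr (addrC (eta x)) subrK mulr1.
congr (_ + _); rewrite -big_split; apply: eq_bigr => j _ /=; rewrite -mulrDl; congr (_ * _).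
have d1 := @smooth_derivable _ _ _ x (delta_mx 0 j) (test_smooth t1).
have d2 := @smooth_derivable _ _ _ x (delta_mx 0 j) (test_smooth t2).
apply: etrans (esym (deriveD d1 d2)) _; congr ('D_(_) _ x); apply/funext => y.
by rewrite [RHS](_ : _ = phi y * eta y + phi y * (1 - eta y))//; ring.
Qed.

Lemma inner_limit_wfield : inner_limit z p.
Proof.
have /choice[r Hr] (x0 : V) : exists r : R, 0 < r /\ (closure Omega x0 -> exists (tau : R) (e : V),
    0 < tau /\ forall x t, closure Omega x -> ball x0 r x -> 0 < t < tau -> Omega (x + t *: e)).
  have [c0|nc] := pselect (closure Omega x0); last by exists 1; split.
  by have [r [tau [e [? ? ?]]]] := inward_direction c0; exists r; split => // _; exists tau, e.
(* The condition on the centre makes [U] a family over all points that is empty off the closure,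
   where no chart is given. *)
pose U x0 := [set x | closure Omega x0 /\ ball x0 (r x0) x].
have oU x0 : open (U x0).
  have [c0|nc] := pselect (closure Omega x0).
    rewrite (_ : U x0 = ball x0 (r x0)); first exact: ball_open.
    by apply/seteqP; split => x // -[].
  rewrite (_ : U x0 = set0); first exact: open0.
  by apply/seteqP; split => x // -[].
have cU : closure Omega `<=` cover (closure Omega) U.
  by move=> x cx; exists x => //; split => //; apply: ballxx; exact: (Hr x).1.
have := closure_domain_compact; rewrite compact_cover => /(_ _ _ _ (fun x _ => oU x) cU)[D _ sD].
rewrite /cover bigcup_fset in sD.
have oW : open (\big[setU/set0]_(x <- finmap.enum_fset D) U x).
  by rewrite -bigcup_seq; exact: bigcup_open.
have [eta [te _ [W oWW [KW W1]]]] := cutoff closure_domain_compact oW sD.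
have hU x0 psi : test_fun (U x0) psi -> inner_limit (fun x => psi x *: z x) (mul_div psi z p).
  move=> tp; have [c0|nc] := pselect (closure Omega x0).
    have [tau [e [tau0 h]]] := (Hr x0).2 c0; apply: (inner_limit_chart tau0 h).
    by apply: test_subset tp => x [].
  by apply: inner_limit_empty; apply: test_subset tp => x [/nc].
(* [eta] is 1 near the closure of Omega, so multiplication by it changes neither the field nor its
   divergence. *)
have := inner_limit_local hU oU te; congr inner_limit; apply/funext => x.
  have [Ox|/vz[-> _]] := pselect (Omega x); last by rewrite scaler0.
  by rewrite W1 ?scale1r//; apply: KW; exact: subset_closure.
apply/rowP => i; rewrite mul_divE; have [Ox|/vz[-> ->]] := pselect (Omega x); last first.
  by rewrite !mxE mulr0 add0r big1// => j _; rewrite mxE mulr0.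
have Wx : W x by apply: KW; exact: subset_closure.
rewrite W1// mul1r big1 ?addr0// => j _.
have -> : partial j eta x = partial j (cst (1 : R)) x.
  by apply: near_eq_derive; apply: filterS (open_nbhs_nbhs (conj oWW Wx)) => y; exact: W1.
by rewrite derive_cst mul0r.
Qed.
End localisation.

(* Extension by zero: div of the extension has no part on the boundary. *)
Lemma zero_trace_wfield M z p : bounded_field M z p -> vanishes_off Omega z p ->
  (forall (phi : V -> 'rV[R]_m) (G : V -> 'M[R]_(m, n)), L1 Omega phi -> L2 Omega phi -> L1 Omega G ->
    is_weak_grad Omega phi G ->
    \int[leb]_(x in Omega) (frob (p x) (phi x) + frob (z x) (G x)) = 0) ->
  wfield A M z p.
Proof.
move=> [mz bz Az L2p dz] vz H; split => // psi tpsi i.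
(* A test function of the whole space need not vanish on the boundary of Omega, which is what the
   trace hypothesis covers; one row of the divergence is tested at a time. *)
pose phi x : 'rV[R]_m := psi x *: delta_mx 0 i.
pose G x : 'M[R]_(m, n) := \matrix_(k, l) ((k == i)%:R%R * partial l psi x).
have phiE k x : phi x 0 k = (k == i)%:R%R * psi x by rewrite !mxE eqxx mulrC.
have [B [_ mpsi pB]] := test_bounded_meas tpsi.
have bi (f : V -> R) C (b : bool) : measurable_fun setT f -> (forall x, `|f x| <= C) ->
    measurable_fun setT (fun x => b%:R%R * f x) /\ forall x, `|b%:R%R * f x| <= C.
  move=> mf fC; split; first exact: measurable_funM.
  by move=> x; case: b; rewrite ?mul1r// mul0r normr0 (le_trans (normr_ge0 _) (fC x)).
have p2 : L2 Omega phi.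
  move=> k0 k; rewrite (ord1 k0); have [m1 b1] := bi _ _ (k == i) mpsi pB.
  by have := bounded_sqi m1 b1; under eq_fun do rewrite -phiE.
have p1 : L1 Omega phi.
  by move=> k0 k; rewrite (ord1 k0); exact: (sqi_itg oO fO (p2 0 k)).
have G1 : L1 Omega G.
  move=> k l; have [C [_ md dC]] := test_bounded_meas (test_derive (delta_mx 0 l) tpsi).
  have [m1 b1] := bi _ _ (k == i) md dC; apply: sqi_itg => //.
  by have := bounded_sqi m1 b1; congr sqi; apply/funext => x; rewrite mxE.
have gr : is_weak_grad Omega phi G.
  move=> chi tchi k l; rewrite mxE.
  have tc := test_subset (@subsetT _ _) tchi.
  have out x : ~ Omega x -> chi x = 0 /\ forall v, 'D_v chi x = 0.
    move=> nx; apply: (vanish_tsupp tchi) => xe; apply: nx; have [_ _] := tchi; exact.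
  rewrite (@Rint_supp _ _ Omega (fun x => phi x 0 k * partial l chi x)); last first.
    by move=> x /out[_ ->]; rewrite mulr0.
  rewrite (@Rint_supp _ _ Omega (fun x => G x k l * chi x)); last first.
    by move=> x /out[-> _]; rewrite mulr0.
  under eq_Rintegral do rewrite phiE -mulrA.
  under [RHS]eq_Rintegral do rewrite mxE -mulrA.
  case: (k == i); last first.
    under eq_Rintegral do rewrite mul0r; under [RHS]eq_Rintegral do rewrite mul0r.
    by rewrite Rintegral_cst// mul0r oppr0.
  under eq_Rintegral do rewrite mul1r; under [RHS]eq_Rintegral do rewrite mul1r.
  by rewrite (integration_by_parts _ tpsi (test_smooth tchi)) opprK.
have := H phi G p1 p2 G1 gr.
have E x : frob (p x) (phi x) + frob (z x) (G x) =
    p x 0 i * psi x + \sum_j z x i j * partial j psi x.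
  rewrite /frob big_ord1; congr (_ + _).
    rewrite (bigD1 i)//= phiE eqxx mul1r big1 ?addr0// => k ki.
    by rewrite phiE (negbTE ki) mul0r mulr0.
  rewrite (bigD1 i)//= [X in _ + X]big1 ?addr0 => [|k ki].
    by apply: eq_bigr => j _; rewrite mxE eqxx mul1r.
  by apply: big1 => j _; rewrite mxE (negbTE ki) mul0r mulr0.
under eq_Rintegral do rewrite E.
rewrite Rint_supp; last first.
  move=> x /vz[-> ->]; rewrite mxE mul0r add0r big1// => j _; by rewrite mxE mul0r.
rewrite RintegralD//.
- by move=> /eqP; rewrite addr_eq0 => /eqP ->.
- exact: sqi_mul (L2p 0 i) (test_sqiT tpsi).
- apply: itg_sum => // j.
  exact: test_mul_meas_bnd (test_derive _ tpsi) (mz i j) (entry_bnd i j bz).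
Qed.

(** * The conjugate integrand *)

Hypothesis A_idem : forall y, A (A y) = A y.
Variable f : V -> W -> R.
Hypothesis f_ge0 : forall x y, closure Omega x -> 0 <= f x y.
Hypothesis f_meas : measurable_fun (closure Omega `*` [set: W]) (fun xy : V * W => f xy.1 xy.2).
Hypothesis f_convex : forall x, closure Omega x ->
  convex_function [set: convex_lmodType W] (f x).
Variables (c0 C0 : R).
Hypotheses (c0_gt0 : 0 < c0) (C0_gt0 : 0 < C0).
Hypothesis f_growth : forall x y, closure Omega x ->
  c0 * frob_norm (A y) <= f x y <= C0 * (1 + frob_norm (A y)).
Let inO x : Omega x -> closure Omega x := @subset_closure _ Omega x.
Implicit Types (x : V) (y v : W).

Lemma frob_norm_ge0 (p q : nat) (y : 'M[R]_(p, q)) : 0 <= frob_norm y.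
Proof. exact: sqrtr_ge0. Qed.

Lemma frob_norm0 (p q : nat) : frob_norm (0 : 'M[R]_(p, q)) = 0.
Proof. by rewrite frob_normE snorm0. Qed.

Lemma fstar_leP x v c : (fstar f x v <= c%:E)%E <-> forall y, frob v y - f x y <= c.
Proof.
split=> [h y|h].
  by rewrite -lee_fin; apply: le_trans h; apply: ereal_sup_ubound; exists y.
by apply: ge_ereal_sup => _ [y _ <-]; rewrite lee_fin.
Qed.

Lemma fstar_ge x v y : ((frob v y - f x y)%:E <= fstar f x v)%E.
Proof. by apply: ereal_sup_ubound; exists y. Qed.

Lemma fstar_lb x v : closure Omega x -> ((- C0)%:E <= fstar f x v)%E.
Proof.
move=> cx; apply: le_trans (fstar_ge x v 0); rewrite lee_fin.
have -> : frob v 0 = 0 := ip0r (frob_ip R m n) v.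
by have /andP[_] := f_growth 0 cx; rewrite linear0 frob_norm0 addr0 mulr1 sub0r lerN2.
Qed.

Lemma fstar_fin x v : closure Omega x -> (fstar f x v < +oo)%E ->
  fstar f x v = (fine (fstar f x v))%:E.
Proof. by move=> cx; have := fstar_lb v cx; case: fstar. Qed.

Lemma fine_fstar_ge x v : closure Omega x -> - C0 <= fine (fstar f x v).
Proof.
move=> cx; have := fstar_lb v cx; case: (fstar f x v) => [r| |] //=; rewrite ?lee_fin// => _.
by rewrite lerNl oppr0 ltW.
Qed.

(** [v : y = v : A y <= c0 |A y| <= f x y], by symmetry of [A] and the lower growth bound. *)
Lemma fstar_small x v : closure Omega x -> A v = v -> frob_norm v <= c0 ->
  (fstar f x v <= 0%:E)%E.
Proof.
move=> cx Az zc; apply/fstar_leP => y; rewrite subr_le0.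
have /andP[h _] := f_growth y cx; apply: le_trans h.
rewrite -Az A_sym; apply: le_trans (ip_le_norm (frob_ip R m n) _ _) _.
by rewrite -!frob_normE ler_wpM2r// frob_norm_ge0.
Qed.

Lemma fstar_norm x v : closure Omega x -> A v = v -> (fstar f x v < +oo)%E ->
  frob_norm v <= C0.
Proof.
move=> cx Az hfin; rewrite leNgt; apply/negP => hz.
have /fstar_leP H : (fstar f x v <= (fine (fstar f x v))%:E)%E by rewrite -fstar_fin.
set r := frob_norm v in hz; set c := fine _ in H.
have r0 : 0 < r by exact: lt_trans C0_gt0 hz.
(* If [|v| = r > C0], then along the ray [s *: v] the quantity under the supremum is at least
   [s r (r - C0) - C0]; this [s] pushes it above the finite value [c]. *)
pose s := (`|c| + C0 + 1) / (r * (r - C0)).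
have d0 : 0 < r * (r - C0) by rewrite mulr_gt0// subr_gt0.
have s0 : 0 <= s by rewrite divr_ge0 ?(ltW d0)// !addr_ge0// ltW.
have := H (s *: v); have /andP[_] := f_growth (s *: v) cx.
have -> : frob v (s *: v) = s * frob v v := ipZr (frob_ip R m n) s v v.
rewrite linearZ /= Az frob_normE snormZ -frob_normE ger0_norm//.
have -> : frob v v = r ^+ 2 by rewrite -[LHS](snorm_sqr (frob_ip R m n)).
have -> : frob_norm v = r by [].
have e : s * (r * (r - C0)) = `|c| + C0 + 1 by rewrite /s divfK// gt_eqF.
move: (f x (s *: v)) (ler_norm c) => b cc h1 h2.
have : s * (r * (r - C0)) <= c + C0 by move: h1 h2; rewrite expr2; lra.
by rewrite e; lra.
Qed.

Lemma fstar_convex x v y a b t : 0 <= t <= 1 -> (fstar f x v <= a%:E)%E ->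
  (fstar f x y <= b%:E)%E -> (fstar f x (t *: v + (1 - t) *: y)%R <= (t * a + (1 - t) * b)%:E)%E.
Proof.
move=> /andP[t0 t1] /fstar_leP ha /fstar_leP hb; apply/fstar_leP => w.
rewrite frobDl !frobZl.
rewrite (_ : t * frob v w + (1 - t) * frob y w - f x w =
  t * (frob v w - f x w) + (1 - t) * (frob y w - f x w)); last by ring.
by apply: lerD; rewrite ler_wpM2l// subr_ge0.
Qed.

(** From [f >= 0]: lowering [f] to [t * f] only increases the quantity under the supremum. This is
    what allows fields to be cut off. *)
Lemma fstar_scale x v a t : closure Omega x -> 0 <= t <= 1 -> (fstar f x v <= a%:E)%E ->
  (fstar f x (t *: v) <= (t * a)%:E)%E.
Proof.
move=> cx /andP[t0 t1] /fstar_leP ha; apply/fstar_leP => w.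
have := ler_wpM2l t0 (ha w); have := f_ge0 w cx; rewrite frobZl; nra.
Qed.

Lemma f_convexE x y (w : W) t : closure Omega x -> 0 <= t <= 1 ->
  f x (t *: y + (1 - t) *: w) <= t * f x y + (1 - t) * f x w.
Proof.
move=> cx /andP[t0 t1].
have := f_convex cx (Itv01 t0 t1) (in_setT (y : convex_lmodType W)) (in_setT (w : convex_lmodType W)).
exact.
Qed.

Definition rat_mx (k : nat) : W := map_mx ratr (odflt 0 (unpickle k : option 'M[rat]_(m, n))).

Lemma rat_mx_dense y e : 0 < e -> exists k, forall i j, `|rat_mx k i j - y i j| < e.
Proof.
move=> e0; have /choice[q hq] (ij : 'I_m * 'I_n) : exists q : rat, `|ratr q - y ij.1 ij.2| < e.
  have [|q] := @rat_in_itvoo R (y ij.1 ij.2 - e) (y ij.1 ij.2 + e); first by lra.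
  rewrite in_itv/= => /andP[h1 h2]; exists q; rewrite ltr_norml; apply/andP; split; lra.
pose Q : 'M[rat]_(m, n) := \matrix_(i, j) q (i, j).
exists (pickle Q) => i j; rewrite /rat_mx pickleK /= !mxE.
exact: (hq (i, j)).
Qed.

(* Convexity and the linear growth bound give upper semicontinuity of f x. *)
Lemma f_rat_approx x v y e : closure Omega x -> 0 < e ->
  exists k, frob v y - f x y - e <= frob v (rat_mx k) - f x (rat_mx k).
Proof.
move=> cx e0.
pose L : R := \sum_i \sum_j frob_norm (A (delta_mx i j)).
pose Z : R := \sum_i \sum_j `|v i j|.
have L0 : 0 <= L by apply: sumr_ge0 => i _; apply: sumr_ge0 => j _; exact: frob_norm_ge0.
have Z0 : 0 <= Z by apply: sumr_ge0 => i _; exact: sumr_ge0.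
pose K := C0 * (1 + (frob_norm (A y) + L)).
have K0 : 0 <= K by rewrite mulr_ge0 ?(ltW C0_gt0)// !addr_ge0 ?frob_norm_ge0.
have AL (h : W) : (forall i j, `|h i j| <= 1) -> frob_norm (A h) <= L.
  move=> h1; rewrite {1}[h]matrix_sum_delta linear_sum /=.
  have nsum (I : Type) (s : seq I) (F : I -> W) (G : I -> R) :
      (forall i, frob_norm (F i) <= G i) -> frob_norm (\sum_(i <- s) F i) <= \sum_(i <- s) G i.
    move=> FG; elim: s => [|i s IH]; first by rewrite !big_nil frob_norm0.
    rewrite !big_cons; apply: le_trans (snormD (frob_ip R m n) _ _) _.
    by rewrite -!frob_normE lerD.
  apply: (nsum) => i; rewrite linear_sum; apply: (nsum) => j; rewrite linearZ /=.
  by rewrite frob_normE snormZ -frob_normE ler_piMl// frob_norm_ge0.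
(* Moving to a rational matrix within [s] of [y] costs at most [s * K] in [f], by convexity and
   growth, and [s * Z] in the linear term. *)
pose s := Num.min 1 (e / (K + Z + 1)).
have KZ : 0 < K + Z + 1 by lra.
have s0 : 0 < s by rewrite lt_min ltr01 divr_gt0.
have s1 : s <= 1 by rewrite ge_min lexx.
have sKZ : s * (K + Z) <= e.
  have : s * (K + Z + 1) <= e by rewrite -ler_pdivlMr// /s ge_min lexx orbT.
  by move: (s0); nra.
have [k hk] := rat_mx_dense y s0; exists k; set d := rat_mx k.
pose h : W := s^-1 *: (d - y).
have h1 i j : `|h i j| <= 1.
  have -> : h i j = s^-1 * (d i j - y i j) by rewrite /h mxE [X in _ * X]mxE [X in _ + X]mxE.
  rewrite normrM gtr0_norm ?invr_gt0// mulrC ler_pdivrMr// mul1r ltW//; exact: hk.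
(* The rational point lies on the segment from [y] to [y + h], with weight only [s] on the far end,
   where the growth bound gives [f <= K]. *)
have dE : d = (1 - s) *: y + (1 - (1 - s)) *: (y + h).
  have -> : 1 - (1 - s) = s by ring.
  rewrite scalerDr addrA -scalerDl subrK scale1r.
  by rewrite /h scalerA divff ?gt_eqF// scale1r addrC subrK.
have fd : f x d <= f x y + s * K.
  have t01 : 0 <= 1 - s <= 1 by apply/andP; split; lra.
  have := f_convexE y (y + h) cx t01; rewrite -dE => /le_trans; apply.
  have /andP[_ hg] := f_growth (y + h) cx.
  have hA : frob_norm (A (y + h)) <= frob_norm (A y) + L.
    rewrite linearD; apply: le_trans (snormD (frob_ip R m n) _ _) _.
    by rewrite -!frob_normE lerD2l AL.
  have fK : f x (y + h) <= K.
    by apply: le_trans hg _; rewrite /K ler_wpM2l ?(ltW C0_gt0)// lerD2l.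
  have := ler_wpM2l (ltW s0) fK; have := f_ge0 y cx; move: (s0).
  move: (f x y) (f x (y + h)) => a b; nra.
have fz : frob v y - s * Z <= frob v d.
  rewrite lerBlDr -lerBlDl /Z mulr_sumr /frob -sumrB; apply: ler_sum => i _.
  rewrite mulr_sumr -sumrB; apply: ler_sum => j _; rewrite -mulrBr.
  apply: le_trans (ler_norm _) _; rewrite normrM mulrC ler_wpM2r//.
  by rewrite distrC ltW.
by move: sKZ; rewrite mulrDr; move: fz fd; lra.
Qed.

(** A countable supremum, which makes the conjugate along a measurable field measurable. *)
Lemma fstar_rat x v : closure Omega x ->
  fstar f x v = ereal_sup (range (fun k => (frob v (rat_mx k) - f x (rat_mx k))%:E)).
Proof.
move=> cx; apply/eqP; rewrite eq_le; apply/andP; split; last first.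
  by apply: ge_ereal_sup => _ [k _ <-]; exact: fstar_ge.
apply: ge_ereal_sup => _ [y _ <-]; apply/lee_addgt0Pr => e e0.
have [k hk] := f_rat_approx v y cx e0.
rewrite -leeBlDr// -EFinB; apply: (@le_trans _ _ (frob v (rat_mx k) - f x (rat_mx k))%:E).
  by rewrite lee_fin.
by apply: ereal_sup_ubound; exists k.
Qed.

Lemma fstar_meas (v : V -> W) : (forall i j, measurable_fun Omega (fun x => v x i j)) ->
  measurable_fun Omega (fun x => fstar f x (v x)).
Proof.
move=> mz; apply: (eq_measurable_fun (fun x =>
    esups (fun k => (frob (v x) (rat_mx k) - f x (rat_mx k))%:E) 0%N)).
  move=> x; rewrite inE => Ox; rewrite fstar_rat; last exact: subset_closure.
  rewrite /esups /=; congr ereal_sup; apply/seteqP; split=> _ [k _ <-]; exists k => //.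
apply: (measurable_fun_esups (f := fun k x => (frob (v x) (rat_mx k) - f x (rat_mx k))%:E)) => k.
apply/measurable_EFinP; apply: measurable_funB.
  apply: measurable_sum => i; apply: measurable_sum => j.
  by apply: measurable_funM => //; exact: measurable_cst.
have mg : measurable_fun Omega (fun x : V => (x, rat_mx k)).
  by apply: (@measurable_funS _ _ _ _ setT).
have mC : measurable (closure Omega).
  by apply: mx_closed_measurable; exact: closed_closure.
apply: (@measurable_comp _ _ _ _ _ _ (closure Omega `*` [set: W]) _ _ _ _ _ f_meas mg).
- exact: measurableX.
- by move=> _ [x Ox <-]; split => //; exact: subset_closure.
Qed.

(** * Fields with vanishing normal trace and their pairing *)

Lemma bounded_field_le M N z p : M <= N -> bounded_field M z p -> bounded_field N z p.
Proof. by move=> MN [mz bz Az L2p dz]; split => // x; exact: le_trans (bz x) MN. Qed.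

Lemma bounded_field_L2 M z p : bounded_field M z p -> L2 Omega p.
Proof. by move=> [_ _ _ h _] i j; apply: sqiS. Qed.

Lemma bounded_field_meas M z p i j : bounded_field M z p ->
  measurable_fun Omega (fun x => z x i j).
Proof. by move=> [h _ _ _ _]; exact: measurable_funS (h i j). Qed.

Lemma bounded_field_X2 M z p : bounded_field M z p -> X2 Omega A z.
Proof.
move=> bf; have [mz bz Az L2p dz] := bf; split.
- split; first by move=> i j; exact: bounded_field_meas bf.
  by exists M; apply: aeW => x _; exact: bz.
- by apply: aeW => x _ /=; exact: Az.
- by exists p; split => //; exact: bounded_field_L2 bf.
Qed.

Lemma divergence_ae z z' p M : X2 Omega A z -> bounded_field M z' p ->
  ae_eq leb Omega z' z -> ae_eq leb Omega (divergence Omega z) p.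
Proof.
move=> [[mz _] _ hg] bf zz; have [g2 dg] := divergenceP hg.
apply: (weak_div_unique g2 (bounded_field_L2 bf) dg).
apply: (weak_div_ae _ mz zz (bf_div bf)) => i j; exact: bounded_field_meas bf.
Qed.

(** Integration by parts without boundary term. The approximation is known for [z'], the pairing is
    built on the representative [z2] of [X2_rep]; both agree with [z] almost everywhere. *)
Lemma inner_limit_mass z z' p M w : X2 Omega A z -> bounded_field M z' p ->
  ae_eq leb Omega z' z -> inner_limit z' p -> L2 Omega w -> BVA Omega A w ->
  total_mass Omega (pairing Omega z w) = - \int[leb]_(x in Omega) frob (p x) (w x).
Proof.
move=> Xz bf zz [N [zk [pk [K [wk hK cz cp]]]]] w2 Bw.
have [mu wmu] := BVA_measures Bw; have [[mz [M0 bz]] Az hg] := Xz.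
have [z2 [p2 [bf2 [v2 zz2 pg]]]] := X2_rep Xz bz.
have ez : ae_eq leb Omega z2 z'.
  by apply: filterS2 zz zz2 => x h1 h2 Ox; rewrite (h1 Ox) (h2 Ox).
have ep : ae_eq leb Omega p2 p.
  by apply: filterS (divergence_ae Xz bf zz) => x h Ox; rewrite pg// h.
rewrite -(total_mass_eq (pairing_of_measure w2 wmu bf2)); last first.
  move=> phi tp; symmetry; apply: (pairingE Xz (bf_meas bf2) _ w2 tp); by split.
pose C := Num.max `|M0| N.
have MC : `|M0| <= C by rewrite le_max lexx.
have NC : N <= C by rewrite le_max lexx orbT.
have bk k := bounded_field_le NC (wfield_bounded (wk k)).
rewrite (total_mass_limit w2 wmu (bounded_field_le MC bf2) bk hK).
- congr (- _); apply: Rint_ae_eq => //.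
  + exact: itg_meas (L2_frob_itg mO (bounded_field_L2 bf2) w2).
  + exact: itg_meas (L2_frob_itg mO (bounded_field_L2 bf) w2).
  + by apply: filterS ep => x h Ox; rewrite h.
- move=> i j; rewrite (_ : (fun k => \int[leb]_(x in Omega) ((zk k x i j - z2 x i j) ^+ 2)) =
    fun k => \int[leb]_(x in Omega) ((zk k x i j - z' x i j) ^+ 2))//; apply/funext => k.
  have mzk := bounded_field_meas i j (bk k).
  have m1 := bounded_field_meas i j bf; have m2 := bounded_field_meas i j bf2.
  apply: Rint_ae_eq => //.
  + by apply: measurable_funX; apply: measurable_funB.
  + by apply: measurable_funX; apply: measurable_funB.
  + by apply: filterS ez => x h Ox; rewrite h.
- move=> i; rewrite (_ : (fun k => \int[leb]_(x in Omega) ((pk k x 0 i - p2 x 0 i) ^+ 2)) =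
    fun k => \int[leb]_(x in Omega) ((pk k x 0 i - p x 0 i) ^+ 2))//; apply/funext => k.
  have mpk := (bounded_field_L2 (bk k) 0 i).1.
  have m1 := (bounded_field_L2 bf 0 i).1; have m2 := (bounded_field_L2 bf2 0 i).1.
  apply: Rint_ae_eq => //.
  + by apply: measurable_funX; apply: measurable_funB.
  + by apply: measurable_funX; apply: measurable_funB.
  + by apply: filterS ep => x h Ox; rewrite h.
Qed.

Lemma trace_integrand_meas z p (phi : V -> 'rV[R]_m) (G : V -> 'M[R]_(m, n)) :
  (forall i j, measurable_fun Omega (fun x => z x i j)) -> L2 Omega p -> L2 Omega phi ->
  L1 Omega G -> measurable_fun Omega (fun x => frob (p x) (phi x) + frob (z x) (G x)).
Proof.
move=> mz p2 phi2 G1; apply: measurable_funD.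
  exact: itg_meas (L2_frob_itg mO p2 phi2).
apply: measurable_sum => i; apply: measurable_sum => j.
by apply: measurable_funM => //; exact: itg_meas (G1 i j).
Qed.

Lemma inner_limit_normal_trace z z' p M : X2 Omega A z -> bounded_field M z' p ->
  ae_eq leb Omega z' z -> inner_limit z' p -> zero_normal_trace Omega z.
Proof.
move=> Xz bf zz il phi G phi1 phi2 G1 gr; have [[mz _] _ hg] := Xz.
have [g2 _] := divergenceP hg.
rewrite -(inner_limit_zero_trace il (bf_meas bf) (bf_bnd bf) (bounded_field_L2 bf 0) phi2 G1 gr).
apply: Rint_ae_eq => //.
- exact: trace_integrand_meas.
- apply: trace_integrand_meas => //; last exact: bounded_field_L2 bf.
  by move=> i j; exact: bounded_field_meas bf.
by apply: filterS2 zz (divergence_ae Xz bf zz) => x h1 h2 Ox; rewrite h1// h2.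
Qed.

(** Zero trace makes the extension by zero a field on the whole space, and such fields can be pushed
    inward. *)
Lemma normal_trace_inner_limit z : X2 Omega A z ->
  zero_normal_trace Omega z -> exists M z' p,
    [/\ bounded_field M z' p, rep_on z z' p & inner_limit z' p].
Proof.
move=> Xz tr; have [[mz [M0 bz]] Az hg] := Xz.
have [z' [p [bf rp]]] := X2_rep Xz bz; have [v zz pg] := rp.
exists `|M0|, z', p; split => //.
apply: (inner_limit_wfield _ v).
apply: (zero_trace_wfield bf v) => phi G phi1 phi2 G1 gr.
rewrite -(tr phi G phi1 phi2 G1 gr); apply: Rint_ae_eq => //.
- apply: trace_integrand_meas => //; last exact: bounded_field_L2 bf.
  by move=> i j; exact: bounded_field_meas bf.
- by apply: trace_integrand_meas => //; have [] := divergenceP hg.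
by apply: filterS zz => x h Ox; rewrite h// pg.
Qed.

Lemma compact_inner_limit M z p K : wfield A M z p -> compact K -> K `<=` Omega ->
  vanishes_off K z p -> inner_limit z p.
Proof.
move=> wf cK KO v; exists M, (fun=> z), (fun=> p), (fun=> K); split => //.
- by move=> i j; under eq_fun do under eq_Rintegral do rewrite subrr expr0n;
    rewrite Rintegral_cst// mul0r; exact: cvg_cst.
- by move=> i; under eq_fun do under eq_Rintegral do rewrite subrr expr0n;
    rewrite Rintegral_cst// mul0r; exact: cvg_cst.
Qed.

(** [fine] sends [+oo] to 0, so this is meaningful only for fields whose conjugate is integrable. *)
Definition energy z := \int[leb]_(x in Omega) fine (fstar f x (z x)).

Lemma fine_fstar_meas z : (forall i j, measurable_fun Omega (fun x => z x i j)) ->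
  measurable_fun Omega (fun x => fine (fstar f x (z x))).
Proof. by move=> mz; apply: measurableT_comp => //; exact: fstar_meas. Qed.

Lemma fstar_itgE z : (forall i j, measurable_fun Omega (fun x => z x i j)) ->
  leb.-integrable Omega (fun x => fstar f x (z x)) ->
  [/\ leb.-integrable Omega (EFin \o (fun x => fine (fstar f x (z x)))),
      {ae leb, forall x, Omega x -> (fstar f x (z x) < +oo)%E} &
      (\int[leb]_(x in Omega) (- fstar f x (z x)))%E = (- energy z)%:E].
Proof.
move=> mz hi; have mf := fstar_meas mz; have mff := fine_fstar_meas mz.
have fi : leb.-integrable Omega (EFin \o (fun x => fine (fstar f x (z x)))).
  apply: (le_integrable mO _ _ hi); first exact/measurable_EFinP.
  by move=> x _ /=; case: (fstar f x (z x)) => [r| |] //=; rewrite normr0 leey.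
have ae := integrable_ae mO hi.
split => //; first by apply: filterS ae => x h /h; case: (fstar f x (z x)) => // r _; rewrite ltry.
rewrite /energy -mulN1r -RintegralZl// -Rint_fin//; last exact: itgZ.
apply: ae_eq_integral => //.
- exact: measurableT_comp.
- by apply/measurable_EFinP; exact: measurable_funM.
- apply: filterS ae => x h /h; case: (fstar f x (z x)) => // r _ /=.
  by rewrite mulN1r.
Qed.

(** An upper bound suffices, since the growth condition bounds the conjugate below by [- C0] and
    Omega has finite measure. *)
Lemma fstar_itg_ub z (h : V -> R) : (forall i j, measurable_fun Omega (fun x => z x i j)) ->
  leb.-integrable Omega (EFin \o h) ->
  {ae leb, forall x, Omega x -> (fstar f x (z x) <= (h x)%:E)%E} ->
  leb.-integrable Omega (fun x => fstar f x (z x)) /\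
  energy z <= \int[leb]_(x in Omega) h x.
Proof.
move=> mz hi zh; have mf := fstar_meas mz.
have fi : leb.-integrable Omega (fun x => fstar f x (z x)).
  have bi : leb.-integrable Omega (EFin \o (fun x => `|h x| + C0)).
    apply: itgD => //; first by have := integrable_norm hi; apply: eq_integrable.
    apply: (@sqi_itg _ _ _ oO fO (fun=> C0)).
    by apply: (bounded_sqi (f := cst C0) (M := C0)) => // x; rewrite gtr0_norm.
  apply/integrableP; split => //.
  have /integrableP[_] := bi; apply: le_lt_trans; apply: ae_ge0_le_integral => //.
  - exact: measurableT_comp.
  - by apply: measurableT_comp => //; exact: measurable_int bi.
  - apply: filterS zh => x H Ox; have := H Ox.
    have := fstar_lb (z x) (inO Ox); case: (fstar f x (z x)) => [r| |] //=.
    rewrite !lee_fin => h1 h2; rewrite [leRHS]ger0_norm ?addr_ge0 ?(ltW C0_gt0)//.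
    have a1 := ler_norm (h x); have a2 := normr_ge0 (h x).
    rewrite ler_norml; apply/andP; split.
      by apply: le_trans h1; rewrite lerN2 lerDr.
    by apply: le_trans h2 (le_trans a1 _); rewrite lerDl ltW.
split => //; have [gi ae _] := fstar_itgE mz fi.
apply: (Rint_ae_le mO gi hi); apply: filterS2 zh ae => x h1 h2 Ox.
by rewrite -lee_fin -(fstar_fin (inO Ox) (h2 Ox)) h1.
Qed.

Lemma energy_ge z : (forall i j, measurable_fun Omega (fun x => z x i j)) ->
  leb.-integrable Omega (fun x => fstar f x (z x)) ->
  - (C0 * fine (leb Omega)) <= energy z.
Proof.
move=> mz hi; have [gi _ _] := fstar_itgE mz hi.
rewrite -mulNr -Rintegral_cst//; apply: Rint_le => //.
  have : sqi leb Omega (cst (- C0)).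
    by apply: (bounded_sqi (M := C0)) => // x; rewrite normrN gtr0_norm.
  by move=> /(sqi_itg oO fO).
by move=> x Ox; exact: (fine_fstar_ge _ (inO Ox)).
Qed.

Lemma Zset_norm z : Zset Omega A f z -> {ae leb, forall x, Omega x -> frob_norm (z x) <= C0}.
Proof.
move=> [[[mz _] Az _] hi]; have [_ ae _] := fstar_itgE mz hi.
apply: filterS2 Az ae => x h1 h2 Ox.
exact: (fstar_norm (inO Ox) (h1 Ox) (h2 Ox)).
Qed.

(** The fields that give continuous affine functionals of [w]. The uniform bound [C0] is the one
    that [fstar_norm] forces on every field of finite energy. *)
Definition admissible z p := exists K, [/\ compact K, K `<=` Omega, vanishes_off K z p,
  wfield A C0 z p & leb.-integrable Omega (fun x => fstar f x (z x))].

Lemma dual_value_inner z z' p M w : Zset Omega A f z -> bounded_field M z' p ->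
  ae_eq leb Omega z' z -> inner_limit z' p -> L2 Omega w -> BVA Omega A w ->
  dual_value Omega f z w = (- energy z - \int[leb]_(x in Omega) frob (p x) (w x))%:E.
Proof.
move=> [Xz hi] bf zz il w2 Bw; have [[mz _] _ _] := Xz.
rewrite /dual_value (inner_limit_mass Xz bf zz il w2 Bw).
by have [_ _ ->] := fstar_itgE mz hi; rewrite -EFinD.
Qed.

Lemma admissible_Zset z p : admissible z p -> Zset Omega A f z.
Proof.
move=> [K [_ _ _ wf hi]]; split => //.
exact: (bounded_field_X2 (wfield_bounded wf)).
Qed.

Lemma admissible_value z p w : admissible z p -> L2 Omega w -> BVA Omega A w ->
  dual_value Omega f z w = (- energy z - \int[leb]_(x in Omega) frob (p x) (w x))%:E.
Proof.
move=> ad w2 Bw; have [K [cK KO v wf hi]] := ad.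
have zz : ae_eq leb Omega z z by apply: aeW.
exact: (dual_value_inner (admissible_Zset ad) (wfield_bounded wf) zz (compact_inner_limit wf cK KO v) w2 Bw).
Qed.

Lemma const_weak_div (B : W) : is_weak_div Omega (fun=> B) (fun=> 0).
Proof.
move=> psi tp i; have i1 j := sqi_itg oO fO (test_sqi oO fO (test_derive (delta_mx 0 j) tp)).
under [RHS]eq_Rintegral do rewrite mxE mul0r.
rewrite Rintegral_cst// mul0r Rint_sum//; last by move=> j; exact: itgZ.
rewrite big1 ?oppr0// => j _; rewrite RintegralZl//.
rewrite Rint_supp; last first.
  move=> x nx; apply: (vanish_tsupp tp _).2 => xe; apply: nx; have [_ _] := tp; exact.
by rewrite (integral_derive0 _ (test_subset (@subsetT _ _) tp)) mulr0.
Qed.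

Lemma admissible_test phi (B : W) : test_fun Omega phi -> (forall x, `|phi x| <= 1) ->
  A B = B -> frob_norm B <= Num.min c0 C0 ->
  admissible (fun x => phi x *: B) (mul_div phi (fun=> B) (fun=> 0)) /\
  energy (fun x => phi x *: B) <= 0.
Proof.
move=> tp p1 AB; rewrite le_min => /andP[Bc BC].
have [wf vf] := field_mul mO (z := fun=> B) (p := fun=> 0) (M := C0) (A := A) (c := 1)
  (fun i j => measurable_cst _) (fun=> BC) (fun=> AB) (wf_L2 (wfield0 A))
  (const_weak_div B) tp p1.
rewrite mul1r in wf.
have mz i j : measurable_fun Omega (fun x => (phi x *: B) i j).
  by apply: (measurable_funS measurableT) => //; have [h] := wf.
have i0 : leb.-integrable Omega (EFin \o cst (0 : R)).
  by have := sqi_itg oO fO (sqi0 leb Omega).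
have ub : {ae leb, forall x, Omega x -> (fstar f x (phi x *: B) <= 0%:E)%E}.
  apply: aeW => x Ox; apply: (fstar_small (inO Ox)); first by rewrite linearZ /= AB.
  rewrite frob_normE snormZ -frob_normE; apply: le_trans Bc.
  by rewrite ler_piMl// frob_norm_ge0.
have [fi E] := fstar_itg_ub mz i0 ub; split; last by move: E; rewrite Rintegral_cst// mul0r.
by exists (tsupp phi); split => //; have [_ cp sp] := tp.
Qed.

Lemma admissible0 : admissible (fun=> 0) (fun=> 0) /\ energy (fun=> 0) <= 0.
Proof.
have i0 : leb.-integrable Omega (EFin \o cst (0 : R)).
  by have := sqi_itg oO fO (sqi0 leb Omega).
have ub : {ae leb, forall x, Omega x -> (fstar f x 0 <= 0%:E)%E}.
  apply: aeW => x Ox; apply: (fstar_small (inO Ox)); first by rewrite linear0.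
  by rewrite frob_norm0 ltW.
have wf := wfield_le (ltW C0_gt0) (wfield0 A).
have mz i j : measurable_fun Omega (fun x : V => (0 : W) i j).
  by apply: (measurable_funS measurableT) => //; have [h] := wf.
have [fi E] := fstar_itg_ub mz i0 ub; split; last by move: E; rewrite Rintegral_cst// mul0r.
by exists set0; split => //; exact: compact0.
Qed.

Lemma distr_gradE w phi i j :
  distr_grad Omega w phi i j = - \int[leb]_(x in Omega) (w x 0 i * partial j phi x).
Proof. by rewrite mxE. Qed.

Lemma lin_mxE a (B C : W) i j : (a *: B + C) i j = a * B i j + C i j.
Proof. by rewrite !mxE. Qed.

Lemma distr_grad_lin w a phi psi : L2 Omega w -> test_fun Omega phi -> test_fun Omega psi ->
  distr_grad Omega w (fun x => a * phi x + psi x) =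
  a *: distr_grad Omega w phi + distr_grad Omega w psi.
Proof.
move=> w2 tp tq; apply/matrixP => i j.
apply: (etrans (distr_gradE _ _ _ _)); apply: (etrans _ (esym (lin_mxE _ _ _ _ _))).
transitivity (a * (- \int[leb]_(x in Omega) (w x 0 i * partial j phi x)) +
    (- \int[leb]_(x in Omega) (w x 0 i * partial j psi x))); last first.
  by congr (a * _ + _); symmetry; exact: distr_gradE.
have i1 := L2_domain_itg w2 i (test_derive (delta_mx 0 j) tp).
have i2 := L2_domain_itg w2 i (test_derive (delta_mx 0 j) tq).
have D x : partial j (fun x => a * phi x + psi x) x = a * partial j phi x + partial j psi x.
  have d1 := @smooth_derivable _ _ phi x (delta_mx 0 j) (test_smooth tp).
  have d2 := @smooth_derivable _ _ psi x (delta_mx 0 j) (test_smooth tq).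
  by have := deriveD (@derivableZ _ _ _ phi a x _ d1) d2; rewrite (deriveZ a d1).
under eq_Rintegral do rewrite D mulrDr mulrCA.
rewrite RintegralD//; last exact: itgZ.
by rewrite RintegralZl// opprD mulrN.
Qed.

Lemma admissible_pairing phi (B : W) w : L2 Omega w -> test_fun Omega phi ->
  - (\int[leb]_(x in Omega) frob (mul_div phi (fun=> B) (fun=> 0) x) (w x)) =
  frob B (distr_grad Omega w phi).
Proof.
move=> w2 tp.
have i1 i j : leb.-integrable Omega (EFin \o (fun x => B i j * (w x 0 i * partial j phi x))).
  by apply: itgZ => //; exact: (L2_domain_itg w2 i (test_derive (delta_mx 0 j) tp)).
transitivity (- \int[leb]_(x in Omega) \sum_i \sum_j B i j * (w x 0 i * partial j phi x)).
  congr (- _); apply: eq_Rintegral => x _; rewrite /frob big_ord1; apply: eq_bigr => i _.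
  rewrite mul_divE mxE mulr0 add0r mulr_suml; apply: eq_bigr => j _; ring.
rewrite Rint_sum//; last by move=> i; exact: itg_sum.
rewrite -sumrN; apply: eq_bigr => i _; rewrite Rint_sum// -sumrN; apply: eq_bigr => j _.
rewrite RintegralZl ?distr_gradE ?mulrN//.
exact: (L2_domain_itg w2 i (test_derive (delta_mx 0 j) tp)).
Qed.

(** The fields [phi *: (k *: B)] have nonpositive energy, so their values are at least [k] times an
    entry of Aw tested with [phi]. A bound on all values therefore bounds that distribution, and
    [riesz_markov] makes it a measure. *)
Lemma bounded_BVA w c : L2 Omega w ->
  (forall z p, admissible z p -> - energy z - \int[leb]_(x in Omega) frob (p x) (w x) <= c) ->
  BVA Omega A w.
Proof.
move=> w2 H; split; first by move=> i j; exact: (sqi_itg oO fO (w2 i j)).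
move=> i j; set B := A (delta_mx i j).
(* Scales [B] below [c0], for a nonpositive conjugate, and below [C0], for admissibility. *)
pose k := Num.min c0 C0 / (frob_norm B + 1).
have B0 : 0 < frob_norm B + 1 by rewrite ltr_pwDr// frob_norm_ge0.
have k0 : 0 < k by rewrite divr_gt0// lt_min c0_gt0.
apply: (@riesz_markov _ _ _ oO _ (c / k)).
  by move=> a phi psi tp tq; rewrite distr_grad_lin// linearD linearZ !mxE.
move=> phi tp p1; have AkB : A (k *: B) = k *: B by rewrite linearZ /= /B A_idem.
have kB : frob_norm (k *: B) <= Num.min c0 C0.
  rewrite frob_normE snormZ -frob_normE (gtr0_norm k0) /k mulrAC ler_pdivrMr//.
  by rewrite ler_pM2l ?lt_min ?c0_gt0// lerDl.
have [ad en] := admissible_test tp p1 AkB kB.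
have := H _ _ ad; rewrite (admissible_pairing _ w2 tp) frobZl.
rewrite (_ : frob B _ = A (distr_grad Omega w phi) i j); last first.
  by rewrite /B A_sym frobC frob_delta.
by rewrite ler_pdivlMr// mulrC; move: en; lra.
Qed.

(** Compactly supported fields already give the full supremum. A bound over them first puts [w] into
    [BVA], so that the pairings are measures; then an arbitrary field is recovered as a limit of its
    cut-offs. *)
Lemma Fdual_leP w c : L2 Omega w -> (Fdual Omega A f w <= c%:E)%E <->
  forall z p, admissible z p -> - energy z - \int[leb]_(x in Omega) frob (p x) (w x) <= c.
Proof.
move=> w2; split.
  rewrite /Fdual; case: ifPn => // /set_mem Bw h z p ad.
  rewrite -lee_fin -(admissible_value ad w2 Bw); apply: le_trans h.
  by apply: ereal_sup_ubound; exists z => //; exact: admissible_Zset ad.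
move=> H; have Bw := bounded_BVA w2 H; rewrite /Fdual mem_set//.
apply: ge_ereal_sup => _ [z Zz <-]; have [Xz hi] := Zz; have [[mz _] _ _] := Xz.
have [mu wmu] := BVA_measures Bw.
have [z' [p [bf rp]]] := X2_rep Xz (Zset_norm Zz); rewrite (gtr0_norm C0_gt0) in bf.
have [v zz pg] := rp; have [mz' bz' Az' L2p dz'] := bf.
have mz'O i j := bounded_field_meas i j bf.
have [eta He] := exhaustion oO.
have te k := (He.1 k).1.
have e1 k x : `|eta k x| <= 1 by exact: (exhausts_bnd k x He).
have [gi ae EN] := fstar_itgE mz hi.
pose g x := fine (fstar f x (z x)).
have mg : measurable_fun Omega g by exact: itg_meas gi.
have me k : measurable_fun Omega (eta k).
  by apply: (measurable_funS measurableT) => //; exact: smooth_meas (test_smooth (te k)).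
have gki k : leb.-integrable Omega (EFin \o (fun x => eta k x * g x)).
  by apply: (bounded_mul_itg mO (me k) _ gi) => x _; exact: e1.
(* The cut-off field [eta k *: z'] is admissible, and by [fstar_scale] its conjugate is at most
   [eta k] times that of [z]. *)
have bnd k : - (\int[leb]_(x in Omega) (eta k x * g x)) + pairing_of z' p w (eta k) <= c.
  have [wf vf] := field_mul mO mz' bz' Az' L2p dz' (te k) (e1 k); rewrite mul1r in wf.
  have my i j : measurable_fun Omega (fun x => (eta k x *: z' x) i j).
    by apply: (measurable_funS measurableT) => //; have [h] := wf.
  have ub : {ae leb, forall x, Omega x -> (fstar f x (eta k x *: z' x) <= (eta k x * g x)%:E)%E}.
    apply: filterS2 zz ae => x h1 h2 Ox; apply: (fstar_scale (inO Ox)).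
      exact: (He.1 k).2.
    by rewrite h1// /g -(fstar_fin (inO Ox) (h2 Ox)).
  have [fi E] := fstar_itg_ub my (gki k) ub.
  have ad : admissible (fun x => eta k x *: z' x) (mul_div (eta k) z' p).
    by exists (tsupp (eta k)); split => //; have [_ cp sp] := te k.
  have := H _ _ ad; rewrite /pairing_of; move: E; lra.
have c1 : (fun k => \int[leb]_(x in Omega) (eta k x * g x)) @ \oo --> energy z.
  apply: (Rint_cvg mO (g := fun x => `|g x|) _ _ _ _ _).2 => //.
  - by move=> k; exact: itg_meas (gki k).
  - apply: aeW => x Ox; rewrite -[X in _ --> X]mul1r; apply: cvgMr_tmp.
    exact: exhausts_cvg He Ox.
  - by have := integrable_norm gi; apply: eq_integrable.
  - by apply: aeW => x k _; rewrite normrM ler_piMl.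
have c2 := total_mass_cvg (pairing_of_measure w2 wmu bf) He.
have tmE : total_mass Omega (pairing_of z' p w) = total_mass Omega (pairing Omega z w).
  apply: (total_mass_eq (pairing_of_measure w2 wmu bf)) => phi tp.
  by symmetry; apply: (pairingE Xz mz' _ w2 tp).
rewrite /dual_value EN -EFinD lee_fin -tmE.
exact: (cvgn_le (cvgD (cvgN c1) c2) bnd).
Qed.

Lemma fstar_int_shift z : (forall i j, measurable_fun Omega (fun x => z x i j)) ->
  leb.-integrable Omega (fun x => fstar f x (z x)) ->
  (\int[leb]_(x in Omega) (fstar f x (z x) + C0%:E))%E = (energy z + C0 * fine (leb Omega))%:E.
Proof.
move=> mz hi; have [gi ae _] := fstar_itgE mz hi.
have Ci : leb.-integrable Omega (EFin \o cst C0).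
  have : sqi leb Omega (cst C0) by apply: (bounded_sqi (M := C0)) => // x; rewrite gtr0_norm.
  by move=> /(sqi_itg oO fO).
rewrite -Rintegral_cst// /energy -RintegralD// -Rint_fin//; last exact: itgD.
apply: ae_eq_integral => //.
- by apply: emeasurable_funD => //; exact: fstar_meas.
- by apply/measurable_EFinP; apply: measurable_funD => //; exact: itg_meas gi.
- apply: filterS ae => x h Ox; rewrite EFinD -(fstar_fin (inO Ox) (h Ox))//.
Qed.

(** The conjugate is a supremum of continuous affine functions. The shift by [C0] prepares for
    Fatou's lemma. *)
Lemma fstar_liminf x (y : W) (zk : nat -> W) : (forall i j, (fun k => zk k i j) @ \oo --> y i j) ->
  (fstar f x y + C0%:E <= limn_einf (fun k => (fstar f x (zk k) + C0%:E)%E))%E.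
Proof.
move=> cz; rewrite -leeBrDr//; apply: ge_ereal_sup => _ [w _ <-]; rewrite leeBrDr// -EFinD.
pose u k := frob (zk k) w - f x w + C0.
have cu : u @ \oo --> frob y w - f x w + C0.
  apply: cvgD; last exact: cvg_cst.
  apply: cvgB; last exact: cvg_cst.
  by apply: frob_cvg => // i j; exact: cvg_cst.
have [<- _] := cvg_limn_einf_sup (cvg_EFin (nearW _ (fun k => erefl : is_true ((u k)%:E \is a fin_num))) cu).
rewrite !limn_einf_lim; apply: lee_lim; [exact: is_cvg_einfs|exact: is_cvg_einfs|].
apply: nearW => N; apply: le_ereal_inf_tmp => _ [k /= Nk <-].
apply: (@le_trans _ _ (u k)%:E); first by apply: ereal_inf_lbound; exists k.
by rewrite /u EFinD leeD2r// fstar_ge.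
Qed.

(** Fatou's lemma for the nonnegative integrands [fstar + C0]. *)
Lemma energy_lsc (zk : nat -> V -> W) z c :
  (forall k i j, measurable_fun Omega (fun x => zk k x i j)) ->
  (forall i j, measurable_fun Omega (fun x => z x i j)) ->
  (forall k, leb.-integrable Omega (fun x => fstar f x (zk k x))) ->
  (forall k, energy (zk k) <= c) ->
  {ae leb, forall x, Omega x -> forall i j, (fun k => zk k x i j) @ \oo --> z x i j} ->
  leb.-integrable Omega (fun x => fstar f x (z x)) /\ energy z <= c.
Proof.
move=> mzk mz fi fc cz.
have g0 (y : V -> W) x : Omega x -> (0 <= fstar f x (y x) + C0%:E)%E.
  move=> Ox; have := fstar_lb (y x) (inO Ox).
  by rewrite -leeBlDr// sub0e -EFinN.
have mg (y : V -> W) : (forall i j, measurable_fun Omega (fun x => y x i j)) ->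
    measurable_fun Omega (fun x => fstar f x (y x) + C0%:E)%E.
  by move=> my; apply: emeasurable_funD => //; exact: fstar_meas.
have H : (\int[leb]_(x in Omega) (fstar f x (z x) + C0%:E) <= (c + C0 * fine (leb Omega))%:E)%E.
  have F := @fatou _ _ _ leb Omega mO (fun k x => fstar f x (zk k x) + C0%:E)%E
    (fun k => mg _ (mzk k)) (fun k x Ox => g0 (zk k) x Ox).
  apply: (@le_trans _ _ (\int[leb]_(x in Omega) limn_einf (fun k => (fstar f x (zk k x) + C0%:E)))%E).
    apply: ae_ge0_le_integral => //.
    - by move=> x Ox; exact: g0.
    - exact: mg.
    - move=> x Ox; rewrite limn_einf_lim; apply: lime_ge; first exact: is_cvg_einfs.
      by apply: nearW => k; apply: le_ereal_inf_tmp => _ [l _ <-]; exact: g0.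
    - apply: measurableT_comp => //; apply: measurable_fun_limn_esup => k.
      by apply: measurableT_comp => //; exact: mg.
    - by apply: filterS cz => x h Ox; exact: fstar_liminf (h Ox).
  apply: le_trans F _; rewrite limn_einf_lim; apply: lime_le; first exact: is_cvg_einfs.
  apply: nearW => k; apply: (@le_trans _ _ (\int[leb]_(x in Omega) (fstar f x (zk k x) + C0%:E))%E).
    by apply: ereal_inf_lbound; exists k => /=.
  by rewrite (fstar_int_shift (mzk k) (fi k)) lee_fin lerD2r.
have i1 : leb.-integrable Omega (fun x => fstar f x (z x) + C0%:E)%E.
  apply/integrableP; split; first exact: mg.
  rewrite (eq_integral (fun x => fstar f x (z x) + C0%:E)%E); last first.
    by move=> x; rewrite inE => Ox; rewrite gee0_abs// g0.
  exact: le_lt_trans H (ltry _).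
have iz : leb.-integrable Omega (fun x => fstar f x (z x)).
  have Ci : leb.-integrable Omega (EFin \o cst C0).
    have : sqi leb Omega (cst C0) by apply: (bounded_sqi (M := C0)) => // x; rewrite gtr0_norm.
    by move=> /(sqi_itg oO fO).
  by have := integrableB mO i1 Ci; apply: eq_integrable => // x _ /=; rewrite addeK.
by split => //; move: H; rewrite (fstar_int_shift mz iz) lee_fin lerD2r.
Qed.

Lemma admissible_convex z1 p1 z2 p2 t : admissible z1 p1 -> admissible z2 p2 -> 0 <= t <= 1 ->
  admissible (fun x => t *: z1 x + (1 - t) *: z2 x) (fun x => t *: p1 x + (1 - t) *: p2 x) /\
  energy (fun x => t *: z1 x + (1 - t) *: z2 x) <= t * energy z1 + (1 - t) * energy z2.
Proof.
move=> [K1 [cK1 KO1 v1 w1 i1]] [K2 [cK2 KO2 v2 w2 i2]] t01; have /andP[t0 t1] := t01.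
have m1 i j := bounded_field_meas i j (wfield_bounded w1).
have m2 i j := bounded_field_meas i j (wfield_bounded w2).
have [g1 ae1 _] := fstar_itgE m1 i1; have [g2 ae2 _] := fstar_itgE m2 i2.
have wf : wfield A C0 (fun x => t *: z1 x + (1 - t) *: z2 x) (fun x => t *: p1 x + (1 - t) *: p2 x).
  have := wfield_lin t (1 - t) w1 w2; rewrite !ger0_norm ?subr_ge0//.
  by rewrite -mulrDl addrC subrK mul1r.
have m3 i j := bounded_field_meas i j (wfield_bounded wf).
have := fstar_itg_ub m3 (itgD mO (itgZ mO t g1) (itgZ mO (1 - t) g2)).
rewrite RintegralD//; [|exact: itgZ|exact: itgZ]; rewrite !RintegralZl//.
case=> [|fi E]; last first.
  split => //; exists (K1 `|` K2); split => //.
  - exact: compactU_rV.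
  - by move=> x [/KO1|/KO2].
  - move=> x nK; have [-> ->] : z1 x = 0 /\ p1 x = 0 by apply: v1 => ?; apply: nK; left.
    have [-> ->] : z2 x = 0 /\ p2 x = 0 by apply: v2 => ?; apply: nK; right.
    by rewrite !scaler0 !addr0.
apply: filterS2 ae1 ae2 => x h1 h2 Ox; apply: fstar_convex => //.
  by rewrite -(fstar_fin (inO Ox) (h1 Ox)).
by rewrite -(fstar_fin (inO Ox) (h2 Ox)).
Qed.

(** * The dual functional as a convex functional on L2 *)

Local Notation H := (L2sp leb mO 1 m).
Local Notation ip := (L2_ip leb mO 1 m).
Local Notation nrm := (snorm ip).

Definition dual_energy (w : H) : \bar R := Fdual Omega A f (w : V -> 'rV[R]_m).

Lemma admissible_L2 z p : admissible z p -> L2set leb Omega p.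
Proof. by move=> [K [_ _ _ [_ _ _ h _] _]] i j; apply: sqiS. Qed.

Lemma dual_energy_leP (w : H) c : (dual_energy w <= c%:E)%E <->
  forall z (P : H), admissible z P -> - energy z - ip P w <= c.
Proof.
split=> [h z P ad|h].
  by have := (Fdual_leP c (L2spP w)).1 h z P ad.
apply/(Fdual_leP c (L2spP w)) => z p ad.
exact: (h z (toL2 mO (admissible_L2 ad)) ad).
Qed.

Lemma dual_energy_ge0 (w : H) : (0 <= dual_energy w)%E.
Proof.
have [ad en] := admissible0; have ad0 : admissible (fun=> 0) (0 : H) := ad.
case E : (dual_energy w) => [c| |] //.
  have : (dual_energy w <= c%:E)%E by rewrite E.
  by move=> /dual_energy_leP/(_ _ _ ad0); rewrite ip0l lee_fin; move: en; lra.
have : (dual_energy w <= (-1)%:E)%E by rewrite E leNye.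
by move=> /dual_energy_leP/(_ _ _ ad0); rewrite ip0l => h; exfalso; move: h en; lra.
Qed.

Lemma dual_energy_convex (x y : H) (a b t : R) : 0 <= t <= 1 ->
  (dual_energy x <= a%:E)%E -> (dual_energy y <= b%:E)%E ->
  (dual_energy (t *: x + (1 - t) *: y)%R <= (t * a + (1 - t) * b)%:E)%E.
Proof.
move=> /andP[t0 t1] /dual_energy_leP ha /dual_energy_leP hb.
apply/dual_energy_leP => z P ad; rewrite ipDr !ipZr.
have := ha _ _ ad; have := hb _ _ ad; move: (energy z) (ip P x) (ip P y) => e px py h1 h2.
have := ler_wpM2l t0 h2; have t1' : 0 <= 1 - t by rewrite subr_ge0.
have := ler_wpM2l t1' h1; lra.
Qed.

Lemma dual_energy_lsc (X : nat -> H) (x : H) (a : R) : scvg ip X x ->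
  (forall k, dual_energy (X k) <= a%:E)%E -> (dual_energy x <= a%:E)%E.
Proof.
move=> Xx h; apply/dual_energy_leP => z P ad.
have c : (fun k => - energy z - ip (X k) P) @ \oo --> - energy z - ip x P.
  by apply: cvgB; [exact: cvg_cst|exact: scvg_ip].
rewrite ipC; apply: (cvgn_le c) => k; rewrite ipC.
exact: (dual_energy_leP _ _).1 (h k) z P ad.
Qed.

(** For a smooth [w] the derivative moves from the field to [w], and admissible fields are bounded
    by [C0]; so F_dual is finite on a dense set. *)
Lemma dual_energy_test (w : H) (psi : 'I_1 -> 'I_m -> V -> R) : (forall i j, test_fun Omega (psi i j)) ->
  (forall x, w x = \matrix_(i, j) psi i j x) -> (dual_energy w < +oo)%E.
Proof.
move=> tp wE.
pose c := C0 * fine (leb Omega) + \sum_i \sum_j C0 * \int[leb]_(x in Omega) `|partial j (psi 0 i) x|.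
apply: (@le_lt_trans _ _ c%:E); last exact: ltry.
apply/dual_energy_leP => z P ad; have [K [cK KO v wf hi]] := ad.
have bf := wfield_bounded wf; have [mz bz Az L2p dz] := bf.
have mzO i j := bounded_field_meas i j bf.
have en := energy_ge mzO hi.
suff : - ip P w <= \sum_i \sum_j C0 * \int[leb]_(x in Omega) `|partial j (psi 0 i) x|.
  by move: en; rewrite /c; lra.
have td i j := test_derive (delta_mx 0 j) (tp 0 i).
have i1 i j : leb.-integrable Omega (EFin \o (fun x => partial j (psi 0 i) x)).
  exact: sqi_itg oO fO _ (test_sqi oO fO (td i j)).
have i2 i j : leb.-integrable Omega (EFin \o (fun x => z x i j * partial j (psi 0 i) x)).
  by apply: (bounded_mul_itg mO (mzO i j) _ (i1 i j)) => x _; exact: entry_bnd.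
have -> : ip P w = \sum_i \int[leb]_(x in Omega) (P x 0 i * psi 0 i x).
  rewrite -Rint_sum//; last first.
    by move=> i; exact: sqi_mul (L2spP P 0 i) (test_sqi oO fO (tp 0 i)).
  by apply: eq_Rintegral => x _; rewrite /frob big_ord1 wE; apply: eq_bigr => i _; rewrite mxE.
rewrite -sumrN; apply: ler_sum => i _; rewrite -(dz _ (tp 0 i) i) opprK Rint_sum//.
apply: ler_sum => j _; apply: le_trans (ler_norm _) _.
apply: le_trans (le_normr_Rintegral _ _) _ => //.
have i3 : leb.-integrable Omega (EFin \o (fun x => `|partial j (psi 0 i) x|)).
  by have := integrable_norm (i1 i j); apply: eq_integrable.
rewrite -RintegralZl//; apply: Rint_le => //.
- by have := integrable_norm (i2 i j); apply: eq_integrable.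
- exact: itgZ.
- by move=> x _; rewrite normrM ler_wpM2r//; exact: entry_bnd.
Qed.

Lemma dual_energy_dense (x : H) e : 0 < e -> exists2 y, (dual_energy y < +oo)%E & nrm (x - y) < e.
Proof.
move=> e0; have [psi [v [tp vE] xv]] := test_dense fO (toL2 (mx_open_measurable oO) (L2spP x)) e0.
exists (toL2 mO (L2spP v)) => //.
by apply: (dual_energy_test (w := toL2 mO (L2spP v)) tp); exact: vE.
Qed.

Local Notation sub := (sub_at ip dual_energy).

Lemma sub_cond_a (u r : H) : sub u r -> cond_a Omega A f u r.
Proof.
move=> [b Fb hb]; split; first exact: L2spP.
move=> w w2; rewrite [Fdual _ _ _ u]Fb.
have := hb (toL2 mO w2); rewrite /dual_energy /=.
case E : (Fdual Omega A f w) => [a| |]; rewrite ?leey//.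
  by move=> /(_ a (lexx _)); rewrite -EFinB lee_fin.
move=> _; have := dual_energy_ge0 (toL2 mO w2); by rewrite /dual_energy /= E.
Qed.

Lemma L2_0 : L2 Omega (fun=> 0 : 'rV[R]_m).
Proof. exact: (L2spP (0 : H)). Qed.

Lemma Fdual0 : exists c, Fdual Omega A f (fun=> 0) = c%:E.
Proof.
have h : (dual_energy (0 : H)%R < +oo)%E.
  apply: (@dual_energy_test (0 : H)%R (fun _ _ => cst 0)) => [i j|x].
    exact: test0.
  by apply/matrixP => i j; rewrite !mxE.
move: h; have := dual_energy_ge0 (0 : H)%R; rewrite /dual_energy /=.
by case: (Fdual _ _ _ _) => // c; exists c.
Qed.

Lemma BVA0 : BVA Omega A (fun=> 0).
Proof.
have [c Fc] := Fdual0; move: Fc; rewrite /Fdual; case: ifPn => // /set_mem//.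
Qed.

Lemma Fdual_fin (w : V -> 'rV[R]_m) : L2 Omega w -> (Fdual Omega A f w < +oo)%E ->
  exists c, Fdual Omega A f w = c%:E.
Proof.
move=> w2; have := dual_energy_ge0 (toL2 mO w2); rewrite /dual_energy /=.
by case: (Fdual _ _ _ _) => // c; exists c.
Qed.

Lemma cond_a_sub (u r : V -> 'rV[R]_m) (u2 : L2 Omega u) (r2 : L2 Omega r) :
  cond_a Omega A f u r -> sub (toL2 mO u2) (toL2 mO r2).
Proof.
move=> [_ h]; have [c Fc] := Fdual0.
have [b Fb] : exists b, Fdual Omega A f u = b%:E.
  (* If F_dual were [+oo] at [u], then testing with [w = 0], where it is finite, would put a real
     number below [-oo]. *)
  apply: Fdual_fin => //; rewrite ltNge leye_eq; apply/negP => /eqP Fu.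
  by have := h _ L2_0; rewrite Fc Fu.
exists b => // w a Fw; have := h _ (L2spP w); rewrite Fb => h1.
rewrite -lee_fin EFinB; apply: le_trans h1 _; by rewrite leeB.
Qed.

Lemma cond_b_a (u r : V -> 'rV[R]_m) : L2 Omega u -> L2 Omega r ->
  cond_b Omega A f u r -> cond_a Omega A f u r.
Proof.
move=> u2 r2 [z Zz h]; split => // w w2; have [c Fc] := Fdual0.
have [b Fb] : exists b, Fdual Omega A f u = b%:E.
  apply: Fdual_fin => //; rewrite ltNge leye_eq; apply/negP => /eqP Fu.
  have := h _ BVA0 L2_0; rewrite Fu; have [Xz hi] := Zz.
  have [[mz _] _ _] := Xz; rewrite /dual_value; have [_ _ ->] := fstar_itgE mz hi.
  by [].
rewrite Fb; case: (pselect (BVA Omega A w)) => [Bw|nB]; last first.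
  by rewrite /Fdual memNset// leey.
have -> : L2_inner Omega r (fun x => w x - u x) = L2_inner Omega (fun x => w x - u x) r.
  by apply: eq_Rintegral => x _; rewrite frobC.
have := h w Bw w2; rewrite Fb => /le_trans; apply; rewrite leeB//.
by rewrite /Fdual mem_set//; apply: ereal_sup_ubound; exists z.
Qed.

Lemma cond_c_b (u r : V -> 'rV[R]_m) : cond_c Omega A f u r -> cond_b Omega A f u r.
Proof. by move=> [z Zz h]; exists z => // w Bw w2; rewrite h. Qed.

(** * A single field realising a subgradient *)

Section subgradient_field.
Variables (u r : L2sp leb mO 1 m).
Hypothesis ur : sub_at (L2_ip leb mO 1 m) dual_energy u r.
Local Notation H1 := (L2sp leb mO m n).
Local Notation ip1 := (L2_ip leb mO m n).

Local Notation ip2 := (pair_ip ip1 ip).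

(* Duality gap of [w |-> F_dual w + |w - (u + r)|^2 / 2] at [w = u], minus [F_dual u]. *)
Definition gap (Z : H1) (P : H) : R := energy Z + ip P u + 2^-1 * ip (P + r) (P + r).

Lemma gap_convex (Z1 Z2 : H1) (P1 P2 : H) t : admissible Z1 P1 -> admissible Z2 P2 -> 0 <= t <= 1 ->
  admissible (t *: Z1 + (1 - t) *: Z2 : H1) (t *: P1 + (1 - t) *: P2 : H) /\
  gap (t *: Z1 + (1 - t) *: Z2) (t *: P1 + (1 - t) *: P2) <= t * gap Z1 P1 + (1 - t) * gap Z2 P2.
Proof.
move=> a1 a2 t01; have [ad en] := admissible_convex a1 a2 t01; split => //.
have := ip_convex ip (P1 + r) (P2 + r) t01.
have -> : t *: (P1 + r) + (1 - t) *: (P2 + r) = t *: P1 + (1 - t) *: P2 + r.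
  by rewrite !scalerDr addrACA -scalerDl [t + _]addrC subrK scale1r.
have eu : ip (t *: P1 + (1 - t) *: P2) u = t * ip P1 u + (1 - t) * ip P2 u by rewrite ipDl !ipZl.
have {}en : energy (t *: Z1 + (1 - t) *: Z2 : H1) <= t * energy Z1 + (1 - t) * energy Z2 := en.
rewrite /gap eu; move: en; move: (energy (t *: Z1 + (1 - t) *: Z2)) (ip (_ + r) (_ + r)) => e0 q0.
move: (ip (P1 + r) (P1 + r)) (ip (P2 + r) (P2 + r)) => q1 q2.
move: (energy Z1) (energy Z2) (ip P1 u) (ip P2 u) => e1 e2 p1 p2.
lra.
Qed.

(** Completes the square in [P + r + u]. *)
Lemma gap_ge (Z : H1) (P : H) : admissible Z P ->
  - (C0 * fine (leb Omega)) - ip r u - 2^-1 * ip u u <= gap Z P.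
Proof.
move=> [K [_ _ _ wf hi]].
have en := energy_ge (fun i j => bounded_field_meas i j (wfield_bounded wf)) hi.
have h : 0 <= ip (P + r + u) (P + r + u) by exact: ip_ge0.
move: h; rewrite ipDl !(ipDr _ _ u) (ipC _ u (P + r)) (ipDl _ P r u) /gap.
by move: (ip (P + r) (P + r)) => a; lra.
Qed.

Lemma admissible_norm (Z : H1) (P : H) : admissible Z P ->
  ip1 Z Z <= C0 ^+ 2 * fine (leb Omega).
Proof.
move=> [K [_ _ _ wf _]]; rewrite L2_ipE -Rintegral_cst//; apply: Rint_le => //.
- exact: L2_frob_itg (L2spP Z) (L2spP Z).
- have : sqi leb Omega (cst (C0 ^+ 2)).
    by apply: (bounded_sqi (M := C0 ^+ 2)) => // x; rewrite ger0_norm// sqr_ge0.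
  by move=> /(sqi_itg oO fO).
move=> x _; by have := wf_bnd wf x; rewrite frob_normE snorm_le_sqr ?(ltW C0_gt0).
Qed.

(** Half of the quadratic term absorbs the linear term [ip (P + r) u]; the rest controls [P + r],
    hence [P]. *)
Lemma gap_norm (Z : H1) (P : H) c : admissible Z P -> gap Z P <= c ->
  ip P P <= 8 * (c + C0 * fine (leb Omega) + ip u u + ip r u) + 2 * ip r r.
Proof.
move=> [K [_ _ _ wf hi]].
have en := energy_ge (fun i j => bounded_field_meas i j (wfield_bounded wf)) hi.
have h1 : 0 <= ip (2^-1 *: (P + r) + u) (2^-1 *: (P + r) + u) by exact: ip_ge0.
have h2 : 0 <= ip ((P + r) + r) ((P + r) + r) by exact: ip_ge0.
have e : ip P P = ip (P + r - r) (P + r - r) by rewrite addrK.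
rewrite e /gap; have -> : ip P u = ip (P + r) u - ip r u by rewrite -ipBl addrK.
move: h1 h2; move: (P + r) => S; rewrite !ipE (ipC _ u S) (ipC _ r S).
by move: (ip S S) (ip S u) (ip S r) en => a b d; lra.
Qed.

(** The gap depends on [Z] only through a convex energy, so minimising sequences need not converge
    in [Z]. Choosing near-minimisers of nearly least norm in the product space makes both components
    Cauchy. *)
Lemma min_sequence : exists (M : R) (x : nat -> (H1 * H)%type),
  [/\ forall k, admissible (x k).1 (x k).2, scauchy ip2 x,
      forall (Z : H1) (P : H), admissible Z P -> M <= gap Z P &
      forall k, gap (x k).1 (x k).2 <= M + k.+1%:R^-1].
Proof.
pose S := [set y : R | exists Z P, admissible (Z : H1) (P : H) /\ y = gap Z P].
have [ad0 _] := admissible0.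
have S0 : S (gap 0 0) by exists 0, 0; split.
have Slb : lbound S (- (C0 * fine (leb Omega)) - ip r u - 2^-1 * ip u u).
  by move=> y [Z [P [ad ->]]]; exact: gap_ge.
have hS : has_inf S by split; [exists (gap 0 0)|exists (- (C0 * fine (leb Omega)) - ip r u - 2^-1 * ip u u)].
pose M := inf S.
have ML (Z : H1) (P : H) : admissible Z P -> M <= gap Z P.
  by move=> ad; apply: (ge_inf hS.2); exists Z, P; split.
pose C k := [set x : (H1 * H)%type | admissible x.1 x.2 /\ gap x.1 x.2 <= M + k.+1%:R^-1].
pose B := C0 ^+ 2 * fine (leb Omega) +
  (8 * (M + 1 + C0 * fine (leb Omega) + ip u u + ip r u) + 2 * ip r r).
have inv1 k : k.+1%:R^-1 <= 1 :> R by rewrite invf_le1// ler1n.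
have [|||x Cx cx] := @nested_cauchy R _ ip2 C _ _ B.
- move=> k x [ad h]; split => //; apply: le_trans h _; rewrite lerD2l lef_pV2 ?posrE//.
  by rewrite ler_nat.
- move=> k [Z1 P1] [Z2 P2] [/= a1 g1] [/= a2 g2].
  have h0 : (0 : R) <= 2^-1 by rewrite invr_ge0 ler0n.
  have hf : 1 - 2^-1 = 2^-1 :> R by rewrite {1}(splitr 1) div1r addrK.
  have h1 : (2^-1 : R) <= 1 by rewrite -subr_ge0 hf.
  have t01 := introT andP (conj h0 h1).
  have [ad g] := gap_convex a1 a2 t01.
  have hZ : 2^-1 *: (Z1 + Z2) = 2^-1 *: Z1 + (1 - 2^-1) *: Z2.
    by rewrite hf scalerDr.
  have hP : 2^-1 *: (P1 + P2) = 2^-1 *: P1 + (1 - 2^-1) *: P2.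
    by rewrite hf scalerDr.
  have gM : gap (2^-1 *: Z1 + (1 - 2^-1) *: Z2) (2^-1 *: P1 + (1 - 2^-1) *: P2) <= M + k.+1%:R^-1.
    apply: le_trans g _; have := lerD g1 g2; rewrite hf -mulrDr mulrC ler_pdivrMr//.
    by rewrite mulr_natr mulr2n.
  by rewrite -hZ -hP in ad gM; exact: (conj ad gM).
- move=> k; have k0 : 0 < k.+1%:R^-1 :> R by rewrite invr_gt0.
  have [_ [Z [P [ad ->]]] hlt] := inf_adherent k0 hS.
  have hle : gap Z P <= M + k.+1%:R^-1 by exact: ltW.
  exists (Z, P); first by split.
  rewrite pair_ipE /= /B lerD//; first exact: admissible_norm ad.
  have hM : gap Z P <= M + 1 by apply: le_trans hle _; rewrite lerD2l.
  exact: (gap_norm ad hM).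
by exists M, x; split => // k; have [] := Cx k.
Qed.

(** The last clause is the first-order condition of the quadratic problem: the limit pair dominates
    all admissible fields in the linear problem at the point [u + r + P]. The number [a] is the
    limit of the energies; that it bounds the energy of [Z] is shown later. *)
Lemma min_limit : exists (zk : nat -> H1) (pk : nat -> H) (Z : H1) (P : H) (a : R),
  [/\ forall k, admissible (zk k) (pk k), scvg ip1 zk Z, scvg ip pk P,
      (fun k => energy (zk k)) @ \oo --> a &
      forall (z : H1) (p : H), admissible z p ->
        - energy z - ip p (u + r + P) <= - a - ip P (u + r + P)].
Proof.
have [M [x [ad /pair_scauchy[c1 c2] ML Mx]]] := min_sequence.
have [Z xZ] := L2_complete c1; have [P xP] := L2_complete c2.
pose zk k := (x k).1; pose pk k := (x k).2.
have xPr : scvg ip (fun k => pk k + r) (P + r) := scvgD xP (scvg_cst ip r).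
have cu := scvg_ip (y := u) xP; have cr := scvg_sqr xPr.
pose a := M - ip P u - 2^-1 * ip (P + r) (P + r).
have cg : (fun k => gap (zk k) (pk k)) @ \oo --> M.
  have cM : (fun k => M + k.+1%:R^-1) @ \oo --> M.
    by rewrite -[X in _ --> X]addr0; apply: cvgD; [exact: cvg_cst|exact: cvg_invS].
  apply: (squeeze_cvgr _ (@cvg_cst _ M _ _ _) cM); apply: nearW => k.
  by apply/andP; split; [exact: ML (ad k)|exact: Mx].
have ca : (fun k => energy (zk k)) @ \oo --> a.
  rewrite (_ : (fun k => energy (zk k)) = fun k => gap (zk k) (pk k) - ip (pk k) u -
    2^-1 * ip (pk k + r) (pk k + r)); last by apply/funext => k; rewrite /gap; ring.
  by apply: cvgB; [exact: cvgB|exact: cvgMl_tmp].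
exists zk, pk, Z, P, a; split; [exact: ad|exact: xZ|exact: xP|exact: ca|move=> z p adz].
(* Moves a fraction [t] of the way from the minimising sequence to [(z, p)] and passes to the limit;
   the linear coefficient in [t] is the sought inequality. *)
have key t : 0 < t <= 1 -> 0 <= t * ((energy z - a) + ip (p - P) (u + r + P)) +
    t ^+ 2 * (2^-1 * ip (p - P) (p - P)).
  move=> /andP[t0 t1]; have t01 : 0 <= t <= 1 by rewrite ltW.
  have cPt : scvg ip (fun k => t *: p + (1 - t) *: pk k) (t *: p + (1 - t) *: P).
    exact: (scvgD (scvg_cst ip _) (scvgZ (1 - t) xP)).
  have cPtr : scvg ip (fun k => t *: p + (1 - t) *: pk k + r) (t *: p + (1 - t) *: P + r).
    exact: (scvgD cPt (scvg_cst ip r)).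
  have L : M <= t * energy z + (1 - t) * a + ip (t *: p + (1 - t) *: P) u +
      2^-1 * ip (t *: p + (1 - t) *: P + r) (t *: p + (1 - t) *: P + r).
    have cR : (fun k => t * energy z + (1 - t) * energy (zk k) + ip (t *: p + (1 - t) *: pk k) u +
      2^-1 * ip (t *: p + (1 - t) *: pk k + r) (t *: p + (1 - t) *: pk k + r)) @ \oo -->
      t * energy z + (1 - t) * a + ip (t *: p + (1 - t) *: P) u +
      2^-1 * ip (t *: p + (1 - t) *: P + r) (t *: p + (1 - t) *: P + r).
      apply: cvgD; last by apply: cvgMl_tmp; exact: scvg_sqr cPtr.
      apply: cvgD; last exact: scvg_ip cPt.
      by apply: cvgD; [exact: cvg_cst|exact: cvgMl_tmp].
    apply: (ler_cvg_to (@cvg_cst _ M _ _ _) cR); apply: nearW => k.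
    have [_ en] := admissible_convex adz (ad k) t01.
    have [adt _] := gap_convex adz (ad k) t01.
    apply: le_trans (ML _ _ adt) _; rewrite /gap !lerD2r; exact: en.
  have e1 : t *: p + (1 - t) *: P = P + t *: (p - P).
    by rewrite scalerBr scalerBl scale1r addrCA addrA.
  have e2 : P + t *: (p - P) + r = (P + r) + t *: (p - P) by rewrite addrAC.
  move: L; rewrite e1 e2 /a; move: (p - P) => D.
  have -> : ip D (u + r + P) = ip D u + ip (P + r) D.
    by rewrite -addrA ipDr (addrC r) (ipC _ (P + r)).
  have -> : ip (P + t *: D) u = ip P u + t * ip D u by rewrite ipDl ipZl.
  have -> : ip (P + r + t *: D) (P + r + t *: D) =
      ip (P + r) (P + r) + 2 * t * ip (P + r) D + t ^+ 2 * ip D D.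
    move: (P + r) => S; rewrite ipDl !ipDr !ipZl !ipZr (ipC _ D S).
    by move: (ip S S) (ip S D) (ip D D) => b c d; ring.
  move: (ip (P + r) (P + r)) (ip (P + r) D) (ip D D) (ip D u) (ip P u) (energy z) => b c d e g h.
  lra.
have := ge0_of_quadratic key; rewrite ipBl; lra.
Qed.

Lemma admissible_field (Z : H1) (P : H) : admissible Z P -> bounded_field C0 Z P.
Proof. by move=> [K [_ _ _ wf _]]; exact: wfield_bounded. Qed.

Lemma admissible_H1 z p : admissible z p -> L2set leb Omega z.
Proof.
move=> [K [_ _ _ wf _]] i j; have [mz bz _ _ _] := wf.
by apply: (bounded_sqi (mz i j) (M := C0)); exact: entry_bnd.
Qed.

Lemma L2_entry_cvg k1 k2 (uk : nat -> L2sp leb mO k1 k2) (l : L2sp leb mO k1 k2) i j :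
  scvg (L2_ip leb mO k1 k2) uk l ->
  (fun k => \int[leb]_(x in Omega) ((uk k x i j - l x i j) ^+ 2)) @ \oo --> (0 : R).
Proof.
move=> ul; have := scvg_sqr (scvgB ul (scvg_cst _ l)); rewrite subrr ip0l => cv.
apply: (@squeeze_cvgr _ _ _ _ (cst 0) _ _ _ _ _ cv) => //; last exact: cvg_cst.
apply: nearW => k; apply/andP; split.
  by apply: Rintegral_ge0 => x _; exact: sqr_ge0.
have E x : (uk k - l : L2sp leb mO k1 k2) x i j = uk k x i j - l x i j.
  by rewrite L2spD L2spN !mxE.
apply: Rint_le => //.
- have := (L2spP (uk k - l) i j).2; apply: eq_integrable => // x _ /=.
  by rewrite E.
- exact: L2_frob_itg (L2spP _) (L2spP _).
- by move=> x _; rewrite -E; exact: sqr_entry_le_frob.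
Qed.

Section limit.
Variables (zk : nat -> H1) (pk : nat -> H) (Z : H1) (P : H) (a : R).
Hypotheses (ad : forall k, admissible (zk k) (pk k)) (zkZ : scvg ip1 zk Z) (pkP : scvg ip pk P).

Lemma limit_div : is_weak_div Omega Z P.
Proof.
move=> psi tp i; have td j := test_sqi oO fO (test_derive (delta_mx 0 j) tp).
have c2 := L2_weak_cvg mO (fun k => L2spP (pk k) 0 i) (L2spP P 0 i) (test_sqi oO fO tp)
  (L2_entry_cvg 0 i pkP).
have c1 : (fun k => - \sum_j \int[leb]_(x in Omega) (zk k x i j * partial j psi x)) @ \oo -->
    - \sum_j \int[leb]_(x in Omega) (Z x i j * partial j psi x).
  apply: cvgN; apply: cvgn_sum => j.
  exact: L2_weak_cvg mO (fun k => L2spP (zk k) i j) (L2spP Z i j) (td j) (L2_entry_cvg i j zkZ).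
rewrite Rint_sum//; last by move=> j; exact: sqi_mul (L2spP Z i j) (td j).
have E k : - (\sum_j \int[leb]_(x in Omega) (zk k x i j * partial j psi x)) =
    \int[leb]_(x in Omega) (pk k x 0 i * psi x).
  rewrite -(bf_div (admissible_field (ad k)) tp i) Rint_sum// => j.
  exact: sqi_mul (L2spP (zk k) i j) (td j).
have := c1; under eq_fun do rewrite E; move=> c3; exact: (cvg_unique _ c3 c2).
Qed.

Lemma limit_constraint : X2 Omega A Z /\ {ae leb, forall x, Omega x -> frob_norm (Z x) <= C0}.
Proof.
have [s ks ae] := L2_cvg_ae zkZ.
have bz : {ae leb, forall x, Omega x -> frob_norm (Z x) <= C0}.
  apply: filterS ae => x h Ox; rewrite frob_normE snorm_le_sqr ?(ltW C0_gt0)//.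
  have c : (fun k => frob (zk (s k) x) (zk (s k) x)) @ \oo --> frob (Z x) (Z x).
    by apply: frob_cvg => i j; exact: h.
  apply: (cvgn_le c) => k; have := bf_bnd (admissible_field (ad (s k))) x.
  by rewrite frob_normE snorm_le_sqr ?(ltW C0_gt0).
split => //; split.
- split; first by move=> i j; have [] := L2spP Z i j.
  by exists C0.
- apply: filterS ae => x h Ox; apply/matrixP => i j.
  have c : (fun k => zk (s k) x i j) @ \oo --> A (Z x) i j.
    rewrite linear_entry; under eq_fun do rewrite -(bf_A (admissible_field (ad (s _)))) linear_entry.
    by apply: cvgn_sum => k; apply: cvgn_sum => l; apply: cvgMr_tmp; exact: h.
  exact: (cvg_unique _ c (h Ox i j)).
- by exists P; split; [exact: L2spP|exact: limit_div].
Qed.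

Lemma limit_energy : (fun k => energy (zk k)) @ \oo --> a ->
  Zset Omega A f Z /\ energy Z <= a.
Proof.
move=> ca; have [XZ bz] := limit_constraint; have [s ks ae] := L2_cvg_ae zkZ.
have mZ i j : measurable_fun Omega (fun x => Z x i j) by have [] := L2spP Z i j.
have key e : 0 < e -> leb.-integrable Omega (fun x => fstar f x (Z x)) /\ energy Z <= a + e.
  move=> e0; have ae1 : a < a + e by rewrite ltrDl.
  have [N _ HN] := cvgr_lt a ca (a + e) ae1.
  apply: (@energy_lsc (fun k => zk (s (k + N)%N))).
  - by move=> k i j; have [] := L2spP (zk (s (k + N)%N)) i j.
  - exact: mZ.
  - by move=> k; have [K [_ _ _ _ h]] := ad (s (k + N)%N).
  - move=> k; apply: ltW; apply: HN => /=.
    by apply: leq_trans (ks _); exact: leq_addl.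
  - apply: filterS ae => x h Ox i j; have := h Ox i j.
    by rewrite -(cvg_shiftn N).
split; first by split => //; have [] := key 1 ltr01.
by apply/ler_addgt0Pr => e /key[].
Qed.

(** The approximating fields have compact support themselves, so the limit is an inner limit as it
    stands; [Z] is only replaced by a representative with bounds at every point. *)
Lemma limit_inner : exists z' p', [/\ bounded_field C0 z' p', ae_eq leb Omega z' Z,
  ae_eq leb Omega p' P & inner_limit z' p'].
Proof.
have [XZ bz] := limit_constraint; have [_ _ hg] := XZ; have [g2 dg] := divergenceP hg.
have [z' [p' [bf rp]]] := X2_rep XZ bz; rewrite (gtr0_norm C0_gt0) in bf.
have [v zz pg] := rp.
have pP : ae_eq leb Omega p' P.
  apply: filterS (weak_div_unique g2 (L2spP P) dg limit_div) => x h Ox.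
  by rewrite pg// h.
exists z', p'; split => //.
have /choice[K hK] k : exists K, [/\ compact K, K `<=` Omega & vanishes_off K (zk k) (pk k)].
  by have [K [cK KO vK _ _]] := ad k; exists K.
exists C0, (fun k => zk k), (fun k => pk k), K; split => //.
- by move=> k; have [? []] := ad k.
- move=> i j; have mz := bounded_field_meas i j bf.
  rewrite (_ : (fun k => \int[leb]_(x in Omega) ((zk k x i j - z' x i j) ^+ 2)) =
    fun k => \int[leb]_(x in Omega) ((zk k x i j - Z x i j) ^+ 2)); first exact: L2_entry_cvg.
  apply/funext => k; have [m1 _] := L2spP (zk k) i j; have [m2 _] := L2spP Z i j.
  apply: Rint_ae_eq => //.
  + by apply: measurable_funX; apply: measurable_funB.
  + by apply: measurable_funX; apply: measurable_funB.
  + by apply: filterS zz => x h Ox; rewrite h.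
- move=> i; have [mp _] := bounded_field_L2 bf 0 i.
  rewrite (_ : (fun k => \int[leb]_(x in Omega) ((pk k x 0 i - p' x 0 i) ^+ 2)) =
    fun k => \int[leb]_(x in Omega) ((pk k x 0 i - P x 0 i) ^+ 2)); first exact: L2_entry_cvg.
  apply/funext => k; have [m1 _] := L2spP (pk k) 0 i; have [m2 _] := L2spP P 0 i.
  apply: Rint_ae_eq => //.
  + by apply: measurable_funX; apply: measurable_funB.
  + by apply: measurable_funX; apply: measurable_funB.
  + by apply: filterS pP => x h Ox; rewrite h.
Qed.

End limit.

(** With [D = r + P], optimality bounds F_dual at [u + D]. The subgradient inequality there and the
    lower bound at [u] combine to [ip D D <= 0]. So [D] is null, which says both that [r = - div Z]
    and that the dual problem at [u] is attained. *)
Lemma sub_cond_d : cond_d Omega A f u r.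
Proof.
have [zk [pk [Z [P [a [ad zkZ pkP ca opt]]]]]] := min_limit.
have [b Fb hb] := ur; have Fb' : Fdual Omega A f u = b%:E := Fb.
have Bu : BVA Omega A u by move: Fb'; rewrite /Fdual; case: ifPn => // /set_mem.
pose D := r + P.
have wE : u + r + P = u + D by rewrite addrA.
have Fw : (dual_energy (u + D)%R <= (- a - ip P (u + D))%:E)%E.
  apply/dual_energy_leP => z Q adz; rewrite -wE.
  exact: (opt (toL2 mO (admissible_H1 adz)) Q adz).
have h1 := hb _ _ Fw; rewrite (addrC u) addrK in h1.
have h2 : - a - ip P u <= b.
  have c : (fun k => - energy (zk k) - ip (pk k) u) @ \oo --> - a - ip P u.
    by apply: cvgB; [exact: cvgN|exact: scvg_ip].
  apply: (cvgn_le c) => k; apply: (dual_energy_leP u b).1 => //.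
  by rewrite Fb.
have DD : ip D D <= 0.
  rewrite {1}/D ipDl; move: h1; rewrite (ipDr ip D u P); move: h2.
  by move: (ip P u) (ip r D) (ip P D) => e1 e2 e3; lra.
have nD : nrm D = 0 by apply/eqP; rewrite eq_le snorm_ge0 andbT snorm_le_sqr// expr0n.
have ip0 Q : ip Q D = 0.
  by apply/eqP; rewrite -normr_eq0 eq_le normr_ge0 andbT (le_trans (ip_le _ _ _))// nD mulr0.
have ba : b <= - a - ip P u.
  by move: h1; rewrite (ipDr ip D u P) !ip0 add0r; move: (ip P u) => e1; lra.
have [ZZ eZ] := limit_energy ad zkZ pkP ca; have [XZ _] := ZZ.
have [z' [p' [bf zz pP il]]] := limit_inner ad zkZ pkP.
have dE : ae_eq leb Omega (divergence Omega Z) P.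
  by apply: filterS2 (divergence_ae XZ bf zz) pP => x e1 e2 Ox; rewrite e1// e2.
split => //; exists Z => //; split.
- apply: filterS2 dE (L2_null nD) => x e1 e2 Ox; rewrite e1//.
  by have := e2 Ox; rewrite L2spD => /eqP; rewrite addr_eq0 => /eqP.
- exact: (inner_limit_normal_trace XZ bf zz il).
- have val := dual_value_inner ZZ bf zz il (L2spP u) Bu.
  have pu : \int[leb]_(x in Omega) frob (p' x) (u x) = ip P u.
    apply: Rint_ae_eq => //.
    + exact: itg_meas (L2_frob_itg mO (bounded_field_L2 bf) (L2spP u)).
    + exact: itg_meas (L2_frob_itg mO (L2spP P) (L2spP u)).
    + by apply: filterS pP => x h Ox; rewrite h.
  apply/eqP; rewrite eq_le; apply/andP; split.
    by rewrite Fb' val lee_fin pu; move: ba; move: (ip P u) => e1; lra.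
  by rewrite /Fdual mem_set//; apply: ereal_sup_ubound; exists Z.
Qed.

End subgradient_field.

(** Zero normal trace makes the pairing of [z] with any [w] equal to [- \int <div z, w>], so the
    dual value is affine in [w] and the equality at [u] propagates to all [w]. *)
Lemma cond_d_c (u r : V -> 'rV[R]_m) : L2 Omega u -> L2 Omega r ->
  cond_d Omega A f u r -> cond_c Omega A f u r.
Proof.
move=> u2 r2 [Bu [z Zz [rd tr Fu]]]; have [Xz hi] := Zz.
have [M [z' [p [bf [v zz pg] il]]]] := normal_trace_inner_limit Xz tr.
have p2 := bounded_field_L2 bf.
exists z => // w Bw w2; rewrite Fu !(dual_value_inner Zz bf zz il)// -EFinB; congr EFin.
pose U := toL2 mO u2; pose W' := toL2 mO w2; pose P := toL2 mO p2; pose Rr := toL2 mO r2.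
have -> : L2_inner Omega (fun x => w x - u x) r = ip (W' - U) Rr by [].
have -> : \int[leb]_(x in Omega) frob (p x) (w x) = ip P W' by [].
have -> : \int[leb]_(x in Omega) frob (p x) (u x) = ip P U by [].
have -> : ip (W' - U) Rr = ip (W' - U) (- P).
  rewrite ipC (ipC _ _ (- P)); apply: L2_ip_ae.
  by apply: filterS rd => x h Ox; rewrite L2spN /= h// pg.
rewrite ipNr ipBl (ipC _ W') (ipC _ U).
by move: (ip P W') (ip P U) => e1 e2; ring.
Qed.

Lemma cond_d_b (u r : V -> 'rV[R]_m) : L2 Omega u -> L2 Omega r -> cond_d Omega A f u r -> cond_b Omega A f u r.
Proof. by move=> u2 r2 h; apply: cond_c_b; exact: cond_d_c. Qed.

Lemma sub_conds (u r : H) : sub u r ->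
  [/\ cond_a Omega A f u r, cond_b Omega A f u r, cond_c Omega A f u r & cond_d Omega A f u r].
Proof.
move=> h; have d : cond_d Omega A f u r.
  exact: sub_cond_d h.
have [u2 r2] := (L2spP u, L2spP r); split => //.
- exact: sub_cond_a h.
- exact: cond_d_b.
- exact: cond_d_c u2 r2 d.
Qed.

Lemma conds_sub (u r : V -> 'rV[R]_m) (u2 : L2 Omega u) (r2 : L2 Omega r) :
  [\/ cond_a Omega A f u r, cond_b Omega A f u r, cond_c Omega A f u r | cond_d Omega A f u r] ->
  sub (toL2 mO u2) (toL2 mO r2).
Proof.
move=> h; apply: cond_a_sub.
have ba : cond_b Omega A f u r -> cond_a Omega A f u r.
  exact: cond_b_a u2 r2.
case: h => [//|/ba//|/cond_c_b/ba//|h]; exact/ba/cond_d_b.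
Qed.

Lemma dual_energy_flow (x0 : H) : exists U v : R -> H,
  [/\ nrm (U 0 - x0) = 0, half_line_continuous ip U, forall t, 0 < t -> sub (U t) (- v t),
      weak_deriv ip U v &
      (forall s t, 0 < s -> s <= t -> nrm (v t) <= nrm (v s)) /\
      (forall t h, 0 < t -> 0 <= h -> nrm (U (t + h) - U t) <= h * nrm (v t))].
Proof.
have Hc : scomplete ip by exact: L2_complete.
have [U [v [U0 Uc Us vl [vr vd Ul]]]] := gradient_flow Hc
  dual_energy_ge0 dual_energy_convex dual_energy_lsc dual_energy_dense x0.
exists U, v; split; [exact: U0|exact: Uc|exact: Us| |split; [exact: vd|exact: Ul]].
by move=> phi tp; exact: (flow_weak_derivative Hc vl vr vd Ul tp).
Qed.

End dual_functional.

(** Existence is stated with all four conditions and uniqueness with any one of them, so the result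
    holds for whichever condition is taken as the definition of a solution. *)
Theorem corollary4p9 (R : realType) (m n : nat) (m_gt0 : (0 < m)%N)
    (n_gt0 : (0 < n)%N) (Omega : set 'rV[R]_n)
    (Omega_bounded : bounded_set Omega) (Omega_open : open Omega)
    (Omega_lipschitz : lipschitz_boundary Omega)
    (A : {linear 'M[R]_(m, n) -> 'M[R]_(m, n)})
    (A_sym : forall y y', frob (A y) y' = frob y (A y'))
    (A_idem : forall y, A (A y) = A y)
    (f : 'rV[R]_n -> 'M[R]_(m, n) -> R)
    (f_ge0 : forall x y, closure Omega x -> 0 <= f x y)
    (f_meas : measurable_fun (closure Omega `*` [set: 'M[R]_(m, n)])
                (fun xy : 'rV[R]_n * 'M[R]_(m, n) => f xy.1 xy.2))
    (f_convex : forall x, closure Omega x ->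
                convex_function [set: convex_lmodType 'M[R]_(m, n)] (f x))
    (c0 C0 : R) (c0_gt0 : 0 < c0) (C0_gt0 : 0 < C0)
    (f_growth : forall x y, closure Omega x ->
                c0 * frob_norm (A y) <= f x y <= C0 * (1 + frob_norm (A y)))
    (u0 : 'rV[R]_n -> 'rV[R]_m) (u0_L2 : L2 Omega u0) :
  exists u : R -> 'rV[R]_n -> 'rV[R]_m,
    is_solution Omega
      (fun v r => [/\ cond_a Omega A f v r, cond_b Omega A f v r,
                      cond_c Omega A f v r & cond_d Omega A f v r]) u0 u /\
    forall w : R -> 'rV[R]_n -> 'rV[R]_m,
      is_solution Omega
        (fun v r => [\/ cond_a Omega A f v r, cond_b Omega A f v r,
                        cond_c Omega A f v r | cond_d Omega A f v r]) u0 w ->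
      forall t, 0 <= t -> ae_eq (lebesgue_rV R n) Omega (w t) (u t).
Proof.
pose mO := mx_open_measurable Omega_open; pose ip := L2_ip (lebesgue_rV R n) mO 1 m.
pose x0 := toL2 mO u0_L2; pose T := toH (m := m) Omega_open.
have TE (h : 'rV[R]_n -> 'rV[R]_m) : L2 Omega h -> (T h : _ -> _) = h by exact: toHE.
have TK (h : L2sp (lebesgue_rV R n) mO 1 m) : T (h : _ -> _) = h.
  by apply: val_inj; exact: TE (L2spP h).
have [U [v [U0 Uc Us Uw [vd Ul]]]] := dual_energy_flow Omega_bounded A_sym A_idem f_ge0 f_meas
  f_convex c0_gt0 C0_gt0 f_growth x0.
have vb : locally_bounded ip v.
  by move=> a b a0; exists (snorm ip (v a)); apply: aeW => p /andP[ap _]; exact: vd.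
exists (fun t => U t : _ -> _); split.
  split.
  - split=> [t _|]; first exact: L2spP.
    apply/(half_line_continuousP Omega_open); first by move=> t _; exact: L2spP.
    by rewrite (_ : (fun t => _) = U)//; apply/funext => t; exact: TK.
  - have := L2_null U0; apply: filterS => x h Ox; have := h Ox; rewrite L2spD L2spN => /eqP.
    by rewrite subr_eq0 => /eqP.
  - exists (fun t => v t : _ -> _).
      split; last exact: weak_time_derivative_of.
      + split=> [t _|a b a0]; first exact: L2spP.
        (* The Lipschitz constant of the flow on [[a, b]] is the norm of the derivative at [a]. *)
        exists (snorm ip (U a) + (b - a) * snorm ip (v a)); apply: aeW => t /andP[ta tb].
        apply: le_trans (snorm_leB ip (U t) (U a)) _; rewrite lerD2l.
        have := Ul a (t - a) a0; rewrite subr_ge0 (addrC a) subrK => /(_ ta) /le_trans; apply.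
        by apply: ler_wpM2r; [exact: snorm_ge0|rewrite lerD2r].
      + split=> [t _|]; first exact: L2spP.
        exact: vb.
    apply: aeW => t t0; exact: (sub_conds Omega_bounded A_sym Omega_lipschitz A_idem f_ge0 f_meas
      f_convex c0_gt0 C0_gt0 f_growth (Us t t0)).
move=> w [[w2 wc] w0 [vw [[w2' _] [vw2 vwb] ww] wP]] t t0.
have W0 : snorm ip (T (w 0) - U 0) = 0.
  have e : snorm ip (T (w 0) - x0) = 0.
    apply: L2_snorm_ae; apply: filterS w0 => x h Ox.
    by rewrite TE; [exact: h|exact: w2].
  exact: etrans (snorm_null_eq (U 0) e) (etrans (snormBC ip x0 (U 0)) U0).
suff : snorm ip (T (w t) - U t) = 0.
  move=> /L2_null; apply: filterS => x h Ox; have := h Ox.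
  by rewrite L2spD L2spN TE; [move=> /eqP; rewrite subr_eq0 => /eqP|exact: w2].
apply: (@evolution_unique _ _ ip (fun t => T (w t)) (fun t => T (vw t)) U v _ Uw _ Uc _ vb _ _ W0 t0).
- exact: weak_deriv_of.
- exact/half_line_continuousP.
- move=> a b a0; have [M HM] := vwb a b a0; exists M.
  have HM' : {ae @lebesgue_measure R, forall p : measurableTypeR R,
    a <= p <= b -> L2_norm Omega (vw p) <= M} by exact: HM.
  apply: filterS HM' => p hp pab.
  have /andP[ap _] := pab; have := hp pab; rewrite -[snorm _ _](L2_norm_snorm (oO := Omega_open)) TE//.
  exact/vw2/(lt_le_trans a0).
- have wP' : {ae @lebesgue_measure R, forall p : measurableTypeR R, 0 < p ->
      [\/ cond_a Omega A f (w p) (fun x => - vw p x), cond_b Omega A f (w p) (fun x => - vw p x),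
          cond_c Omega A f (w p) (fun x => - vw p x) | cond_d Omega A f (w p) (fun x => - vw p x)]}.
    exact: wP.
  apply: filterS wP' => p hp p0.
  have r2 : L2 Omega (fun x => - vw p x).
    rewrite (_ : (fun x => _) = (- T (vw p) : L2sp _ mO 1 m)); first exact: L2spP.
    by apply/funext => x; rewrite L2spN TE//; exact: vw2.
  (* Any one of the conditions makes [- vw p] a subgradient at [w p]; monotonicity against the
     subgradient [- v p] at [U p] then gives the sign required for uniqueness. *)
  have s1 := conds_sub Omega_open Omega_bounded A_sym Omega_lipschitz A_idem f_ge0 f_meas
    f_convex c0_gt0 C0_gt0 f_growth (w2' p p0) r2 (hp p0).
  have := sub_monotone s1 (Us p p0).
  rewrite opprK.
  have -> : toL2 mO (w2' p p0) = T (w p) by apply: val_inj; rewrite /= TE//; exact: w2' p p0.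
  have -> : toL2 mO r2 = - T (vw p).
    apply: val_inj; apply/funext => x.
    by transitivity (- (T (vw p) : _ -> _) x); first by rewrite TE//; exact: vw2.
  by rewrite (addrC (- T (vw p))) -opprB ipNl oppr_ge0.
Qed.
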